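(* Let $a,b\in\mathbb{B}^2$ with $a\neq b$, let $m=d(\{0\},L[a,b])$, and let $f:\mathbb{B}^2\to\mathbb{B}^2$ be a $K$-quasiregular mapping ($K\ge1$) with $f(\mathbb{B}^2)=\mathbb{B}^2$. Then $$\operatorname{th}\frac{h_{\mathbb{B}^2}(f(a),f(b))}{4}\le D\left(\operatorname{th}\frac{h_{\mathbb{B}^2}(a,b)}{4}\right)^{1/K},\qquad D=2^{1-1/K}\left(\frac{1}{\sqrt{1-m^2}}\right)^{1/K}.$$
   Context: $\mathbb{B}^2$ is the open unit disk in $\mathbb{C}$; $L[a,b]$ is the line through $a$ and $b$ and $d(\{0\},L[a,b])$ is its Euclidean distance from the origin; $\operatorname{th}$ is the hyperbolic tangent. For distinct $a,b\in\mathbb{B}^2$ the Hilbert metric is $h_{\mathbb{B}^2}(a,b)=\log\frac{|u-b||a-v|}{|u-a||b-v|}$, where $u,v$ are the two intersection points of $L[a,b]$ with the unit circle, labelled so that $|u-a|<|u-b|$; also $h_{\mathbb{B}^2}(a,a)=0$. *)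

(* Defs.v *)
From HB Require Import structures.
From mathcomp Require Import all_boot all_order all_algebra.
From mathcomp Require Import all_classical all_reals all_analysis.
Set Implicit Arguments. Unset Strict Implicit. Unset Printing Implicit Defensive.
Import Order.TTheory GRing.Theory Num.Theory.
Import numFieldNormedType.Exports.
Local Open Scope classical_set_scope.
Local Open Scope ring_scope.

Section Defs.
Variable R : realType.

Definition eucl (p : R * R) : R := Num.sqrt (p.1 ^+ 2 + p.2 ^+ 2).
Definition psub (p q : R * R) : R * R := (p.1 - q.1, p.2 - q.2).

Definition B2 : set (R * R) := [set z | eucl z < 1].
Definition S1 : set (R * R) := [set z | eucl z = 1].

Definition line (a b : R * R) : set (R * R) :=
  [set p | exists t : R, p = (a.1 + t * (b.1 - a.1), a.2 + t * (b.2 - a.2))].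

Definition dist0 (A : set (R * R)) : R := inf [set eucl p | p in A].

Definition th (x : R) : R := (expR x - expR (- x)) / (expR x + expR (- x)).

Definition hil_u (a b : R * R) : R * R :=
  xget (0, 0) [set p | line a b p /\ S1 p /\ eucl (psub p a) < eucl (psub p b)].
Definition hil_v (a b : R * R) : R * R :=
  xget (0, 0) [set p | line a b p /\ S1 p /\ p <> hil_u a b].
Definition hilbert (a b : R * R) : R :=
  if a == b then 0 else
  let u := hil_u a b in let v := hil_v a b in
  ln ((eucl (psub u b) * eucl (psub a v)) / (eucl (psub u a) * eucl (psub b v))).

Definition abs_cont_on (g : R -> R) (a b : R) : Prop :=
  forall e : R, 0 < e -> exists2 d : R, 0 < d &
    forall (n : nat) (s t : 'I_n -> R),
      (forall i, a <= s i /\ s i <= t i /\ t i <= b) ->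
      (forall i j, i != j -> t i <= s j \/ t j <= s i) ->
      \sum_(i < n) (t i - s i) < d ->
      \sum_(i < n) `|g (t i) - g (s i)| < e.

Definition leb := (@lebesgue_measure R).
Definition leb2 := (leb \x leb)%E.

Definition crect (a1 b1 a2 b2 : R) : set (R * R) :=
  [set z | (a1 <= z.1 <= b1) /\ (a2 <= z.2 <= b2)].

Definition ACL (u : R * R -> R) (U : set (R * R)) : Prop :=
  forall a1 b1 a2 b2 : R, crect a1 b1 a2 b2 `<=` U ->
    leb.-negligible [set y | a2 <= y <= b2 /\
                       ~ abs_cont_on (fun x => u (x, y)) a1 b1] /\
    leb.-negligible [set x | a1 <= x <= b1 /\
                       ~ abs_cont_on (fun y => u (x, y)) a2 b2].

Definition locL2 (g : R * R -> R) (U : set (R * R)) : Prop :=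
  forall a1 b1 a2 b2 : R, crect a1 b1 a2 b2 `<=` U ->
    leb2.-integrable (crect a1 b1 a2 b2) (fun z => (g z ^+ 2)%:E).

Definition opnorm (a b c d : R) : R :=
  sup [set r | exists x y : R, x ^+ 2 + y ^+ 2 = 1 /\
               r = Num.sqrt ((a * x + b * y) ^+ 2 + (c * x + d * y) ^+ 2)].

(* f = (u, v) is K-quasiregular in the open set U:
   f is continuous, f is in W^{1,2}_loc(U) (ACL with locally L^2 partial
   derivatives), and |f'(z)|^2 <= K J_f(z) for almost every z in U. *)
Definition quasiregular (K : R) (U : set (R * R)) (f : R * R -> R * R) : Prop :=
  (forall z, U z -> {for z, continuous f}) /\
  ACL (fun z => (f z).1) U /\ ACL (fun z => (f z).2) U /\
  exists ux uy vx vy : R * R -> R,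
    locL2 ux U /\ locL2 uy U /\ locL2 vx U /\ locL2 vy U /\
    leb2.-negligible [set z | U z /\ ~ (
        is_derive z.1 1 (fun x => (f (x, z.2)).1) (ux z) /\
        is_derive z.2 1 (fun y => (f (z.1, y)).1) (uy z) /\
        is_derive z.1 1 (fun x => (f (x, z.2)).2) (vx z) /\
        is_derive z.2 1 (fun y => (f (z.1, y)).2) (vy z) /\
        opnorm (ux z) (uy z) (vx z) (vy z) ^+ 2
          <= K * (ux z * vy z - uy z * vx z))].

End Defs.

(* Main.v *)
(* Let S and C be the hyperbolic sine and cosine of half the hyperbolic distance
   of a and b, S' and C' the same for f a and f b, and let I(p, q) be the
   complete elliptic integral int_0^(pi/2) (p^2 cos^2 + q^2 sin^2)^(-1/2).
   Elliptic coordinates on the hyperboloid model map the complement of the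
   hyperbolic segment [a, b] in the disc conformally onto an annulus whose
   modulus is a multiple of I(C, S) / I(1, C).  Every level curve of this annulus
   is mapped by f to a curve that meets both rays of the hyperbolic line through
   f a and f b outside the segment [f a, f b], whose complement is a quadrilateral
   of known modulus; the length-area method, which needs no more than Stokes'
   formula for continuous Sobolev functions, yields
   I(1, C') I(C, S) <= K I(1, C) I(C', S').
   By Gauss's transformation log(2 (1 + C) / S) - (pi/2) I(C, S) / I(1, C) is
   nonnegative and increasing in C, so that the bound passes to
   log(2 (1 + C) / S) <= K log(2 (1 + C') / S').  Finally
   sh(h/2) = sqrt(1 - m^2) S, where h is the Hilbert distance of a and b, which
   compares th(h/4) with S / (1 + C). *)
Require Import Defs.
From HB Require Import structures.
From mathcomp Require Import all_boot all_order all_algebra.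
From mathcomp Require Import all_classical all_reals all_analysis.
From mathcomp Require Import measurable_realfun ring lra.
Set Implicit Arguments. Unset Strict Implicit. Unset Printing Implicit Defensive.
Import Order.TTheory GRing.Theory Num.Theory.
Import numFieldNormedType.Exports.
Local Open Scope classical_set_scope.
Local Open Scope ring_scope.

(** * Absolutely continuous functions *)

(* [lra] restricted to the inequalities that are premises of the goal. *)
Ltac hide_inequalities := repeat match goal with H : is_true ?b |- _ => change (hide (is_true b)) in H end.
Ltac lra_from := hide_inequalities; intros; lra.

(** A quasiregular map need not be injective: the annulus may cover parts of the target many times,
    so its energy cannot be compared with the area of the target. A calibration replaces this
    comparison. Let X + i Y be the conformal coordinate of the slit target, where |Y| < I(C', S'),
    and let W = tan(k Y) with k = pi / (2 I(C', S')). Then k (1 + W^2) |grad X|^2 is the Jacobian of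
    (X, W), and composition with f only turns k into k / K. As dX dW is exact, Stokes' formula moves
    it onto the weight cos^2 of the annulus coordinate; the equation W' = k (1 + W^2) is what makes
    the remainder a sum of squares. No integral over a curve occurs. A level curve is replaced by a
    weight supported near its level, and the angle, which is multivalued, by its sine, its cosine
    and its differential. Degree, openness and discreteness of f are replaced by the sign of its
    Jacobian: where a Stokes integral forces the Jacobian to vanish, the whole derivative vanishes
    and f is locally constant. All coordinates degenerate on the slits, hence the many cutoffs and
    the limits that remove them. *)

Section AbsolutelyContinuous.
Variable R : realType.
Local Notation mu := (@lebesgue_measure R).
Implicit Types (g h : R -> R) (a b : R).

(** The supremum [c] of the points of [[a, b]] satisfying [P] is approached from the left by such
    points, and one step across [c] would lead beyond it unless [c = b]. The step starts left of [c]
    and ends right of it, so nothing is asked at [c] itself. *)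
Lemma interval_induction (P : R -> Prop) a b : a <= b -> P a ->
  (forall c, a <= c <= b -> exists2 d, 0 < d & forall x y,
     a <= x -> x <= c -> c <= y -> y <= b -> c - d < x -> y < c + d -> P x -> P y) ->
  P b.
Proof.
move=> ab Pa step.
pose S : set R := [set x | a <= x <= b /\ P x].
have Sa : S a by split; rewrite ?lexx.
have Sub : has_ubound S by exists b => x [/andP[_ ?]].
have hS : has_sup S by split; [exists a | ].
set c := sup S.
have ac : a <= c by exact: ub_le_sup.
have cb : c <= b by apply: ge_sup; [exists a | move=> x [/andP[_ ?]]].
have [d d0 dP] := step c (introT andP (conj ac cb)).
have [x [/andP[ax xb] Px] cdx] := sup_adherent d0 hS.
have xc : x <= c by apply: ub_le_sup => //; split => //; rewrite ax xb.
have Pc : P c by apply: (dP x c) => //; rewrite ltrDl.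
have [bc|cltb] := leP b c; first by have -> : b = c by apply/eqP; rewrite eq_le bc cb.
pose y := Num.min b (c + d / 2).
have cy : c < y by rewrite lt_min cltb /= ltrDl divr_gt0.
have yb : y <= b by rewrite ge_min lexx.
have Py : P y.
  apply: (dP x y) => //; first exact: ltW.
  by rewrite gt_min ltrD2l; apply/orP; right; lra.
suff : y <= c by rewrite leNgt cy.
by apply: ub_le_sup => //; split => //; rewrite yb (le_trans ac (ltW cy)).
Qed.

Lemma is_derive_approx (f : R -> R) (x l : R) : is_derive x 1 f l ->
  forall e, 0 < e -> exists2 d, 0 < d & forall y, `|y - x| < d ->
    `|f y - f x - l * (y - x)| <= e * `|y - x|.
Proof.
move=> [df fl] e e0.
have : h^-1 *: (f (h *: 1 + x) - f x) @[h --> 0^'] --> l by rewrite -fl; exact: df.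
move=> /cvgrPdist_le /(_ e e0); rewrite near_withinE => -[d /= d0 dP].
exists d => // y yd; have [->|yx] := eqVneq y x.
  by rewrite !subrr mulr0 subrr normr0 mulr0.
have yx0 : y - x != 0 by rewrite subr_eq0.
have := dP (y - x); rewrite /ball/= sub0r normrN => /(_ yd yx0).
rewrite /GRing.scale/= mulr1 subrK => H.
have -> : f y - f x - l * (y - x) = - ((l - (y - x)^-1 * (f y - f x)) * (y - x)).
  by field.
by rewrite normrN normrM ler_wpM2r.
Qed.

(** With lists instead of indexed families, one more interval can be appended to a collection; the
    induction on the end point below does so at every bad point. *)
Lemma abs_cont_on_seq g a b : abs_cont_on g a b ->
  forall e, 0 < e -> exists2 d, 0 < d & forall l : seq (R * R),
    {in l, forall p, a <= p.1 /\ p.1 <= p.2 /\ p.2 <= b} ->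
    pairwise (fun p q => p.2 <= q.1) l ->
    \sum_(p <- l) (p.2 - p.1) < d -> \sum_(p <- l) `|g p.2 - g p.1| < e.
Proof.
move=> ac e e0; have [d d0 dP] := ac e e0; exists d => // l lab lpw lsum.
rewrite (big_nth (0, 0)) big_mkord.
apply: (dP (size l) (fun i => (nth (0,0) l i).1) (fun i => (nth (0,0) l i).2)).
- by move=> i; apply: lab; rewrite mem_nth.
- move=> i j ij; have /pairwiseP := lpw => /(_ (0, 0)) H.
  have : (i < j)%N || (j < i)%N by rewrite -neq_ltn.
  by case/orP => ?; [left|right]; apply: H => //; rewrite inE.
- by move: lsum; rewrite (big_nth (0, 0)) big_mkord.
Qed.

(* Real induction on the right end point: away from a null set the increments
   of [g] are controlled by those of the primitive [F] of [`|g1|]; the null set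
   is covered by a small open set, where absolute continuity takes over. *)
Lemma abs_cont_increment_le g (g1 : R -> R) a b : a <= b -> abs_cont_on g a b ->
  mu.-integrable setT (EFin \o g1) ->
  mu.-negligible [set x | a <= x <= b /\ ~ is_derive x 1 g (g1 x)] ->
  `|g b - g a| <= \int[mu]_(x in `]a, b]) `|g1 x|.
Proof.
move=> ab ac ig1 ngl.
pose h : R -> R := fun x => `|g1 x|.
have ih : mu.-integrable setT (EFin \o h) by exact: integrable_norm.
pose F : R -> R := fun x => \int[mu]_(t in `]-oo, x]) h t.
have iyh y : mu.-integrable `]-oo, y] (EFin \o h).
  by apply: integrableS ih.
have Fae : {ae mu, forall x : R, derivable F x 1 /\ derive1 F x = h x}.
  exact: (FTC1Ny iyh (open_integrable_locally openT ih)).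
have Fint x y : x <= y -> F y - F x = \int[mu]_(t in `]x, y]) h t.
  by move=> xy; rewrite /F Rintegral_itvB.
have Fmono x y : x <= y -> F x <= F y.
  by move=> xy; rewrite -subr_ge0 Fint//; apply: Rintegral_ge0 => ? _; exact: normr_ge0.
rewrite -Fint//.
apply/ler_addgt0Pr => e e0.
pose e1 := e / 4 / (b - a + 1).
have ba1 : 0 < b - a + 1 by lra.
have e10 : 0 < e1 by rewrite !divr_gt0.
have [d d0 dP] := abs_cont_on_seq ac (divr_gt0 e0 (ltr0Sn R 1)).
pose N := [set x | a <= x <= b /\ ~ is_derive x 1 g (g1 x)] `|`
          [set x | ~ (derivable F x 1 /\ derive1 F x = h x)].
have nN : mu.-negligible N.
  by apply: negligibleU.
have [Op [opO NO Od]] := outer_measure_open_le N (divr_gt0 d0 (ltr0Sn R 1)).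
move: nN => /negligible_outer_measure nN; rewrite nN add0e in Od.
(* Increments at good points are paid by [F] and a small slope. Increments across points of [N] are
   paid by the intervals of [l], whose total length is charged to [Op] and hence stays below [d]. *)
pose good x := exists l : seq (R * R),
  [/\ {in l, forall p, a <= p.1 /\ p.1 <= p.2 /\ p.2 <= x},
      pairwise (fun p q => p.2 <= q.1) l,
      ((\sum_(p <- l) (p.2 - p.1))%:E <= mu (Op `&` `]a, x]))%E &
      `|g x - g a| <= F x - F a + 2 * e1 * (x - a) + \sum_(p <- l) `|g p.2 - g p.1|].
have mO : measurable (Op : set (measurableTypeR R)) by exact: measurable_realfun.open_measurable.
suff [l [l1 l2 l3 l4]] : good b.
  apply: (le_trans l4).
  have H1 : \sum_(p <- l) (p.2 - p.1) < d.
    rewrite -lte_fin; apply: (le_lt_trans l3).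
    apply: (@le_lt_trans _ _ (mu Op)).
      by apply: le_measure; rewrite ?inE//=; apply: measurableI.
    by apply: (le_lt_trans Od); rewrite lte_fin; lra.
  have H2 := dP l l1 l2 H1.
  have H3 : 2 * e1 * (b - a) <= e / 2.
    have E : e1 * (b - a + 1) = e / 4 by rewrite /e1 mulfVK// gt_eqF.
    nra.
  by move: H2 H3; lra_from.
apply: (@interval_induction _ a b ab).
  exists [::]; split => //; last by rewrite big_nil !subrr normr0 mulr0 !addr0.
  by rewrite big_nil measure_ge0.
move=> c /andP[ac' cb]; have [Nc|Nc] := pselect (N c).
  have := opO c (NO c Nc); rewrite -nbhs_ballE => -[r /= r0 rO].
  exists r => // x y ax xc cy yb cx yc [l [l1 l2 l3 l4]].
  have xyO : `]x, y] `<=` Op.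
    move=> z /=; rewrite in_itv/= => /andP[xz zy]; apply: rO.
    by rewrite /ball/= ltr_norml; apply/andP; split; move: xz zy cx yc; lra_from.
  exists (rcons l (x, y)); split.
  - move=> p; rewrite mem_rcons inE => /orP[/eqP ->/=|/l1[? [? ?]]].
      by split => //; split => //; apply: (le_trans xc).
    by split => //; split => //; apply: (@le_trans _ _ x) => //; apply: (le_trans xc).
  - rewrite pairwise_rcons l2 andbT; apply/allP => p /l1[_ [_]]; exact.
  - rewrite -cats1 big_cat big_seq1 /= EFinD.
    have -> : Op `&` `]a, y] = (Op `&` `]a, x]) `|` `]x, y].
      apply/seteqP; split => z /=; rewrite !in_itv/=.
        move=> [Oz /andP[az zy]]; have [zx|xz] := leP z x; first by left; rewrite az.
        by right.
      move=> [[Oz /andP[az zx]]|/andP[xz zy]].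
        by split => //; rewrite az (le_trans zx)// (le_trans xc).
      split; first by apply: xyO; rewrite /= in_itv/= xz.
      by rewrite zy (le_lt_trans ax).
    rewrite measureU//.
    + apply: leeD => //; apply: le_trans (_ : _ <= mu `]x, y])%E _ => //.
      rewrite lebesgue_measure_itv/= lte_fin.
      case: ltP => xy; first by rewrite -EFinB lee_fin.
      by rewrite lee_fin subr_le0.
    + exact: measurableI.
    + apply/seteqP; split => z //= [[_]]; rewrite !in_itv/= => /andP[_ zx] /andP[xz _].
      by move: (lt_le_trans xz zx); rewrite ltxx.
  - rewrite -cats1 big_cat big_seq1 /=.
    have H1 : `|g y - g a| <= `|g y - g x| + `|g x - g a|.
      by apply: le_trans (ler_normD _ _); rewrite subrKA.
    have H2 : F x <= F y by apply: Fmono; apply: (le_trans xc).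
    have H3 : 0 <= e1 * (y - x) by apply: mulr_ge0; [exact: ltW|move: xc cy; lra_from].
    by move: H1 H2 H3 l4; lra_from.
have [Nc1 Nc2] : is_derive c 1 g (g1 c) /\ (derivable F c 1 /\ derive1 F c = h c).
  split; apply: contrapT => H; apply: Nc; [left|right] => //.
  by split => //; rewrite ac' cb.
have Fc : is_derive c 1 F (h c).
  by case: Nc2 => dF eF; rewrite -eF derive1E; exact: derivableP.
have [d1 d10 d1P] := is_derive_approx Nc1 e10.
have [d2 d20 d2P] := is_derive_approx Fc e10.
exists (Num.min d1 d2); first by rewrite lt_min d10 d20.
(* Near [c] both [g] and [F] stay within [e1] of their linear approximations, whose slopes [g1 c]
   and [|g1 c|] agree in absolute value. *)
have key y : `|y - c| < Num.min d1 d2 -> `|g y - g c| <= `|F y - F c| + 2 * e1 * `|y - c|.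
  rewrite lt_min => /andP[/d1P H1 /d2P H2].
  have H3 : `|g y - g c| <= `|g y - g c - g1 c * (y - c)| + `|g1 c * (y - c)|.
    by apply: le_trans (ler_normD _ _); rewrite subrK.
  have H4 : `|h c * (y - c)| <= `|F y - F c| + `|F y - F c - h c * (y - c)|.
    by rewrite {1}(_ : h c * (y - c) = (F y - F c) - (F y - F c - h c * (y - c))); [exact: ler_normB|ring].
  rewrite normrM /h normr_id -normrM in H4.
  by move: H1 H2 H3 H4; lra_from.
move=> x y ax xc cy yb cx yc [l [l1 l2 l3 l4]].
exists l; split => //.
- move=> p /l1[? [? ?]]; split => //; split => //.
  by apply: (@le_trans _ _ x) => //; apply: (le_trans xc).
- apply: (le_trans l3); apply: le_measure; rewrite ?inE; try exact: measurableI.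
  move=> z /= [Oz]; rewrite !in_itv/= => /andP[az zx]; split => //.
  by rewrite az (le_trans zx)// (le_trans xc).
- have K1 : `|g x - g c| <= `|F x - F c| + 2 * e1 * `|x - c|.
    by apply: key; rewrite ler0_norm; [move: cx; rewrite ltrBlDr -ltrBlDl; lra_from|rewrite subr_le0].
  have K2 : `|g y - g c| <= `|F y - F c| + 2 * e1 * `|y - c|.
    by apply: key; rewrite ger0_norm; [move: yc; lra_from|rewrite subr_ge0].
  rewrite (ler0_norm (_ : F x - F c <= 0)) in K1; last by rewrite subr_le0 Fmono.
  rewrite (ler0_norm (_ : x - c <= 0)) in K1; last by rewrite subr_le0.
  rewrite (ger0_norm (_ : 0 <= F y - F c)) in K2; last by rewrite subr_ge0 Fmono.
  rewrite (ger0_norm (_ : 0 <= y - c)) in K2; last by rewrite subr_ge0.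
  have H1 : `|g y - g a| <= `|g y - g c| + `|g x - g c| + `|g x - g a|.
    rewrite (distrC (g x) (g c)).
    by apply: (le_trans _ (le_trans (ler_normD _ _) (lerD (ler_normD _ _) (lexx _)))); rewrite !subrKA.
  by move: H1 K1 K2 l4; lra_from.
Qed.
End AbsolutelyContinuous.

#[global] Instance ae_filter1 (R : realType) :
  Filter (almost_everywhere (@lebesgue_measure R)) := ae_filter_ringOfSetsType _.
#[global] Instance ae_filter2 (R : realType) :
  Filter (almost_everywhere (@lebesgue_measure R \x @lebesgue_measure R)%E) :=
  ae_filter_ringOfSetsType _.

(** * Integration over the plane: translations, square integrable functions, a Fatou argument *)

Section PlaneIntegrals.
Variable R : realType.
Local Notation mu := (@lebesgue_measure R).
Local Notation mu2 := (mu \x mu)%E.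
Local Notation P := (measurableTypeR R * measurableTypeR R)%type.

(** Measurability refers to the product sigma-algebra, so the open set is written as the union of
    the countably many rational squares that it contains. *)
Lemma open_measurable2 (U : set (R * R)) : open U ->
  measurable (U : set (measurableTypeR R * measurableTypeR R)).
Proof.
move=> oU.
pose B (q : rat * rat * rat) : set (measurableTypeR R * measurableTypeR R) :=
  `]ratr q.1.1 - ratr q.2, ratr q.1.1 + ratr q.2[ `*`
  `]ratr q.1.2 - ratr q.2, ratr q.1.2 + ratr q.2[.
have -> : U = \bigcup_q (if asbool (B q `<=` U) then B q else set0).
  apply/seteqP; split; last first.
    by move=> z [q _]; case: asboolP => // H /H.
  move=> z Uz; have := oU z Uz; rewrite -nbhs_ballE => -[e /= e0 eU].
  have e2 : 0 < e / 2 by rewrite divr_gt0.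
  have [r] := rat_in_itvoo e2; rewrite in_itv/= => /andP[r0 re].
  have H1 : z.1 - ratr r < z.1 by rewrite ltrBlDr ltrDl.
  have H2 : z.2 - ratr r < z.2 by rewrite ltrBlDr ltrDl.
  have [q1] := rat_in_itvoo H1; rewrite in_itv/= => /andP[q11 q12].
  have [q2] := rat_in_itvoo H2; rewrite in_itv/= => /andP[q21 q22].
  exists (q1, q2, r) => //; rewrite ifT; last first.
    apply/asboolP => w [/=]; rewrite !in_itv/= => /andP[w1 w2] /andP[w3 w4].
    apply: eU; split; rewrite /ball/= ltr_norml; apply/andP; split; move: w1 w2 w3 w4 q11 q12 q21 q22 r0 re; lra_from.
  by split; rewrite /= in_itv/=; apply/andP; split; lra.
apply: countable_bigcupT_measurable; first exact: countableP.
move=> q; case: asboolP => _ //; apply: measurableX; exact: measurable_itv.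
Qed.

Lemma open_continuous_measurable_fun2 (D : set (R * R)) (f : R * R -> R) : open D ->
  (forall z, D z -> {for z, continuous f}) ->
  measurable_fun (D : set (measurableTypeR R * measurableTypeR R)) f.
Proof.
move=> oD cf; apply: (measurability _ (RGenOpens.measurableE R)).
move=> _ [_ [a [b ->] <-]]; apply: open_measurable2.
rewrite openE => z [Dz /= fz]; apply: filterI; first exact: oD.
by apply: (cf z Dz); apply: open_nbhs_nbhs; split => //; exact: interval_open.
Qed.

Definition csupp (V : R * R -> R) := exists r, forall z : R * R, r < `|z| -> V z = 0.

Lemma csuppM V W : csupp V -> csupp (fun z => V z * W z).
Proof. by move=> [r rV]; exists r => z /rV ->; rewrite mul0r. Qed.

Definition box (r : R) : set (measurableTypeR R * measurableTypeR R) := `[- r, r] `*` `[- r, r].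

Lemma boxP r (z : R * R) : box r z <-> `|z| <= r.
Proof.
rewrite /box /= !in_itv/= prod_normE ge_max -!ler_norml.
by split => [[-> ->]|/andP].
Qed.

Lemma measurable_box r : measurable (box r).
Proof. by apply: measurableX; exact: measurable_itv. Qed.

Lemma box_finite r : (mu2 (box r) < +oo)%E.
Proof.
rewrite /box product_measure1E//= lebesgue_measure_itv/=.
by case: ifP => _; rewrite ?mule0// -EFinB -EFinM ltry.
Qed.

Lemma box_compact r : compact (box r : set (R * R)).
Proof. by apply: compact_setX; exact: segment_compact. Qed.

Lemma measurable_csupp_integrable V (M : R) :
  measurable_fun setT (V : measurableTypeR R * measurableTypeR R -> R) ->
  csupp V -> (forall z, `|V z| <= M) -> mu2.-integrable setT (EFin \o V).
Proof.
move=> mV [r rV] bV.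
have -> : V = V \_ (box r).
  apply/funext => z; rewrite patchE; case: ifPn => //; rewrite notin_setE => /boxP.
  by move=> /negP; rewrite -ltNge => /rV.
rewrite -restrict_EFin; apply/integrable_restrict => //; first exact: measurable_box.
rewrite setTI; apply: measurable_bounded_integrable.
- exact: measurable_box.
- exact: box_finite.
- exact: measurable_funTS.
- exists M; split; first exact: num_real.
  by move=> x Mx z _ /=; apply: (le_trans (bV z)); exact: ltW.
Qed.

Lemma continuous_csupp_bounded V : continuous V -> csupp V ->
  exists M, forall z : R * R, `|V z| <= M.
Proof.
move=> cV [r rV].
have : bounded_set (V @` box r).
  apply: compact_bounded; apply: continuous_compact; last exact: box_compact.
  exact: continuous_subspaceT.
move=> [M [_ HM]]; exists (Num.max 0 (M + 1)) => z.
have [zr|/rV ->] := leP `|z| r; last by rewrite normr0 le_max lexx.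
by rewrite le_max; apply/orP; right; apply: (HM (M + 1)); [rewrite ltrDl|exists z => //; exact/boxP].
Qed.

Lemma continuous_measurable_fun2 (V : R * R -> R) : continuous V ->
  measurable_fun setT (V : measurableTypeR R * measurableTypeR R -> R).
Proof. by move=> cV; apply: open_continuous_measurable_fun2 => // *; [exact: openT|exact: cV]. Qed.

Lemma continuous_csupp_integrable V : continuous V -> csupp V ->
  mu2.-integrable setT (EFin \o V).
Proof.
move=> cV sV; have [M HM] := continuous_csupp_bounded cV sV.
by apply: measurable_csupp_integrable HM => //; exact: continuous_measurable_fun2.
Qed.

(** The translated measure agrees with Lebesgue measure on half-open intervals, and these determine
    the measure. *)
Lemma integral_shift (f : R -> \bar R) (c : R) : measurable_fun setT f ->
  (forall x, (0 <= f x)%E) -> (\int[mu]_x f (x + c)%R = \int[mu]_x f x)%E.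
Proof.
move=> mf f0.
pose t : measurableTypeR R -> measurableTypeR R := fun x : R => (x + c)%R.
have mc : measurable_fun setT t.
  by apply: measurable_funD => //; exact: measurable_cst.
have -> : (\int[mu]_x f x = \int[pushforward mu t]_x f x)%E.
  apply: eq_measure_integral => A mA _; apply: lebesgue_measure_unique => //=.
  move=> _ [[a b]] _ <-; rewrite /pushforward /=.
  have -> : t @^-1` [set` `]a, b]] = `]a - c, b - c]%classic.
    by apply/seteqP; split => x; rewrite /t /= !in_itv/= ltrBlDr lerBrDr.
  rewrite !lebesgue_measure_itv/= !lte_fin ltrD2r -!EFinB.
  by case: ifP => // _; congr EFin; lra.
by rewrite ge0_integral_pushforward.
Qed.


Lemma integral_shift2 (F : R * R -> \bar R) (e : R * R) :
  measurable_fun setT (F : measurableTypeR R * measurableTypeR R -> \bar R) ->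
  (forall z, (0 <= F z)%E) -> (\int[mu2]_z F (z + e)%R = \int[mu2]_z F z)%E.
Proof.
move=> mF F0.
have mFe : measurable_fun setT (fun z : measurableTypeR R * measurableTypeR R => F (z + e)%R).
  apply: (measurableT_comp mF); apply: measurable_fun_pair => /=.
    by apply: measurable_funD => //; exact: measurable_cst.
  by apply: measurable_funD => //; exact: measurable_cst.
rewrite (fubini_tonelli1 (fun z : measurableTypeR R * measurableTypeR R => F (z + e)%R))//.
rewrite [RHS](fubini_tonelli1 (F : P -> \bar R) mF F0).
rewrite /fubini_F -[RHS](@integral_shift _ e.1); last 2 first.
- exact: measurable_fun_fubini_tonelli_F.
- by move=> x; apply: integral_ge0.
apply: eq_integral => x _ /=.
rewrite -[RHS](@integral_shift _ e.2)//.
exact: measurableT_comp.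
Qed.

Lemma Rintegral_shift2 (F : R * R -> R) (e : R * R) :
  measurable_fun setT (F : measurableTypeR R * measurableTypeR R -> R) ->
  \int[mu2]_z F (z + e) = \int[mu2]_z F z.
Proof.
move=> mF; rewrite /Rintegral integralE [in RHS]integralE; congr fine.
have mE : measurable_fun setT (EFin \o F : measurableTypeR R * measurableTypeR R -> \bar R).
  exact/measurable_EFinP.
congr (_ - _)%E.
  have H := @integral_shift2 _ e (measurable_funepos mE) (funepos_ge0 _).
  etransitivity; last exact: H.
  by apply: eq_integral => z _; rewrite !funeposE.
have H := @integral_shift2 _ e (measurable_funeneg mE) (funeneg_ge0 _).
etransitivity; last exact: H.
by apply: eq_integral => z _; rewrite !funenegE.
Qed.

Lemma continuous_shift2 (V : R * R -> R) (e : R * R) : continuous V ->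
  continuous (fun z : R * R => V (z + e)).
Proof. by move=> cV z; apply: continuous_comp; [apply: cvgD; [exact: cvg_id|exact: cvg_cst]|exact: cV]. Qed.

Lemma csupp_shift (V : R * R -> R) (e : R * R) : csupp V -> csupp (fun z : R * R => V (z + e)).
Proof.
move=> [r rV]; exists (r + `|e|) => z rz; apply: rV; rewrite -ltrBrDr in rz.
by apply: (lt_le_trans rz); rewrite -{1}(addrK e z); rewrite lerBlDr; exact: ler_normB.
Qed.

Lemma RintegralM_shift (Z V : R * R -> R) (a b : R * R) : continuous Z -> continuous V ->
  \int[mu2]_z (Z (z + a) * V (z + b)) = \int[mu2]_z (Z z * V (z + (b - a))).
Proof.
move=> cZ cV.
have cF : continuous (fun z : R * R => Z (z + a) * V (z + b)).
  by move=> z; apply: cvgM; [exact: continuous_shift2|exact: continuous_shift2].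
rewrite -(@Rintegral_shift2 _ (- a)); last exact: continuous_measurable_fun2.
by apply: eq_Rintegral => z _; rewrite subrK -addrA (addrC (- a)).
Qed.

Definition cdiff (e : R * R) (V : R * R -> R) (z : R * R) := V (z + e) - V (z - e).

Lemma continuous_cdiff e V : continuous V -> continuous (cdiff e V).
Proof. by move=> cV z; apply: cvgB; exact: continuous_shift2. Qed.

Lemma csupp_cdiff e V : csupp V -> csupp (cdiff e V).
Proof.
move=> sV; have [r rV] := csupp_shift e sV; have [q qV] := csupp_shift (- e) sV.
by exists (Num.max r q) => z; rewrite gt_max => /andP[/rV H1 /qV H2]; rewrite /cdiff H1 H2 subrr.
Qed.

(** The discrete form of Stokes' formula. Expanded, either side is a combination of four
    correlations of [Z] and [V], each depending only on the difference of two shifts; with central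
    differences the four differences are the same on both sides, which fails for forward
    differences. *)
Lemma Rintegral_cdiffM (Z V : R * R -> R) (a b : R * R) :
  continuous Z -> csupp Z -> continuous V ->
  \int[mu2]_z (cdiff a Z z * cdiff b V z) = \int[mu2]_z (cdiff b Z z * cdiff a V z).
Proof.
move=> cZ sZ cV.
have int c d : mu2.-integrable setT (EFin \o (fun z : R * R => Z (z + c) * V (z + d))).
  apply: continuous_csupp_integrable.
    by move=> z; apply: cvgM; exact: continuous_shift2.
  by apply: csuppM; exact: csupp_shift.
pose J c d := \int[mu2]_z (Z (z + c) * V (z + d)).
have E c d : \int[mu2]_z (cdiff c Z z * cdiff d V z) =
    J c d - J c (- d) - (J (- c) d - J (- c) (- d)).
  rewrite /J -!RintegralB//.
    by apply: eq_Rintegral => z _; rewrite /cdiff; ring.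
    exact: (integrableB _ (int _ _) (int _ _)).
    exact: (integrableB _ (int _ _) (int _ _)).
rewrite !E /J !RintegralM_shift// !opprK.
rewrite (addrC b a) (addrC (- b) a) (addrC (- b) (-a)) (addrC (- a) b).
ring.
Qed.


Definition L2 (f : R * R -> R) := measurable_fun setT (f : P -> R) /\
  (\int[mu2]_z ((f z) ^+ 2)%:E < +oo)%E.

Lemma L2_sqr f : L2 f -> mu2.-integrable setT (EFin \o (fun z => f z ^+ 2)).
Proof.
move=> [mf f2]; apply/integrableP; split.
  by apply/measurable_EFinP; exact: measurable_funX.
apply: le_lt_trans f2; rewrite le_eqVlt; apply/orP; left; apply/eqP.
by apply: eq_integral => z _ /=; rewrite ger0_norm// sqr_ge0.
Qed.

Lemma L2M f g : L2 f -> L2 g -> mu2.-integrable setT (EFin \o (fun z => f z * g z)).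
Proof.
move=> Lf Lg; have := integrableD measurableT (L2_sqr Lf) (L2_sqr Lg).
apply: le_integrable => //.
  by apply/measurable_EFinP; apply: measurable_funM; [case: Lf|case: Lg].
move=> z _ /=; rewrite lee_fin [leRHS]ger0_norm ?addr_ge0 ?sqr_ge0//.
rewrite ler_norml; apply/andP; split; nra.
Qed.

Lemma L2_continuous f : continuous f -> csupp f -> L2 f.
Proof.
move=> cf sf; split; first exact: continuous_measurable_fun2.
have : mu2.-integrable setT (EFin \o (fun z => f z * f z)).
  apply: continuous_csupp_integrable; last exact: csuppM.
  by move=> z; apply: cvgM; exact: cf.
move=> /integrableP[_]; apply: le_lt_trans.
rewrite le_eqVlt; apply/orP; left; apply/eqP; apply: eq_integral => z _ /=.
by rewrite -expr2 ger0_norm// sqr_ge0.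
Qed.

Lemma L2_lincomb f g (a b : R) : L2 f -> L2 g -> L2 (fun z => a * f z + b * g z).
Proof.
move=> Lf Lg; have mfg : measurable_fun setT ((fun z => a * f z + b * g z) : P -> R).
  by apply: measurable_funD; apply: measurable_funM => //; [case: Lf|case: Lg].
split => //.
have := integrableD measurableT (integrableZl measurableT (2 * a ^+ 2) (L2_sqr Lf))
  (integrableZl measurableT (2 * b ^+ 2) (L2_sqr Lg)).
move=> /integrableP[_]; apply: le_lt_trans; apply: ge0_le_integral => //=.
- by move=> z _; rewrite lee_fin sqr_ge0.
- by apply/measurable_EFinP; exact: measurable_funX.
- apply/measurable_EFinP; apply: measurableT_comp => //; apply: measurable_funD; apply: measurable_funM => //; apply: measurable_funX.
    by case: Lf.
  by case: Lg.
- move=> z _; rewrite lee_fin; apply: le_trans (ler_norm _).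
  rewrite -subr_ge0 (_ : _ - _ = (a * f z - b * g z) ^+ 2) ?sqr_ge0//; ring.
Qed.

Lemma L2_EFin f : L2 f -> (\int[mu2]_z (f z ^+ 2)%:E = (\int[mu2]_z (f z ^+ 2))%:E)%E.
Proof.
move=> [mf f2]; rewrite /Rintegral fineK// ge0_fin_numE//.
by apply: integral_ge0 => z _; rewrite lee_fin sqr_ge0.
Qed.

Lemma Rintegral_sqrD f g : L2 f -> L2 g -> \int[mu2]_z ((f z + g z) ^+ 2) =
  \int[mu2]_z (f z ^+ 2) + \int[mu2]_z (g z ^+ 2) + 2 * \int[mu2]_z (f z * g z).
Proof.
move=> Lf Lg; rewrite -RintegralD//; try exact: L2_sqr.
rewrite -RintegralZl//; last exact: L2M.
rewrite -RintegralD//.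
- by apply: eq_Rintegral => z _; ring.
- exact: (integrableD measurableT (L2_sqr Lf) (L2_sqr Lg)).
- exact: (integrableZl measurableT 2 (L2M Lf Lg)).
Qed.

Lemma fatou_le (F_ : nat -> P -> R) (F : P -> R) (M : R) :
  (forall n, measurable_fun setT (F_ n)) -> (forall n z, 0 <= F_ n z) ->
  measurable_fun setT F -> (forall z, 0 <= F z) ->
  {ae mu2, forall z, F_ n z @[n --> \oo] --> F z} ->
  (forall n, (\int[mu2]_z (F_ n z)%:E <= M%:E)%E) ->
  (\int[mu2]_z (F z)%:E <= M%:E)%E.
Proof.
move=> mF_ F_0 mF F0 cF bF.
have mE n : measurable_fun setT (fun z => (F_ n z)%:E) by exact/measurable_EFinP.
have E0 n z : setT z -> (0 <= (F_ n z)%:E)%E by rewrite lee_fin.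
have := fatou mu2 measurableT mE E0.
have -> : (\int[mu2]_z limn_einf (fun n => (F_ n z)%:E) = \int[mu2]_z (F z)%:E)%E.
  apply: ae_eq_integral => //.
  - apply: (emeasurable_fun_cvg (fun n z => einfs (fun k => (F_ k z)%:E) n)).
      by move=> n; exact: measurable_fun_einfs.
    by move=> z _; rewrite limn_einf_lim; exact: is_cvg_einfs.
  - exact/measurable_EFinP.
  - apply: filterS cF => z cz _.
    have : (F_ n z)%:E @[n --> \oo] --> (F z)%:E by apply: cvg_EFin => //; exact: nearW.
    by move/cvg_limn_einf_sup => [].
move=> H; apply: (le_trans H).
rewrite limn_einf_lim; apply: lime_le; first exact: is_cvg_einfs.
apply: nearW => n; apply: le_trans (bF n); apply: ereal_inf_lbound.
by exists n => //=.
Qed.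

(* Fatou applied to [(a_n + b_n)^2 + (c_n - d_n)^2]: the hypothesis
   [int a_n b_n = int c_n d_n] makes the integrals of these bounded by the sum of
   the four energies. *)
Lemma L2_limit_le (a_ b_ c_ d_ : nat -> R * R -> R) (a b c d : R * R -> R) :
  (forall n, L2 (a_ n)) -> (forall n, L2 (b_ n)) -> (forall n, L2 (c_ n)) -> (forall n, L2 (d_ n)) ->
  L2 a -> L2 b -> L2 c -> L2 d ->
  {ae mu2, forall z, a_ n z @[n --> \oo] --> a z} ->
  {ae mu2, forall z, b_ n z @[n --> \oo] --> b z} ->
  {ae mu2, forall z, c_ n z @[n --> \oo] --> c z} ->
  {ae mu2, forall z, d_ n z @[n --> \oo] --> d z} ->
  (forall n, \int[mu2]_z (a_ n z ^+ 2) <= \int[mu2]_z (a z ^+ 2)) ->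
  (forall n, \int[mu2]_z (b_ n z ^+ 2) <= \int[mu2]_z (b z ^+ 2)) ->
  (forall n, \int[mu2]_z (c_ n z ^+ 2) <= \int[mu2]_z (c z ^+ 2)) ->
  (forall n, \int[mu2]_z (d_ n z ^+ 2) <= \int[mu2]_z (d z ^+ 2)) ->
  (forall n, \int[mu2]_z (a_ n z * b_ n z) = \int[mu2]_z (c_ n z * d_ n z)) ->
  \int[mu2]_z (a z * b z) <= \int[mu2]_z (c z * d z).
Proof.
move=> La_ Lb_ Lc_ Ld_ La Lb Lc Ld ca cb cc cd Ia Ib Ic Id E.
have LN f : L2 f -> L2 (fun z => - f z).
  move=> Lf; have := L2_lincomb (-1) 0 Lf Lf; congr L2.
  by apply/funext => z; rewrite mul0r addr0 mulN1r.
have LD f g : L2 f -> L2 g -> L2 (fun z => f z + g z).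
  move=> Lf Lg; have := L2_lincomb 1 1 Lf Lg; congr L2.
  by apply/funext => z; rewrite !mul1r.
have key f g h k : L2 f -> L2 g -> L2 h -> L2 k ->
  \int[mu2]_z ((f z + g z) ^+ 2 + (h z + - k z) ^+ 2) =
  \int[mu2]_z (f z ^+ 2) + \int[mu2]_z (g z ^+ 2) + \int[mu2]_z (h z ^+ 2) +
  \int[mu2]_z (k z ^+ 2) + 2 * \int[mu2]_z (f z * g z) - 2 * \int[mu2]_z (h z * k z).
  move=> Lf Lg Lh Lk; rewrite RintegralD//; last 2 first.
  - exact: L2_sqr (LD _ _ Lf Lg).
  - exact: L2_sqr (LD _ _ Lh (LN _ Lk)).
  rewrite Rintegral_sqrD// Rintegral_sqrD//; last exact: LN.
  have -> : \int[mu2]_z ((- k z) ^+ 2) = \int[mu2]_z (k z ^+ 2).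
    by apply: eq_Rintegral => z _; rewrite sqrrN.
  have -> : \int[mu2]_z (h z * - k z) = - \int[mu2]_z (h z * k z).
    rewrite -mulN1r -RintegralZl//; last exact: L2M.
    by apply: eq_Rintegral => z _; rewrite mulN1r mulrN.
  ring.
set M := \int[mu2]_z (a z ^+ 2) + \int[mu2]_z (b z ^+ 2) + \int[mu2]_z (c z ^+ 2) +
  \int[mu2]_z (d z ^+ 2).
have EE f g h k : L2 f -> L2 g -> L2 h -> L2 k ->
  (\int[mu2]_z ((f z + g z) ^+ 2 + (h z + - k z) ^+ 2)%:E =
   (\int[mu2]_z ((f z + g z) ^+ 2 + (h z + - k z) ^+ 2))%:E)%E.
  move=> Lf Lg Lh Lk; rewrite /Rintegral fineK//; apply: integrable_fin_num => //.
  exact: (integrableD measurableT (L2_sqr (LD _ _ Lf Lg)) (L2_sqr (LD _ _ Lh (LN _ Lk)))).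
have mm f g h k : L2 f -> L2 g -> L2 h -> L2 k ->
  measurable_fun setT ((fun z => (f z + g z) ^+ 2 + (h z + - k z) ^+ 2) : P -> R).
  move=> [mf _] [mg _] [mh _] [mk _].
  apply: measurable_funD; apply: measurable_funX; apply: measurable_funD => //.
  exact: measurableT_comp.
have : (\int[mu2]_z ((a z + b z) ^+ 2 + (c z + - d z) ^+ 2)%:E <= M%:E)%E.
  apply: (@fatou_le (fun n z => (a_ n z + b_ n z) ^+ 2 + (c_ n z + - d_ n z) ^+ 2)).
  - by move=> n; exact: mm.
  - by move=> n z; rewrite addr_ge0// sqr_ge0.
  - exact: mm.
  - by move=> z; rewrite addr_ge0// sqr_ge0.
  - apply: filterS2 (filterI ca cb) (filterI cc cd) => z [az bz] [cz dz].
    apply: cvgD; rewrite expr2; under eq_fun do rewrite expr2.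
      by apply: cvgM; apply: cvgD.
    by apply: cvgM; apply: cvgD => //; apply: cvgN.
  - move=> n; rewrite EE// key// lee_fin E.
    by rewrite addrK /M; do 3 (apply: lerD => //).
by rewrite EE// key// lee_fin -/M -addrA gerDl subr_le0 ler_pM2l.
Qed.

End PlaneIntegrals.

(** * Stokes' formula for Sobolev functions *)

Section PlaneStokes.
Variable R : realType.
Local Notation mu := (@lebesgue_measure R).
Local Notation mu2 := (mu \x mu)%E.
Local Notation P := (measurableTypeR R * measurableTypeR R)%type.

Lemma central_difference_cvg (f : R -> R) (x l : R) : is_derive x 1 f l ->
  (2 * n.+1%:R^-1)^-1 * (f (x + n.+1%:R^-1) - f (x - n.+1%:R^-1)) @[n --> \oo] --> l.
Proof.
move=> df; apply/cvgrPdist_le => e e0.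
have [d d0 dP] := is_derive_approx df e0.
near=> n.
set h := n.+1%:R^-1.
have h0 : 0 < h by rewrite invr_gt0.
have hd : h < d by rewrite /h; near: n; exact: near_infty_natSinv_lt (PosNum d0).
have H1 := dP (x + h); rewrite (addrC x) addrK gtr0_norm// in H1.
have H2 := dP (x - h); rewrite (addrC x) addrK normrN gtr0_norm// in H2.
have {}H1 := H1 hd; have {}H2 := H2 hd.
have -> : l - (2 * h)^-1 * (f (x + h) - f (x - h)) =
  (2 * h)^-1 * ((f (-h + x) - f x - l * (- h)) - (f (h + x) - f x - l * h)).
  by rewrite (addrC (- h)) (addrC h x); field; rewrite gt_eqF.
rewrite normrM gtr0_norm ?invr_gt0 ?mulr_gt0//.
rewrite ler_pdivrMl ?mulr_gt0//.
by apply: (le_trans (ler_normB _ _)); lra.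
Unshelve. all: by end_near. Qed.

(** The Cauchy-Schwarz inequality, with an infinite right side allowed. It comes from integrating
    [|f| <= t / 2 + f ^ 2 / (2 t)], where [t] is the mean slope [|d| / (b - a)], the value for which
    a constant [f] gives equality. *)
Lemma increment_sqr_le (f : R -> R) (d a b : R) : a < b -> measurable_fun setT f ->
  (`|d|%:E <= \int[mu]_(x in `]a, b]) `|f x|%:E)%E ->
  ((d ^+ 2)%:E <= (b - a)%:E * \int[mu]_(x in `]a, b]) (f x ^+ 2)%:E)%E.
Proof.
move=> ab mf dI; have ba0 : 0 < b - a by rewrite subr_gt0.
have J0 : (0 <= \int[mu]_(x in `]a, b]) (f x ^+ 2)%:E)%E.
  by apply: integral_ge0 => x _; rewrite lee_fin sqr_ge0.
have [->|d0] := eqVneq d 0.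
  by rewrite expr0n/=; apply: mule_ge0 => //; rewrite lee_fin ltW.
have nd : 0 < `|d| by rewrite normr_gt0.
pose t := `|d| / (b - a).
have t0 : 0 < t by rewrite divr_gt0.
have mf2 : measurable_fun `]a, b] (fun x => (f x ^+ 2)%:E).
  by apply/measurable_EFinP/measurable_funTS/measurable_funX.
have : (\int[mu]_(x in `]a, b]) `|f x|%:E <=
    \int[mu]_(x in `]a, b]) ((t / 2)%:E + (2 * t)^-1%:E * (f x ^+ 2)%:E))%E.
  apply: ge0_le_integral => //=.
  - by apply/measurable_EFinP/measurableT_comp => //; exact: measurable_funTS.
  - by apply: emeasurable_funD => //; apply: measurable_funeM.
  - move=> x _; rewrite -EFinM -EFinD lee_fin.
    have -> : t / 2 + (2 * t)^-1 * f x ^+ 2 = `|f x| + (2 * t)^-1 * (`|f x| - t) ^+ 2.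
      by rewrite sqrrB real_normK ?num_real//; field; rewrite gt_eqF.
    by rewrite lerDl mulr_ge0 ?sqr_ge0// invr_ge0 mulr_ge0// ltW.
move=> /(le_trans dI); rewrite ge0_integralD//=; last 3 first.
- by move=> x _; rewrite lee_fin divr_ge0// ltW.
- by move=> x _; rewrite -EFinM lee_fin mulr_ge0 ?sqr_ge0// invr_ge0 mulr_ge0// ltW.
- by apply: measurable_funeM.
rewrite integral_cst//= lebesgue_measure_itv/= lte_fin ab -EFinB.
rewrite ge0_integralZl//; last 2 first.
- by move=> x _; rewrite lee_fin sqr_ge0.
- by rewrite lee_fin invr_ge0 mulr_ge0// ltW.
move: J0; case: (\int[mu]_(x in _) _)%E => [j||]//= J0.
  rewrite -!EFinM -EFinD !lee_fin => H.
  have E : t * (b - a) = `|d| by rewrite /t mulfVK// gt_eqF.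
  have {}H : `|d| / 2 <= (2 * t)^-1 * j by move: H; rewrite mulrAC E; lra.
  have H2 : t * `|d| <= j.
    have := ler_wpM2l (ltW (mulr_gt0 (ltr0Sn R 1) t0)) H.
    rewrite mulVKf ?gt_eqF ?mulr_gt0 ?invr_gt0//.
    by rewrite (_ : 2 * t * (`|d| / 2) = t * `|d|)//; field.
  rewrite -(real_normK (num_real d)) expr2 -{1}E mulrAC mulrC.
  by apply: ler_wpM2l => //; exact: ltW.
by move=> _; rewrite gt0_muley ?lte_fin// leey.
Qed.

Lemma integral_itv_indic (f : R -> R) (A : set R) : measurable (A : set (measurableTypeR R)) ->
  (\int[mu]_(x in A) (f x)%:E = \int[mu]_x ((f x * \1_A x)%:E))%E.
Proof.
move=> mA; rewrite integral_mkcond; apply: eq_integral => x _.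
by rewrite patchE indicE; case: ifP; rewrite ?mulr1 ?mulr0.
Qed.

(** The squared difference at [x] is at most [2 h] times the integral of [f ^ 2] over an interval of
    length [2 h] around [x]. Integrating in [x] and exchanging the integrals counts every [s] for
    the [x] in an interval of length [2 h], which is the second factor. *)
Lemma central_difference_L2 (g f : R -> R) (h : R) : 0 < h -> measurable_fun setT f ->
  measurable_fun setT g ->
  (forall a b, a <= b -> (`|g b - g a|%:E <= \int[mu]_(x in `]a, b]) `|f x|%:E)%E) ->
  (\int[mu]_x ((g (x + h) - g (x - h)) ^+ 2)%:E <=
   ((2 * h) ^+ 2)%:E * \int[mu]_x ((f x) ^+ 2)%:E)%E.
Proof.
move=> h0 mf mg gf.
pose E : set P := [set z | z.1 - h < z.2] `&` ~` [set z | z.1 + h < z.2].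
have mE : measurable E.
  have cE (c : R) : measurable ([set z | z.1 + c < z.2] : set P).
    apply: open_measurable2; rewrite (_ : [set z | _] = (fun z : R * R => z.2 - z.1 - c) @^-1` [set x | 0 < x]); last first.
      by apply/seteqP; split => z /=; lra.
    apply: open_comp; last exact: open_gt.
    move=> z _; apply: cvgB; last exact: cvg_cst.
    by apply: cvgB; [exact: cvg_snd|exact: cvg_fst].
  by apply: measurableI; [exact: cE|apply: measurableC; exact: cE].
pose F (z : P) := (f z.2 ^+ 2 * \1_E z)%:E.
have F0 z : (0 <= F z)%E by rewrite lee_fin mulr_ge0 ?sqr_ge0// indicE ler0n.
have mF : measurable_fun setT F.
  apply/measurable_EFinP; apply: measurable_funM; last exact: measurable_indic.
  by apply: measurable_funX; apply: measurableT_comp.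
have E1 (x s : R) : \1_E (x, s) = \1_(`]x - h, x + h]) s :> R.
  rewrite !indicE; suff -> : ((x, s) \in E) = (s \in (`]x - h, x + h]%classic : set R)) by [].
  apply/idP/idP; rewrite !inE /E /= in_itv/=.
    by move=> [-> /negP]; rewrite -leNgt.
  by move=> /andP[-> sx]; split => //; apply/negP; rewrite -leNgt.
have E2 (x s : R) : \1_E (x, s) = \1_(`[s - h, s + h[) x :> R.
  rewrite E1 !indicE.
  suff -> : (s \in (`]x - h, x + h]%classic : set R)) = (x \in (`[s - h, s + h[%classic : set R)) by [].
  apply/idP/idP; rewrite !inE /= !in_itv/= => /andP[? ?]; apply/andP; split; lra.
have mH : measurable_fun setT (fun x => \int[mu]_s F (x, s))%E.
  exact: measurable_fun_fubini_tonelli_F.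
apply: (@le_trans _ _ (\int[mu]_x ((2 * h)%:E * \int[mu]_s F (x, s)))%E).
  apply: ge0_le_integral => //.
  - by move=> x _; rewrite lee_fin sqr_ge0.
  - apply/measurable_EFinP; apply: measurable_funX; apply: measurable_funB;
    by apply: (measurableT_comp mg); apply: measurable_funD => //; exact: measurable_cst.
  - by apply: measurable_funeM.
  - move=> x _.
    have := @increment_sqr_le f (g (x + h) - g (x - h)) (x - h) (x + h).
    rewrite (_ : x + h - (x - h) = 2 * h); last by ring.
    rewrite (_ : (\int[mu]_s F (x, s))%E = (\int[mu]_(s in `](x - h)%R, (x + h)%R]) (f s ^+ 2)%:E)%E); last first.
      by rewrite [RHS]integral_itv_indic//; apply: eq_integral => s _; rewrite /F /= E1.
    by apply => //; [lra|apply: gf; lra].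
rewrite ge0_integralZl//; last 2 first.
- by move=> x _; exact: integral_ge0.
- by rewrite lee_fin mulr_ge0// ltW.
rewrite (fubini_tonelli F mF F0).
rewrite (_ : (fun y => \int[mu]_x F (x, y))%E = (fun s => (2 * h)%:E * (f s ^+ 2)%:E)%E); last first.
  apply/funext => s.
  rewrite (_ : (\int[mu]_x F (x, s))%E = (\int[mu]_x ((f s ^+ 2)%:E * (\1_(`[s - h, s + h[) x)%:E))%E); last first.
    by apply: eq_integral => x _; rewrite /F /= E2 EFinM.
  rewrite ge0_integralZl//; last 2 first.
  - by apply/measurable_EFinP; exact: measurable_indic.
  - by rewrite lee_fin sqr_ge0.
  have -> : (\int[mu]_x (\1_(`[(s - h)%R, (s + h)%R[) x)%:E = (2 * h)%:E)%E.
    rewrite integral_indic// setIT.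
    transitivity (mu `[(s - h)%R, (s + h)%R[%classic); first by [].
    rewrite lebesgue_measure_itv/= lte_fin ifT; last lra.
    by rewrite -EFinB; congr EFin; ring.
  by rewrite muleC.
rewrite ge0_integralZl//.
- by rewrite muleA -EFinM expr2.
- by apply/measurable_EFinP; exact: measurable_funX.
- by move=> s _; rewrite lee_fin sqr_ge0.
- by rewrite lee_fin mulr_ge0// ltW.
Qed.


(** Continuous functions of class W^{1,2} with compact support. Absolute continuity enters only
    through the bound of increments by the integral of the derivative, since this is what difference
    quotients need. *)
Record sob0 (V Vx Vy : R * R -> R) : Prop := Sob0 {
  sob0_continuous : continuous V;
  sob0_csupp : csupp V;
  sob0_L2x : L2 Vx;
  sob0_L2y : L2 Vy;
  sob0_incrx : {ae mu, forall y : R, forall a b, a <= b ->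
    (`|V (b, y) - V (a, y)|%:E <= \int[mu]_(x in `]a, b]) `|Vx (x, y)|%:E)%E};
  sob0_incry : {ae mu, forall x : R, forall a b, a <= b ->
    (`|V (x, b) - V (x, a)|%:E <= \int[mu]_(y in `]a, b]) `|Vy (x, y)|%:E)%E};
  sob0_dx : {ae mu2, forall z : R * R, is_derive z.1 1 (fun x => V (x, z.2)) (Vx z)};
  sob0_dy : {ae mu2, forall z : R * R, is_derive z.2 1 (fun y => V (z.1, y)) (Vy z)} }.

Let ex (h : R) : R * R := (h, 0).
Let ey (h : R) : R * R := (0, h).

Lemma cdiff_exE (V : R * R -> R) h z : cdiff (ex h) V z = V (z.1 + h, z.2) - V (z.1 - h, z.2).
Proof. by case: z => x y; rewrite /cdiff /ex; congr (V (_, _) - V (_, _)); rewrite /= ?addr0 ?subr0. Qed.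

Lemma cdiff_eyE (V : R * R -> R) h z : cdiff (ey h) V z = V (z.1, z.2 + h) - V (z.1, z.2 - h).
Proof. by case: z => x y; rewrite /cdiff /ey; congr (V (_, _) - V (_, _)); rewrite /= ?addr0 ?subr0. Qed.

Lemma measurable_pair1 (V : R * R -> R) (x : R) : measurable_fun setT (V : P -> R) ->
  measurable_fun setT (fun y : R => V (x, y)).
Proof. by move=> mV; apply: (measurableT_comp mV); exact: measurable_fun_pair. Qed.

Lemma measurable_pair2 (V : R * R -> R) (y : R) : measurable_fun setT (V : P -> R) ->
  measurable_fun setT (fun x : R => V (x, y)).
Proof. by move=> mV; apply: (measurableT_comp mV); exact: measurable_fun_pair. Qed.

Lemma sob0_cdiff_ex V Vx Vy h : sob0 V Vx Vy -> 0 < h ->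
  \int[mu2]_z ((cdiff (ex h) V z) ^+ 2) <= (2 * h) ^+ 2 * \int[mu2]_z (Vx z ^+ 2).
Proof.
move=> [cV sV Lx Ly ix iy dx dy] h0.
have mV : measurable_fun setT (V : P -> R) by exact: continuous_measurable_fun2.
have Ld : L2 (cdiff (ex h) V).
  by apply: L2_continuous; [exact: continuous_cdiff|exact: csupp_cdiff].
have mVx : measurable_fun setT (Vx : P -> R) by case: Lx.
have mVx2 : measurable_fun setT ((fun z => (Vx z ^+ 2)%:E) : P -> _).
  by apply/measurable_EFinP; exact: measurable_funX.
have mc2 : measurable_fun setT ((fun z => (cdiff (ex h) V z ^+ 2)%:E) : P -> _).
  by apply/measurable_EFinP; apply: measurable_funX; case: Ld.
rewrite -lee_fin EFinM -!L2_EFin//.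
rewrite fubini_tonelli2//; last by move=> z; rewrite lee_fin sqr_ge0.
rewrite [in leRHS]fubini_tonelli2//; last by move=> z; rewrite lee_fin sqr_ge0.
have mG : measurable_fun setT (fubini_G mu ((fun z => (Vx z ^+ 2)%:E) : P -> _)).
  by apply: measurable_fun_fubini_tonelli_G => // z; rewrite lee_fin sqr_ge0.
rewrite -ge0_integralZl//; last 2 first.
- by move=> y _; apply: integral_ge0 => x _; rewrite lee_fin sqr_ge0.
- by rewrite lee_fin sqr_ge0.
apply: ae_ge0_le_integral => //.
- by move=> y _; apply: integral_ge0 => x _; rewrite lee_fin sqr_ge0.
- by apply: measurable_fun_fubini_tonelli_G => // z; rewrite lee_fin sqr_ge0.
- move=> y _; apply: mule_ge0; first by rewrite lee_fin sqr_ge0.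
  by apply: integral_ge0 => x _; rewrite lee_fin sqr_ge0.
- exact: measurable_funeM.
apply: filterS ix => y iy' _; rewrite /fubini_G.
have := @central_difference_L2 (fun x => V (x, y)) (fun x => Vx (x, y)) h h0
  (measurable_pair2 y mVx) (measurable_pair2 y mV) iy'.
apply: le_trans; rewrite le_eqVlt; apply/orP; left; apply/eqP.
by apply: eq_integral => x _; rewrite cdiff_exE.
Qed.

Lemma sob0_cdiff_ey V Vx Vy h : sob0 V Vx Vy -> 0 < h ->
  \int[mu2]_z ((cdiff (ey h) V z) ^+ 2) <= (2 * h) ^+ 2 * \int[mu2]_z (Vy z ^+ 2).
Proof.
move=> [cV sV Ly Lx iy ix dx dy] h0.
have mV : measurable_fun setT (V : P -> R) by exact: continuous_measurable_fun2.
have Ld : L2 (cdiff (ey h) V).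
  by apply: L2_continuous; [exact: continuous_cdiff|exact: csupp_cdiff].
have mVx : measurable_fun setT (Vy : P -> R) by case: Lx.
have mVx2 : measurable_fun setT ((fun z => (Vy z ^+ 2)%:E) : P -> _).
  by apply/measurable_EFinP; exact: measurable_funX.
have mc2 : measurable_fun setT ((fun z => (cdiff (ey h) V z ^+ 2)%:E) : P -> _).
  by apply/measurable_EFinP; apply: measurable_funX; case: Ld.
rewrite -lee_fin EFinM -!L2_EFin//.
rewrite fubini_tonelli1//; last by move=> z; rewrite lee_fin sqr_ge0.
rewrite [in leRHS]fubini_tonelli1//; last by move=> z; rewrite lee_fin sqr_ge0.
have mG : measurable_fun setT (fubini_F mu ((fun z => (Vy z ^+ 2)%:E) : P -> _)).
  by apply: measurable_fun_fubini_tonelli_F => // z; rewrite lee_fin sqr_ge0.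
rewrite -ge0_integralZl//; last 2 first.
- by move=> y _; apply: integral_ge0 => x _; rewrite lee_fin sqr_ge0.
- by rewrite lee_fin sqr_ge0.
apply: ae_ge0_le_integral => //.
- by move=> y _; apply: integral_ge0 => x _; rewrite lee_fin sqr_ge0.
- by apply: measurable_fun_fubini_tonelli_F => // z; rewrite lee_fin sqr_ge0.
- move=> y _; apply: mule_ge0; first by rewrite lee_fin sqr_ge0.
  by apply: integral_ge0 => x _; rewrite lee_fin sqr_ge0.
- exact: measurable_funeM.
apply: filterS ix => x ix' _; rewrite /fubini_F.
have := @central_difference_L2 (fun y => V (x, y)) (fun y => Vy (x, y)) h h0
  (measurable_pair1 x mVx) (measurable_pair1 x mV) ix'.
apply: le_trans; rewrite le_eqVlt; apply/orP; left; apply/eqP.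
by apply: eq_integral => y _; rewrite cdiff_eyE.
Qed.

(** Central difference quotients converge almost everywhere to the derivatives, and their energies
    never exceed those of the derivatives; so the discrete formula passes to the limit by
    [L2_limit_le]. That limit gives an inequality only, and exchanging the two products gives the
    opposite one. *)
Lemma sob0_stokes_le Z Zx Zy V Vx Vy : sob0 Z Zx Zy -> sob0 V Vx Vy ->
  \int[mu2]_z (Zx z * Vy z) <= \int[mu2]_z (Zy z * Vx z) /\
  \int[mu2]_z (Zy z * Vx z) <= \int[mu2]_z (Zx z * Vy z).
Proof.
move=> sZ sV.
pose h (n : nat) : R := n.+1%:R^-1.
have h0 n : 0 < h n by rewrite invr_gt0.
have k0 n : 0 < (2 * h n)^-1 by rewrite invr_gt0 mulr_gt0.
pose dx (W : R * R -> R) n z := (2 * h n)^-1 * cdiff (ex (h n)) W z.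
pose dy (W : R * R -> R) n z := (2 * h n)^-1 * cdiff (ey (h n)) W z.
have LL W n e : continuous W -> csupp W -> L2 (fun z => (2 * h n)^-1 * cdiff e W z).
  move=> cW sW; have Ld : L2 (cdiff e W).
    by apply: L2_continuous; [exact: continuous_cdiff|exact: csupp_cdiff].
  have := L2_lincomb (2 * h n)^-1 0 Ld Ld; congr L2.
  by apply/funext => z; rewrite mul0r addr0.
have LE W n e : continuous W -> csupp W ->
    \int[mu2]_z (((2 * h n)^-1 * cdiff e W z) ^+ 2) = (2 * h n) ^-2 * \int[mu2]_z ((cdiff e W z) ^+ 2).
  move=> cW sW; rewrite -RintegralZl//; last first.
    by apply: L2_sqr; apply: L2_continuous; [exact: continuous_cdiff|exact: csupp_cdiff].
  by apply: eq_Rintegral => z _; rewrite exprMn exprVn.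
have cx W Wx Wy : sob0 W Wx Wy -> {ae mu2, forall z, dx W n z @[n --> \oo] --> Wx z}.
  move=> sW; apply: filterS (sob0_dx sW) => z /central_difference_cvg; rewrite /dx.
  by under [in X in _ -> X]eq_fun do rewrite cdiff_exE.
have cy W Wx Wy : sob0 W Wx Wy -> {ae mu2, forall z, dy W n z @[n --> \oo] --> Wy z}.
  move=> sW; apply: filterS (sob0_dy sW) => z /central_difference_cvg; rewrite /dy.
  by under [in X in _ -> X]eq_fun do rewrite cdiff_eyE.
have bx W Wx Wy n : sob0 W Wx Wy -> \int[mu2]_z (dx W n z ^+ 2) <= \int[mu2]_z (Wx z ^+ 2).
  move=> sW; case: (sW) => cW cs _ _ _ _ _ _; rewrite LE// ler_pdivrMl ?exprn_gt0 ?mulr_gt0//.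
  exact: sob0_cdiff_ex sW _.
have by_ W Wx Wy n : sob0 W Wx Wy -> \int[mu2]_z (dy W n z ^+ 2) <= \int[mu2]_z (Wy z ^+ 2).
  move=> sW; case: (sW) => cW cs _ _ _ _ _ _; rewrite LE// ler_pdivrMl ?exprn_gt0 ?mulr_gt0//.
  exact: sob0_cdiff_ey sW _.
case: (sZ) => cZ cs LZx LZy _ _ _ _; case: (sV) => cV csV LVx LVy _ _ _ _.
have E n : \int[mu2]_z (dx Z n z * dy V n z) = \int[mu2]_z (dy Z n z * dx V n z).
  have EE e f : \int[mu2]_z (((2 * h n)^-1 * cdiff e Z z) * ((2 * h n)^-1 * cdiff f V z)) =
      ((2 * h n)^-1) ^+ 2 * \int[mu2]_z (cdiff e Z z * cdiff f V z).
    rewrite -RintegralZl//; last first.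
      apply: continuous_csupp_integrable.
        by move=> z; apply: cvgM; exact: continuous_cdiff.
      by apply: csuppM; exact: csupp_cdiff.
    by apply: eq_Rintegral => z _; ring.
  by rewrite /dx /dy !EE Rintegral_cdiffM.
split.
  apply: (@L2_limit_le _ (dx Z) (dy V) (dy Z) (dx V)) => //; try (by move=> n; exact: LL).
  - exact: cx sZ.
  - exact: cy sV.
  - exact: cy sZ.
  - exact: cx sV.
  - by move=> n; exact: bx sZ.
  - by move=> n; exact: by_ sV.
  - by move=> n; exact: by_ sZ.
  - by move=> n; exact: bx sV.
apply: (@L2_limit_le _ (dy Z) (dx V) (dx Z) (dy V)) => //; try (by move=> n; exact: LL).
- exact: cy sZ.
- exact: cx sV.
- exact: cx sZ.
- exact: cy sV.
- by move=> n; exact: by_ sZ.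
- by move=> n; exact: bx sV.
- by move=> n; exact: bx sZ.
- by move=> n; exact: by_ sV.
Qed.

(* [int dZ /\ dV = 0] *)
Lemma sob0_stokes Z Zx Zy V Vx Vy : sob0 Z Zx Zy -> sob0 V Vx Vy ->
  \int[mu2]_z (Zx z * Vy z - Zy z * Vx z) = 0.
Proof.
move=> sZ sV; have [H1 H2] := sob0_stokes_le sZ sV.
case: (sZ) => cZ cs LZx LZy _ _ _ _; case: (sV) => cV csV LVx LVy _ _ _ _.
rewrite RintegralB//; try exact: L2M.
by apply/eqP; rewrite subr_eq0 eq_le H1 H2.
Qed.

End PlaneStokes.

(** * Differential calculus in the plane *)

Section Gradients.
Variable R : realType.
Implicit Types (z : R * R) (g h : R * R -> R).

Lemma approx_is_derive (f : R -> R) (x l : R) :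
  (forall e, 0 < e -> exists2 d, 0 < d & forall y, `|y - x| < d ->
    `|f y - f x - l * (y - x)| <= e * `|y - x|) -> is_derive x 1 f l.
Proof.
move=> H.
have E : h^-1 *: (f (h *: 1 + x) - f x) @[h --> 0^'] --> l.
  apply/cvgrPdist_le => e e0; have [d d0 dP] := H e e0.
  rewrite near_withinE; exists d => //= y; rewrite /ball/= sub0r normrN => yd y0.
  have := dP (y + x); rewrite addrK => /(_ yd).
  rewrite /GRing.scale/= mulr1 => K.
  have -> : l - y^-1 * (f (y + x) - f x) = - (f (y + x) - f x - l * y) * y^-1 by field.
  by rewrite normrM normrN normfV ler_pdivrMr ?normr_gt0.
have df : derivable f x 1 by apply/cvg_ex; exists l.
by apply: DeriveDef => //; apply/cvg_lim.
Qed.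

(** Frechet differentiability with gradient [(p, q)]. Partial derivatives alone would not give the
    chain rule along curves, which [has_grad_curve] needs. *)
Definition has_grad g z (p q : R) := forall e, 0 < e -> exists2 d, 0 < d &
  forall w, `|w.1 - z.1| < d -> `|w.2 - z.2| < d ->
    `|g w - g z - (p * (w.1 - z.1) + q * (w.2 - z.2))| <= e * (`|w.1 - z.1| + `|w.2 - z.2|).

Lemma has_grad_cst (c : R) z : has_grad (fun=> c) z 0 0.
Proof.
move=> e e0; exists 1 => // w _ _; rewrite !mul0r !subrr addr0 subr0 normr0.
by rewrite mulr_ge0 ?addr_ge0// ltW.
Qed.

Lemma has_grad_fst z : has_grad fst z 1 0.
Proof.
move=> e e0; exists 1 => // w _ _; rewrite mul1r mul0r addr0 subrr normr0.
by rewrite mulr_ge0 ?addr_ge0// ltW.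
Qed.

Lemma has_grad_snd z : has_grad snd z 0 1.
Proof.
move=> e e0; exists 1 => // w _ _; rewrite mul1r mul0r add0r subrr normr0.
by rewrite mulr_ge0 ?addr_ge0// ltW.
Qed.

Lemma has_gradD g h z p q p' q' : has_grad g z p q -> has_grad h z p' q' ->
  has_grad (fun w => g w + h w) z (p + p') (q + q').
Proof.
move=> Hg Hh e e0.
have e2 : 0 < e / 2 by rewrite divr_gt0.
have [d1 d10 H1] := Hg _ e2; have [d2 d20 H2] := Hh _ e2.
exists (Num.min d1 d2); first by rewrite lt_min d10.
move=> w; rewrite !lt_min => /andP[a1 a2] /andP[b1 b2].
have := H1 w a1 b1; have := H2 w a2 b2 => K2 K1.
set X := g w - _ - _ in K1; set Y := h w - _ - _ in K2.
rewrite (_ : _ - _ - _ = X + Y); last by rewrite /X /Y; ring.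
by apply: (le_trans (ler_normD _ _)); lra.
Qed.

Lemma has_grad_bound g z p q : has_grad g z p q -> exists2 d, 0 < d &
  forall w, `|w.1 - z.1| < d -> `|w.2 - z.2| < d ->
    `|g w - g z| <= (`|p| + `|q| + 1) * (`|w.1 - z.1| + `|w.2 - z.2|).
Proof.
move=> Hg; have [d d0 H] := Hg 1 ltr01; exists d => // w w1 w2.
have := H w w1 w2 => K.
set X := _ - _ - _ in K; rewrite (_ : g w - g z = X + (p * (w.1 - z.1) + q * (w.2 - z.2))); last by rewrite /X; ring.
apply: (le_trans (ler_normD _ _)).
have := ler_normD (p * (w.1 - z.1)) (q * (w.2 - z.2)); rewrite !normrM => K2.
have := normr_ge0 p; have := normr_ge0 q; have := normr_ge0 (w.1 - z.1); have := normr_ge0 (w.2 - z.2).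
nra.
Qed.

Lemma has_grad_continuous g z p q : has_grad g z p q -> {for z, continuous g}.
Proof.
move=> Hg; have [d d0 H] := has_grad_bound Hg.
set M := `|p| + `|q| + 1 in H.
have M0 : 0 < M by rewrite ltr_wpDl// addr_ge0.
apply/cvgrPdist_le => e e0.
pose r := Num.min d (e / (2 * M)).
have r0 : 0 < r by rewrite lt_min d0 divr_gt0 ?mulr_gt0.
exists (ball z.1 r, ball z.2 r) => /=; first by split; exact: nbhsx_ballx.
move=> w [/=]; rewrite /ball/= => w1 w2; rewrite distrC.
rewrite distrC in w1; rewrite distrC in w2.
move: w1 w2; rewrite !lt_min => /andP[a1 a2] /andP[b1 b2].
apply: (le_trans (H w a1 b1)).
rewrite -ler_pdivlMl//; apply: ltW.
have E : e / (2 * M) + e / (2 * M) = M^-1 * e by field; rewrite gt_eqF.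
by rewrite -E; exact: ltrD.
Qed.

Lemma has_grad_comp (f : R -> R) (l : R) g z p q : has_grad g z p q ->
  is_derive (g z) 1 f l -> has_grad (fun w => f (g w)) z (l * p) (l * q).
Proof.
move=> Hg Hf e e0.
have [d0 d00 B] := has_grad_bound Hg; set M := `|p| + `|q| + 1 in B.
have M0 : 0 < M by rewrite ltr_wpDl// addr_ge0.
have e1 : 0 < e / 2 / M by rewrite !divr_gt0.
have [d1 d10 H1] := is_derive_approx Hf e1.
have e2 : 0 < e / 2 / (`|l| + 1) by rewrite !divr_gt0// ltr_wpDl.
have [d2 d20 H2] := Hg _ e2.
pose r := d1 / (2 * M).
have r0 : 0 < r by rewrite divr_gt0// mulr_gt0.
exists (Num.min (Num.min d0 d2) r); first by rewrite !lt_min d00 d20 r0.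
move=> w; rewrite !lt_min => /andP[/andP[a1 a2] a3] /andP[/andP[b1 b2] b3].
have K0 := B w a1 b1; have K2 := H2 w a2 b2.
have gd : `|g w - g z| < d1.
  apply: (le_lt_trans K0); rewrite -ltr_pdivlMl//.
  have E : r + r = M^-1 * d1 by rewrite /r; field; rewrite gt_eqF.
  by rewrite -E; exact: ltrD.
have K1 := H1 _ gd.
set s := `|w.1 - z.1| + `|w.2 - z.2| in K0 K2 *.
have s0 : 0 <= s by rewrite addr_ge0.
set X := f _ - _ - _ in K1; set Y := g w - _ - _ in K2.
rewrite (_ : _ - _ - _ = X + l * Y); last by rewrite /X /Y; ring.
apply: (le_trans (ler_normD _ _)); rewrite normrM.
have A1 : `|X| <= e / 2 * s.
  apply: (le_trans K1); rewrite -[leRHS](_ : e / 2 / M * (M * s) = _).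
    by rewrite ler_wpM2l// ltW.
  by field; rewrite gt_eqF.
have A2 : `|l| * `|Y| <= e / 2 * s.
  apply: (@le_trans _ _ ((`|l| + 1) * (e / 2 / (`|l| + 1) * s))).
    by apply: ler_pM => //; rewrite lerDl.
  rewrite le_eqVlt; apply/orP; left; apply/eqP; field.
  by rewrite gt_eqF// ltr_wpDl.
by rewrite (splitr e) mulrDl; exact: lerD.
Qed.

(** By polarisation: the product is half of [(g + h) ^ 2 - g ^ 2 - h ^ 2], so the chain rule for the
    square and the sum rule are enough. *)
Lemma has_gradM g h z p q p' q' : has_grad g z p q -> has_grad h z p' q' ->
  has_grad (fun w => g w * h w) z (g z * p' + h z * p) (g z * q' + h z * q).
Proof.
have sqr k a b : has_grad k z a b -> has_grad (fun w => k w ^+ 2) z (2 * k z * a) (2 * k z * b).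
  move=> Hk; apply: (has_grad_comp (f := fun t => t ^+ 2) Hk).
  apply: approx_is_derive => e e0; exists e => // y ye.
  rewrite (_ : _ - _ - _ = (y - k z) ^+ 2); last by ring.
  by rewrite normrX expr2 ler_wpM2r// ltW.
have scl k a b c : has_grad k z a b -> has_grad (fun w => c * k w) z (c * a) (c * b).
  move=> Hk; apply: (has_grad_comp (f := fun t => c * t) Hk).
  apply: approx_is_derive => e e0; exists 1 => // y _.
  by rewrite -mulrBr subrr normr0 mulr_ge0// ltW.
move=> Hg Hh.
have := scl _ _ _ (1 / 2) (has_gradD (sqr _ _ _ (has_gradD Hg Hh))
   (scl _ _ _ (-1) (has_gradD (sqr _ _ _ Hg) (sqr _ _ _ Hh)))).
congr has_grad; last by field.
  by apply/funext => w /=; field.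
by field.
Qed.

Lemma has_grad_eq g z p q p' q' : has_grad g z p q -> p = p' -> q = q' -> has_grad g z p' q'.
Proof. by move=> H <- <-. Qed.

Lemma has_grad_curve g (c1 c2 : R -> R) (t p q l1 l2 : R) : has_grad g (c1 t, c2 t) p q ->
  is_derive t 1 c1 l1 -> is_derive t 1 c2 l2 ->
  is_derive t 1 (fun x => g (c1 x, c2 x)) (p * l1 + q * l2).
Proof.
move=> Hg H1 H2.
have to2 (c : R -> R) l : is_derive t 1 c l -> has_grad (fun z => c z.1) (t, 0) l 0.
  move=> Hc; have := has_grad_comp (has_grad_fst (t, 0)) Hc.
  by rewrite mulr1 mulr0.
have G1 := to2 _ _ H1; have G2 := to2 _ _ H2.
apply: approx_is_derive => e e0.
have [k1 k10 B1] := has_grad_bound G1; have [k2 k20 B2] := has_grad_bound G2.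
set M1 := `|l1| + _ + _ in B1; set M2 := `|l2| + _ + _ in B2.
pose M := M1 + M2.
have M10 : 0 < M1 by rewrite ltr_wpDl// addr_ge0.
have M20 : 0 < M2 by rewrite ltr_wpDl// addr_ge0.
have M0 : 0 < M by rewrite addr_gt0.
have e1 : 0 < e / 2 / M by rewrite !divr_gt0.
have [d dg HG] := Hg _ e1.
pose N := `|p| + `|q| + 1.
have N0 : 0 < N by rewrite ltr_wpDl// addr_ge0.
have e2 : 0 < e / 2 / N by rewrite !divr_gt0.
have [d1 d10 D1] := is_derive_approx H1 e2; have [d2 d20 D2] := is_derive_approx H2 e2.
exists (Num.min (Num.min (Num.min k1 k2) (Num.min d1 d2)) (d / M)).
  by rewrite !lt_min k10 k20 d10 d20 divr_gt0.
move=> y; rewrite !lt_min => /andP[/andP[/andP[y1 y2] /andP[y3 y4]] y5].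
have n0 := normr_ge0 (y - t).
have {B1}B1 := B1 (y, 0); rewrite /= subrr normr0 addr0 in B1.
have {B2}B2 := B2 (y, 0); rewrite /= subrr normr0 addr0 in B2.
have {}B1 := B1 y1 k10; have {}B2 := B2 y2 k20.
have y6 : M * `|y - t| < d by rewrite mulrC -ltr_pdivlMr.
have {HG}HG := HG (c1 y, c2 y); rewrite /= in HG.
have {HG}HG : `|g (c1 y, c2 y) - g (c1 t, c2 t) - (p * (c1 y - c1 t) + q * (c2 y - c2 t))| <=
  e / 2 / M * (`|c1 y - c1 t| + `|c2 y - c2 t|).
  by apply: HG; apply: le_lt_trans y6; [apply: (le_trans B1)|apply: (le_trans B2)]; rewrite /M;
    apply: ler_wpM2r => //; rewrite ?lerDl ?lerDr ltW.
have {}D1 := D1 y y3; have {}D2 := D2 y y4.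
set X := g _ - _ - _ in HG; set Y1 := c1 y - _ - _ in D1; set Y2 := c2 y - _ - _ in D2.
rewrite (_ : _ - _ - _ = X + (p * Y1 + q * Y2)); last by rewrite /X /Y1 /Y2; ring.
apply: (le_trans (ler_normD _ _)).
have A1 : `|X| <= e / 2 * `|y - t|.
  apply: (le_trans HG); rewrite -[leRHS](_ : e / 2 / M * (M * `|y - t|) = _).
    by rewrite ler_wpM2l ?(ltW e1)// /M mulrDl lerD.
  by field; rewrite gt_eqF.
have A2 : `|p * Y1 + q * Y2| <= e / 2 * `|y - t|.
  apply: (le_trans (ler_normD _ _)); rewrite !normrM.
  rewrite -[leRHS](_ : N * (e / 2 / N * `|y - t|) = _); last by field; rewrite gt_eqF.
  set w := e / 2 / N * _ in D1 D2 *.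
  have w0 : 0 <= w by rewrite mulr_ge0// ltW.
  have := normr_ge0 p; have := normr_ge0 q; rewrite /N; nra.
by move: A1 A2; lra_from.
Qed.

Lemma has_grad_near g h z p q : has_grad g z p q ->
  (exists2 d, 0 < d & forall w, `|w.1 - z.1| < d -> `|w.2 - z.2| < d -> h w = g w) -> has_grad h z p q.
Proof.
move=> Hg [d d0 E] e e0; have [d1 d10 H] := Hg e e0.
exists (Num.min d d1); first by rewrite lt_min d0.
move=> w; rewrite !lt_min => /andP[a1 a2] /andP[b1 b2].
by rewrite !E ?subrr ?normr0//; exact: H.
Qed.

Definition C1on (D : set (R * R)) g gx gy := forall z, D z ->
  [/\ has_grad g z (gx z) (gy z), {for z, continuous gx} & {for z, continuous gy}].

Definition C1 (f f' : R -> R) := forall x : R, is_derive x 1 f (f' x) /\ {for x, continuous f'}.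

Lemma C1on_continuous D g gx gy z : C1on D g gx gy -> D z -> {for z, continuous g}.
Proof. by move=> H /H[/has_grad_continuous]. Qed.

Lemma C1onM D g gx gy h hx hy : C1on D g gx gy -> C1on D h hx hy ->
  C1on D (fun z => g z * h z) (fun z => g z * hx z + h z * gx z) (fun z => g z * hy z + h z * gy z).
Proof.
move=> Hg Hh z Dz; have [g1 g2 g3] := Hg z Dz; have [h1 h2 h3] := Hh z Dz.
have cg := has_grad_continuous g1; have ch := has_grad_continuous h1.
split; first exact: has_gradM.
  by apply: cvgD; apply: cvgM.
by apply: cvgD; apply: cvgM.
Qed.

Lemma C1onD D g gx gy h hx hy : C1on D g gx gy -> C1on D h hx hy ->
  C1on D (fun z => g z + h z) (fun z => gx z + hx z) (fun z => gy z + hy z).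
Proof.
move=> Hg Hh z Dz; have [g1 g2 g3] := Hg z Dz; have [h1 h2 h3] := Hh z Dz.
split; first exact: has_gradD.
  exact: cvgD.
exact: cvgD.
Qed.

Lemma C1on_cst D c : C1on D (fun=> c) (fun=> 0) (fun=> 0).
Proof. by move=> z _; split; [exact: has_grad_cst|exact: cvg_cst|exact: cvg_cst]. Qed.

Lemma C1on_comp D f f' g gx gy : C1on D g gx gy ->
  (forall z, D z -> is_derive (g z) 1 f (f' (g z)) /\ {for g z, continuous f'}) ->
  C1on D (fun z => f (g z)) (fun z => f' (g z) * gx z) (fun z => f' (g z) * gy z).
Proof.
move=> Hg Hf z Dz; have [g1 g2 g3] := Hg z Dz; have [f1 f2] := Hf z Dz.
have cg := has_grad_continuous g1.
have cf : {for z, continuous (fun z => f' (g z))} by apply: continuous_comp.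
split; first exact: has_grad_comp.
  exact: cvgM.
exact: cvgM.
Qed.

Lemma C1on_compC1 D f f' g gx gy : C1on D g gx gy -> C1 f f' ->
  C1on D (fun z => f (g z)) (fun z => f' (g z) * gx z) (fun z => f' (g z) * gy z).
Proof. by move=> Hg Hf; apply: C1on_comp => // z _; exact: Hf. Qed.

Lemma C1on_fst D : C1on D fst (fun=> 1) (fun=> 0).
Proof. by move=> z _; split; [exact: has_grad_fst|exact: cvg_cst|exact: cvg_cst]. Qed.

Lemma C1on_snd D : C1on D snd (fun=> 0) (fun=> 1).
Proof. by move=> z _; split; [exact: has_grad_snd|exact: cvg_cst|exact: cvg_cst]. Qed.

Lemma C1onS D E g gx gy : E `<=` D -> C1on D g gx gy -> C1on E g gx gy.
Proof. by move=> ED H z /ED /H. Qed.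

Definition clamp (a b x : R) : R := Num.max a (Num.min b x).

Lemma clamp_in a b x : a <= b -> a <= clamp a b x <= b.
Proof. by move=> ab; rewrite /clamp le_max lexx/= ge_max ab ge_min lexx. Qed.

Lemma clamp_id a b x : a <= x <= b -> clamp a b x = x.
Proof. by move=> /andP[ax xb]; rewrite /clamp min_r// max_r. Qed.

Lemma clamp_lo a b x : a <= b -> x <= a -> clamp a b x = a.
Proof. by move=> ab xa; rewrite /clamp max_l// ge_min xa orbT. Qed.

Lemma clamp_hi a b x : a <= b -> b <= x -> clamp a b x = b.
Proof. by move=> ab bx; rewrite /clamp min_l// max_r. Qed.

Lemma clamp_lip a b x y : a <= b -> `|clamp a b y - clamp a b x| <= `|y - x|.
Proof.
move=> ab.
have E t : clamp a b t = if t <= a then a else if b <= t then b else t.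
  case: (lerP t a) => [/(clamp_lo ab)//|ta].
  case: (lerP b t) => [/(clamp_hi ab)//|tb].
  by apply: clamp_id; rewrite !ltW.
have := ler_norm (y - x); have := ler_norm (x - y); rewrite (distrC x y) !E ler_norml.
by case: (lerP y a); case: (lerP x a); case: (lerP b y); case: (lerP b x) => h1 h2 h3 h4 n1 n2; apply/andP; split; move: ab h1 h2 h3 h4 n1 n2; lra_from.
Qed.

(** Freezing the argument outside [[a, b]] makes the function constant there, and the vanishing of
    [f'] at the two ends is what lets the pieces fit together. *)
Lemma C1_clamp (f f' : R -> R) a b : a <= b -> C1 f f' -> f' a = 0 -> f' b = 0 ->
  C1 (fun x => f (clamp a b x)) (fun x => f' (clamp a b x)).
Proof.
move=> ab Hf fa fb x.
have cc : {for x, continuous (clamp a b)}.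
  apply/cvgrPdist_le => e e0; exists e => //= y xy.
  by apply: (le_trans (clamp_lip _ _ ab)); exact: ltW.
split; last first.
  by apply: continuous_comp => //; case: (Hf (clamp a b x)).
apply: approx_is_derive => e e0.
have [d d0 H] := is_derive_approx (Hf (clamp a b x)).1 e0.
have [xa|ax] := leP x a.
  rewrite (clamp_lo ab xa) in H *; exists d => // y yx; rewrite fa mul0r subr0.
  have K := clamp_lip x y ab; rewrite (clamp_lo ab xa) in K.
  have := H _ (le_lt_trans K yx); rewrite fa mul0r subr0 => /le_trans; apply.
  by rewrite ler_wpM2l// ltW.
have [bx|xb] := leP b x.
  rewrite (clamp_hi ab bx) in H *; exists d => // y yx; rewrite fb mul0r subr0.
  have K := clamp_lip x y ab; rewrite (clamp_hi ab bx) in K.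
  have := H _ (le_lt_trans K yx); rewrite fb mul0r subr0 => /le_trans; apply.
  by rewrite ler_wpM2l// ltW.
rewrite (clamp_id (x := x)) in H *; last by rewrite !ltW.
exists (Num.min d (Num.min (x - a) (b - x))); first by rewrite !lt_min d0 !subr_gt0 ax.
move=> y; rewrite !lt_min => /andP[yd /andP[y1 y2]].
rewrite clamp_id; first exact: H.
move: y1 y2; rewrite !ltr_norml => /andP[? ?] /andP[? ?]; apply/andP; split; lra.
Qed.

(** The cubic Hermite step from 0 to 1, from which all cutoffs are built; its derivative
    [6 c (1 - c)] vanishes at both ends. *)
Definition smoothstep x : R := let c := clamp 0 1 x in c ^+ 2 * (3 - 2 * c).
Definition smoothstep' x : R := let c := clamp 0 1 x in 6 * c * (1 - c).

Lemma C1_smoothstep : C1 smoothstep smoothstep'.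
Proof.
apply: (@C1_clamp (fun c => c ^+ 2 * (3 - 2 * c)) (fun c => 6 * c * (1 - c))) => //; last 2 first.
- by rewrite mulr0 mul0r.
- by rewrite subrr mulr0.
move=> x; split.
  apply: approx_is_derive => e e0.
  pose M := `|3 - 6 * x| + 2.
  have M0 : 0 < M by rewrite ltr_wpDl.
  exists (Num.min 1 (e / M)); first by rewrite lt_min ltr01 divr_gt0.
  move=> y; rewrite lt_min => /andP[y1 y2].
  rewrite (_ : _ - _ - _ = (y - x) * ((y - x) * (3 - 6 * x - 2 * (y - x)))); last by ring.
  rewrite normrM mulrC ler_wpM2r// normrM.
  have K : `|3 - 6 * x - 2 * (y - x)| <= M.
    apply: (le_trans (ler_normB _ _)); rewrite normrM ger0_norm// /M; lra.
  apply: (@le_trans _ _ (`|y - x| * M)); first by rewrite ler_wpM2l.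
  by rewrite -ler_pdivlMr// ltW.
apply: cvgM; first by apply: cvgM; [exact: cvg_cst|exact: cvg_id].
by apply: cvgB; [exact: cvg_cst|exact: cvg_id].
Qed.

Lemma smoothstep0 x : x <= 0 -> smoothstep x = 0.
Proof. by move=> x0; rewrite /smoothstep clamp_lo// expr0n mul0r. Qed.

Lemma smoothstep1 x : 1 <= x -> smoothstep x = 1.
Proof. by move=> x1; rewrite /smoothstep clamp_hi// expr1n mul1r mulr1; ring. Qed.

Lemma smoothstep_in x : 0 <= smoothstep x <= 1.
Proof.
rewrite /smoothstep; have := clamp_in x (@ler01 R); set c := clamp _ _ _ => /andP[c0 c1] /=.
apply/andP; split; first by rewrite mulr_ge0 ?sqr_ge0//; lra.
rewrite -subr_ge0 (_ : _ - _ = (1 - c) ^+ 2 * (1 + 2 * c)); last by ring.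
by rewrite mulr_ge0 ?sqr_ge0//; lra.
Qed.

Lemma smoothstep'_ge0 x : 0 <= smoothstep' x.
Proof.
rewrite /smoothstep'; have := clamp_in x (@ler01 R); set c := clamp _ _ _ => /andP[c0 c1] /=.
by nra.
Qed.

Lemma smoothstep'0 x : x <= 0 \/ 1 <= x -> smoothstep' x = 0.
Proof.
by case=> x0; rewrite /smoothstep' ?(clamp_lo (@ler01 R) x0) ?(clamp_hi (@ler01 R) x0) ?subrr !mulr0 ?mul0r.
Qed.

End Gradients.

Lemma cvg_pair_at (R : realType) (T : topologicalType) (c1 c2 : T -> R) t :
  {for t, continuous c1} -> {for t, continuous c2} ->
  {for t, continuous (fun x => (c1 x, c2 x))}.
Proof. by move=> h1 h2; rewrite /continuous_at; exact: (cvg_pair h1 h2). Qed.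

(** * Local Sobolev functions on the unit disc *)

Section SobolevDisc.
Variable R : realType.
Local Notation mu := (@lebesgue_measure R).
Local Notation mu2 := (mu \x mu)%E.
Local Notation P := (measurableTypeR R * measurableTypeR R)%type.
Local Notation B2 := (@B2 R).
Implicit Types (r : R) (z : R * R).

Definition normsq z : R := z.1 ^+ 2 + z.2 ^+ 2.
(* [r] is the squared radius. *)
Definition disc r : set (R * R) := [set z | normsq z <= r].

Lemma normsq_ge0 z : 0 <= normsq z.
Proof. by rewrite addr_ge0// sqr_ge0. Qed.

Lemma B2E z : B2 z <-> normsq z < 1.
Proof.
rewrite /Defs.B2 /eucl /= -/(normsq z).
have [n0|n0] := eqVneq (normsq z) 0; first by rewrite n0 sqrtr0.
by rewrite -[X in _ < X <-> _]sqrtr1 ltr_sqrt.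
Qed.

Lemma discS r z : r < 1 -> disc r z -> B2 z.
Proof. by move=> r1 zr; apply/B2E; exact: le_lt_trans r1. Qed.

Lemma continuous_normsq : continuous normsq.
Proof.
by move=> z; apply: cvgD; rewrite expr2; under eq_fun do rewrite expr2;
  apply: cvgM; (exact: cvg_fst || exact: cvg_snd).
Qed.

Lemma open_B2 : open B2.
Proof.
rewrite (_ : B2 = normsq @^-1` [set x | x < 1]); last by apply/seteqP; split => z /B2E.
by apply: open_comp; [move=> z _; exact: continuous_normsq|exact: open_lt].
Qed.

Lemma closed_disc r : closed (disc r).
Proof.
rewrite (_ : disc r = normsq @^-1` [set x | x <= r]); last by [].
by apply: closed_comp; [move=> z _; exact: continuous_normsq|exact: closed_le].
Qed.

Lemma disc_box r : r < 1 -> disc r `<=` box 1.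
Proof.
move=> r1 z zr; apply/boxP; rewrite prod_normE ge_max !ler_norml.
by have := zr; rewrite /disc /normsq /= => H; do 2 (apply/andP; split); try nra; split; nra.
Qed.

Lemma compact_disc r : r < 1 -> compact (disc r).
Proof.
move=> r1; apply: (@subclosed_compact _ _ (box 1)).
- exact: closed_disc.
- exact: box_compact.
- exact: disc_box.
Qed.

Lemma measurable_disc r : measurable (disc r : set P).
Proof.
rewrite -(setCK (disc r)); apply: measurableC; apply: open_measurable2.
by apply: closed_openC; exact: closed_disc.
Qed.

Lemma measurable_B2 : measurable (B2 : set P).
Proof. exact: open_measurable2 open_B2. Qed.

Lemma bounded_disc (g : R * R -> R) r : r < 1 ->
  (forall z, B2 z -> {for z, continuous g}) -> exists M, forall z, disc r z -> `|g z| <= M.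
Proof.
move=> r1 cg; have : bounded_set (g @` disc r).
  apply: compact_bounded; apply: continuous_compact; last exact: compact_disc.
  by apply: continuous_in_subspaceT => z; rewrite inE => /(discS r1)/cg.
move=> [M [_ HM]]; exists (M + 1) => z zr.
by apply: (HM (M + 1)); [rewrite ltrDl|exists z].
Qed.

Lemma MVT_abs (h h' : R -> R) (M : R) : (forall t : R, 0 <= t <= 1 -> is_derive t 1 h (h' t)) ->
  (forall t, 0 <= t <= 1 -> `|h' t| <= M) -> `|h 1 - h 0| <= M.
Proof.
move=> dh bh.
have [|t| |c] := @MVT_segment R h h' 0 1 _ _.
- exact: ler01.
- by rewrite in_itv/= => /andP[t0 t1]; apply: dh; rewrite !ltW.
- apply: derivable_within_continuous => t; rewrite in_itv/= => /dh dht.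
  by case: dht.
- by rewrite in_itv/= => c01 ->; rewrite subr0 mulr1; exact: bh.
Qed.

Lemma is_derive_affine (a b t : R) : is_derive t 1 (fun s => a + s * b) b.
Proof.
apply: approx_is_derive => e e0; exists 1 => // y _.
rewrite (_ : _ - _ - _ = 0); last by ring.
by rewrite normr0 mulr_ge0// ltW.
Qed.

Lemma disc_convex r z w t : disc r z -> disc r w -> 0 <= t <= 1 ->
  disc r (z.1 + t * (w.1 - z.1), z.2 + t * (w.2 - z.2)).
Proof.
rewrite /disc /normsq /= => hz hw /andP[t0 t1].
have : 0 <= (1 - t) * (r - (z.1 ^+ 2 + z.2 ^+ 2)) by rewrite mulr_ge0// ?subr_ge0//.
have : 0 <= t * (r - (w.1 ^+ 2 + w.2 ^+ 2)) by rewrite mulr_ge0// ?subr_ge0//.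
have : 0 <= t * (1 - t) * ((w.1 - z.1) ^+ 2 + (w.2 - z.2) ^+ 2).
  by rewrite !mulr_ge0 ?subr_ge0// addr_ge0// sqr_ge0.
nra.
Qed.

Lemma C1on_lipschitz g gx gy r : C1on B2 g gx gy -> r < 1 -> exists2 M, 0 <= M &
  forall z w, disc r z -> disc r w -> `|g w - g z| <= M * (`|w.1 - z.1| + `|w.2 - z.2|).
Proof.
move=> Hg r1.
have [Mx HMx] := bounded_disc r1 (fun z Bz => let: And3 _ c _ := Hg z Bz in c).
have [My HMy] := bounded_disc r1 (fun z Bz => let: And3 _ _ c := Hg z Bz in c).
pose M := Num.max 0 (Num.max Mx My).
exists M; first by rewrite le_max lexx.
have Mxx z : disc r z -> `|gx z| <= M by move=> /HMx H; rewrite !le_max H orbT.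
have Myy z : disc r z -> `|gy z| <= M by move=> /HMy H; rewrite !le_max H !orbT.
move=> z w zr wr.
pose c t : R * R := (z.1 + t * (w.1 - z.1), z.2 + t * (w.2 - z.2)).
have cr t : 0 <= t <= 1 -> disc r (c t) by exact: disc_convex.
have := @MVT_abs (fun t => g (c t)) (fun t => gx (c t) * (w.1 - z.1) + gy (c t) * (w.2 - z.2)).
rewrite /c !mul1r !mul0r !addr0 !(addrC z.1) !(addrC z.2) !subrK -!surjective_pairing; apply.
  move=> t /cr ct; have [h1 _ _] := Hg _ (discS r1 ct).
  by apply: has_grad_curve; [exact: h1|exact: is_derive_affine|exact: is_derive_affine].
move=> t /cr ct; apply: (le_trans (ler_normD _ _)); rewrite !normrM [leRHS]mulrDr.
by apply: lerD; apply: ler_wpM2r => //; [exact: Mxx|exact: Myy].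
Qed.

Lemma abs_cont_on_id (a b : R) : abs_cont_on id a b.
Proof.
move=> e e0; exists e => // n s t st _ H; apply: le_lt_trans H.
by apply: ler_sum => i _; rewrite ger0_norm// subr_ge0; case: (st i) => _ [].
Qed.

Lemma abs_cont_on_cst (c a b : R) : abs_cont_on (fun=> c) a b.
Proof. by move=> e e0; exists e => // n s t _ _ _; rewrite big1// => i _; rewrite subrr normr0. Qed.

Lemma abs_cont_onS g (a b a' b' : R) : a <= a' -> b' <= b ->
  abs_cont_on g a b -> abs_cont_on g a' b'.
Proof.
move=> aa bb ac e e0; have [d d0 H] := ac e e0; exists d => // n s t st.
apply: H => i; have [? [? ?]] := st i; split; first exact: le_trans aa _.
by split => //; exact: le_trans bb.
Qed.

(** The common source of the chain rule and of the product rule for absolute continuity: both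
    functions are Lipschitz in the two given ones. *)
Lemma abs_cont_on_lip g c1 c2 (a b M : R) : 0 <= M -> abs_cont_on c1 a b -> abs_cont_on c2 a b ->
  (forall s t, a <= s <= b -> a <= t <= b -> `|g t - g s| <= M * (`|c1 t - c1 s| + `|c2 t - c2 s|)) ->
  abs_cont_on g a b.
Proof.
move=> M0 ac1 ac2 H e e0.
have e1 : 0 < e / (2 * (M + 1)) by rewrite divr_gt0// mulr_gt0// ltr_wpDl.
have [d1 d10 H1] := ac1 _ e1; have [d2 d20 H2] := ac2 _ e1.
exists (Num.min d1 d2); first by rewrite lt_min d10.
move=> n s t st dis; rewrite lt_min => /andP[sd1 sd2].
have {}H1 := H1 n s t st dis sd1; have {}H2 := H2 n s t st dis sd2.
set S1 := \sum_(i < n) _ in H1; set S2 := \sum_(i < n) _ in H2.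
apply: (@le_lt_trans _ _ (M * (S1 + S2))).
  rewrite /S1 /S2 -big_split mulr_sumr; apply: ler_sum => i _.
  have [h1 [h2 h3]] := st i; apply: H; rewrite ?h1 ?h3 ?andbT//=.
    exact: le_trans h3.
  exact: le_trans h2.
have S10 : 0 <= S1 by apply: sumr_ge0 => i _.
have S20 : 0 <= S2 by apply: sumr_ge0 => i _.
apply: (@le_lt_trans _ _ ((M + 1) * (S1 + S2))).
  by rewrite ler_wpM2r ?addr_ge0// lerDl.
rewrite mulrC -ltr_pdivlMr ?ltr_wpDl//.
have -> : e / (M + 1) = e / (2 * (M + 1)) + e / (2 * (M + 1)).
  by field; rewrite gt_eqF// ltr_wpDl.
exact: ltrD.
Qed.

(** Continuous functions of class W^{1,2}_loc. The exceptional lines do not depend on the segment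
    considered, and the gradient belongs to the data because it is determined only almost
    everywhere. *)
Record sobD (V Vx Vy : R * R -> R) : Prop := SobD {
  sobD_continuous : forall z, B2 z -> {for z, continuous V};
  sobD_mx : measurable_fun (B2 : set P) Vx;
  sobD_my : measurable_fun (B2 : set P) Vy;
  sobD_L2x : forall r, r < 1 -> (\int[mu2]_(z in disc r) (Vx z ^+ 2)%:E < +oo)%E;
  sobD_L2y : forall r, r < 1 -> (\int[mu2]_(z in disc r) (Vy z ^+ 2)%:E < +oo)%E;
  sobD_acx : {ae mu, forall y : R, forall a b, a <= b -> (forall x, a <= x <= b -> B2 (x, y)) ->
    abs_cont_on (fun x => V (x, y)) a b};
  sobD_acy : {ae mu, forall x : R, forall a b, a <= b -> (forall y, a <= y <= b -> B2 (x, y)) ->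
    abs_cont_on (fun y => V (x, y)) a b};
  sobD_dx : {ae mu2, forall z : R * R, B2 z -> is_derive z.1 1 (fun x => V (x, z.2)) (Vx z)};
  sobD_dy : {ae mu2, forall z : R * R, B2 z -> is_derive z.2 1 (fun y => V (z.1, y)) (Vy z)} }.

Lemma disc_finite r : r < 1 -> (mu2 (disc r) < +oo)%E.
Proof.
move=> r1; apply: (@le_lt_trans _ _ (mu2 (box 1))); last exact: box_finite.
by apply: le_measure; rewrite ?inE; [exact: measurable_disc|exact: measurable_box|exact: disc_box].
Qed.

Lemma disc_bounded_integral (F : R * R -> R) M r : r < 1 -> measurable_fun (disc r : set P) F ->
  (forall z, disc r z -> `|F z| <= M) -> (\int[mu2]_(z in disc r) (F z ^+ 2)%:E < +oo)%E.
Proof.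
move=> r1 mF bF.
have := @ge0_le_integral _ _ _ mu2 _ (measurable_disc r) (fun z => (F z ^+ 2)%:E) (cst (M ^+ 2)%:E).
rewrite integral_cst; last exact: measurable_disc.
have Ft : ((M ^+ 2)%:E * mu2 (disc r) < +oo)%E.
  by rewrite lte_mul_pinfty// ?lee_fin ?sqr_ge0//; exact: disc_finite.
move=> H; apply: le_lt_trans Ft; apply: H => //.
- by move=> z _; rewrite lee_fin sqr_ge0.
- by apply/measurable_EFinP; exact: measurable_funX.
- move=> z /bF Hz; rewrite lee_fin -(real_normK (num_real (F z))) ler_pXn2r// nnegrE.
  exact: le_trans Hz.
Qed.

Lemma sobD_bounded (V Vx Vy : R * R -> R) :
  (forall z, B2 z -> {for z, continuous V}) ->
  (forall z, B2 z -> {for z, continuous Vx}) -> (forall z, B2 z -> {for z, continuous Vy}) ->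
  [/\ measurable_fun (B2 : set P) Vx, measurable_fun (B2 : set P) Vy,
   (forall r, r < 1 -> (\int[mu2]_(z in disc r) (Vx z ^+ 2)%:E < +oo)%E) &
   (forall r, r < 1 -> (\int[mu2]_(z in disc r) (Vy z ^+ 2)%:E < +oo)%E)].
Proof.
move=> cV cx cy.
have mx : measurable_fun (B2 : set P) Vx by apply: open_continuous_measurable_fun2 => //; exact: open_B2.
have my : measurable_fun (B2 : set P) Vy by apply: open_continuous_measurable_fun2 => //; exact: open_B2.
split => // r r1.
  have [M HM] := bounded_disc r1 cx; apply: (disc_bounded_integral r1 _ HM).
  by apply: measurable_funS mx; [exact: measurable_B2|move=> z; exact: discS].
have [M HM] := bounded_disc r1 cy; apply: (disc_bounded_integral r1 _ HM).
by apply: measurable_funS my; [exact: measurable_B2|move=> z; exact: discS].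
Qed.

Lemma sobD_fst : sobD fst (fun=> 1) (fun=> 0).
Proof.
have [m1 m2 l1 l2] := @sobD_bounded fst (fun=> 1) (fun=> 0) (fun _ _ => cvg_fst) (fun _ _ => @cvg_cst _ _ _ _ _) (fun _ _ => @cvg_cst _ _ _ _ _).
apply: SobD; [by move=> *; exact: cvg_fst|exact: m1|exact: m2|exact: l1|exact: l2|..]; apply: aeW => /=.
- by move=> y a b _ _; exact: abs_cont_on_id.
- by move=> x a b _ _; exact: abs_cont_on_cst.
- by move=> z _; exact: is_derive_id.
- by move=> z _; exact: is_derive_cst.
Qed.

Lemma sobD_snd : sobD snd (fun=> 0) (fun=> 1).
Proof.
have [m1 m2 l1 l2] := @sobD_bounded snd (fun=> 0) (fun=> 1) (fun _ _ => cvg_snd) (fun _ _ => @cvg_cst _ _ _ _ _) (fun _ _ => @cvg_cst _ _ _ _ _).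
apply: SobD; [by move=> *; exact: cvg_snd|exact: m1|exact: m2|exact: l1|exact: l2|..]; apply: aeW => /=.
- by move=> y a b _ _; exact: abs_cont_on_cst.
- by move=> x a b _ _; exact: abs_cont_on_id.
- by move=> z _; exact: is_derive_cst.
- by move=> z _; exact: is_derive_id.
Qed.

(** Chain rule and product rule both produce gradients of the form [p F + q G] with [p] and [q]
    continuous, hence bounded on the compact disc. *)
Lemma disc_sqr_lincomb r (F G p q : R * R -> R) : r < 1 ->
  measurable_fun (B2 : set P) F -> measurable_fun (B2 : set P) G ->
  (forall z, B2 z -> {for z, continuous p}) -> (forall z, B2 z -> {for z, continuous q}) ->
  (\int[mu2]_(z in disc r) (F z ^+ 2)%:E < +oo)%E ->
  (\int[mu2]_(z in disc r) (G z ^+ 2)%:E < +oo)%E ->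
  measurable_fun (B2 : set P) (fun z => p z * F z + q z * G z) /\
  (\int[mu2]_(z in disc r) ((p z * F z + q z * G z) ^+ 2)%:E < +oo)%E.
Proof.
move=> r1 mF mG cp cq IF IG.
have mp : measurable_fun (B2 : set P) p by apply: open_continuous_measurable_fun2 => //; exact: open_B2.
have mq : measurable_fun (B2 : set P) q by apply: open_continuous_measurable_fun2 => //; exact: open_B2.
have m : measurable_fun (B2 : set P) (fun z => p z * F z + q z * G z).
  by apply: measurable_funD; exact: measurable_funM.
split => //.
have [Mp HMp] := bounded_disc r1 cp; have [Mq HMq] := bounded_disc r1 cq.
pose M := 2 * (Mp ^+ 2 + Mq ^+ 2).
have M0 : 0 <= M by rewrite mulr_ge0// addr_ge0// sqr_ge0.
have mS (H : R * R -> R) : measurable_fun (B2 : set P) H -> measurable_fun (disc r : set P) H.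
  by apply: measurable_funS; [exact: measurable_B2|move=> z; exact: discS].
have mFr := mS _ mF; have mGr := mS _ mG; have mr := mS _ m.
apply: (@le_lt_trans _ _ (\int[mu2]_(z in disc r) (M%:E * ((F z ^+ 2)%:E + (G z ^+ 2)%:E)))%E).
  apply: ge0_le_integral => //=.
  - exact: measurable_disc.
  - by move=> z _; rewrite lee_fin sqr_ge0.
  - by apply/measurable_EFinP; exact: measurable_funX.
  - by apply: measurable_funeM; apply: emeasurable_funD; apply/measurable_EFinP; exact: measurable_funX.
  - move=> z zr; rewrite -EFinD -EFinM lee_fin.
    have p2 : p z ^+ 2 <= Mp ^+ 2.
      have Hz := HMp z zr; rewrite -(real_normK (num_real (p z))) ler_pXn2r// nnegrE.
      exact: le_trans Hz.
    have q2 : q z ^+ 2 <= Mq ^+ 2.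
      have Hz := HMq z zr; rewrite -(real_normK (num_real (q z))) ler_pXn2r// nnegrE.
      exact: le_trans Hz.
    have H1 : (p z * F z + q z * G z) ^+ 2 <= 2 * (p z ^+ 2 * F z ^+ 2 + q z ^+ 2 * G z ^+ 2).
      by rewrite -subr_ge0 (_ : _ - _ = (p z * F z - q z * G z) ^+ 2) ?sqr_ge0//; ring.
    apply: (le_trans H1); rewrite /M -[leRHS]mulrA ler_wpM2l//.
    have F2 := sqr_ge0 (F z); have G2 := sqr_ge0 (G z).
    have P2 := sqr_ge0 Mp; have Q2 := sqr_ge0 Mq.
    by nra.
rewrite ge0_integralZl//; last 3 first.
- exact: measurable_disc.
- by apply: emeasurable_funD; apply/measurable_EFinP; exact: measurable_funX.
- by move=> z _; rewrite -EFinD lee_fin addr_ge0// sqr_ge0.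
rewrite lte_mul_pinfty// ge0_integralD//.
- by rewrite lte_add_pinfty.
- exact: measurable_disc.
- by move=> z _; rewrite lee_fin sqr_ge0.
- by apply/measurable_EFinP; exact: measurable_funX.
- by move=> z _; rewrite lee_fin sqr_ge0.
- by apply/measurable_EFinP; exact: measurable_funX.
Qed.


(** Compactness keeps the image of a segment away from the unit circle; on the smaller disc so
    obtained C^1 functions are Lipschitz and continuous ones are bounded. *)
Lemma segment_disc (a b : R) (c : R -> R * R) : a <= b ->
  (forall x, a <= x <= b -> normsq (c x) < 1) ->
  (forall x, a <= x <= b -> {for x, continuous c}) ->
  exists2 r, r < 1 & forall x, a <= x <= b -> disc r (c x).
Proof.
move=> ab cB cc.
have [|x xab Hx] := @EVT_max R (fun x => normsq (c x)) a b ab.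
  apply: continuous_in_subspaceT => x; rewrite inE /= in_itv/= => xab.
  by apply: continuous_comp; [exact: cc|exact: continuous_normsq].
exists (normsq (c x)); first by apply: cB; move: xab; rewrite in_itv.
by move=> t tab; apply: Hx; rewrite in_itv.
Qed.

Lemma continuous_at_line1 (V : R * R -> R) (x y : R) : {for (x, y), continuous V} ->
  {for x, continuous (fun t => V (t, y))}.
Proof.
move=> cV; apply: (@continuous_comp _ _ _ (fun t => (t, y)) V) => //.
by apply: cvg_pair_at; [exact: cvg_id|exact: cvg_cst].
Qed.

Lemma continuous_at_line2 (V : R * R -> R) (x y : R) : {for (x, y), continuous V} ->
  {for y, continuous (fun t => V (x, t))}.
Proof.
move=> cV; apply: (@continuous_comp _ _ _ (fun t => (x, t)) V) => //.
by apply: cvg_pair_at; [exact: cvg_cst|exact: cvg_id].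
Qed.

Section Composition.
Variables (f1 f1x f1y f2 f2x f2y g gx gy : R * R -> R).
Hypothesis s1 : sobD f1 f1x f1y.
Hypothesis s2 : sobD f2 f2x f2y.
Hypothesis fB : forall z, B2 z -> B2 (f1 z, f2 z).
Hypothesis Cg : C1on B2 g gx gy.

Let cf z : B2 z -> {for z, continuous (fun w => (f1 w, f2 w))}.
Proof. by move=> Bz; apply: cvg_pair_at; [exact: (sobD_continuous s1)|exact: (sobD_continuous s2)]. Qed.

Lemma sobD_comp : sobD (fun z => g (f1 z, f2 z))
  (fun z => gx (f1 z, f2 z) * f1x z + gy (f1 z, f2 z) * f2x z)
  (fun z => gx (f1 z, f2 z) * f1y z + gy (f1 z, f2 z) * f2y z).
Proof.
have cp z : B2 z -> {for z, continuous (fun w => gx (f1 w, f2 w))}.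
  by move=> Bz; apply: (@continuous_comp _ _ _ (fun w => (f1 w, f2 w)) gx); [exact: cf|case: (Cg (fB Bz))].
have cq z : B2 z -> {for z, continuous (fun w => gy (f1 w, f2 w))}.
  by move=> Bz; apply: (@continuous_comp _ _ _ (fun w => (f1 w, f2 w)) gy); [exact: cf|case: (Cg (fB Bz))].
have Lx r (r1 : r < 1) := disc_sqr_lincomb r1 (sobD_mx s1) (sobD_mx s2) cp cq (sobD_L2x s1 r1) (sobD_L2x s2 r1).
have Ly r (r1 : r < 1) := disc_sqr_lincomb r1 (sobD_my s1) (sobD_my s2) cp cq (sobD_L2y s1 r1) (sobD_L2y s2 r1).
apply: SobD.
- move=> z Bz; apply: (@continuous_comp _ _ _ (fun w => (f1 w, f2 w)) g); first exact: cf.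
  exact: C1on_continuous Cg (fB Bz).
- by case: (Lx 0 ltr01).
- by case: (Ly 0 ltr01).
- by move=> r /Lx[].
- by move=> r /Ly[].
- apply: filterS2 (sobD_acx s1) (sobD_acx s2) => y h1 h2 a b ab sB.
  have [r r1 Hr] := @segment_disc a b (fun x => (f1 (x, y), f2 (x, y))) ab
    (fun x xab => (B2E _).1 (fB (sB x xab)))
    (fun x xab => cvg_pair_at (continuous_at_line1 (sobD_continuous s1 (sB x xab))) (continuous_at_line1 (sobD_continuous s2 (sB x xab)))).
  have [M M0 HM] := C1on_lipschitz Cg r1.
  by apply: (abs_cont_on_lip M0 (h1 a b ab sB) (h2 a b ab sB)) => s t sab tab; exact: (HM (_, _) (_, _) (Hr s sab) (Hr t tab)).
- apply: filterS2 (sobD_acy s1) (sobD_acy s2) => x h1 h2 a b ab sB.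
  have [r r1 Hr] := @segment_disc a b (fun y => (f1 (x, y), f2 (x, y))) ab
    (fun y yab => (B2E _).1 (fB (sB y yab)))
    (fun y yab => cvg_pair_at (continuous_at_line2 (sobD_continuous s1 (sB y yab))) (continuous_at_line2 (sobD_continuous s2 (sB y yab)))).
  have [M M0 HM] := C1on_lipschitz Cg r1.
  by apply: (abs_cont_on_lip M0 (h1 a b ab sB) (h2 a b ab sB)) => s t sab tab; exact: (HM (_, _) (_, _) (Hr s sab) (Hr t tab)).
- apply: filterS2 (sobD_dx s1) (sobD_dx s2) => z h1 h2 Bz.
  apply: (@has_grad_curve _ g (fun x => f1 (x, z.2)) (fun x => f2 (x, z.2))).
  + by rewrite -surjective_pairing; case: (Cg (fB Bz)).
  + exact: h1.
  + exact: h2.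
- apply: filterS2 (sobD_dy s1) (sobD_dy s2) => z h1 h2 Bz.
  apply: (@has_grad_curve _ g (fun y => f1 (z.1, y)) (fun y => f2 (z.1, y))).
  + by rewrite -surjective_pairing; case: (Cg (fB Bz)).
  + exact: h1.
  + exact: h2.
Qed.

End Composition.

Lemma sobD_C1 g gx gy : C1on B2 g gx gy -> sobD g gx gy.
Proof.
move=> Cg; have := sobD_comp sobD_fst sobD_snd (fun z => _) Cg.
have idB z : B2 z -> B2 (z.1, z.2) by rewrite -surjective_pairing.
move=> /(_ idB); congr sobD; apply/funext => z; rewrite -!surjective_pairing//.
  by rewrite mulr1 mulr0 addr0.
by rewrite mulr1 mulr0 add0r.
Qed.

Lemma sobDM V Vx Vy W Wx Wy : sobD V Vx Vy -> sobD W Wx Wy ->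
  sobD (fun z => V z * W z) (fun z => V z * Wx z + W z * Vx z) (fun z => V z * Wy z + W z * Vy z).
Proof.
move=> sV sW.
have cV := sobD_continuous sV; have cW := sobD_continuous sW.
have Lx r (r1 : r < 1) := disc_sqr_lincomb r1 (sobD_mx sW) (sobD_mx sV) cV cW (sobD_L2x sW r1) (sobD_L2x sV r1).
have Ly r (r1 : r < 1) := disc_sqr_lincomb r1 (sobD_my sW) (sobD_my sV) cV cW (sobD_L2y sW r1) (sobD_L2y sV r1).
have prod_ac (v w : R -> R) (a b M : R) : 0 <= M -> (forall x, a <= x <= b -> `|v x| <= M) ->
    (forall x, a <= x <= b -> `|w x| <= M) -> abs_cont_on v a b -> abs_cont_on w a b ->
    abs_cont_on (fun x => v x * w x) a b.
  move=> M0 Mv Mw acv acw; apply: (abs_cont_on_lip M0 acv acw) => s t /Mw ws /Mv vt.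
  rewrite (_ : _ - _ = v t * (w t - w s) + w s * (v t - v s)); last by ring.
  apply: (le_trans (ler_normD _ _)); rewrite !normrM mulrDr addrC.
  by apply: lerD; apply: ler_wpM2r.
have bnd (c : R -> R * R) (a b : R) : a <= b -> (forall x, a <= x <= b -> B2 (c x)) ->
   (forall x, a <= x <= b -> {for x, continuous c}) -> exists2 M, 0 <= M &
   forall x, a <= x <= b -> `|V (c x)| <= M /\ `|W (c x)| <= M.
  move=> ab cB cc; have [r r1 Hr] := segment_disc ab (fun x xab => (B2E _).1 (cB x xab)) cc.
  have [M1 H1] := bounded_disc r1 cV; have [M2 H2] := bounded_disc r1 cW.
  exists (Num.max 0 (Num.max M1 M2)); first by rewrite le_max lexx.
  by move=> x /Hr xr; rewrite !le_max H1// H2// !orbT.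
apply: SobD.
- by move=> z Bz; apply: cvgM; [exact: cV|exact: cW].
- by case: (Lx 0 ltr01).
- by case: (Ly 0 ltr01).
- by move=> r /Lx[].
- by move=> r /Ly[].
- apply: filterS2 (sobD_acx sV) (sobD_acx sW) => y h1 h2 a b ab sB.
  have [M M0 HM] := bnd (fun x => (x, y)) a b ab sB (fun x _ => cvg_pair_at (@cvg_id _ _) (@cvg_cst _ _ _ _ _)).
  by apply: (prod_ac _ _ _ _ M) => //; [move=> x /HM[]|move=> x /HM[]|exact: h1|exact: h2].
- apply: filterS2 (sobD_acy sV) (sobD_acy sW) => x h1 h2 a b ab sB.
  have [M M0 HM] := bnd (fun y => (x, y)) a b ab sB (fun y _ => cvg_pair_at (@cvg_cst _ _ _ _ _) (@cvg_id _ _)).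
  by apply: (prod_ac _ _ _ _ M) => //; [move=> y /HM[]|move=> y /HM[]|exact: h1|exact: h2].
- apply: filterS2 (sobD_dx sV) (sobD_dx sW) => z h1 h2 Bz.
  have := is_deriveM (h1 Bz) (h2 Bz); rewrite -!surjective_pairing; exact.
- apply: filterS2 (sobD_dy sV) (sobD_dy sW) => z h1 h2 Bz.
  have := is_deriveM (h1 Bz) (h2 Bz); rewrite -!surjective_pairing; exact.
Qed.

Definition cutoff r r' z := 1 - smoothstep ((normsq z - r) / (r' - r)).
Definition cutoffx r r' z := - (smoothstep' ((normsq z - r) / (r' - r)) / (r' - r) * (2 * z.1)).
Definition cutoffy r r' z := - (smoothstep' ((normsq z - r) / (r' - r)) / (r' - r) * (2 * z.2)).

Lemma C1on_normsq D : C1on D normsq (fun z => 2 * z.1) (fun z => 2 * z.2).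
Proof.
have := C1onD (C1onM (@C1on_fst R D) (@C1on_fst R D)) (C1onM (@C1on_snd R D) (@C1on_snd R D)).
by congr C1on; apply/funext => z; rewrite /normsq ?expr2//; ring.
Qed.

Lemma C1on_cutoff D r r' : C1on D (cutoff r r') (cutoffx r r') (cutoffy r r').
Proof.
have H1 := C1onD (C1onM (C1onD (@C1on_normsq D) (C1on_cst (- r))) (C1on_cst (r' - r)^-1)) (C1on_cst 0).
have H2 := C1on_compC1 H1 (@C1_smoothstep R).
have := C1onD (C1on_cst 1) (C1onM (C1on_cst (-1)) H2).
congr C1on; apply/funext => z; rewrite /cutoff /cutoffx /cutoffy ?addr0; ring.
Qed.

Lemma cutoff1 r r' z : r < r' -> normsq z <= r ->
  [/\ cutoff r r' z = 1, cutoffx r r' z = 0 & cutoffy r r' z = 0].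
Proof.
move=> rr zr.
have H : (normsq z - r) / (r' - r) <= 0.
  by rewrite pmulr_lle0 ?invr_gt0 ?subr_gt0// subr_le0.
have E : smoothstep' ((normsq z - r) / (r' - r)) = 0 by apply: smoothstep'0; left.
by split; rewrite ?/cutoff ?/cutoffx ?/cutoffy ?E ?mul0r ?oppr0// smoothstep0// subr0.
Qed.

Lemma cutoff0 r r' z : r < r' -> r' <= normsq z -> cutoff r r' z = 0.
Proof.
by move=> rr zr; rewrite /cutoff smoothstep1 ?subrr// ler_pdivlMr ?subr_gt0// mul1r lerD2r.
Qed.

End SobolevDisc.

(** * Stokes' formula on the disc *)

Section DiscStokes.
Variable R : realType.
Local Notation mu := (@lebesgue_measure R).
Local Notation mu2 := (mu \x mu)%E.
Local Notation P := (measurableTypeR R * measurableTypeR R)%type.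
Local Notation B2 := (@B2 R).
Implicit Types (r : R) (z : R * R).

Lemma ae_ysection (Q : R * R -> Prop) : {ae mu2, forall z, Q z} ->
  {ae mu, forall y : R, {ae mu, forall x : R, Q (x, y)}}.
Proof.
move=> [A [mA A0 QA]].
pose F (z : P) : \bar R := (\1_A z)%:E.
have mF : measurable_fun setT F by apply/measurable_EFinP; exact: measurable_indic.
have F0 z : (0 <= F z)%E by rewrite lee_fin indicE ler0n.
have mG : measurable_fun setT (fubini_G mu F) by exact: measurable_fun_fubini_tonelli_G.
have G0 : (\int[mu]_y `|fubini_G mu F y| = 0)%E.
  transitivity (\int[mu]_y fubini_G mu F y)%E.
    by apply: eq_integral => y _; rewrite gee0_abs//; exact: integral_ge0.
  rewrite -fubini_tonelli2// /F; transitivity (mu2 A) => //.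
  by rewrite integral_indic// setIT.
have := (ae_eq_integral_abs mu measurableT mG).1 G0.
apply: filterS => y /(_ I); rewrite /fubini_G => Gy.
have mAy : measurable (ysection A y) by exact: measurable_ysection.
exists (ysection A y); split => //.
- transitivity (\int[mu]_x F (x, y))%E; last exact: Gy.
  rewrite (_ : (fun x => F (x, y)) = (fun x => (\1_(ysection A y) x)%:E)).
    by rewrite integral_indic// setIT.
  by apply/funext => x; rewrite /F !indicE mem_ysection.
- move=> x /= nQ; rewrite /ysection/=; rewrite inE; apply: QA => /=; exact: nQ.
Qed.

Lemma ae_xsection (Q : R * R -> Prop) : {ae mu2, forall z, Q z} ->
  {ae mu, forall x : R, {ae mu, forall y : R, Q (x, y)}}.
Proof.
move=> [A [mA A0 QA]].
pose F (z : P) : \bar R := (\1_A z)%:E.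
have mF : measurable_fun setT F by apply/measurable_EFinP; exact: measurable_indic.
have F0 z : (0 <= F z)%E by rewrite lee_fin indicE ler0n.
have mG : measurable_fun setT (fubini_F mu F) by exact: measurable_fun_fubini_tonelli_F.
have G0 : (\int[mu]_x `|fubini_F mu F x| = 0)%E.
  transitivity (\int[mu]_x fubini_F mu F x)%E.
    by apply: eq_integral => y _; rewrite gee0_abs//; exact: integral_ge0.
  rewrite -fubini_tonelli1// /F; transitivity (mu2 A) => //.
  by rewrite integral_indic// setIT.
have := (ae_eq_integral_abs mu measurableT mG).1 G0.
apply: filterS => x /(_ I); rewrite /fubini_F => Gx.
have mAx : measurable (xsection A x) by exact: measurable_xsection.
exists (xsection A x); split => //.
- transitivity (\int[mu]_y F (x, y))%E; last exact: Gx.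
  rewrite (_ : (fun y => F (x, y)) = (fun y => (\1_(xsection A x) y)%:E)).
    by rewrite integral_indic// setIT.
  by apply/funext => y; rewrite /F !indicE mem_xsection.
- move=> y /= nQ; rewrite /xsection/=; rewrite inE; apply: QA => /=; exact: nQ.
Qed.

Definition trunc r (F : R * R -> R) : R * R -> R := F \_ (disc r).

Lemma trunc_in r F z : disc r z -> trunc r F z = F z.
Proof. by move=> zr; rewrite /trunc patchE mem_set. Qed.

Lemma trunc_out r F z : ~ disc r z -> trunc r F z = 0.
Proof. by move=> zr; rewrite /trunc patchE memNset. Qed.

Lemma trunc_L2 r (F : R * R -> R) : r < 1 -> measurable_fun (B2 : set P) F ->
  (\int[mu2]_(z in disc r) (F z ^+ 2)%:E < +oo)%E -> L2 (trunc r F).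
Proof.
move=> r1 mF IF; split.
  have mr : measurable_fun (disc r : set P) F.
    by apply: measurable_funS mF; [exact: measurable_B2|move=> z; exact: discS].
  exact: (measurable_restrictT F (measurable_disc r)).1 mr.
apply: le_lt_trans IF; rewrite le_eqVlt; apply/orP; left; apply/eqP.
rewrite [RHS]integral_mkcond; apply: eq_integral => z _.
rewrite patchE; case: ifPn; first by rewrite inE => /trunc_in ->.
by rewrite notin_setE => /trunc_out ->; rewrite expr0n.
Qed.

Lemma clamp_itv (w a b x : R) : 0 < w -> clamp (- w) w a < x -> x <= clamp (- w) w b -> a < x /\ x <= b.
Proof.
move=> w0; have ww : - w <= w by lra.
have E t : clamp (- w) w t = if t <= - w then - w else if w <= t then w else t.
  case: (lerP t (- w)) => [/(clamp_lo ww)//|ta].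
  case: (lerP w t) => [/(clamp_hi ww)//|tb].
  by apply: clamp_id; rewrite !ltW.
rewrite !E; case: (lerP a (- w)); case: (lerP b (- w)); case: (lerP w a); case: (lerP w b) => *; split; lra.
Qed.

Lemma clamp_mono (w a b : R) : 0 < w -> a <= b -> clamp (- w) w a <= clamp (- w) w b.
Proof.
move=> w0 ab; have ww : - w <= w by lra.
have E t : clamp (- w) w t = if t <= - w then - w else if w <= t then w else t.
  case: (lerP t (- w)) => [/(clamp_lo ww)//|ta].
  case: (lerP w t) => [/(clamp_hi ww)//|tb].
  by apply: clamp_id; rewrite !ltW.
by rewrite !E; case: (lerP a (- w)); case: (lerP b (- w)); case: (lerP w a); case: (lerP w b) => *; lra.
Qed.

(** Since [g] vanishes beyond the chord, an increment equals the one between the clamped end points,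
    where absolute continuity is available. *)
Lemma increment_chord (g f : R -> R) (w a b : R) : 0 < w -> a <= b ->
  (forall x, w <= `|x| -> g x = 0) -> abs_cont_on g (- w) w ->
  mu.-integrable setT (EFin \o f) ->
  {ae mu, forall x : R, `|x| <= w -> is_derive x 1 g (f x)} ->
  (`|g b - g a|%:E <= \int[mu]_(x in `]a, b]) `|f x|%:E)%E.
Proof.
move=> w0 ab g0 ac If df.
have ww : - w <= w by lra.
have gc t : g t = g (clamp (- w) w t).
  have [tw|wt] := lerP `|t| w; first by rewrite clamp_id// -ler_norml.
  rewrite g0 ?ltW//; have [t0|t0] := lerP 0 t.
    by rewrite clamp_hi ?g0 ?ger0_norm//; [exact: ltW|rewrite ger0_norm// in wt; exact: ltW].
  rewrite ltr0_norm// in wt; rewrite clamp_lo ?g0 ?normrN ?gtr0_norm//; lra.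
rewrite (gc a) (gc b); set a' := clamp _ _ a; set b' := clamp _ _ b.
have ab' : a' <= b' by exact: clamp_mono.
have /andP[a1 a2] := clamp_in a ww; have /andP[b1 b2] := clamp_in b ww.
have H : `|g b' - g a'| <= \int[mu]_(x in `]a', b']) `|f x|.
  apply: abs_cont_increment_le => //; first exact: abs_cont_onS ac.
  case: df => A [mA A0 HA]; exists A; split => // x /= [/andP[xa xb] nd].
  apply: HA => /= K; apply: nd; apply: K; rewrite ler_norml; apply/andP; split.
    exact: le_trans xa.
  exact: le_trans b2.
have If' : mu.-integrable `]a', b'] (EFin \o (fun x => `|f x|)).
  by apply: integrable_norm; apply: integrableS If.
apply: (@le_trans _ _ (\int[mu]_(x in `]a', b']) `|f x|%:E)%E).
  move: H; rewrite -lee_fin /Rintegral fineK//.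
  exact: (integrable_fin_num _ If').
apply: ge0_subset_integral => //=.
  by apply/measurable_EFinP; apply: measurableT_comp => //; apply: measurable_funTS; case/integrableP : If => /measurable_EFinP.
move=> x /=; rewrite !in_itv/= => /andP[h1 h2].
by have [-> ->] := clamp_itv w0 h1 h2.
Qed.

Lemma near_line1 z (A : set (R * R)) : nbhs z A -> \forall x \near z.1, A (x, z.2).
Proof.
case: z => x0 y0 /= nA.
have : (fun x => (x, y0)) x @[x --> x0] --> (x0, y0).
  by apply: (@cvg_pair_at _ _ id (fun=> y0)); [exact: cvg_id|exact: cvg_cst].
by move/(_ _ nA).
Qed.

Lemma near_line2 z (A : set (R * R)) : nbhs z A -> \forall y \near z.2, A (z.1, y).
Proof.
case: z => x0 y0 /= nA.
have : (fun y => (x0, y)) y @[y --> y0] --> (x0, y0).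
  by apply: (@cvg_pair_at _ _ (fun=> x0) id); [exact: cvg_cst|exact: cvg_id].
by move/(_ _ nA).
Qed.

(** Extension by zero: a local Sobolev function that vanishes outside a smaller disc is a Sobolev
    function of the whole plane. The gradient is cut off at [r'], strictly outside the support, so
    that every point has a neighbourhood in the disc or one where [Z] is zero. *)
Lemma sobD_sob0 Z Zx Zy r r' : sobD Z Zx Zy -> r < r' -> r' < 1 ->
  (forall z, r < normsq z -> Z z = 0) -> sob0 Z (trunc r' Zx) (trunc r' Zy).
Proof.
move=> sZ rr r1 Z0.
have r1' : r < 1 by exact: lt_trans r1.
have near0 z : r < normsq z -> \forall w \near z, r < normsq w.
  move=> rz; apply: (@open_nbhs_nbhs _ z); split => //.
  have := @open_comp _ _ (@normsq R) [set x | r < x]; apply; last exact: open_gt.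
  by move=> w _; exact: continuous_normsq.
have Lx : L2 (trunc r' Zx) by apply: trunc_L2; [|exact: sobD_mx sZ|exact: (sobD_L2x sZ)].
have Ly : L2 (trunc r' Zy) by apply: trunc_L2; [|exact: sobD_my sZ|exact: (sobD_L2y sZ)].
have L1 : L2 (trunc r' (fun=> 1)).
  apply: trunc_L2 => //.
  apply: (@disc_bounded_integral _ (fun=> 1) 1) => //.
  by move=> z _; rewrite normr1.
have int F : L2 (trunc r' F) -> mu2.-integrable setT (EFin \o trunc r' F).
  move=> LF; have := L2M LF L1; congr (_.-integrable _ _); apply/funext => z /=; congr EFin.
  by have [zr|zr] := pselect (disc r' z); [rewrite !trunc_in// mulr1|rewrite !trunc_out// mul0r].
have dx0 z : r < normsq z -> is_derive z.1 1 (fun x => Z (x, z.2)) 0.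
  move=> rz; have H := near0 z rz.
  have : \forall x \near z.1, (fun=> 0) x = Z (x, z.2).
    by apply: filterS (near_line1 H) => x /= Hx; rewrite Z0.
  by move=> E; apply: near_eq_is_derive E _ => //; exact: is_derive_cst.
have dy0 z : r < normsq z -> is_derive z.2 1 (fun y => Z (z.1, y)) 0.
  move=> rz; have H := near0 z rz.
  have : \forall y \near z.2, (fun=> 0) y = Z (z.1, y).
    by apply: filterS (near_line2 H) => y /= Hy; rewrite Z0.
  by move=> E; apply: near_eq_is_derive E _ => //; exact: is_derive_cst.
(* The square root is half the length of the chord that the disc of squared radius [r'] cuts from
   the line at height [y]. *)
have chord y : y ^+ 2 < r' -> [/\ 0 < Num.sqrt (r' - y ^+ 2),
    forall x, Num.sqrt (r' - y ^+ 2) <= `|x| -> r' <= x ^+ 2 + y ^+ 2 &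
    forall x, `|x| <= Num.sqrt (r' - y ^+ 2) -> x ^+ 2 + y ^+ 2 <= r'].
  move=> yr; have p : 0 < r' - y ^+ 2 by rewrite subr_gt0.
  have E : Num.sqrt (r' - y ^+ 2) ^+ 2 = r' - y ^+ 2 by rewrite sqr_sqrtr// ltW.
  have s0 : 0 <= Num.sqrt (r' - y ^+ 2) by exact: sqrtr_ge0.
  split; first by rewrite sqrtr_gt0.
    move=> x wx; rewrite -lerBlDr -(real_normK (num_real x)) -[X in X <= _]E.
    by rewrite ler_pXn2r ?nnegrE.
  move=> x wx; rewrite -lerBrDr -(real_normK (num_real x)) -[X in _ <= X]E.
  by rewrite ler_pXn2r ?nnegrE.
split => //.
- move=> z; have [zr|zr] := ltP (normsq z) 1; first by apply: (sobD_continuous sZ); apply/B2E.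
  have rz : r < normsq z by exact: lt_le_trans zr.
  have E : {near z, (fun=> 0) =1 Z}.
    by apply: filterS (near0 z rz) => w /Z0 ->.
  rewrite /continuous_at (Z0 _ rz).
  by apply: cvg_trans (near_eq_cvg E) _; exact: cvg_cst.
- exists 1 => z z1; apply: Z0; apply: (lt_trans r1').
  move: z1; rewrite prod_normE lt_max /normsq => /orP[H|H].
    have K : 1 < z.1 ^+ 2 by rewrite -(real_normK (num_real z.1)); rewrite -(expr1n _ 2) ltr_pXn2r ?nnegrE.
    by apply: (lt_le_trans K); rewrite lerDl sqr_ge0.
  have K : 1 < z.2 ^+ 2 by rewrite -(real_normK (num_real z.2)); rewrite -(expr1n _ 2) ltr_pXn2r ?nnegrE.
  by apply: (lt_le_trans K); rewrite lerDr sqr_ge0.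
- have s1 := ae_ysection (sobD_dx sZ).
  have s2 := ae_integrable2 (int _ Lx).
  apply: filterS3 (sobD_acx sZ) s1 s2 => y h1 h2 h3 a b ab.
  have [yr|yr] := ltP (y ^+ 2) r'; last first.
    rewrite !Z0 ?subrr ?normr0; last 2 first.
    + by rewrite /normsq /= (lt_le_trans rr)// (le_trans yr)// lerDr sqr_ge0.
    + by rewrite /normsq /= (lt_le_trans rr)// (le_trans yr)// lerDr sqr_ge0.
    by apply: integral_ge0 => x _; rewrite lee_fin.
  have [w0 w1 w2] := chord y yr; set w := Num.sqrt _ in w0 w1 w2.
  apply: (@increment_chord (fun x => Z (x, y)) (fun x => trunc r' Zx (x, y)) w) => //.
  + by move=> x /w1 K; apply: Z0; rewrite /normsq /=; exact: lt_le_trans K.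
  + apply: h1; first by lra.
    by move=> x; rewrite -ler_norml => /w2 K; apply/B2E; exact: le_lt_trans K _.
  + apply: filterS h2 => x K xw; rewrite trunc_in; last exact: w2.
    by apply: K; apply/B2E; apply: le_lt_trans r1; exact: w2.
- have s1 := ae_xsection (sobD_dy sZ).
  have s2 := ae_integrable1 (int _ Ly).
  apply: filterS3 (sobD_acy sZ) s1 s2 => x h1 h2 h3 a b ab.
  have [xr|xr] := ltP (x ^+ 2) r'; last first.
    rewrite !Z0 ?subrr ?normr0; last 2 first.
    + by rewrite /normsq /= (lt_le_trans rr)// (le_trans xr)// lerDl sqr_ge0.
    + by rewrite /normsq /= (lt_le_trans rr)// (le_trans xr)// lerDl sqr_ge0.
    by apply: integral_ge0 => y _; rewrite lee_fin.
  have [w0 w1 w2] := chord x xr; set w := Num.sqrt _ in w0 w1 w2.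
  apply: (@increment_chord (fun y => Z (x, y)) (fun y => trunc r' Zy (x, y)) w) => //.
  + by move=> y /w1 K; apply: Z0; rewrite /normsq /= addrC; exact: lt_le_trans K.
  + apply: h1; first by lra.
    by move=> y; rewrite -ler_norml => /w2 K; apply/B2E; rewrite /normsq /= addrC; exact: le_lt_trans K _.
  + apply: filterS h2 => y K yw; rewrite trunc_in; last by rewrite /disc /normsq /= addrC; exact: w2.
    by apply: K; apply/B2E; apply: le_lt_trans r1; rewrite /normsq /= addrC; exact: w2.
- apply: filterS (sobD_dx sZ) => z K; have [zr|zr] := lerP (normsq z) r'.
    by rewrite trunc_in//; apply: K; exact: discS zr.
  rewrite trunc_out; last by rewrite /disc /= leNgt zr.
  by apply: dx0; exact: lt_trans zr.
- apply: filterS (sobD_dy sZ) => z K; have [zr|zr] := lerP (normsq z) r'.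
    by rewrite trunc_in//; apply: K; exact: discS zr.
  rewrite trunc_out; last by rewrite /disc /= leNgt zr.
  by apply: dy0; exact: lt_trans zr.
Qed.


Lemma is_derive_unique (f : R -> R) (x l l' : R) : is_derive x 1 f l -> is_derive x 1 f l' -> l = l'.
Proof. by move=> [_ <-] [_ <-]. Qed.

Lemma ae_grad_locally_zero V Vx Vy (E : set (R * R)) : sobD V Vx Vy -> open E ->
  (forall z, E z -> V z = 0) -> {ae mu2, forall z, B2 z -> E z -> Vx z = 0 /\ Vy z = 0}.
Proof.
move=> sV openE V0; apply: filterS2 (sobD_dx sV) (sobD_dy sV) => z hx hy Bz Ez.
have nE : nbhs z E by apply: open_nbhs_nbhs.
split.
  apply: (is_derive_unique (hx Bz)).
  have : \forall x \near z.1, (fun=> 0) x = V (x, z.2).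
    by apply: filterS (near_line1 nE) => x /= Hx; rewrite V0.
  by move=> e; apply: near_eq_is_derive e _ => //; exact: is_derive_cst.
apply: (is_derive_unique (hy Bz)).
have : \forall y \near z.2, (fun=> 0) y = V (z.1, y).
  by apply: filterS (near_line2 nE) => y /= Hy; rewrite V0.
by move=> e; apply: near_eq_is_derive e _ => //; exact: is_derive_cst.
Qed.

Lemma open_outside r : open [set z | r < normsq z].
Proof.
have := @open_comp _ _ (@normsq R) [set x | r < x]; apply; last exact: open_gt.
by move=> w _; exact: continuous_normsq.
Qed.

Lemma disc_L2_trunc (F : R * R -> R) r : r < 1 -> measurable_fun (B2 : set P) F ->
  (\int[mu2]_(z in disc r) (F z ^+ 2)%:E < +oo)%E ->
  forall G : R * R -> R, measurable_fun (B2 : set P) G ->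
  (\int[mu2]_(z in disc r) (G z ^+ 2)%:E < +oo)%E ->
  mu2.-integrable (disc r) (EFin \o (fun z => F z * G z)).
Proof.
move=> r1 mF IF G mG IG.
have := L2M (trunc_L2 r1 mF IF) (trunc_L2 r1 mG IG).
move=> /(integrableS measurableT (measurable_disc r) (@subsetT _ _)).
apply: eq_integrable; first exact: measurable_disc.
by move=> z; rewrite inE => zr /=; rewrite !trunc_in.
Qed.

(** Only [Z] vanishes near the circle. Both functions are multiplied by a cutoff that is 1 on a disc
    slightly larger than the support of [Z]: inside [disc r] nothing changes, and outside it [Z] and
    almost everywhere its gradient are zero, so the integrand is unaffected. *)
Lemma disc_stokes r Z Zx Zy V Vx Vy : r < 1 -> sobD Z Zx Zy -> sobD V Vx Vy ->
  (forall z, B2 z -> r < normsq z -> Z z = 0) ->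
  \int[mu2]_(z in disc r) (Zx z * Vy z - Zy z * Vx z) = 0.
Proof.
move=> r1 sZ sV Z0.
pose r' := r + (1 - r) / 4; pose r'' := r + (1 - r) / 2; pose r3 := r + 3 * (1 - r) / 4.
have h1 : r < r' by rewrite /r'; lra.
have h2 : r' < r'' by rewrite /r' /r''; lra.
have h3 : r'' < r3 by rewrite /r'' /r3; lra.
have h4 : r3 < 1 by rewrite /r3; lra.
have sc := sobD_C1 (@C1on_cutoff R B2 r' r'').
have sZc := sobDM sZ sc; have sVc := sobDM sV sc.
have c0 z : r'' < normsq z -> cutoff r' r'' z = 0 by move=> /ltW; exact: cutoff0.
have s0Z : sob0 _ _ _ := sobD_sob0 sZc h3 h4 (fun z rz => (eq_trans (congr1 _ (c0 z rz)) (mulr0 _))).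
have s0V : sob0 _ _ _ := sobD_sob0 sVc h3 h4 (fun z rz => (eq_trans (congr1 _ (c0 z rz)) (mulr0 _))).
have := sob0_stokes s0Z s0V.
set Zcx := trunc r3 _; set Vcy := trunc r3 _; set Zcy := trunc r3 _; set Vcx := trunc r3 _ => E.
have Zout : {ae mu2, forall z, B2 z -> r < normsq z ->
   Z z * cutoffx r' r'' z + cutoff r' r'' z * Zx z = 0 /\
   Z z * cutoffy r' r'' z + cutoff r' r'' z * Zy z = 0}.
  pose O := B2 `&` [set z | r < normsq z].
  have openO : open O by apply: openI; [exact: open_B2|exact: open_outside].
  have ZO z : O z -> Z z * cutoff r' r'' z = 0 by move=> [Bz rz]; rewrite Z0// mul0r.
  by apply: filterS (ae_grad_locally_zero sZc openO ZO) => z K Bz rz; apply: K.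
have r31 z : disc r z -> disc r3 z.
  by rewrite /disc /= => /le_trans; apply; rewrite /r3; lra.
have mint F G : L2 F -> L2 G -> measurable_fun setT ((fun z => F z * G z) : P -> R).
  by move=> [mF _] [mG _]; exact: measurable_funM.
have [[_ _ LZx LZy _ _ _ _] [_ _ LVx LVy _ _ _ _]] := (s0Z, s0V).
rewrite -{}E /Rintegral; congr fine; rewrite [LHS]integral_mkcond; apply: ae_eq_integral => //.
- apply: (measurable_restrictT _ (measurable_disc r)).1; apply/measurable_EFinP.
  have mS (H : R * R -> R) : measurable_fun (B2 : set P) H -> measurable_fun (disc r : set P) H.
    by apply: measurable_funS; [exact: measurable_B2|move=> z; exact: discS].
  by apply: measurable_funB; apply: measurable_funM; apply: mS;
   [exact: sobD_mx sZ|exact: sobD_my sV|exact: sobD_my sZ|exact: sobD_mx sV].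
- by apply/measurable_EFinP; apply: measurable_funB; exact: mint.
apply: filterS Zout => z K _; rewrite patchE; case: ifPn; rewrite ?inE ?notin_setE => zr.
  have [ca cb cc] := cutoff1 h2 (le_trans zr (ltW h1)).
  rewrite /Zcx /Vcy /Zcy /Vcx !trunc_in//; try exact: r31.
  by rewrite ca cb cc !mulr0 !mul1r !add0r.
have {}zr : r < normsq z by rewrite ltNge; apply/negP.
have [z3|z3] := pselect (disc r3 z); last by rewrite /Zcx /Zcy !trunc_out// !mul0r subrr.
have [k1 k2] := K (discS h4 z3) zr.
by rewrite /Zcx /Zcy (trunc_in _ z3) (trunc_in _ z3) k1 k2 !mul0r subrr.
Qed.

End DiscStokes.

(** * From the definition of quasiregularity to Sobolev functions *)

Section Quasiregular.
Variable R : realType.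
Local Notation mu := (@lebesgue_measure R).
Local Notation mu2 := (mu \x mu)%E.
Local Notation P := (measurableTypeR R * measurableTypeR R)%type.
Local Notation B2 := (@B2 R).
Implicit Types (r : R) (z : R * R).

(** The definition speaks of one closed rectangle at a time. Rectangles with rational corners are
    countably many, so that their null sets can be united. A number that codes no rectangle yields
    the degenerate one at the origin. *)
Definition rat_rect (i : nat) : R * R * (R * R) :=
  if @unpickle (rat * rat * (rat * rat))%type i is Some q
  then (ratr q.1.1, ratr q.1.2, (ratr q.2.1, ratr q.2.2)) else (0, 0, (0, 0)).

Definition rrect i := crect (rat_rect i).1.1 (rat_rect i).1.2 (rat_rect i).2.1 (rat_rect i).2.2.

Lemma rat_between (x y : R) : x < y -> exists q : rat, x < ratr q < y.
Proof. by move=> /rat_in_itvoo[q]; rewrite in_itv/=; exists q. Qed.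

Lemma rat_rect_around (a b c d m n : R) : `|a| <= m -> `|b| <= m -> `|c| <= n -> `|d| <= n ->
  m ^+ 2 + n ^+ 2 < 1 -> exists i, [/\ (rat_rect i).1.1 < a, b < (rat_rect i).1.2,
    (rat_rect i).2.1 < c, d < (rat_rect i).2.2 & rrect i `<=` B2].
Proof.
(* Enlarging the half sides [m] and [n] by [D] adds [2 D (m + n) + 2 D ^ 2] to the squared radius.
   This is less than [8 D], because [m], [n] are below 1 and [D] is at most 1/8. *)
move=> am bm cn dn mn; set D := (1 - m ^+ 2 - n ^+ 2) / 8.
have D0 : 0 < D by rewrite /D; lra.
have m0 := le_trans (normr_ge0 _) am; have n0 := le_trans (normr_ge0 _) cn.
have m1 : m < 1 by nra.
have n1 : n < 1 by nra.
have [q1 /andP[h1 h1']] := @rat_between (a - D) a ltac:(lra).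
have [q2 /andP[h2 h2']] := @rat_between b (b + D) ltac:(lra).
have [q3 /andP[h3 h3']] := @rat_between (c - D) c ltac:(lra).
have [q4 /andP[h4 h4']] := @rat_between d (d + D) ltac:(lra).
exists (pickle ((q1, q2), (q3, q4))); rewrite /rrect /rat_rect pickleK /=; split => //.
move=> z [/= /andP[z1 z2] /andP[z3 z4]]; apply/B2E; rewrite /normsq.
move: am bm cn dn; rewrite !ler_norml => /andP[am am'] /andP[bm bm'] /andP[cn cn'] /andP[dn dn'].
have E1 : z.1 ^+ 2 <= (m + D) ^+ 2.
  by have := @mulr_ge0 _ (m + D - z.1) (m + D + z.1) ltac:(lra) ltac:(lra); lra.
have E2 : z.2 ^+ 2 <= (n + D) ^+ 2.
  by have := @mulr_ge0 _ (n + D - z.2) (n + D + z.2) ltac:(lra) ltac:(lra); lra.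
have D1 : D <= 1 / 8 by rewrite /D; nra.
have E : m ^+ 2 + n ^+ 2 = 1 - 8 * D by rewrite /D; field.
nra.
Qed.

Lemma measurable_rrect i : measurable (rrect i : set P).
Proof.
rewrite (_ : rrect i = `[(rat_rect i).1.1, (rat_rect i).1.2] `*` `[(rat_rect i).2.1, (rat_rect i).2.2]).
  by apply: measurableX; exact: measurable_itv.
by apply/seteqP; split => z; rewrite /rrect /crect /= !in_itv.
Qed.

Lemma integral_setU_finite (A B : set P) (F : P -> \bar R) : measurable A -> measurable B ->
  measurable_fun (A `|` B) F -> (forall x, (0 <= F x)%E) ->
  (\int[mu2]_(z in A) F z < +oo)%E -> (\int[mu2]_(z in B) F z < +oo)%E ->
  (\int[mu2]_(z in A `|` B) F z < +oo)%E.
Proof.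
move=> mA mB mF F0 fA fB.
have mBA : measurable (B `\` A) by exact: measurableD.
have E : A `|` B = A `|` (B `\` A) by rewrite setUDr setDv setD0.
rewrite E ge0_integral_setU//.
- apply: lte_add_pinfty => //; apply: le_lt_trans fB.
  apply: ge0_subset_integral => //.
    by apply: measurable_funS mF => //; exact: measurableU.
- by rewrite -E.
- by apply/disj_setPS => x [? []].
Qed.

(** The disc of squared radius [r] is compact, and every point of it has a rational rectangle of the
    unit disc as a neighbourhood; so finitely many of them, collected in [A n], cover it. *)
Lemma disc_integral_finite (F : R * R -> R) : measurable_fun (B2 : set P) F ->
  (forall z, 0 <= F z) ->
  (forall i, rrect i `<=` B2 -> (\int[mu2]_(z in rrect i) (F z)%:E < +oo)%E) ->
  forall r, r < 1 -> (\int[mu2]_(z in disc r) (F z)%:E < +oo)%E.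
Proof.
move=> mF F0 FI r r1.
pose A n : set P := \bigcup_(i in [set i | (i < n)%N /\ rrect i `<=` B2]) rrect i.
have AS n : rrect n `<=` B2 -> A n.+1 = A n `|` rrect n.
  move=> nB; apply/seteqP; split => z.
    move=> [i [/= + iB] iz]; rewrite ltnS leq_eqVlt => /orP[/eqP i_n|i_n].
      by right; rewrite -i_n.
    by left; exists i.
  move=> [[i [/= i_n iB] iz]|nz]; first by exists i => //; split => //=; exact: ltnW.
  by exists n => //; split => /=.
have AS' n : ~ rrect n `<=` B2 -> A n.+1 = A n.
  move=> nB; apply/seteqP; split => z; last first.
    by move=> [i [/= i_n iB] iz]; exists i => //; split => //=; exact: ltnW.
  move=> [i [/= + iB] iz]; rewrite ltnS leq_eqVlt => /orP[/eqP i_n|i_n]; last by exists i.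
  by move: iB; rewrite i_n.
have AB n : A n `<=` B2 by move=> z [i [_ iB] /iB].
have A0 : A 0%N = set0 by apply/seteqP; split => z // -[i []].
have mA n : measurable (A n).
  elim: n => [|n IH]; first by rewrite A0.
  have [nB|nB] := pselect (rrect n `<=` B2); last by rewrite AS'.
  by rewrite AS//; apply: measurableU => //; exact: measurable_rrect.
have mFS (B : set P) : measurable B -> B `<=` B2 -> measurable_fun B (EFin \o F).
  by move=> mB BB; apply/measurable_EFinP; apply: measurable_funS mF => //; exact: measurable_B2.
have IA n : (\int[mu2]_(z in A n) (F z)%:E < +oo)%E.
  elim: n => [|n IH]; first by rewrite A0 integral_set0.
  have [nB|nB] := pselect (rrect n `<=` B2); last by rewrite AS'.
  have := AB n.+1; have := mA n.+1; rewrite AS// => mA1 AB1; apply: integral_setU_finite => //; first exact: measurable_rrect.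
  + exact: mFS.
  + exact: FI.
have [n _ dA] : \forall n \near \oo, disc r `<=` A n.
  have /compact_near_coveringP := @compact_disc R r r1.
  apply => z /(discS r1) /B2E zB.
  have [i [h1 h2 h3 h4 iB]] := @rat_rect_around z.1 z.1 z.2 z.2 `|z.1| `|z.2| (lexx _) (lexx _) (lexx _) (lexx _) ltac:(by rewrite !real_normK ?num_real).
  have nz : \forall z' \near z, rrect i z'.
    have cf : continuous (@fst R R) by move=> w; exact: cvg_fst.
    have cs : continuous (@snd R R) by move=> w; exact: cvg_snd.
    near=> z'; split; apply/andP; split; apply: ltW; near: z'.
    - exact: (cf z _ (open_nbhs_nbhs (conj (@open_gt _ _) h1))).
    - exact: (cf z _ (open_nbhs_nbhs (conj (@open_lt _ _) h2))).
    - exact: (cs z _ (open_nbhs_nbhs (conj (@open_gt _ _) h3))).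
    - exact: (cs z _ (open_nbhs_nbhs (conj (@open_lt _ _) h4))).
  exists (rrect i, [set n | (i < n)%N]); first by split => //=; exists i.+1.
  by move=> [z' n] [/= z'i i_n]; exists i.
have mr := @measurable_disc R r.
apply: le_lt_trans (IA n); apply: ge0_subset_integral => //.
- exact: mFS.
- by move=> z _; rewrite lee_fin.
- exact: (dA n (leqnn n)).
Unshelve. all: by end_near.
Qed.

(** Discarding one null set for each rational rectangle leaves lines on which every segment of the
    disc works, because such a segment lies in a rational rectangle of the disc. *)
Lemma ACL_ae (u : R * R -> R) : ACL u B2 ->
  {ae mu, forall y : R, forall a b, a <= b -> (forall x, a <= x <= b -> B2 (x, y)) ->
     abs_cont_on (fun x => u (x, y)) a b} /\
  {ae mu, forall x : R, forall a b, a <= b -> (forall y, a <= y <= b -> B2 (x, y)) ->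
     abs_cont_on (fun y => u (x, y)) a b}.
Proof.
move=> acl; split.
- have : {ae mu, forall y : R, forall i, rrect i `<=` B2 ->
      (rat_rect i).2.1 <= y <= (rat_rect i).2.2 ->
      abs_cont_on (fun x => u (x, y)) (rat_rect i).1.1 (rat_rect i).1.2}.
    apply: ae_foralln => i; have [iB|iB] := pselect (rrect i `<=` B2); last by apply: aeW.
    apply: negligibleS (acl _ _ _ _ iB).1 => y /= /not_implyP[_ /not_implyP[yi nac]].
    by split.
  apply: filterS => y H a b ab abB.
  have := abB a ltac:(by rewrite lexx ab); have := abB b ltac:(by rewrite lexx ab).
  rewrite !B2E /normsq /= => b1 a1.
  have [i [h1 h2 h3 h4 iB]] : exists i, [/\ (rat_rect i).1.1 < a, b < (rat_rect i).1.2,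
      (rat_rect i).2.1 < y, y < (rat_rect i).2.2 & rrect i `<=` B2].
    apply: (@rat_rect_around _ _ _ _ (Num.max `|a| `|b|) `|y|) => //; try by rewrite le_max lexx ?orbT.
    by case: (leP `|a| `|b|) => _; rewrite !real_normK ?num_real.
  by apply: abs_cont_onS (H i iB _) => //; rewrite ltW// ltW.
- have : {ae mu, forall x : R, forall i, rrect i `<=` B2 ->
      (rat_rect i).1.1 <= x <= (rat_rect i).1.2 ->
      abs_cont_on (fun y => u (x, y)) (rat_rect i).2.1 (rat_rect i).2.2}.
    apply: ae_foralln => i; have [iB|iB] := pselect (rrect i `<=` B2); last by apply: aeW.
    apply: negligibleS (acl _ _ _ _ iB).2 => y /= /not_implyP[_ /not_implyP[yi nac]].
    by split.
  apply: filterS => x H a b ab abB.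
  have := abB a ltac:(by rewrite lexx ab); have := abB b ltac:(by rewrite lexx ab).
  rewrite !B2E /normsq /= => b1 a1.
  have [i [h1 h2 h3 h4 iB]] : exists i, [/\ (rat_rect i).1.1 < x, x < (rat_rect i).1.2,
      (rat_rect i).2.1 < a, b < (rat_rect i).2.2 & rrect i `<=` B2].
    apply: (@rat_rect_around _ _ _ _ `|x| (Num.max `|a| `|b|)) => //; try by rewrite le_max lexx ?orbT.
    by case: (leP `|a| `|b|) => _; rewrite !real_normK ?num_real.
  by apply: abs_cont_onS (H i iB _) => //; rewrite ltW// ltW.
Qed.

(** Off the null set [A] the derivative is the limit of difference quotients of a continuous
    function, and on [A] it is redefined as zero. The function is first extended by zero to the
    plane; for large [n] the quotients at a point of the disc do not see the extension. *)
Lemma measurable_directional (u l : R * R -> R) (A : set P) (p q : R) :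
  measurable A -> (forall z, B2 z -> {for z, continuous u}) ->
  (forall z, B2 z -> ~ A z -> (2 * n.+1%:R^-1)^-1 *
     (u (z.1 + p * n.+1%:R^-1, z.2 + q * n.+1%:R^-1) -
      u (z.1 - p * n.+1%:R^-1, z.2 - q * n.+1%:R^-1)) @[n --> \oo] --> l z) ->
  measurable_fun (B2 : set P) (l \_ (~` A)).
Proof.
move=> mA cu ul.
have mu0 : measurable_fun setT (u \_ B2 : P -> R).
  apply: (measurable_restrictT _ _).1; first exact: measurable_B2.
  by apply: open_continuous_measurable_fun2 => //; exact: open_B2.
have msh (a b : R) : measurable_fun setT (fun z : P => (u \_ B2) (z.1 + a, z.2 + b)).
  apply: (measurableT_comp mu0) => /=.
  by apply: measurable_fun_pair; apply: measurable_funD.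
pose h n : R := n.+1%:R^-1.
pose Q n : P -> R := (fun z : P => (2 * h n)^-1 *
   ((u \_ B2) (z.1 + p * h n, z.2 + q * h n) - (u \_ B2) (z.1 + - (p * h n), z.2 + - (q * h n)))) \_ (~` A).
apply: (@measurable_fun_cvg _ _ _ _ Q).
- move=> n; apply: measurable_funTS; apply: (measurable_restrictT _ (measurableC mA)).1.
  by apply: measurable_funTS; apply: measurable_funM => //; apply: measurable_funB; exact: msh.
move=> z Bz; rewrite /Q; have [Az|Az] := pselect (A z).
  by rewrite patchE memNset//; under eq_fun do rewrite patchE memNset//; exact: cvg_cst.
rewrite patchE mem_set//; under eq_fun do rewrite patchE mem_set//.
apply: cvg_trans (ul z Bz Az); apply: near_eq_cvg.
have hto (c s : R) : c + s * h n @[n --> \oo] --> c.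
  rewrite -[X in _ --> X]addr0 -[X in _ + X](mulr0 s); apply: cvgD; first exact: cvg_cst.
  by apply: cvgM; [exact: cvg_cst|exact: cvg_harmonic].
have inB (s t : R) : \forall n \near \oo, B2 (z.1 + s * h n, z.2 + t * h n).
  have := cvg_pair (hto z.1 s) (hto z.2 t).
  case: z Bz {Az} => z1 z2 /= Bz; apply.
  by apply: (@open_nbhs_nbhs _ ((z1, z2) : R * R)); split => //; exact: open_B2.
near=> n.
have B1 : B2 (z.1 + p * h n, z.2 + q * h n) by near: n; exact: inB.
have B3 : B2 (z.1 + - p * h n, z.2 + - q * h n) by near: n; exact: inB.
rewrite !patchE !mem_set//; by rewrite -!mulNr.
Unshelve. all: by end_near.
Qed.

Lemma locL2_disc (g : R * R -> R) (A : set P) : measurable A -> locL2 g B2 ->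
  measurable_fun (B2 : set P) (g \_ (~` A)) ->
  forall r, r < 1 -> (\int[mu2]_(z in disc r) ((g \_ (~` A)) z ^+ 2)%:E < +oo)%E.
Proof.
move=> mA Lg mg; apply: disc_integral_finite => //.
- exact: measurable_funX.
- by move=> z; exact: sqr_ge0.
move=> i iB; have /integrableP[mg2 fg2] := Lg _ _ _ _ iB.
apply: le_lt_trans fg2; apply: ge0_le_integral.
- exact: measurable_rrect.
- by move=> z _; rewrite lee_fin sqr_ge0.
- apply/measurable_EFinP; apply: measurable_funX; apply: measurable_funS mg => //; exact: measurable_B2.
- exact: measurableT_comp.
move=> z _; rewrite /= ger0_norm ?sqr_ge0// lee_fin patchE; case: ifPn => // _.
by rewrite expr0n /= sqr_ge0.
Qed.

Lemma sobD_of_ACL (u ux uy : R * R -> R) (A : set P) : measurable A -> mu2 A = 0%E ->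
  (forall z, B2 z -> {for z, continuous u}) -> ACL u B2 -> locL2 ux B2 -> locL2 uy B2 ->
  (forall z, B2 z -> ~ A z -> is_derive z.1 1 (fun x => u (x, z.2)) (ux z)) ->
  (forall z, B2 z -> ~ A z -> is_derive z.2 1 (fun y => u (z.1, y)) (uy z)) ->
  sobD u (ux \_ (~` A)) (uy \_ (~` A)).
Proof.
move=> mA A0 cu acl Lx Ly dx dy; have [acx acy] := ACL_ae acl.
have mx : measurable_fun (B2 : set P) (ux \_ (~` A)).
  apply: (@measurable_directional u _ A 1 0) => // z Bz Az.
  under eq_fun do rewrite mul0r addr0 subr0 mul1r.
  exact: central_difference_cvg (dx z Bz Az).
have my : measurable_fun (B2 : set P) (uy \_ (~` A)).
  apply: (@measurable_directional u _ A 0 1) => // z Bz Az.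
  under eq_fun do rewrite mul0r addr0 subr0 mul1r.
  exact: central_difference_cvg (dy z Bz Az).
apply: SobD; [exact: cu|exact: mx|exact: my|exact: locL2_disc|exact: locL2_disc|exact: acx|exact: acy|..].
- exists A; split => // z /= /not_implyP[Bz nd]; apply: contrapT => Az; apply: nd.
  by rewrite patchE mem_set//; exact: dx.
- exists A; split => // z /= /not_implyP[Bz nd]; apply: contrapT => Az; apply: nd.
  by rewrite patchE mem_set//; exact: dy.
Qed.

Lemma quasiregular_sobD K f : quasiregular K B2 f -> exists ux uy vx vy,
  [/\ sobD (fun z => (f z).1) ux uy, sobD (fun z => (f z).2) vx vy &
   {ae mu2, forall z, B2 z ->
     opnorm (ux z) (uy z) (vx z) (vy z) ^+ 2 <= K * (ux z * vy z - uy z * vx z)}].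
Proof.
move=> [cf [acl1 [acl2 [ux [uy [vx [vy [Lux [Luy [Lvx [Lvy [A [mA A0 HA]]]]]]]]]]]]].
have H z : B2 z -> ~ A z -> [/\ is_derive z.1 1 (fun x => (f (x, z.2)).1) (ux z),
   is_derive z.2 1 (fun y => (f (z.1, y)).1) (uy z),
   is_derive z.1 1 (fun x => (f (x, z.2)).2) (vx z),
   is_derive z.2 1 (fun y => (f (z.1, y)).2) (vy z) &
   opnorm (ux z) (uy z) (vx z) (vy z) ^+ 2 <= K * (ux z * vy z - uy z * vx z)].
  move=> Bz Az; apply: contrapT => nH; apply: Az; apply: HA; split => // -[? [? [? [? ?]]]].
  by apply: nH; split.
exists (ux \_ (~` A)), (uy \_ (~` A)), (vx \_ (~` A)), (vy \_ (~` A)); split.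
- apply: (sobD_of_ACL mA A0 _ acl1 Lux Luy).
  + by move=> z Bz; apply: (@continuous_comp _ _ _ f fst); [exact: cf|exact: cvg_fst].
  + by move=> z Bz Az; have [] := H z Bz Az.
  + by move=> z Bz Az; have [] := H z Bz Az.
- apply: (sobD_of_ACL mA A0 _ acl2 Lvx Lvy).
  + by move=> z Bz; apply: (@continuous_comp _ _ _ f snd); [exact: cf|exact: cvg_snd].
  + by move=> z Bz Az; have [] := H z Bz Az.
  + by move=> z Bz Az; have [] := H z Bz Az.
- exists A; split => // z /= /not_implyP[Bz nd]; apply: contrapT => Az; apply: nd.
  by rewrite !patchE !mem_set//; have [] := H z Bz Az.
Qed.

End Quasiregular.

(** * Comparison of increments and existence of primitives *)

Section Primitive.
Variable R : realType.
Local Notation mu := (@lebesgue_measure R).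

Lemma increment_le (F G f g : R -> R) (a b : R) : a <= b ->
  (forall x : R, a <= x <= b -> is_derive x 1 F (f x)) ->
  (forall x : R, a <= x <= b -> is_derive x 1 G (g x)) ->
  (forall x, a <= x <= b -> f x <= g x) -> F b - F a <= G b - G a.
Proof.
move=> ab dF dG fg.
have dH (x : R) : a <= x <= b -> is_derive x 1 (fun x => G x - F x) (g x - f x).
  by move=> h; have h1 := dF x h; have h2 := dG x h; exact: is_deriveB.
have [|x| |c] := @MVT_segment R (fun x => G x - F x) (fun x => g x - f x) a b _ _.
- exact: ab.
- by rewrite in_itv/= => /andP[x0 x1]; apply: dH; rewrite !ltW.
- apply: derivable_within_continuous => t; rewrite in_itv/= => /dH dht.
  by case: dht.
- rewrite in_itv/= => /fg cfg E.
  have : 0 <= (g c - f c) * (b - a) by rewrite mulr_ge0// subr_ge0.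
  by rewrite -E; lra.
Qed.

Lemma increment_eq (F G f : R -> R) (a b : R) : a <= b ->
  (forall x : R, a <= x <= b -> is_derive x 1 F (f x)) ->
  (forall x : R, a <= x <= b -> is_derive x 1 G (f x)) -> F b - F a = G b - G a.
Proof.
by move=> ab dF dG; apply/le_anti/andP; split; apply: (increment_le ab) dF dG _ || apply: (increment_le ab) dG dF _.
Qed.

Lemma continuous_itv_integrable (f : R -> R) (a b : R) : continuous f ->
  mu.-integrable `[a, b] (EFin \o f).
Proof.
move=> cf; apply: continuous_compact_integrable; first exact: segment_compact.
exact: continuous_subspaceT.
Qed.

Lemma primitive_ex (f : R -> R) : continuous f -> exists2 F, C1 F f & F 0 = 0.
Proof.
move=> cf.
pose F x := if 0 <= x then \int[mu]_(t in `]0, x]) f t else - \int[mu]_(t in `]x, 0]) f t.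
have FE n x : 0 <= n -> - n <= x <= n ->
    F x = \int[mu]_(t in `[- n, x]) f t - \int[mu]_(t in `[- n, 0]) f t.
  move=> n0 /andP[x1 x2]; rewrite /F; case: (leP 0 x) => x0.
    by rewrite Rintegral_itvB ?bnd_simp//; [exact: continuous_itv_integrable|lra].
  by rewrite -opprB Rintegral_itvB ?bnd_simp//; [exact: continuous_itv_integrable|exact: ltW].
exists F; last by rewrite /F lexx set_itvoc0 Rintegral_set0.
move=> x; split; last exact: cf.
pose n := `|x| + 1.
have nx : - n < x < n by rewrite -ltr_norml /n; lra.
have /andP[nx1 nx2] := nx.
have n0 : 0 <= n by rewrite /n addr_ge0.
have := @continuous_FTC1_closed R f (- n) x n nx2 (continuous_itv_integrable _ _ cf) nx1 (cf x).
move=> [d1 d2].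
have dG : is_derive x 1 (fun x => \int[mu]_(t in `[- n, x]) f t - \int[mu]_(t in `[- n, 0]) f t) (f x).
  by rewrite -[X in is_derive _ _ _ X]subr0; apply: is_deriveB; rewrite -d2 derive1E; exact/derivableP.
apply: near_eq_is_derive dG.
near=> y; symmetry; apply: FE => //.
rewrite -ler_norml ltW//; near: y.
have : `|y| @[y --> x] --> `|x| by apply: cvg_norm; exact: cvg_id.
by move=> /cvgr_lt; apply; rewrite /n; lra.
Unshelve. all: by end_near.
Qed.

Lemma C1_continuous (f f' : R -> R) : C1 f f' -> continuous f.
Proof. by move=> H x; have [[d _] _] := H x; apply: differentiable_continuous; exact/derivable1_diffP. Qed.

End Primitive.

(** * The angular coordinate and its multivaluedness *)

Section Circle.
Variable R : realType.
Implicit Types (A : R -> R) (x y : R) (z : R * R).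

Lemma cos_eq1_cases x : cos x = 1 -> `|x| < 4 * pi -> [\/ x = 0, x = 2 * pi | x = - (2 * pi)].
Proof.
have pi0 := pi_gt0 R.
have half (t : R) : 0 <= t -> t < 4 * pi -> cos t = 1 -> t = 0 \/ t = 2 * pi.
  move=> t0 t4 c1; pose u := t / 2; have tu : t = u + u by rewrite /u; field.
  have su : sin u = 0.
    have := cosD u u; rewrite -tu c1; have := cos2Dsin2 u; rewrite !expr2 => h1 h2.
    by apply/eqP; rewrite -sqrf_eq0 expr2; apply/eqP; lra.
  have [u0|u0|u0] := ltgtP u 0; [rewrite /u in u0; lra| |left; lra].
  right; have [up|up|up] := ltgtP u pi; last by lra.
    by have := @sin_gt0_pi _ u ltac:(by rewrite u0 up); rewrite su ltxx.
  have := @sin_gt0_pi _ (u - pi) ltac:(by rewrite subr_gt0 up/= ltrBlDr /u; lra).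
  by rewrite sinB su cospi sinpi mulr0 mul0r subrr ltxx.
move=> cx; rewrite ltr_norml => /andP[x1 x2].
have [x0|x0] := leP 0 x.
  by case: (half x x0 x2 cx) => ->; [constructor 1|constructor 2].
have [E|E] := half (- x) ltac:(lra) ltac:(lra) (etrans (cosN x) cx).
  by constructor 1; lra.
by constructor 3; lra.
Qed.

Definition periodic2pi A := forall x, A (x + 2 * pi) = A x.

(** Two angles with the same sine and cosine differ by a multiple of [2 pi], and the bound leaves
    only the multiples by -1, 0 and 1. *)
Lemma periodic_eq A x y : periodic2pi A -> sin x = sin y -> cos x = cos y ->
  `|x - y| < 4 * pi -> A x = A y.
Proof.
move=> pA sxy cxy; have : cos (x - y) = 1 by rewrite cosB sxy cxy -!expr2 cos2Dsin2.
move=> /cos_eq1_cases H /H [] E.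
- by congr A; lra.
- by rewrite -(pA y); congr A; lra.
- by rewrite -(pA x); congr A; lra.
Qed.

(** The sine is the first argument. This branch jumps across the half line where the cosine is -1
    and the sine changes sign, so only periodic functions of it are used. *)
Definition angle (n1 n2 : R) : R := if 0 <= n1 then acos n2 else - acos n2.

Lemma angleP (n1 n2 : R) : n1 ^+ 2 + n2 ^+ 2 = 1 ->
  [/\ sin (angle n1 n2) = n1, cos (angle n1 n2) = n2 & `|angle n1 n2| <= pi].
Proof.
move=> n12; have n2b : -1 <= n2 <= 1.
  by rewrite -ler_norml -(@ler_pXn2r _ 2%N) ?nnegrE ?normr_ge0// expr1n real_normK ?num_real//; have := sqr_ge0 n1; lra.
have E : Num.sqrt (1 - n2 ^+ 2) = `|n1| by rewrite -n12 addrK sqrtr_sqr.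
have a0 := acos_ge0 n2b; have ap := acos_lepi n2b.
rewrite /angle; case: (leP 0 n1) => n0.
  by split; [rewrite sin_acos// E ger0_norm|rewrite acosK// in_itv|rewrite ger0_norm].
split; [by rewrite sinN sin_acos// E ltr0_norm// opprK|by rewrite cosN acosK// in_itv|].
by rewrite normrN ger0_norm.
Qed.

Variables (D : set (R * R)) (n1 n2 px py : R * R -> R).
Hypothesis oD : open D.
Hypothesis dn1 : C1on D n1 (fun z => n2 z * px z) (fun z => n2 z * py z).
Hypothesis dn2 : C1on D n2 (fun z => - n1 z * px z) (fun z => - n1 z * py z).
Hypothesis n12 : forall z, D z -> n1 z ^+ 2 + n2 z ^+ 2 = 1.

(** Continuity is known only for the products of [px] with the sine and the cosine; as the squares
    of these add up to 1, [px] is recovered from the two products. *)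
Lemma circle_form_continuous z : D z -> {for z, continuous px} /\ {for z, continuous py}.
Proof.
move=> Dz; have [g1 c1 c2] := dn1 Dz; have [g2 c3 c4] := dn2 Dz.
have k1 := has_grad_continuous g1; have k2 := has_grad_continuous g2.
have E (p : R * R -> R) : {near z, (fun w => n2 w * (n2 w * p w) - n1 w * (- n1 w * p w)) =1 p}.
  apply: filterS (open_nbhs_nbhs (conj oD Dz)) => w /n12 H.
  by rewrite -[RHS]mul1r -H; ring.
have E' (p : R * R -> R) : n2 z * (n2 z * p z) - n1 z * (- n1 z * p z) = p z.
  by rewrite -[RHS]mul1r -(n12 Dz); ring.
have K (p : R * R -> R) : {for z, continuous (fun w => n2 w * p w)} ->
    {for z, continuous (fun w => - n1 w * p w)} -> {for z, continuous p}.
  move=> h1 h2; change (p w @[w --> z] --> p z).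
  rewrite -[X in _ --> X]E'; apply: cvg_trans (near_eq_cvg (E p)) _.
  by apply: cvgB; apply: cvgM.
by split; exact: K.
Qed.

(** The hypotheses say that [(n1, n2)] is the sine and cosine of an angle with differential
    [(px, py)], without naming such an angle. Near [z0] the function [th] is a genuine branch, built
    from the arcsine, and periodicity makes [A] blind to the difference between the branches. *)
Lemma C1on_angle A A' : C1 A A' -> periodic2pi A -> periodic2pi A' ->
  C1on D (fun z => A (angle (n1 z) (n2 z))) (fun z => A' (angle (n1 z) (n2 z)) * px z)
    (fun z => A' (angle (n1 z) (n2 z)) * py z).
Proof.
move=> hA pA pA' z0 Dz0.
have [g1 _ _] := dn1 Dz0; have [g2 _ _] := dn2 Dz0.
have [cpx cpy] := circle_form_continuous Dz0.
set a := angle (n1 z0) (n2 z0); have [sa ca ba] := angleP (n12 Dz0); rewrite -/a in sa ca ba.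
(* The functions [q] and [p] are the sine and the cosine of the angle relative to its value [a] at
   [z0]; near [z0] the cosine is positive and the arcsine of [q] is smooth. *)
pose q z := n1 z * cos a + n2 z * - sin a.
pose p z := n1 z * sin a + n2 z * cos a.
have q0 : q z0 = 0 by rewrite /q sa ca; ring.
have p0 : p z0 = 1 by rewrite /p sa ca -!expr2 n12.
have gq : has_grad q z0 (px z0) (py z0).
  apply: has_grad_eq.
  - apply: has_gradD; apply: has_gradM; [exact: g1|exact: has_grad_cst|exact: g2|exact: has_grad_cst].
  - by rewrite sa ca -[RHS]mul1r -(n12 Dz0); ring.
  - by rewrite sa ca -[RHS]mul1r -(n12 Dz0); ring.
have cp : {for z0, continuous p}.
  by apply: cvgD; apply: cvgM; [exact: has_grad_continuous g1|exact: cvg_cst|exact: has_grad_continuous g2|exact: cvg_cst].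
pose th z := a + asin (q z).
have asin0 : asin (0 : R) = 0.
  by rewrite -[X in asin X](@sin0 R) sinK// in_itv/=; have pi0 := pi_gt0 R; apply/andP; split; lra.
have th0 : th z0 = a by rewrite /th q0 asin0 addr0.
have gth : has_grad th z0 (px z0) (py z0).
  apply: has_grad_eq.
  - apply: has_gradD; first exact: has_grad_cst.
    apply: has_grad_comp gq _; apply: is_derive1_asin; rewrite q0; apply/andP; split; lra.
  - by rewrite q0 expr0n /= subr0 sqrtr1 invr1; ring.
  - by rewrite q0 expr0n /= subr0 sqrtr1 invr1; ring.
have near_th (B : R -> R) : periodic2pi B -> \forall z \near z0, B (angle (n1 z) (n2 z)) = B (th z).
  move=> pB; have np : \forall z \near z0, 0 < p z.
    by move/cvgr_gt : (cp); apply; rewrite p0.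
  apply: filterS2 np (open_nbhs_nbhs (conj oD Dz0)) => z pz Dz.
  have [s1 c1 b1] := angleP (n12 Dz).
  have qp : q z ^+ 2 + p z ^+ 2 = 1.
    rewrite /q /p; transitivity ((n1 z ^+ 2 + n2 z ^+ 2) * (cos a ^+ 2 + sin a ^+ 2)); first by ring.
    by rewrite n12// cos2Dsin2 mulr1.
  have qb : -1 <= q z <= 1.
    by rewrite -ler_norml -(@ler_pXn2r _ 2%N) ?nnegrE ?normr_ge0// expr1n real_normK ?num_real//; have := sqr_ge0 (p z); lra.
  have sth : sin (asin (q z)) = q z by rewrite asinK// in_itv.
  have cth : cos (asin (q z)) = p z by rewrite cos_asin// -qp addrC addKr sqrtr_sqr gtr0_norm.
  apply: periodic_eq => //.
  - rewrite s1 /th sinD sth cth /p /q; transitivity (n1 z * (cos a ^+ 2 + sin a ^+ 2)); last by ring.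
    by rewrite cos2Dsin2 mulr1.
  - rewrite c1 /th cosD sth cth /p /q; transitivity (n2 z * (cos a ^+ 2 + sin a ^+ 2)); last by ring.
    by rewrite cos2Dsin2 mulr1.
  - have pi0 := pi_gt0 R; have h1 := asin_geNpi2 qb; have h2 := asin_lepi2 qb.
    by move: b1 ba; rewrite /th !ler_norml ltr_norml => /andP[? ?] /andP[? ?]; apply/andP; split; lra.
have [dA cA'] := hA a.
have cA : {for z0, continuous (fun z => A' (angle (n1 z) (n2 z)))}.
  have E := near_th _ pA'.
  change (A' (angle (n1 z) (n2 z)) @[z --> z0] --> A' (angle (n1 z0) (n2 z0))).
  rewrite [X in _ --> X](nbhs_singleton E).
  have E' : {near z0, (fun z => A' (th z)) =1 (fun z => A' (angle (n1 z) (n2 z)))}.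
    by apply: filterS E => z ->.
  apply: cvg_trans (near_eq_cvg E') _.
  by apply: (@continuous_comp _ _ _ th A'); [exact: has_grad_continuous gth|rewrite th0; exact: cA'].
split; [|exact: cvgM|exact: cvgM].
have gA : has_grad (fun z => A (th z)) z0 (A' a * px z0) (A' a * py z0).
  by apply: has_grad_comp gth _; rewrite th0.
apply: (has_grad_near gA).
have /nbhs_ballP[d /= d0 H] := near_th _ pA; exists d => // w h1 h2; apply: H.
by split; rewrite /ball /= distrC.
Qed.

End Circle.

(** * Gluing of C^1 functions and positivity of integrals *)

Section Glue.
Variable R : realType.
Local Notation mu := (@lebesgue_measure R).
Local Notation mu2 := (mu \x mu)%E.
Local Notation P := (measurableTypeR R * measurableTypeR R)%type.
Local Notation B2 := (@B2 R).
Implicit Types (z : R * R) (F G : R * R -> R).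

Lemma nbhs_box z (A : set (R * R)) : nbhs z A -> exists2 d : R, 0 < d &
  forall w : R * R, `|w.1 - z.1| < d -> `|w.2 - z.2| < d -> A w.
Proof.
move=> /nbhs_ballP[d /= d0 H]; exists d => // w h1 h2; apply: H.
by split; rewrite /ball /= distrC.
Qed.

Lemma has_grad_locally_cst F z (c : R) (E : set (R * R)) : open E -> E z ->
  (forall w, E w -> F w = c) -> has_grad F z 0 0.
Proof.
move=> openE Ez Fc; apply: (has_grad_near (has_grad_cst c z)).
by have [d d0 H] := nbhs_box (open_nbhs_nbhs (conj openE Ez)); exists d => // w h1 h2; apply: Fc; exact: H.
Qed.

Lemma continuous_locally_cst F z (c : R) (E : set (R * R)) : open E -> E z ->
  (forall w, E w -> F w = c) -> {for z, continuous F}.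
Proof. by move=> h1 h2 /(has_grad_locally_cst h1 h2)/has_grad_continuous. Qed.

Lemma C1on_glue (D E B : set (R * R)) F Fx Fy (c : R) : open E -> C1on D F Fx Fy ->
  (forall z, E z -> [/\ F z = c, Fx z = 0 & Fy z = 0]) -> (forall z, B z -> D z \/ E z) ->
  C1on B F Fx Fy.
Proof.
move=> openE CF FE BDE z /BDE[/CF//|Ez]; have [_ -> ->] := FE z Ez.
split; [apply: (@has_grad_locally_cst _ _ c _ openE Ez)|apply: (@continuous_locally_cst _ _ 0 _ openE Ez)
  |apply: (@continuous_locally_cst _ _ 0 _ openE Ez)]; by move=> w /FE[].
Qed.

Lemma ae_le_Rintegral (D : set P) (f g : P -> R) : measurable D ->
  mu2.-integrable D (EFin \o f) -> mu2.-integrable D (EFin \o g) ->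
  {ae mu2, forall z, D z -> f z <= g z} -> \int[mu2]_(z in D) f z <= \int[mu2]_(z in D) g z.
Proof.
move=> mD If Ig fg; rewrite -subr_ge0 -RintegralB//.
rewrite (_ : \int[mu2]_(x in D) (g x - f x) = \int[mu2]_(x in D) `|g x - f x|).
  by apply: Rintegral_ge0 => x _; exact: normr_ge0.
have := integrableB mD Ig If => /integrableP[mgf _].
congr fine; apply: ae_eq_integral => //.
  apply/measurable_EFinP; apply: measurableT_comp => //; apply: measurable_funB; apply/measurable_EFinP.
    by case/integrableP: Ig.
  by case/integrableP: If.
apply: filterS fg => z H Dz; rewrite ger0_norm// subr_ge0; exact: H.
Qed.

Lemma continuous_disc_integrable F r : r < 1 -> (forall z, B2 z -> {for z, continuous F}) ->
  mu2.-integrable (disc r) (EFin \o F).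
Proof.
move=> r1 cF; have mF : measurable_fun (B2 : set P) F.
  by apply: open_continuous_measurable_fun2 => //; exact: open_B2.
apply: measurable_bounded_integrable; first exact: measurable_disc.
- exact: disc_finite.
- by apply: measurable_funS mF; [exact: measurable_B2|move=> z; exact: discS].
- have [M HM] := bounded_disc r1 cF; exists M; split; first exact: num_real.
  by move=> x Mx z /= zr; apply: (le_trans (HM _ zr)); exact: ltW.
Qed.

Lemma open_positive_measure (E : set (R * R)) z : open E -> E z -> measurable (E : set P) ->
  (0 < mu2 (E : set P))%E.
Proof.
move=> openE Ez mE.
have [d d0 H] := nbhs_box (open_nbhs_nbhs (conj openE Ez)).
pose Q : set P := `]z.1 - d, z.1 + d[ `*` `]z.2 - d, z.2 + d[.
apply: (@lt_le_trans _ _ (mu2 Q)); last first.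
  apply: le_measure; rewrite ?inE//; first by apply: measurableX; exact: measurable_itv.
  by move=> w [/=]; rewrite !in_itv/= => h1 h2; apply: H; rewrite ltr_distl.
rewrite /Q product_measure1E; [|exact: measurable_itv|exact: measurable_itv].
have E1 (x : R) : lebesgue_measure (`]x - d, x + d[%classic : set R) = (2 * d)%:E.
  rewrite lebesgue_measure_itv /= lte_fin ifT; last by lra.
  by rewrite -EFinB; congr EFin; ring.
apply: (@lt_le_trans _ _ ((2 * d)%:E * (2 * d)%:E)%E).
  by rewrite -EFinM lte_fin mulr_gt0//; lra.
rewrite le_eqVlt; apply/orP; left; apply/eqP; congr (_ * _)%E; symmetry; exact: E1.
Qed.

Lemma integral_continuous_gt0 F r z : r < 1 -> (forall z, B2 z -> {for z, continuous F}) ->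
  (forall z, B2 z -> 0 <= F z) -> normsq z < r -> 0 < F z -> 0 < \int[mu2]_(z in disc r) F z.
Proof.
move=> r1 cF F0 zr Fz.
have mr := @measurable_disc R r.
have IF := continuous_disc_integrable r1 cF.
have dF w : disc r w -> 0 <= F w by move=> /(discS r1)/F0.
rewrite lt_neqAle Rintegral_ge0 ?andbT; last by move=> w /dF.
apply/eqP => E0.
have Ea : (\int[mu2]_(w in disc r) `|(F w)%:E| = 0)%E.
  rewrite -[LHS]fineK; last by exact: (integrable_fin_num _ (integrable_abse IF)).
  rewrite -[RHS]/((0 : R)%:E); congr EFin; rewrite E0 /Rintegral; congr fine.
  by apply: eq_integral => w; rewrite inE => /dF h; rewrite /= ger0_norm.
have /integrableP[mF _] := IF.
have [A [mA A0 HA]] := (ae_eq_integral_abs mu2 mr mF).1 Ea.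
pose E : set (R * R) := [set w | normsq w < r] `&` ([set w | 0 < F w] `&` B2).
have openE : open E.
  rewrite openE => w [/= h1 [h2 h3]]; apply: filterI.
    by have := @continuous_normsq R w => /cvgr_lt; apply.
  apply: filterI; first by have := cF w h3 => /cvgr_gt; apply.
  by apply: open_nbhs_nbhs; split => //; exact: open_B2.
have mE : measurable (E : set P) by exact: open_measurable2.
have Ez : E z by split => //; split => //; apply: (@discS _ r) => //; exact: ltW.
have := open_positive_measure openE Ez mE; apply/negP; rewrite -leNgt -A0.
apply: le_measure; rewrite ?inE// => w [/= h1 [h2 h3]]; apply: HA => /= /(_ (ltW h1)) [] h4.
by rewrite h4 ltxx in h2.
Qed.

End Glue.

(** * Coordinates on a ring and the length-area inequality *)

Section Ring.
Variable R : realType.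
Local Notation mu := (@lebesgue_measure R).
Local Notation mu2 := (mu \x mu)%E.
Local Notation P := (measurableTypeR R * measurableTypeR R)%type.
Local Notation B2 := (@B2 R).
Implicit Types (z : R * R) (F G : R * R -> R).

Variables (tau tx ty n1 n2 px py : R * R -> R) (t r : R).
Local Notation Dp := [set z | B2 z /\ 0 < tau z].
Local Notation "'Int' F" := (\int[mu2]_(z in disc r) F z) (at level 10, F at level 8).

(** On the part of the disc where [tau] is positive, [tau] and the angle with sine [n1], cosine [n2]
    and differential [(px, py)] are positively oriented coordinates; the rest is the slit, where the
    angle has no meaning. The last two fields confine the levels up to [t] to a smaller disc. *)
Record ring_chart : Prop := RingChart {
  rc_cont : forall z, B2 z -> {for z, continuous tau};
  rc_tau : C1on Dp tau tx ty;
  rc_n1 : C1on Dp n1 (fun z => n2 z * px z) (fun z => n2 z * py z);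
  rc_n2 : C1on Dp n2 (fun z => - n1 z * px z) (fun z => - n1 z * py z);
  rc_circle : forall z, Dp z -> n1 z ^+ 2 + n2 z ^+ 2 = 1;
  rc_area : forall z, Dp z -> 0 < px z * ty z - py z * tx z;
  rc_t : 0 < t;
  rc_r : r < 1;
  rc_disc : forall z, B2 z -> tau z <= t -> normsq z < r }.

(** Integration against [k (tau)] takes the place of integration over level curves. The support of
    [k] between [e] and [t] stays away from the slit and from the unit circle. *)
Definition weight (e : R) (K k : R -> R) :=
  [/\ 0 < e, C1 K k, (forall x, x <= e -> k x = 0) & (forall x, t <= x -> k x = 0)].

Hypothesis rc : ring_chart.
Let r1 := rc_r rc.
Let mr := @measurable_disc R r.

Lemma ring_open : open Dp.
Proof.
rewrite openE => z [Bz tz]; apply: filterI; first by apply: open_nbhs_nbhs; split => //; exact: open_B2.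
by have := rc_cont rc Bz => /cvgr_gt; apply.
Qed.

Lemma near_slit_open e : open [set z | B2 z /\ tau z < e].
Proof.
rewrite openE => z [Bz tz]; apply: filterI; first by apply: open_nbhs_nbhs; split => //; exact: open_B2.
by have := rc_cont rc Bz => /cvgr_lt; apply.
Qed.

Lemma ring_or_slit e z : 0 < e -> B2 z -> Dp z \/ B2 z /\ tau z < e.
Proof. by move=> e0 Bz; have [h|h] := ltP (tau z) e; [right|left; split => //; exact: lt_le_trans h]. Qed.

Lemma C1on_ring F Fx Fy (c e : R) : 0 < e -> C1on Dp F Fx Fy ->
  (forall z, B2 z -> tau z < e -> [/\ F z = c, Fx z = 0 & Fy z = 0]) -> C1on B2 F Fx Fy.
Proof.
move=> e0 CF FE; apply: (@C1on_glue _ _ _ _ _ _ _ c (@near_slit_open e) CF).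
- by move=> z []; exact: FE.
- by move=> z; exact: ring_or_slit.
Qed.

Lemma continuous_ring F e : 0 < e -> (forall z, Dp z -> {for z, continuous F}) ->
  (forall z, B2 z -> tau z < e -> F z = 0) -> forall z, B2 z -> {for z, continuous F}.
Proof.
move=> e0 cF F0 z Bz; have [/cF//|Ez] := ring_or_slit e0 Bz.
by apply: (@continuous_locally_cst _ _ _ 0 _ (@near_slit_open e) Ez) => w []; exact: F0.
Qed.

Definition ramp (e x : R) := smoothstep ((x - e / 2) / (e / 2)).
Definition ramp' (e x : R) := smoothstep' ((x - e / 2) / (e / 2)) / (e / 2).

Lemma C1_affine_comp (f f' : R -> R) (a b : R) : C1 f f' ->
  C1 (fun x => f ((x - a) / b)) (fun x => f' ((x - a) / b) / b).
Proof.
move=> Hf x; have [d c] := Hf ((x - a) / b).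
have da : is_derive x 1 (fun y => (y - a) / b) b^-1.
  by have := @is_derive_affine R (- a / b) b^-1 x; congr is_derive; apply/funext => y /=; ring.
have ca : {for x, continuous (fun y => (y - a) / b)}.
  by case: da => /derivable1_diffP /differentiable_continuous.
split; first exact: (@is_derive1_comp _ f (fun y => (y - a) / b) _ _ _ d da).
by apply: cvgM; [apply: (@continuous_comp _ _ _ (fun y => (y - a) / b) f')|exact: cvg_cst].
Qed.

Lemma C1_ramp e : C1 (ramp e) (ramp' e).
Proof. exact: (C1_affine_comp _ _ (@C1_smoothstep R)). Qed.

Lemma rampE e : 0 < e -> [/\ forall x, x <= e / 2 -> ramp e x = 0, forall x, x <= e / 2 -> ramp' e x = 0,
  forall x, e <= x -> ramp e x = 1 & forall x, e <= x -> ramp' e x = 0].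
Proof.
move=> e0; have e20 : 0 < e / 2 by lra.
have lo x : x <= e / 2 -> (x - e / 2) / (e / 2) <= 0 by move=> h; rewrite ler_pdivrMr// mul0r subr_le0.
have hi x : e <= x -> 1 <= (x - e / 2) / (e / 2) by move=> h; rewrite ler_pdivlMr// mul1r; lra.
split => x h; rewrite /ramp /ramp'.
- by apply: smoothstep0; exact: lo.
- by rewrite smoothstep'0 ?mul0r//; left; exact: lo.
- by apply: smoothstep1; exact: hi.
- by rewrite smoothstep'0 ?mul0r//; right; exact: hi.
Qed.

Lemma weight_cst e K k : weight e K k -> (forall x, x <= e -> K x = K e) /\ (forall x, t <= x -> K x = K t).
Proof.
move=> [e0 CK k0 kt].
have H (a b : R) : a <= b -> (forall x, a <= x <= b -> k x = 0) -> K b = K a.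
  move=> ab kab; apply/eqP; rewrite -subr_eq0; apply/eqP.
  rewrite -[RHS](subrr (0 : R)); apply: (@increment_eq _ K (fun=> 0) (fun=> 0) a b ab).
  by move=> x /kab h; have [d _] := CK x; rewrite -h.
split => x h.
  by symmetry; apply: H => // y /andP[_ ?]; exact: k0.
by apply: H => // y /andP[? _]; exact: kt.
Qed.

Lemma C1on_weight e K k : weight e K k ->
  C1on B2 (fun z => K (tau z)) (fun z => k (tau z) * tx z) (fun z => k (tau z) * ty z).
Proof.
move=> W; have [Ke _] := weight_cst W; have [e0 CK k0 _] := W.
apply: (@C1on_ring _ _ _ (K e) e) => //; first exact: C1on_compC1 (rc_tau rc) CK.
by move=> z Bz /ltW h; rewrite Ke// k0// !mul0r.
Qed.

(** The form [k (tau) dtau] is the differential of [K (tau) - K t], which vanishes near the unit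
    circle. *)
Lemma ring_stokes e K k V Vx Vy : weight e K k -> sobD V Vx Vy ->
  Int (fun z => k (tau z) * (tx z * Vy z - ty z * Vx z)) = 0.
Proof.
move=> W sV; have [_ Kt] := weight_cst W.
have CZ := C1onD (C1on_weight W) (@C1on_cst _ B2 (- K t)).
have := disc_stokes r1 (sobD_C1 CZ) sV => H.
rewrite -[RHS]H; last first.
  move=> z Bz rz; rewrite Kt ?subrr//; apply/ltW; rewrite ltNge; apply/negP => /(rc_disc rc Bz).
  by move/(lt_trans rz); rewrite ltxx.
by apply: eq_Rintegral => z _; rewrite !addr0; ring.
Qed.

Definition area z := px z * ty z - py z * tx z.

Section Periodic.
Variables (A A' : R -> R).
Hypotheses (CA : C1 A A') (pA : periodic2pi A) (pA' : periodic2pi A').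
Local Notation th z := (angle (n1 z) (n2 z)).

(** The ramp suppresses functions of the angle near the slit, where they are discontinuous, and is 1
    at all levels where a weight with the same [e] can be nonzero. *)
Lemma C1on_ramp_angle e : 0 < e -> C1on B2 (fun z => ramp e (tau z) * A (th z))
  (fun z => ramp e (tau z) * (A' (th z) * px z) + A (th z) * (ramp' e (tau z) * tx z))
  (fun z => ramp e (tau z) * (A' (th z) * py z) + A (th z) * (ramp' e (tau z) * ty z)).
Proof.
move=> e0; have [a1 a2 _ _] := rampE e0.
apply: (@C1on_ring _ _ _ 0 (e / 2)); first lra.
  apply: C1onM; first exact: C1on_compC1 (rc_tau rc) (C1_ramp e).
  exact: (C1on_angle ring_open (rc_n1 rc) (rc_n2 rc) (rc_circle rc)).
by move=> z Bz /ltW h; rewrite a1// a2//; split; ring.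
Qed.

(* [k dA] is exact on the ring. *)
Lemma ring_stokes_angle e K k U Ux Uy : weight e K k -> sobD U Ux Uy ->
  Int (fun z => k (tau z) * (A (th z) * (tx z * Uy z - ty z * Ux z) - U z * A' (th z) * area z)) = 0.
Proof.
move=> W sU; have [e0 _ k0 _] := W; have [_ _ a3 a4] := rampE e0.
have := ring_stokes W (sobDM sU (sobD_C1 (C1on_ramp_angle e0))) => H; rewrite -[RHS]H.
apply: eq_Rintegral => z _; have [h|/ltW h] := leP (tau z) e; first by rewrite k0// !mul0r.
by rewrite a3// a4// /area; congr (_ * _); ring.
Qed.

End Periodic.

Lemma continuous_area z : Dp z -> {for z, continuous area}.
Proof.
move=> Dz; have [cpx cpy] := circle_form_continuous ring_open (rc_n1 rc) (rc_n2 rc) (rc_circle rc) Dz.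
have [_ cx cy] := rc_tau rc Dz.
by apply: cvgB; apply: cvgM.
Qed.

Lemma weight_integrable e K k F : weight e K k -> (forall z, Dp z -> {for z, continuous F}) ->
  mu2.-integrable (disc r) (EFin \o (fun z => k (tau z) * F z)).
Proof.
move=> [e0 CK k0 _] cF; apply: continuous_disc_integrable => //.
apply: (@continuous_ring _ e) => //; last by move=> z Bz /ltW h; rewrite k0// mul0r.
move=> z Dz; apply: cvgM; last exact: cF.
apply: (@continuous_comp _ _ _ tau k); last by have [_] := CK (tau z).
by apply: (rc_cont rc); case: Dz.
Qed.

Lemma disc_integrableZ F (a : R) : mu2.-integrable (disc r) (EFin \o F) ->
  mu2.-integrable (disc r) (EFin \o (fun z => a * F z)).
Proof. by move=> /(integrableZl mr a); apply: eq_integrable. Qed.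

Section PeriodicWeight.
Variables (X c : R -> R).
Hypotheses (CX : C1 X c) (pc : periodic2pi c).
Let m := (X (2 * pi) - X 0) / (2 * pi).
Local Notation th z := (angle (n1 z) (n2 z)).

(** The increments of [X] over a period do not depend on the starting point, since their derivative
    is zero; subtracting the mean slope [m] therefore leaves a periodic function. *)
Lemma detrended_periodic :
  C1 (fun x => X x - m * x) (fun x => c x - m) /\ periodic2pi (fun x => X x - m * x).
Proof.
have CA : C1 (fun x => X x - m * x) (fun x => c x - m).
  move=> x; have [d cc] := CX x; split; last by apply: cvgB => //; exact: cvg_cst.
  have dm : is_derive x 1 (fun x => m * x) m.
    by have := is_derive_affine 0 m x; congr is_derive; apply/funext => y /=; rewrite add0r mulrC.
  exact: is_deriveB.
split => //.
have dG (x : R) : is_derive x 1 (fun y => X (y + 2 * pi) - X y) 0.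
  rewrite -(subrr (c x)); have [d1 _] := CX x; have [d2 _] := CX (x + 2 * pi).
  have ds : is_derive x 1 (fun y => y + 2 * pi) 1.
    by have := is_derive_affine (2 * pi) 1 x; congr is_derive; apply/funext => y /=; rewrite mulr1 addrC.
  have := @is_derive1_comp _ X (fun y => y + 2 * pi) x _ _ d2 ds; rewrite mulr1 pc => d3.
  exact: is_deriveB.
move=> x; have := is_derive_0_is_cst x 0 dG; rewrite add0r => E.
have : m * (2 * pi) = X (2 * pi) - X 0 by rewrite /m divfK// mulf_neq0// gt_eqF// pi_gt0.
by move: E => /=; nra.
Qed.

Lemma continuous_periodic_area z : Dp z -> {for z, continuous (fun z => c (th z) * area z)}.
Proof.
move=> Dz; have [CA pA] := detrended_periodic.
have pA' : periodic2pi (fun x => c x - m) by move=> x; rewrite /= pc.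
have [_ c1 c2] := C1on_angle ring_open (rc_n1 rc) (rc_n2 rc) (rc_circle rc) CA pA pA' Dz.
have [_ cx cy] := rc_tau rc Dz; have ca := continuous_area Dz.
have E w : c (th w) * area w = (c (th w) - m) * px w * ty w - (c (th w) - m) * py w * tx w + m * area w.
  by rewrite /area; ring.
rewrite (_ : (fun z => c (th z) * area z) = fun w => (c (th w) - m) * px w * ty w - (c (th w) - m) * py w * tx w + m * area w); last by apply/funext.
apply: cvgD; last by apply: cvgM => //; exact: cvg_cst.
by apply: cvgB; apply: cvgM.
Qed.

(** The differential of the detrended function is exact on the ring, so a periodic density of the
    angle may be replaced by its mean in such integrals. *)
Lemma ring_angular_mean e K k : weight e K k ->
  Int (fun z => k (tau z) * (c (th z) * area z)) =
  (X (2 * pi) - X 0) / (2 * pi) * Int (fun z => k (tau z) * area z).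
Proof.
move=> W; have [CA pA] := detrended_periodic.
have pA' : periodic2pi (fun x => c x - m) by move=> x; rewrite /= pc.
have := ring_stokes_angle CA pA pA' W (sobD_C1 (@C1on_cst _ B2 1)) => H.
have I1 := weight_integrable W continuous_periodic_area.
have I2 := weight_integrable W continuous_area.
have I3 := disc_integrableZ m I2.
have : -1 * (Int (fun z => k (tau z) * (c (th z) * area z)) - m * Int (fun z => k (tau z) * area z)) = 0.
  rewrite -(RintegralZl _ mr I2) -(RintegralB mr I1 I3) -(RintegralZl _ mr); last first.
    by apply: eq_integrable (integrableB mr I1 I3).
  by rewrite -H; apply: eq_Rintegral => z _; ring.
by rewrite -/m; lra.
Qed.

End PeriodicWeight.

(** The angle is not a function, but its differential is [n2 dn1 - n1 dn2]. Stokes' formula is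
    applied to [n2 (K - K t)] with [n1], and to [n1 (K - K t)] with [n2]; the products [dn1 dn2]
    vanish and the squares of [n1] and [n2] add up to 1. The hypothesis on [K] makes the first
    factors vanish near the slit as well. *)
Lemma ring_zero_total e K k : weight e K k -> K t = K e -> Int (fun z => k (tau z) * area z) = 0.
Proof.
move=> W Kte; have [Ke Kt] := weight_cst W; have [e0 CK k0 k1] := W.
have [a1 a2 a3 a4] := rampE e0.
have CKt : C1on Dp (fun z => K (tau z) - K t) (fun z => k (tau z) * tx z + 0) (fun z => k (tau z) * ty z + 0).
  apply: (C1onD (C1onS _ (C1on_weight W)) (@C1on_cst _ _ (- K t))); by move=> z [].
have Kout z : B2 z -> r < normsq z -> K (tau z) - K t = 0.
  move=> Bz rz; rewrite Kt ?subrr//; apply/ltW; rewrite ltNge; apply/negP => /(rc_disc rc Bz).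
  by move/(lt_trans rz); rewrite ltxx.
have Kin z : B2 z -> tau z < e -> K (tau z) - K t = 0 /\ k (tau z) = 0.
  by move=> Bz /ltW h; rewrite Ke// Kte subrr k0.
have Cr : C1on Dp (fun z => ramp e (tau z)) _ _ := C1on_compC1 (rc_tau rc) (C1_ramp e).
have e20 : 0 < e / 2 by lra.
have CZ1 := @C1on_ring _ _ _ 0 e e0 (C1onM (rc_n2 rc) CKt)
  ltac:(by move=> z Bz /(Kin z Bz)[-> ->]; split; ring).
have CZ2 := @C1on_ring _ _ _ 0 e e0 (C1onM (rc_n1 rc) CKt)
  ltac:(by move=> z Bz /(Kin z Bz)[-> ->]; split; ring).
have CV1 := @C1on_ring _ _ _ 0 _ e20 (C1onM Cr (rc_n1 rc))
  ltac:(by move=> z Bz /ltW h; rewrite a1// a2//; split; ring).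
have CV2 := @C1on_ring _ _ _ 0 _ e20 (C1onM Cr (rc_n2 rc))
  ltac:(by move=> z Bz /ltW h; rewrite a1// a2//; split; ring).
have H1 := disc_stokes r1 (sobD_C1 CZ1) (sobD_C1 CV1) (fun z Bz rz => etrans (congr1 _ (Kout z Bz rz)) (mulr0 _)).
have H2 := disc_stokes r1 (sobD_C1 CZ2) (sobD_C1 CV2) (fun z Bz rz => etrans (congr1 _ (Kout z Bz rz)) (mulr0 _)).
have Dpin z : z \in (disc r : set P) -> e <= tau z -> Dp z.
  by rewrite inE => /(discS r1) Bz h; split => //; exact: lt_le_trans h.
have E2 : Int (fun z => k (tau z) * (n1 z ^+ 2 * area z)) = 0.
  rewrite -[RHS]H2.
  apply: eq_Rintegral => z zr; have [h|h] := leP e (tau z); last first.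
    have Bz : B2 z by move: zr; rewrite inE => /(discS r1).
    by have [-> ->] := Kin z Bz h; rewrite /area; ring.
  by rewrite a3// a4// /area; ring.
have cn (n : R * R -> R) nx ny : C1on Dp n nx ny -> forall z, Dp z -> {for z, continuous (fun z => n z ^+ 2 * area z)}.
  move=> Cn z Dz; apply: cvgM; last exact: continuous_area.
  by apply: cvgM; exact: C1on_continuous Cn Dz.
have I1 := weight_integrable W (cn _ _ _ (rc_n2 rc)).
have I2 := weight_integrable W (cn _ _ _ (rc_n1 rc)).
have E1 : -1 * Int (fun z => k (tau z) * (n2 z ^+ 2 * area z)) = 0.
  rewrite -(RintegralZl _ mr I1) -[RHS]H1.
  apply: eq_Rintegral => z zr; have [h|h] := leP e (tau z); last first.
    have Bz : B2 z by move: zr; rewrite inE => /(discS r1).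
    by have [-> ->] := Kin z Bz h; rewrite /area; ring.
  by rewrite a3// a4// /area; ring.
have {}E1 : Int (fun z => k (tau z) * (n2 z ^+ 2 * area z)) = 0 by lra.
rewrite -[RHS]addr0 -{1}E1 -E2 -RintegralD//.
apply: eq_Rintegral => z zr; have [h|h] := leP e (tau z); last by rewrite k0 ?ltW// !mul0r addr0.
by rewrite -mulrDr -mulrDl [n2 z ^+ 2 + _]addrC (rc_circle rc (Dpin z zr h)) mul1r.
Qed.

Lemma weight_lincomb e e' K k K' k' (a : R) : weight e K k -> weight e' K' k' ->
  weight (Num.min e e') (fun x => K x + a * K' x) (fun x => k x + a * k' x).
Proof.
move=> [e0 CK k0 k1] [e0' CK' k0' k1']; split.
- by rewrite lt_min e0.
- move=> x; have [d c] := CK x; have [d' c'] := CK' x; split.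
    have da : is_derive x 1 (fun y => a * K' y) (a * k' x).
      have := @is_derive1_comp _ (fun y => 0 + y * a) K' x _ _ (is_derive_affine 0 a (K' x)) d'.
      by congr is_derive; apply/funext => y /=; rewrite add0r mulrC.
    exact: is_deriveD.
  by apply: cvgD => //; apply: cvgM => //; exact: cvg_cst.
- by move=> x; rewrite le_min => /andP[h h']; rewrite k0// k0'// mulr0 addr0.
- by move=> x h; rewrite k1// k1'// mulr0 addr0.
Qed.

(** Geometrically [c] is the increase of the angle along any level curve. It is defined as the
    integral for the reference weight [K1], which rises from 0 to 1, and is positive because the
    weight is positive at the level of [z0]. Another weight differs from a multiple of this one by a
    weight of total zero. *)
Lemma ring_constant z0 : B2 z0 -> 0 < tau z0 < t -> exists2 c, 0 < c &
  forall e K k, weight e K k -> Int (fun z => k (tau z) * area z) = c * (K t - K 0).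
Proof.
move=> Bz0 /andP[t0 tt]; pose e := tau z0 / 2.
have e0 : 0 < e by rewrite /e; lra.
have et : e < t by rewrite /e; lra.
pose K1 x := @smoothstep R ((x - e) / (t - e)); pose k1 x := @smoothstep' R ((x - e) / (t - e)) / (t - e).
have te : 0 < t - e by rewrite subr_gt0.
have lo x : x <= e -> (x - e) / (t - e) <= 0 by move=> h; rewrite ler_pdivrMr// mul0r subr_le0.
have hi x : t <= x -> 1 <= (x - e) / (t - e) by move=> h; rewrite ler_pdivlMr// mul1r; lra.
have W1 : weight e K1 k1.
  split => //; first exact: (C1_affine_comp _ _ (@C1_smoothstep R)).
    by move=> x h; rewrite /k1 smoothstep'0 ?mul0r//; left; exact: lo.
  by move=> x h; rewrite /k1 smoothstep'0 ?mul0r//; right; exact: hi.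
have K1t : K1 t = 1 by apply: smoothstep1; exact: hi.
have K10 : K1 0 = 0 by apply: smoothstep0; exact: lo (ltW e0).
have k10 x : 0 <= k1 x by rewrite mulr_ge0 ?smoothstep'_ge0// invr_ge0 ltW.
have k1p : 0 < k1 (tau z0).
  rewrite mulr_gt0 ?invr_gt0//.
  set y := (_ / (t - e)); have y0 : 0 < y by rewrite divr_gt0// subr_gt0 /e; lra.
  have y1 : y < 1 by rewrite ltr_pdivrMr// mul1r; lra.
  by rewrite /smoothstep' clamp_id ?ltW//; rewrite mulr_gt0 ?subr_gt0// mulr_gt0.
exists (Int (fun z => k1 (tau z) * area z)).
  apply: (@integral_continuous_gt0 _ _ _ z0) => //.
  - apply: (@continuous_ring _ e) => //; last first.
      by move=> z Bz /ltW h; have [_ _ -> //] := W1; rewrite mul0r.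
    move=> z Dz; apply: cvgM; last exact: continuous_area.
    apply: (@continuous_comp _ _ _ tau k1); first by apply: (rc_cont rc); case: Dz.
    by have [_ C _ _] := W1; have [] := C (tau z).
  - move=> z Bz; have [h|h] := leP (tau z) e; first by have [_ _ -> //] := W1; rewrite mul0r.
    by rewrite mulr_ge0// ltW//; apply: (rc_area rc); split => //; exact: lt_trans h.
  - by apply: (rc_disc rc) => //; exact: ltW.
  - by rewrite mulr_gt0//; apply: (rc_area rc).
move=> e' K k W; pose I := K t - K 0.
have W2 := weight_lincomb (- I) W W1.
have [Kc _] := weight_cst W; have [e0' _ _ _] := W.
have [K1c _] := weight_cst W1.
have I1 := weight_integrable W continuous_area.
have I2 := weight_integrable W1 continuous_area.
have := ring_zero_total W2; set m := Num.min e' e.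
have me : m <= e by rewrite ge_min lexx orbT.
have me' : m <= e' by rewrite ge_min lexx.
rewrite (Kc m me') (K1c m me) -(Kc 0 (ltW e0')) -(K1c 0 (ltW e0)) K1t K10 => /(_ _) H.
have {}H := H ltac:(rewrite /I; ring).
have : Int (fun z => k (tau z) * area z) + - I * Int (fun z => k1 (tau z) * area z) = 0.
  rewrite -(RintegralZl _ mr I2) -(RintegralD mr I1 (disc_integrableZ _ I2)) -[RHS]H.
  by apply: eq_Rintegral => z _; ring.
by rewrite /I; lra.
Qed.

Lemma weight_sob_integrable e K k V Vx Vy : weight e K k -> sobD V Vx Vy ->
  mu2.-integrable (disc r) (EFin \o (fun z => k (tau z) * (tx z * Vy z - ty z * Vx z))).
Proof.
move=> W sV; have sK := sobD_C1 (C1on_weight W).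
have J1 := disc_L2_trunc r1 (sobD_mx sK) (sobD_L2x sK r1) (sobD_my sV) (sobD_L2y sV r1).
have J2 := disc_L2_trunc r1 (sobD_my sK) (sobD_L2y sK r1) (sobD_mx sV) (sobD_L2x sV r1).
apply: eq_integrable (integrableB mr J1 J2) => //.
by move=> z _ /=; rewrite -EFinB; congr EFin; ring.
Qed.


(** * Oscillation of a function along level curves *)

Section LevelCurves.
Hypothesis ring_inverse : forall z0, Dp z0 -> forall e : R, 0 < e -> exists2 d, 0 < d & forall z, Dp z ->
  `|n1 z - n1 z0| < d -> `|n2 z - n2 z0| < d -> `|tau z - tau z0| < d ->
  `|z.1 - z0.1| < e /\ `|z.2 - z0.2| < e.
Variables (c m0 m1 : R) (U Ux Uy : R * R -> R).
Hypothesis c0 : 0 < c.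
Hypothesis area_total : forall e K k, weight e K k ->
  Int (fun z => k (tau z) * area z) = c * (K t - K 0).
Hypothesis sU : sobD U Ux Uy.
Local Notation th z := (angle (n1 z) (n2 z)).
Let wedge z := tx z * Uy z - ty z * Ux z.

(** To be read at the cosine [x] of an angle between two unit vectors: [2 - 2 x] is the squared
    length of their difference, so the bump lives where the vectors are closer than [d]. *)
Definition bump (d x : R) := @smoothstep R ((x - (1 - d ^+ 2 / 2)) / (d ^+ 2 / 2)).

Lemma bump_ge0 (d x : R) : 0 <= bump d x.
Proof. by have /andP[] := @smoothstep_in R ((x - (1 - d ^+ 2 / 2)) / (d ^+ 2 / 2)). Qed.

Lemma bump_supp (d x : R) : 0 < d -> bump d x != 0 -> 2 - 2 * x < d ^+ 2.
Proof.
move=> d0 bx; have d20 : 0 < d ^+ 2 by rewrite exprn_gt0.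
rewrite ltNge; apply/negP => h; move: bx; rewrite /bump smoothstep0 ?eqxx//.
by rewrite ler_pdivrMr ?mul0r; lra.
Qed.

Lemma bump1 (d : R) : 0 < d -> bump d 1 = 1.
Proof.
move=> d0; have d20 : 0 < d ^+ 2 by rewrite exprn_gt0.
by apply: smoothstep1; rewrite ler_pdivlMr ?mul1r; lra.
Qed.

Lemma C1_shift (f f' : R -> R) (a : R) : C1 f f' -> C1 (fun x => f (x - a)) (fun x => f' (x - a)).
Proof.
move=> H; have := C1_affine_comp a 1 H; congr C1; apply/funext => x; by rewrite !divr1.
Qed.

(* The primitive [F] of a bump around an angle climbs by [I] per turn, so the
   difference of two translates of [F] stays within a strip of height [I]. *)
Lemma bump_step (d a b : R) : 0 < d -> `|a - b| <= 2 * pi -> exists (I : R) (F : R -> R) (s : R),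
  [/\ 0 < I, C1 F (fun x => bump d (cos x)), F (2 * pi) - F 0 = I &
    forall x, `|F (x - a) - F (x - b) - s| <= I / 2 /\ F (x + 2 * pi) = F x + I].
Proof.
move=> d0 ab; pose g x := bump d (cos x).
have cg : continuous g.
  move=> x; have Cb := C1_affine_comp (1 - d ^+ 2 / 2) (d ^+ 2 / 2) (@C1_smoothstep R).
  by apply: (@continuous_comp _ _ _ cos (bump d)); [exact: continuous_cos|exact: (C1_continuous Cb)].
have [F CF F0] := primitive_ex cg.
have mono x y : x <= y -> F x <= F y.
  move=> xy; rewrite -subr_ge0 -[leLHS](subrr (0 : R)).
  apply: (@increment_le _ (fun=> 0) F (fun=> 0) g x y xy) => z _.
    by have [] := CF z.
  exact: bump_ge0.
have pg : periodic2pi g by move=> x; rewrite /g mulrC mulr_natr cosD2pi.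
have [CA pA] := detrended_periodic CF pg.
set m := (F (2 * pi) - F 0) / (2 * pi) in CA pA.
have pi0 := pi_gt0 R.
have mE : m * (2 * pi) = F (2 * pi) - F 0 by rewrite /m divfK// mulf_neq0// gt_eqF.
have perF x : F (x + 2 * pi) = F x + (F (2 * pi) - F 0).
  by have := pA x; rewrite /= -mE; lra.
have I0 : 0 < F (2 * pi) - F 0.
  rewrite lt_neqAle subr_ge0 mono ?andbT; last by lra.
  apply/eqP => E0.
  have Fc x : 0 <= x <= 2 * pi -> F x = F 0.
    move=> /andP[x0 x1]; have h1 := mono _ _ x0; have h2 := mono _ _ x1; lra.
  have E1 x : `|x| <= 2 * pi -> F x = F 0.
    rewrite ler_norml => /andP[x0 x1]; have [xp|xn] := leP 0 x; first by rewrite Fc// xp.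
    by have := perF x; rewrite -E0 addr0 => <-; rewrite Fc//; apply/andP; split; lra.
  have d1 : is_derive (0 : R) 1 F 0.
    have H : \forall x \near (0 : R), (fun=> F 0) x = F x.
      have H : \forall x \near (0 : R), `|x| < 2 * pi.
        have := @norm_continuous _ R^o 0 => /cvgr_lt; apply; rewrite normr0; lra.
      by apply: filterS H => x /ltW /E1 ->.
    by apply: near_eq_is_derive H _; exact: is_derive_cst.
  have [d2 _] := CF 0; have := is_derive_unique d1 d2.
  by rewrite /g cos0 bump1// => /eqP; rewrite eq_sym oner_eq0.
set I := F (2 * pi) - F 0 in I0 perF *.
(* Because [F] increases and gains [I] per turn, the difference lies in [[0, I]] when [a <= b] and
   in [[- I, 0]] otherwise; [s] is the midpoint. *)
exists I, F, (if a <= b then I / 2 else - (I / 2)); split => // x; split => //.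
move: ab; rewrite ler_norml => /andP[ab1 ab2].
case: (leP a b) => h.
  have h1 : F (x - b) <= F (x - a) by apply: mono; lra.
  have h2 : F (x - a) <= F (x - b + 2 * pi) by apply: mono; lra.
  by move: h2; rewrite perF ler_norml => h2; apply/andP; split; lra.
have h1 : F (x - a) <= F (x - b) by apply: mono; lra.
have h2 : F (x - b) <= F (x - a + 2 * pi) by apply: mono; lra.
by move: h2; rewrite perF ler_norml => h2; apply/andP; split; lra.
Qed.

(** A closed curve on which [U] takes both values has variation at least [2 (m1 - m0)]. Dually, [dU]
    is tested against a periodic [A] of the angle with [|A| <= I / 2] whose derivative is a bump at
    the angle of [za] minus one at the angle of [zb]. Stokes' formula turns the test into averages
    of [U] near the two points, where it is within [e] of [m0] and [m1]. *)
Lemma wedge_local za zb (tau0 e : R) : Dp za -> Dp zb -> tau za = tau0 -> tau zb = tau0 -> tau0 < t ->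
  U za = m0 -> U zb = m1 -> 0 < e -> exists2 d, 0 < d & forall e' K k, weight e' K k ->
  (forall x, 0 <= k x) -> (forall x, d <= `|x - tau0| -> k x = 0) ->
  c / pi * (m1 - m0 - 2 * e) * (K t - K 0) <= Int (fun z => k (tau z) * `|wedge z|).
Proof.
move=> Da Db ta tb tt Ua Ub e0.
have near_U z0 : Dp z0 -> exists2 d, 0 < d & forall z, Dp z ->
    `|n1 z - n1 z0| < d -> `|n2 z - n2 z0| < d -> `|tau z - tau z0| < d -> `|U z - U z0| <= e.
  move=> D0; have Bz0 : B2 z0 by case: D0.
  have cU := sobD_continuous sU Bz0.
  have [d1 d10 H1] := nbhs_box ((cvgrPdist_le _ _).1 cU e e0).
  have [d d0 H] := ring_inverse D0 d10; exists d => // z Dz h1 h2 h3.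
  by have [h4 h5] := H z Dz h1 h2 h3; rewrite distrC; exact: H1.
have [da da0 Ha] := near_U za Da; have [db db0 Hb] := near_U zb Db.
pose d := Num.min da db; have d0 : 0 < d by rewrite lt_min da0.
pose a := th za; pose b := th zb.
have [sa ca ba] := angleP (rc_circle rc Da); have [sb cb bb] := angleP (rc_circle rc Db).
rewrite -/a in sa ca ba; rewrite -/b in sb cb bb.
have [I [F [s [I0 CF FI Fb]]]] := @bump_step d a b d0 ltac:(
  by apply: le_trans (ler_normB _ _) _; lra).
exists d => // e' K k W kp kd.
have pi0 := pi_gt0 R.
pose chi (u x : R) := bump d (cos (x - u)).
have Cs u : C1 (fun x => F (x - u)) (chi u) by exact: C1_shift CF.
have pchi u : periodic2pi (chi u) by move=> x; rewrite /chi addrAC mulrC mulr_natr cosD2pi.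
have shiftI u : F (2 * pi - u) - F (0 - u) = I.
  by rewrite [2 * pi - u]addrC add0r; have [_ ->] := Fb (- u); lra.
pose A x := F (x - a) - F (x - b) - s; pose A' x := chi a x - chi b x.
have CA : C1 A A'.
  move=> x; have [h1 h2] := Cs a x; have [h3 h4] := Cs b x; split; last exact: cvgB.
  have h5 : is_derive x 1 (fun x => F (x - a) - F (x - b)) (chi a x - chi b x) by exact: is_deriveB.
  by rewrite /A' -[X in is_derive _ _ _ X]subr0; apply: is_deriveB.
have pA : periodic2pi A.
  move=> x; have E u : F (x + 2 * pi - u) = F (x - u) + I by rewrite addrAC; have [_ ->] := Fb (x - u).
  by rewrite /A !E; ring.
have pA' : periodic2pi A' by move=> x; rewrite /A' !pchi.
have St := ring_stokes_angle CA pA pA' W sU.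
have Ma := ring_angular_mean (Cs a) (pchi a) W; have Mb := ring_angular_mean (Cs b) (pchi b) W.
rewrite /= shiftI (area_total W) in Ma; rewrite /= shiftI (area_total W) in Mb.
have Ja := weight_integrable W (continuous_periodic_area (Cs a) (pchi a)).
have Jb := weight_integrable W (continuous_periodic_area (Cs b) (pchi b)).
have Jw : mu2.-integrable (disc r) (EFin \o (fun z => k (tau z) * `|wedge z|)).
  apply: eq_integrable (integrable_abse (weight_sob_integrable W sU)) => //.
  by move=> z _ /=; congr EFin; rewrite normrM ger0_norm.
have Js : mu2.-integrable (disc r) (EFin \o (fun z => k (tau z) * (A (th z) * wedge z - U z * A' (th z) * area z))).
  have [e'0 _ k0 _] := W; have [_ _ a3 a4] := rampE e'0.
  apply: eq_integrable (weight_sob_integrable W (sobDM sU (sobD_C1 (C1on_ramp_angle CA pA pA' e'0)))) => //.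
  move=> z _ /=; congr EFin; have [h|/ltW h] := leP (tau z) e'; first by rewrite k0// !mul0r.
  by rewrite a3// a4// /area /wedge; congr (_ * _); ring.
(* Nonnegative at every point: [A] is at most [I / 2] in absolute value, [U] is at most [m0 + e] on
   the first bump and at least [m1 - e] on the second. Its integral is the claim up to the factor
   [I / 2]. *)
pose H z := I / 2 * (k (tau z) * `|wedge z|) + ((m0 + e) * (k (tau z) * (chi a (th z) * area z)) +
  (- (m1 - e) * (k (tau z) * (chi b (th z) * area z)) +
  k (tau z) * (A (th z) * wedge z - U z * A' (th z) * area z))).
have Hge z : disc r z -> 0 <= H z.
  move=> zr; have Bz := discS r1 zr.
  have [kz|kz] := eqVneq (k (tau z)) 0; first by rewrite /H kz !mul0r !mulr0 !addr0.
  have [e'0 _ k0 _] := W.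
  have tz : 0 < tau z.
    apply: (lt_trans e'0); rewrite ltNge; apply/negP => /k0 E; by rewrite E eqxx in kz.
  have Dz : Dp z by [].
  have td : `|tau z - tau0| < d by rewrite ltNge; apply/negP => /kd E; rewrite E eqxx in kz.
  have ar := rc_area rc Dz; rewrite -/(area z) in ar.
  have [sz cz _] := angleP (rc_circle rc Dz).
  have cosE u : (n1 z - sin u) ^+ 2 + (n2 z - cos u) ^+ 2 = 2 - 2 * cos (th z - u).
    rewrite cosB sz cz.
    transitivity ((n1 z ^+ 2 + n2 z ^+ 2) + (cos u ^+ 2 + sin u ^+ 2) - 2 * (n2 z * cos u + n1 z * sin u)); first by ring.
    by rewrite (rc_circle rc Dz) cos2Dsin2; ring.
  have absl (x : R) : x ^+ 2 < d ^+ 2 -> `|x| < d.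
    by move=> h; rewrite -(@ltr_pXn2r _ 2%N) ?nnegrE//; [rewrite real_normK ?num_real|exact: ltW].
  have close u : chi u (th z) != 0 -> `|n1 z - sin u| < d /\ `|n2 z - cos u| < d.
    move=> /(bump_supp d0); rewrite -cosE => h.
    have := sqr_ge0 (n1 z - sin u); have := sqr_ge0 (n2 z - cos u) => h1 h2.
    by split; apply: absl; apply: le_lt_trans h; rewrite ?lerDl ?lerDr.
  have ga : 0 <= (m0 + e - U z) * chi a (th z).
    have [->|/close[]] := eqVneq (chi a (th z)) 0; first by rewrite mulr0.
    rewrite sa ca => h1 h2; apply: mulr_ge0; last exact: bump_ge0.
    have := Ha z Dz (lt_le_trans h1 _) (lt_le_trans h2 _); rewrite ta Ua ler_norml.
    have dda : d <= da by rewrite ge_min lexx.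
    by move=> /(_ dda dda (lt_le_trans td dda)) /andP[_]; rewrite lerBlDl subr_ge0.
  have gb : 0 <= (U z - (m1 - e)) * chi b (th z).
    have [->|/close[]] := eqVneq (chi b (th z)) 0; first by rewrite mulr0.
    rewrite sb cb => h1 h2; apply: mulr_ge0; last exact: bump_ge0.
    have := Hb z Dz (lt_le_trans h1 _) (lt_le_trans h2 _); rewrite tb Ub ler_norml.
    have ddb : d <= db by rewrite ge_min lexx orbT.
    by move=> /(_ ddb ddb (lt_le_trans td ddb)) /andP[+ _]; rewrite lerBrDl subr_ge0.
  have gA : 0 <= I / 2 * `|wedge z| + A (th z) * wedge z.
    have [FA _] := Fb (th z); rewrite -/(A (th z)) in FA.
    have : - (`|A (th z)| * `|wedge z|) <= A (th z) * wedge z by rewrite -normrM lerNl -normrN; exact: ler_norm.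
    have := ler_wpM2r (normr_ge0 (wedge z)) FA; lra_from.
  have -> : H z = k (tau z) * ((I / 2 * `|wedge z| + A (th z) * wedge z) +
     ((m0 + e - U z) * chi a (th z) + (U z - (m1 - e)) * chi b (th z)) * area z).
    by rewrite /H /A'; ring.
  apply: mulr_ge0 => //; apply: addr_ge0 => //; apply: mulr_ge0; [exact: addr_ge0|exact: ltW].
have I3 := disc_integrableZ (- (m1 - e)) Jb.
have I4 : mu2.-integrable (disc r) (EFin \o (fun z => - (m1 - e) * (k (tau z) * (chi b (th z) * area z)) +
  k (tau z) * (A (th z) * wedge z - U z * A' (th z) * area z))).
  by apply: eq_integrable (integrableD mr I3 Js).
have I2 := disc_integrableZ (m0 + e) Ja.
have I5 : mu2.-integrable (disc r) (EFin \o (fun z => (m0 + e) * (k (tau z) * (chi a (th z) * area z)) + (- (m1 - e) * (k (tau z) * (chi b (th z) * area z)) +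
  k (tau z) * (A (th z) * wedge z - U z * A' (th z) * area z)))).
  by apply: eq_integrable (integrableD mr I2 I4).
have : 0 <= Int H by apply: Rintegral_ge0 => z; exact: Hge.
rewrite /H (RintegralD mr (disc_integrableZ _ Jw) I5) (RintegralD mr I2 I4) (RintegralD mr I3 Js).
rewrite (RintegralZl _ mr Jw) (RintegralZl _ mr Ja) (RintegralZl _ mr Jb) St Ma Mb addr0.
set X := \int[mu2]_(z in disc r) (k (tau z) * `|wedge z|); set Y := K t - K 0 => HX.
have : 0 <= I / 2 * (X - c / pi * (m1 - m0 - 2 * e) * Y).
  suff -> : I / 2 * (X - c / pi * (m1 - m0 - 2 * e) * Y) = I / 2 * X + ((m0 + e) * (I / (2 * pi) * (c * Y)) + - (m1 - e) * (I / (2 * pi) * (c * Y))) by [].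
  by clearbody X Y; rewrite [(2 * pi)^-1]invfM; ring.
by rewrite pmulr_rge0 ?subr_ge0// divr_gt0.
Qed.

(** The local estimate holds for weights concentrated near one level. Real induction on the right
    end of the support decomposes a general weight, and the estimates add up because they are linear
    in [K]. *)
Lemma wedge_total (e1 t1 e : R) : 0 < e1 -> e1 <= t1 -> t1 < t -> 0 < e ->
  (forall s, e1 <= s <= t1 -> exists za zb, [/\ Dp za, Dp zb, tau za = s, tau zb = s & U za = m0 /\ U zb = m1]) ->
  forall K k, weight e1 K k -> (forall x, 0 <= k x) -> (forall x, t1 <= x -> k x = 0) ->
  c / pi * (m1 - m0 - 2 * e) * (K t - K 0) <= Int (fun z => k (tau z) * `|wedge z|).
Proof.
move=> e10 et tt e0 lev.
have pos e' K k : weight e' K k -> (forall x, 0 <= k x) ->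
    mu2.-integrable (disc r) (EFin \o (fun z => k (tau z) * `|wedge z|)).
  move=> W kp; apply: eq_integrable (integrable_abse (weight_sob_integrable W sU)) => //.
  by move=> z _ /=; congr EFin; rewrite normrM ger0_norm.
pose Q s := forall K k, weight e1 K k -> (forall x, 0 <= k x) -> (forall x, s <= x -> k x = 0) ->
  c / pi * (m1 - m0 - 2 * e) * (K t - K 0) <= Int (fun z => k (tau z) * `|wedge z|).
apply: (@interval_induction _ Q e1 t1 et).
  move=> K k W kp ks; have [Kc _] := weight_cst W; have [_ CK k0 _] := W.
  have kz x : k x = 0 by have [/k0//|/ltW/ks] := leP x e1.
  have -> : K t - K 0 = 0 - 0.
    apply: (@increment_eq _ K (fun=> 0) (fun=> 0)); first exact: ltW (rc_t rc).
    by move=> x _; have [d _] := CK x; rewrite -(kz x).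
  rewrite subrr mulr0; apply: Rintegral_ge0 => z _; by rewrite kz mul0r.
move=> s /[dup] sb /lev[za [zb [Da Db ta tb [Ua Ub]]]].
have st : s < t by move: sb => /andP[_ h]; exact: le_lt_trans h tt.
have [d d0 Hd] := wedge_local Da Db ta tb st Ua Ub e0.
have d20 : 0 < d / 2 by lra.
exists (d / 2) => // x y ex xs sy yt dx yd Qx K k W kp ks.
(* The switch takes place between [s - 3 d / 4] and [s - d / 2]: the part with [1 - q] ends before
   [x], where the induction hypothesis applies, and the part with [q] stays within [d] of [s]. *)
pose q u := @smoothstep R ((u - (s - 3 * d / 4)) / (d / 4)).
have d40 : 0 < d / 4 by lra.
have q0 u : u <= s - 3 * d / 4 -> q u = 0.
  by move=> h; apply: smoothstep0; rewrite ler_pdivrMr// mul0r subr_le0.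
have q1 u : s - d / 2 <= u -> q u = 1.
  by move=> h; apply: smoothstep1; rewrite ler_pdivlMr// mul1r; lra.
have qb u : 0 <= q u <= 1 by exact: smoothstep_in.
have [_ CK k0 k1] := W.
have cq : continuous q := C1_continuous (C1_affine_comp (s - 3 * d / 4) (d / 4) (@C1_smoothstep R)).
have ck : continuous k by move=> u; have [] := CK u.
have cq1 : continuous (fun u => k u * q u) by move=> u; apply: cvgM; [exact: ck|exact: cq].
have [K2 CK2 _] := primitive_ex cq1.
pose k1' u := k u + -1 * (k u * q u).
have W2 : weight e1 K2 (fun u => k u * q u).
  by split => // u h; [rewrite k0// mul0r|rewrite k1// mul0r].
have W1 : weight e1 (fun u => K u + -1 * K2 u) k1'.
  by have := weight_lincomb (-1) W W2; rewrite minxx.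
have kp2 u : 0 <= k u * q u by rewrite mulr_ge0//; have /andP[] := qb u.
have kp1 u : 0 <= k1' u.
  have -> : k1' u = k u * (1 - q u) by rewrite /k1'; ring.
  by rewrite mulr_ge0// subr_ge0; have /andP[] := qb u.
have H1 := Qx _ _ W1 kp1 _.
have {}H1 := H1 ltac:(move=> u xu; rewrite /k1' q1; [ring|lra]).
have H2 := Hd _ _ _ W2 kp2 _.
have {}H2 : c / pi * (m1 - m0 - 2 * e) * (K2 t - K2 0) <= Int (fun z => k (tau z) * q (tau z) * `|wedge z|).
  apply: H2 => u; rewrite ler_normr => /orP[h|h].
    by rewrite ks ?mul0r//; lra.
  by rewrite q0 ?mulr0//; lra.
have -> : Int (fun z => k (tau z) * `|wedge z|) =
    Int (fun z => k1' (tau z) * `|wedge z|) + Int (fun z => k (tau z) * q (tau z) * `|wedge z|).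
  rewrite -(RintegralD mr (pos _ _ _ W1 kp1) (pos _ _ _ W2 kp2)).
  by apply: eq_Rintegral => z _; rewrite /k1'; ring.
by move: H1 H2; rewrite -!mulrA; nra.
Qed.

End LevelCurves.

End Ring.

(** * The calibrated length-area inequality *)

Section RingInequality.
Variable R : realType.
Local Notation mu := (@lebesgue_measure R).
Local Notation mu2 := (mu \x mu)%E.
Local Notation P := (measurableTypeR R * measurableTypeR R)%type.
Local Notation B2 := (@B2 R).

Variables (tau tx ty n1 n2 px py : R * R -> R) (t r : R).
Local Notation Dp := [set z | B2 z /\ 0 < tau z].
Local Notation "'Int' F" := (\int[mu2]_(z in disc r) F z) (at level 10, F at level 8).
Local Notation th z := (angle (n1 z) (n2 z)).
Hypothesis rc : ring_chart tau tx ty n1 n2 px py t r.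
Hypothesis ring_inverse : forall z0, Dp z0 -> forall e : R, 0 < e -> exists2 d, 0 < d & forall z, Dp z ->
  `|n1 z - n1 z0| < d -> `|n2 z - n2 z0| < d -> `|tau z - tau z0| < d ->
  `|z.1 - z0.1| < e /\ `|z.2 - z0.2| < e.
Variables (X h : R -> R).
Hypothesis CX : C1 X h.
Hypothesis ph : periodic2pi h.
Hypothesis h0 : forall x, 0 <= h x.
Hypothesis grad_area : forall z, Dp z -> tx z ^+ 2 + ty z ^+ 2 = h (th z) * area tx ty px py z.
Variables (U Ux Uy W Wx Wy : R * R -> R) (k m0 m1 : R).
Hypothesis sU : sobD U Ux Uy.
Hypothesis sW : sobD W Wx Wy.
Hypothesis k0 : 0 < k.
Hypothesis UW : {ae mu2, forall z : R * R, B2 z ->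
  k * (1 + W z ^+ 2) * (Ux z ^+ 2 + Uy z ^+ 2) <= Ux z * Wy z - Uy z * Wx z}.
Hypothesis levels : forall s, 0 < s < t ->
  exists za zb, [/\ Dp za, Dp zb, tau za = s, tau zb = s & U za = m0 /\ U zb = m1].

(** The bound on [J] is split along [1 + w ^ 2]. The part with [w ^ 2], the cross term and the share
    [s ^ 2] of [kt] form two perfect squares ([h3]); the part with 1 and the share [b ^ 2 c ^ 2]
    give the length term by the arithmetic-geometric inequality ([h4]). Here [c] and [s] will be
    cosine and sine of the level, [b] a ramp. *)
Lemma length_area_pointwise (a b c s kt w p q x y J : R) : 0 <= a -> 0 < k ->
  k * (1 + w ^+ 2) * (p ^+ 2 + q ^+ 2) <= J -> s ^+ 2 + b ^+ 2 * c ^+ 2 <= kt \/ c = 0 /\ 0 <= kt ->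
  0 <= b ->
  2 * k * a * (b * c ^+ 2 * `|x * q - y * p|) <=
  c ^+ 2 * J + 2 * k * a * (c * s * w * (x * q - y * p)) + k * a ^+ 2 * (kt * (x ^+ 2 + y ^+ 2)).
Proof.
move=> a0 kp HJ [Hk|[-> Hk]] b0; last first.
  rewrite expr0n /= !(mulr0, mul0r) !add0r.
  by rewrite !mulr_ge0 ?sqr_ge0 ?addr_ge0 ?sqr_ge0// ltW.
set D := x * q - y * p.
have h1 : 0 <= c ^+ 2 * (J - k * (1 + w ^+ 2) * (p ^+ 2 + q ^+ 2)) by rewrite mulr_ge0 ?sqr_ge0// subr_ge0.
have h2 : 0 <= k * a ^+ 2 * ((kt - (s ^+ 2 + b ^+ 2 * c ^+ 2)) * (x ^+ 2 + y ^+ 2)).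
  apply: mulr_ge0; first by rewrite mulr_ge0 ?sqr_ge0 ?(ltW kp).
  by apply: mulr_ge0; [rewrite subr_ge0|rewrite addr_ge0 ?sqr_ge0].
have h3 : 0 <= k * ((c * w * q + a * s * x) ^+ 2 + (c * w * p - a * s * y) ^+ 2).
  by rewrite mulr_ge0 ?addr_ge0 ?sqr_ge0// ltW.
have h4 : 0 <= k * c ^+ 2 * ((p ^+ 2 + q ^+ 2) + a ^+ 2 * b ^+ 2 * (x ^+ 2 + y ^+ 2) - 2 * a * b * `|D|).
  apply: mulr_ge0; first by rewrite mulr_ge0 ?sqr_ge0 ?ltW.
  have [D0|D0] := leP 0 D.
    rewrite ger0_norm// (_ : _ - _ = (q - a * b * x) ^+ 2 + (p + a * b * y) ^+ 2); last by rewrite /D; ring.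
    by rewrite addr_ge0 ?sqr_ge0.
  rewrite ltr0_norm// (_ : _ - _ = (q + a * b * x) ^+ 2 + (p - a * b * y) ^+ 2); last by rewrite /D; ring.
  by rewrite addr_ge0 ?sqr_ge0.
rewrite -subr_ge0; have := addr_ge0 (addr_ge0 h1 h2) (addr_ge0 h3 h4).
by congr (0 <= _); rewrite /D; move: `|x * q - y * p| => N; ring.
Qed.

Lemma length_area_algebra (l w c p d I s m : R) : l != 0 -> w != 0 -> c != 0 -> p != 0 -> d != 0 ->
  4 * l * (p * d) / (w * c) * (w * (p / 2 / d / l) * (I / (2 * p) * (c * s)) - 2 * w * (c / p * m * (d / 2))) =
  p * I * s - 4 * l * m * d ^+ 2.
Proof. by move=> *; field; do ?[apply/andP; split]. Qed.

Lemma C1_cos2 (w e : R) : C1 (fun x => cos (w * (x - e)) ^+ 2)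
  (fun x => - (2 * w * (cos (w * (x - e)) * sin (w * (x - e))))).
Proof.
move=> x; have dl : is_derive x 1 (fun y => w * (y - e)) w.
  by have := is_derive_affine (- (w * e)) w x; congr is_derive; apply/funext => y /=; ring.
have dc := @is_derive1_comp _ cos (fun y => w * (y - e)) x _ _ (is_derive_cos _) dl.
have ds := @is_derive1_comp _ sin (fun y => w * (y - e)) x _ _ (is_derive_sin _) dl.
have cc : {for x, continuous (fun y => cos (w * (y - e)))}.
  by case: dc => /derivable1_diffP /differentiable_continuous.
have cs : {for x, continuous (fun y => sin (w * (y - e)))}.
  by case: ds => /derivable1_diffP /differentiable_continuous.
split.
  have := is_deriveM dc dc; congr is_derive; rewrite /= /GRing.scale /=; ring.
apply: (@cvgN _ _ _ _ _ (fun y => 2 * w * (cos (w * (y - e)) * sin (w * (y - e))))).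
by apply: cvgM; [exact: cvg_cst|exact: cvgM].
Qed.

(** Stokes' formula for [psi (tau) W] and [U], with [psi] the squared cosine, annihilates the terms
    with [J] and the cross term of [length_area_pointwise]. What remains bounds the oscillation
    integral, estimated below by [wedge_total], by an integral of the angular density alone. *)
Lemma ring_inequality_approx (d : R) : 0 < d -> 2 * d < t ->
  4 * k * (m1 - m0 - 2 * d) * (t - d) ^+ 2 <= pi * (X (2 * pi) - X 0) * t.
Proof.
move=> d0 dt; have pi0 := pi_gt0 R.
(* Half of [d] is given up at the slit and half at the outer level, as room for cutoffs; the cosine
   runs through a quarter period on the remaining length [t - d]. *)
pose e2 := d / 2; pose T1 := t - d / 2.
have e20 : 0 < e2 by rewrite /e2; lra.
have eT : e2 < T1 by rewrite /e2 /T1; lra.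
have Tt : T1 < t by rewrite /T1; lra.
have TE : T1 - e2 = t - d by rewrite /T1 /e2; lra.
pose w := pi / 2 / (T1 - e2).
have td0 : 0 < T1 - e2 by rewrite subr_gt0.
have w0 : 0 < w by rewrite !divr_gt0.
have wT : w * (T1 - e2) = pi / 2 by rewrite /w divfK// gt_eqF.
pose cl x := clamp e2 T1 x.
pose ct x := cos (w * (cl x - e2)); pose st x := sin (w * (cl x - e2)).
pose psi x := ct x ^+ 2; pose psi' x := - (2 * w * (ct x * st x)).
have cl_lo x : x <= e2 -> ct x = 1 /\ st x = 0.
  by move=> hx; rewrite /ct /st /cl (clamp_lo (ltW eT) hx) subrr mulr0 cos0 sin0.
have cl_hi x : T1 <= x -> ct x = 0 /\ st x = 1.
  by move=> hx; rewrite /ct /st /cl (clamp_hi (ltW eT) hx) wT cos_pihalf sin_pihalf.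
have Cpsi : C1 psi psi'.
  apply: (C1_clamp (ltW eT) (C1_cos2 w e2)).
    by rewrite subrr mulr0 sin0 !mulr0 oppr0.
  by rewrite wT cos_pihalf mul0r mulr0 oppr0.
have Wpsi : weight t e2 psi psi'.
  split => // x hx; rewrite /psi'.
    by have [_ ->] := cl_lo x hx; rewrite !mulr0 oppr0.
  by have [-> _] := cl_hi x ltac:(lra); rewrite mul0r mulr0 oppr0.
have cr : continuous (ramp e2) := C1_continuous (C1_ramp e2).
have [ra1 _ ra3 _] := rampE e20.
have rb x : 0 <= ramp e2 x <= 1 by exact: smoothstep_in.
have cb : continuous (fun x => ramp e2 x * psi x).
  by move=> x; apply: cvgM; [exact: cr|exact: (C1_continuous Cpsi)].
have [Kb CKb _] := primitive_ex cb.
pose q x := @smoothstep R ((x - T1) / (t - T1)).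
have tT : 0 < t - T1 by rewrite subr_gt0.
have q0 x : x <= T1 -> q x = 0.
  by move=> hx; apply: smoothstep0; rewrite ler_pdivrMr// mul0r subr_le0.
have q1 x : t <= x -> q x = 1.
  by move=> hx; apply: smoothstep1; rewrite ler_pdivlMr// mul1r; lra.
have qb x : 0 <= q x <= 1 by exact: smoothstep_in.
have ckt : continuous (fun x => ramp e2 x * (1 - q x)).
  move=> x; apply: cvgM; first exact: cr.
  apply: cvgB; first exact: cvg_cst.
  exact: (C1_continuous (C1_affine_comp T1 (t - T1) (@C1_smoothstep R))).
have [Kt CKt _] := primitive_ex ckt.
have e40 : 0 < e2 / 2 by lra.
have Wb : weight t (e2 / 2) Kb (fun x => ramp e2 x * psi x).
  split => // x hx; first by rewrite ra1// mul0r.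
  by rewrite /psi; have [-> _] := cl_hi x ltac:(lra); rewrite expr0n /= mulr0.
have Wt : weight t (e2 / 2) Kt (fun x => ramp e2 x * (1 - q x)).
  split => // x hx; first by rewrite ra1// mul0r.
  by rewrite q1// subrr mulr0.
have [z0 [_ [[Bz0 tz0] _ tz1 _ _]]] := @levels (t / 2) ltac:(have := rc_t rc; lra).
have [c c0 area_total] := ring_constant rc Bz0 ltac:(rewrite tz1; have := rc_t rc; lra).
have bpos x : 0 <= ramp e2 x * psi x.
  by rewrite mulr_ge0 ?sqr_ge0//; have /andP[] := rb x.
have Clow := wedge_total rc ring_inverse area_total sU e40 (ltac:(lra) : e2 / 2 <= T1) Tt d0
  (fun s hs => @levels s ltac:(move: hs => /andP[? ?]; apply/andP; split; lra)) Wb bpos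
  (fun x hx => ltac:(rewrite /psi; have [-> _] := cl_hi x hx; by rewrite expr0n /= mulr0)).
set D := fun z => tx z * Uy z - ty z * Ux z in Clow.
have mr := @measurable_disc R r; have r1 := rc_r rc.
have JD : mu2.-integrable (disc r) (EFin \o (fun z => ramp e2 (tau z) * psi (tau z) * `|D z|)).
  apply: eq_integrable (integrable_abse (weight_sob_integrable rc Wb sU)) => //.
  by move=> z _ /=; congr EFin; rewrite normrM ger0_norm.
have Nh := ring_angular_mean rc CX ph Wt; rewrite /= (area_total _ _ _ Wt) in Nh.
have JN := weight_integrable rc Wt (continuous_periodic_area rc CX ph).
have sZ := sobDM (sobD_C1 (C1on_weight rc Wpsi)) sW.
have St := disc_stokes r1 sZ sU (fun z Bz rz => ltac:(
  rewrite /psi; have [-> _] := cl_hi (tau z) (ltW (lt_trans Tt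
    ltac:(by rewrite ltNge; apply/negP => /(rc_disc rc Bz) /(lt_trans rz); rewrite ltxx)));
  by rewrite expr0n /= mul0r)).
have JS : mu2.-integrable (disc r) (EFin \o (fun z => (psi (tau z) * Wx z + W z * (psi' (tau z) * tx z)) * Uy z -
    (psi (tau z) * Wy z + W z * (psi' (tau z) * ty z)) * Ux z)).
  have J1 := disc_L2_trunc r1 (sobD_mx sZ) (sobD_L2x sZ r1) (sobD_my sU) (sobD_L2y sU r1).
  have J2 := disc_L2_trunc r1 (sobD_my sZ) (sobD_L2y sZ r1) (sobD_mx sU) (sobD_L2x sU r1).
  by apply: eq_integrable (integrableB mr J1 J2).
(* With this [a] the cross term [2 k a c s] of the pointwise inequality is exactly [- psi']. *)
pose a := w / k.
have a0 : 0 < a by rewrite divr_gt0.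
have ka : k * a = w by rewrite /a mulrC divfK// gt_eqF.
have main : {ae mu2, forall z, disc r z -> 2 * k * a * (ramp e2 (tau z) * psi (tau z) * `|D z|) <=
  -1 * ((psi (tau z) * Wx z + W z * (psi' (tau z) * tx z)) * Uy z -
    (psi (tau z) * Wy z + W z * (psi' (tau z) * ty z)) * Ux z) +
  k * a ^+ 2 * (ramp e2 (tau z) * (1 - q (tau z)) * (h (th z) * area tx ty px py z))}.
  apply: filterS UW => z Hz zr; have Bz := discS r1 zr.
  have /andP[b0 b1] := rb (tau z).
  have kt0 : 0 <= ramp e2 (tau z) * (1 - q (tau z)).
    by rewrite mulr_ge0// subr_ge0; have /andP[] := qb (tau z).
  have [tz|tz] := leP (tau z) (e2 / 2).
    have [c1 s1] := cl_lo (tau z) ltac:(move: tz e20; lra_from).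
    rewrite ra1// !mul0r !mulr0 addr0 /psi /psi' c1 s1 expr1n.
    have := Hz Bz; have : 0 <= k * (1 + W z ^+ 2) * (Ux z ^+ 2 + Uy z ^+ 2).
      by rewrite !mulr_ge0 ?addr_ge0 ?sqr_ge0// ltW.
    by rewrite !(mulr0, mul0r, oppr0, mul1r, addr0); lra_from.
  have Dz : Dp z by split => //=; move: tz e20; lra_from.
  have := @length_area_pointwise a (ramp e2 (tau z)) (ct (tau z)) (st (tau z))
    (ramp e2 (tau z) * (1 - q (tau z))) (W z) (Ux z) (Uy z) (tx z) (ty z)
    (Ux z * Wy z - Uy z * Wx z) (ltW a0) k0 (Hz Bz).
  rewrite (grad_area Dz) -/(psi (tau z)) -/(D z) => H.
  apply: (le_trans (H _ b0)).
    have [h1|h1] := leP T1 (tau z); first by right; split => //; have [] := cl_hi _ h1.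
    left; rewrite (q0 (tau z) (ltW h1)) subr0 mulr1 /psi.
    have [h2|h2] := leP (tau z) e2.
      have [-> ->] := cl_lo _ h2; rewrite expr1n expr0n /= add0r mulr1 expr2.
      exact: ler_piMr.
    by rewrite (ra3 _ (ltW h2)) expr1n mul1r addrC /ct /st cos2Dsin2.
  have w2 : 2 * w = 2 * k * a by rewrite -mulrA ka.
  rewrite /D /psi' w2 le_eqVlt; apply/orP; left; apply/eqP; ring.
have := ae_le_Rintegral mr (disc_integrableZ (2 * k * a) JD) _ main => H.
have JS' := disc_integrableZ (-1) JS; have JN' := disc_integrableZ (k * a ^+ 2) JN.
have {}H := H ltac:(by apply: eq_integrable (integrableD mr JS' JN')).
move: H; rewrite (RintegralD mr JS' JN') (RintegralZl _ mr JD) (RintegralZl _ mr JS) (RintegralZl _ mr JN) St Nh mulr0 add0r.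
set V := \int[mu2]_(z in disc r) (ramp e2 (tau z) * psi (tau z) * `|D z|) => H.
have Ct (x : R) : is_derive x 1 Kt (ramp e2 x * (1 - q x)) by have [] := CKt x.
have Cb (x : R) : is_derive x 1 Kb (ramp e2 x * psi x) by have [] := CKb x.
have rt := rc_t rc.
have DKt : Kt t - Kt 0 <= t.
  have := @increment_le _ Kt id _ (fun=> 1) 0 t (ltW rt) (fun x _ => Ct x) (fun x _ => is_derive_id _ _).
  rewrite subr0; apply => x _; have /andP[b0 b1] := rb x; have /andP[p0 p1] := qb x.
  by rewrite mulr_ile1 ?subr_ge0// lerBlDr lerDl.
(* The squared cosine has mean one half over a quarter period; [G] is its explicit primitive. *)
have DKb : (T1 - e2) / 2 <= Kb t - Kb 0.
  have mono x y : x <= y -> Kb x <= Kb y.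
    move=> xy; rewrite -subr_ge0 -[leLHS](subrr (0 : R)).
    by apply: (@increment_le _ (fun=> 0) Kb (fun=> 0) _ x y xy) => // z _; exact: Cb.
  pose G x := 2^-1 * x + sin (2 * w * (x - e2)) / (4 * w).
  have dG (x : R) : is_derive x 1 G (cos (w * (x - e2)) ^+ 2).
    have dl : is_derive x 1 (fun y => 2 * w * (y - e2)) (2 * w).
      by have := is_derive_affine (- (2 * w * e2)) (2 * w) x; congr is_derive; apply/funext => y /=; ring.
    have ds := @is_derive1_comp _ sin _ x _ _ (is_derive_sin _) dl.
    have ds2 := @is_derive1_comp _ (fun y => 0 + y * (4 * w)^-1) (fun y => sin (2 * w * (y - e2))) x _ _ (is_derive_affine _ _ _) ds.
    have dx := is_derive_affine 0 2^-1 x.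
    have := is_deriveD dx ds2; congr is_derive.
      by apply/funext => y; rewrite fctE /= !add0r /G [2^-1 * y]mulrC.
    have -> : 2 * w * (x - e2) = w * (x - e2) + w * (x - e2) by ring.
    have -> : cos (w * (x - e2) + w * (x - e2)) = 2 * cos (w * (x - e2)) ^+ 2 - 1.
      by rewrite cosD -!expr2; have := cos2Dsin2 (w * (x - e2)); move: (cos _) (sin _) => u v; lra_from.
    by field; exact: lt0r_neq0.
  have := @increment_eq _ Kb G (fun x => cos (w * (x - e2)) ^+ 2) e2 T1 (ltW eT).
  move=> /(_ _ (fun x _ => dG x)) EG.
  have {}EG := EG ltac:(move=> x /andP[h1 h2]; have := Cb x;
    by rewrite ra3// mul1r /psi /ct /cl clamp_id// h1).
  have : G T1 - G e2 = (T1 - e2) / 2.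
    rewrite /G subrr mulr0 sin0 mul0r addr0 -mulrA wT.
    by rewrite (_ : 2 * (pi / 2) = pi) ?sinpi ?mul0r; field.
  by have := mono _ _ (ltW Tt); have := mono _ _ (ltW e20); lra_from.
have I0 : 0 <= X (2 * pi) - X 0.
  rewrite -[leLHS](subrr (0 : R)); apply: (@increment_le _ (fun=> 0) X (fun=> 0) h 0 (2 * pi)) => //; first by rewrite mulr_ge0// pi_ge0.
  by move=> x _; have [] := CX x.
have Vlow : 2 * w * V <= w * a * ((X (2 * pi) - X 0) / (2 * pi) * (c * t)).
  have w1 : 2 * k * a = 2 * w by rewrite -mulrA ka.
  have w2 : k * a ^+ 2 = w * a by rewrite expr2 mulrA ka.
  move: H; rewrite w1 w2 => /le_trans; apply.
  apply: ler_wpM2l; first by rewrite mulr_ge0 ?ltW.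
  apply: ler_wpM2l; last by rewrite ler_wpM2l// ltW.
  by apply: divr_ge0; [exact: I0|rewrite mulr_ge0 ?ltW].
have {}Clow : c / pi * (m1 - m0 - 2 * d) * (Kb t - Kb 0) <= V by exact: Clow.
have [mm|mm] := leP (m1 - m0 - 2 * d) 0.
  apply: (@le_trans _ _ 0).
    by rewrite mulr_le0_ge0 ?sqr_ge0// mulr_ge0_le0// mulr_ge0// ltW.
  by rewrite mulr_ge0 ?(ltW rt)// mulr_ge0// ltW.
set I := X (2 * pi) - X 0 in Vlow *.
have L1 : c / pi * (m1 - m0 - 2 * d) * ((T1 - e2) / 2) <= V.
  by apply: le_trans Clow; apply: ler_wpM2l => //; rewrite !mulr_ge0 ?invr_ge0 ?ltW.
have L2 : 2 * w * (c / pi * (m1 - m0 - 2 * d) * ((T1 - e2) / 2)) <= w * a * (I / (2 * pi) * (c * t)).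
  by apply: le_trans Vlow; apply: ler_wpM2l => //; rewrite mulr_ge0 ?ltW.
have kaE : k * a = pi / 2 / (T1 - e2) by rewrite ka.
have : 0 <= (4 * k * (pi * (T1 - e2)) / (w * c)) * (w * a * (I / (2 * pi) * (c * t)) - 2 * w * (c / pi * (m1 - m0 - 2 * d) * ((T1 - e2) / 2))).
  apply: mulr_ge0; last by rewrite subr_ge0.
  by apply: divr_ge0; apply: mulr_ge0; rewrite ?(ltW w0) ?(ltW c0)// ?mulr_ge0 ?(ltW k0) ?(ltW pi0) ?(ltW td0).
suff -> : (4 * k * (pi * (T1 - e2)) / (w * c)) * (w * a * (I / (2 * pi) * (c * t)) - 2 * w * (c / pi * (m1 - m0 - 2 * d) * ((T1 - e2) / 2)))
  = pi * I * t - 4 * k * (m1 - m0 - 2 * d) * (t - d) ^+ 2 by rewrite subr_ge0.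
have aE : a = pi / 2 / (T1 - e2) / k by rewrite -kaE mulrC mulKf// gt_eqF.
by rewrite -TE aE; apply: length_area_algebra; exact: lt0r_neq0.
Qed.

Lemma ring_inequality_limit : 4 * k * (m1 - m0) * t <= pi * (X (2 * pi) - X 0).
Proof.
have rt := rc_t rc; rewrite -(ler_pM2r rt).
rewrite leNgt; apply/negP => H.
pose p (d : R) := 4 * k * (m1 - m0 - 2 * d) * (t - d) ^+ 2.
have cp : {for 0, continuous p}.
  apply: cvgM.
    apply: cvgM; first exact: cvg_cst.
    by apply: cvgB; [exact: cvg_cst|apply: cvgM; [exact: cvg_cst|exact: cvg_id]].
  by apply: cvgM; apply: cvgB; [exact: cvg_cst|exact: cvg_id|exact: cvg_cst|exact: cvg_id].
have p0 : pi * (X (2 * pi) - X 0) * t < p 0.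
  by apply: (lt_le_trans H); rewrite /p mulr0 !subr0 expr2 mulrA.
have /nbhs_ballP[d /= d0 Hd] : \forall x \near (0 : R), pi * (X (2 * pi) - X 0) * t < p x.
  by move/cvgr_gt : cp; apply.
pose e := Num.min (d / 2) (t / 3).
have e0 : 0 < e by rewrite lt_min; apply/andP; split; lra.
have e1 : e <= d / 2 by rewrite ge_min lexx.
have e2 : e <= t / 3 by rewrite ge_min lexx orbT.
have := Hd e; rewrite /ball /= sub0r normrN gtr0_norm// => /(_ ltac:(lra)).
by rewrite ltNge ring_inequality_approx//; lra.
Qed.


End RingInequality.

(** * Quasiregular maps *)

Section Opnorm.
Variable R : realType.
Implicit Types (a b c d x y : R).

Lemma opnorm_bound a b c d x y :
  (a * x + b * y) ^+ 2 + (c * x + d * y) ^+ 2 <= opnorm a b c d ^+ 2 * (x ^+ 2 + y ^+ 2).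
Proof.
pose E := [set r | exists x y : R, x ^+ 2 + y ^+ 2 = 1 /\
               r = Num.sqrt ((a * x + b * y) ^+ 2 + (c * x + d * y) ^+ 2)].
have Eub : has_ubound E.
  exists (Num.sqrt (a ^+ 2 + b ^+ 2 + c ^+ 2 + d ^+ 2)) => _ [u [v [uv ->]]].
  rewrite ler_sqrt; last by rewrite !addr_ge0 ?sqr_ge0.
  rewrite -[leRHS]mulr1 -uv -subr_ge0 (_ : _ - _ = (a * v - b * u) ^+ 2 + (c * v - d * u) ^+ 2); last by ring.
  by rewrite addr_ge0 ?sqr_ge0.
have [n0|n0] := eqVneq (x ^+ 2 + y ^+ 2) 0.
  have : x = 0 /\ y = 0.
    have := sqr_ge0 x; have := sqr_ge0 y => h1 h2.
    by split; apply/eqP; rewrite -sqrf_eq0; apply/eqP; lra.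
  by move=> [-> ->]; rewrite !mulr0 !addr0 expr0n /= !addr0 mulr0.
have np : 0 < x ^+ 2 + y ^+ 2 by rewrite lt_def n0 addr_ge0 ?sqr_ge0.
set s := Num.sqrt (x ^+ 2 + y ^+ 2).
have s0 : 0 < s by rewrite sqrtr_gt0.
have s2 : s ^+ 2 = x ^+ 2 + y ^+ 2 by rewrite sqr_sqrtr// ltW.
have Es : E (Num.sqrt ((a * (x / s) + b * (y / s)) ^+ 2 + (c * (x / s) + d * (y / s)) ^+ 2)).
  exists (x / s), (y / s); split => //.
  by rewrite !exprMn exprVn -mulrDl s2 mulfV// -s2 expf_neq0// gt_eqF.
have := ub_le_sup Eub Es; rewrite -/(opnorm a b c d) => H.
have : ((a * (x / s) + b * (y / s)) ^+ 2 + (c * (x / s) + d * (y / s)) ^+ 2) <= opnorm a b c d ^+ 2.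
  rewrite -[leLHS]sqr_sqrtr ?addr_ge0 ?sqr_ge0// ler_pXn2r ?nnegrE ?sqrtr_ge0//.
  exact: le_trans (sqrtr_ge0 _) H.
move=> /(ler_wpM2r (ltW np)); apply: le_trans; rewrite -s2 le_eqVlt; apply/orP; left; apply/eqP.
by field; exact: lt0r_neq0.
Qed.

(** The gradient of a composition involves the transposed derivative. With [(p, q)] the image under
    the transpose, its squared length is the pairing of [(x, y)] with the image of [(p, q)], and the
    Cauchy-Schwarz inequality with [opnorm_bound] lets one factor cancel. *)
Lemma opnorm_transpose a b c d x y :
  (x * a + y * c) ^+ 2 + (x * b + y * d) ^+ 2 <= opnorm a b c d ^+ 2 * (x ^+ 2 + y ^+ 2).
Proof.
set p := x * a + y * c; set q := x * b + y * d.
have := opnorm_bound a b c d p q; set N := opnorm a b c d ^+ 2 => H.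
have [n0|n0] := eqVneq (p ^+ 2 + q ^+ 2) 0.
  by rewrite n0 mulr_ge0 ?addr_ge0 ?sqr_ge0.
have np : 0 < p ^+ 2 + q ^+ 2 by rewrite lt_def n0 addr_ge0 ?sqr_ge0.
rewrite -(ler_pM2r np) -expr2.
have E : p ^+ 2 + q ^+ 2 = x * (a * p + b * q) + y * (c * p + d * q) by rewrite {1}/p {1}/q /p /q; ring.
apply: (@le_trans _ _ ((x ^+ 2 + y ^+ 2) * ((a * p + b * q) ^+ 2 + (c * p + d * q) ^+ 2))).
  rewrite {1}E -subr_ge0 (_ : _ - _ = (x * (c * p + d * q) - y * (a * p + b * q)) ^+ 2); last by ring.
  exact: sqr_ge0.
by rewrite mulrAC mulrC; apply: ler_wpM2r => //; rewrite addr_ge0 ?sqr_ge0.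
Qed.

Lemma opnorm0 a b c d : opnorm a b c d ^+ 2 <= 0 -> [/\ a = 0, b = 0, c = 0 & d = 0].
Proof.
move=> N0; have h1 := opnorm_bound a b c d 1 0; have h2 := opnorm_bound a b c d 0 1.
rewrite !(mulr1, mulr0, addr0, add0r, expr1n, expr0n) /= in h1 h2.
have := sqr_ge0 a; have := sqr_ge0 b; have := sqr_ge0 c; have := sqr_ge0 d => p1 p2 p3 p4.
by split; apply/eqP; rewrite -sqrf_eq0; apply/eqP; lra.
Qed.

End Opnorm.

Section QuasiregularPullback.
Variable R : realType.
Local Notation mu := (@lebesgue_measure R).
Local Notation mu2 := (mu \x mu)%E.
Local Notation P := (measurableTypeR R * measurableTypeR R)%type.
Local Notation B2 := (@B2 R).
Variables (K : R) (f1 f2 ux uy vx vy : R * R -> R).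
Hypothesis K0 : 0 < K.
Hypothesis s1 : sobD f1 ux uy.
Hypothesis s2 : sobD f2 vx vy.
Hypothesis fB : forall z, B2 z -> B2 (f1 z, f2 z).
Hypothesis qr : {ae mu2, forall z : R * R, B2 z ->
  opnorm (ux z) (uy z) (vx z) (vy z) ^+ 2 <= K * (ux z * vy z - uy z * vx z)}.

(** Under composition the Jacobian of [(g, w)] gains the factor [J], while the squared gradient of
    [g] gains at most [K J]; so the calibration inequality persists with [k / K]. *)
Lemma quasiregular_pullback (g gx gy w wx wy : R * R -> R) (k : R) : 0 < k ->
  (forall z, B2 z -> k * (1 + w z ^+ 2) * (gx z ^+ 2 + gy z ^+ 2) <= gx z * wy z - gy z * wx z) ->
  {ae mu2, forall z : R * R, B2 z ->
    k / K * (1 + w (f1 z, f2 z) ^+ 2) *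
      ((gx (f1 z, f2 z) * ux z + gy (f1 z, f2 z) * vx z) ^+ 2 +
       (gx (f1 z, f2 z) * uy z + gy (f1 z, f2 z) * vy z) ^+ 2) <=
    (gx (f1 z, f2 z) * ux z + gy (f1 z, f2 z) * vx z) * (wx (f1 z, f2 z) * uy z + wy (f1 z, f2 z) * vy z) -
    (gx (f1 z, f2 z) * uy z + gy (f1 z, f2 z) * vy z) * (wx (f1 z, f2 z) * ux z + wy (f1 z, f2 z) * vx z)}.
Proof.
move=> k0 H; apply: filterS qr => z Hz Bz; have {}H := H _ (fB Bz); have {}Hz := Hz Bz.
set F := (f1 z, f2 z) in H *.
have := opnorm_transpose (ux z) (uy z) (vx z) (vy z) (gx F) (gy F).
set N := opnorm _ _ _ _ ^+ 2 in Hz *; set J := _ - _ in Hz.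
have N0 : 0 <= N by exact: sqr_ge0.
have J0 : 0 <= J by rewrite -(pmulr_rge0 _ K0); exact: le_trans Hz.
move=> HN; set Q := _ + _ in HN *.
have k1 : 0 <= k / K * (1 + w F ^+ 2) by rewrite mulr_ge0 ?divr_ge0 ?addr_ge0 ?sqr_ge0 ?ltW.
set G := gx F ^+ 2 + gy F ^+ 2 in H HN.
have G0 : 0 <= G by rewrite addr_ge0 ?sqr_ge0.
apply: (@le_trans _ _ (k / K * (1 + w F ^+ 2) * (K * J * G))).
  by apply: ler_wpM2l => //; apply: (le_trans HN); exact: ler_wpM2r.
apply: (@le_trans _ _ ((k * (1 + w F ^+ 2) * G) * J)).
  by rewrite le_eqVlt; apply/orP; left; apply/eqP; field; exact: lt0r_neq0.
apply: (le_trans (ler_wpM2r J0 H)); rewrite le_eqVlt; apply/orP; left; apply/eqP.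
by rewrite /J; ring.
Qed.

End QuasiregularPullback.

(** * Sobolev functions with vanishing gradient *)

Section LocallyConstant.
Variable R : realType.
Local Notation mu := (@lebesgue_measure R).
Local Notation mu2 := (mu \x mu)%E.
Local Notation P := (measurableTypeR R * measurableTypeR R)%type.
Local Notation B2 := (@B2 R).

Lemma ae_near (Q : R -> Prop) (y e : R) : {ae mu, forall x : R, Q x} -> 0 < e ->
  exists x, `|x - y| < e /\ Q x.
Proof.
move=> [A [mA A0 HA]] e0; apply: contrapT => H.
pose E : set R := `]y - e, y + e[%classic.
have sub : E `<=` A.
  move=> x; rewrite /E /= in_itv /= => hx; apply: HA => /= Qx; apply: H; exists x.
  by rewrite ltr_distl.
have : (mu E <= mu A)%E by apply: le_measure; rewrite ?inE//; exact: measurable_itv.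
rewrite A0 /E lebesgue_measure_itv /= lte_fin ifT; last by lra.
by rewrite -EFinB lee_fin; lra.
Qed.

Lemma abs_cont_cst (g : R -> R) (a b : R) : a <= b -> abs_cont_on g a b ->
  {ae mu, forall x : R, a <= x <= b -> is_derive x 1 g 0} -> g b = g a.
Proof.
move=> ab ac dg; have I0 : mu.-integrable setT (EFin \o (fun=> 0 : R)) by exact: integrable0.
have := abs_cont_increment_le ab ac I0.
rewrite normr0 /Rintegral integral0 /= => H.
apply/eqP; rewrite -subr_eq0 -normr_le0; apply: H.
by apply: negligibleS dg => x /= [xab nd] H; apply: nd; exact: H.
Qed.

(** On almost every line absolute continuity gives constancy along segments in a box of [E];
    continuity extends this to the remaining lines, and two points of the box are joined by a
    horizontal and a vertical segment. *)
Lemma sobD_locally_cst (V Vx Vy : R * R -> R) (E : set (R * R)) : sobD V Vx Vy -> open E -> E `<=` B2 ->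
  {ae mu2, forall z, E z -> Vx z = 0 /\ Vy z = 0} ->
  forall z, E z -> exists2 d, 0 < d & forall w, `|w.1 - z.1| < d -> `|w.2 - z.2| < d -> V w = V z.
Proof.
move=> sV openE EB V0 z Ez; have [d d0 Hd] := nbhs_box (open_nbhs_nbhs (conj openE Ez)).
have in1 (a x b : R) : `|a - z.1| < d -> `|b - z.1| < d -> a <= x <= b -> `|x - z.1| < d.
  by rewrite !ltr_distl => /andP[? ?] /andP[? ?] /andP[? ?]; apply/andP; split; lra.
have in2 (a x b : R) : `|a - z.2| < d -> `|b - z.2| < d -> a <= x <= b -> `|x - z.2| < d.
  by rewrite !ltr_distl => /andP[? ?] /andP[? ?] /andP[? ?]; apply/andP; split; lra.
have contV w : `|w.1 - z.1| < d -> `|w.2 - z.2| < d -> {for w, continuous V}.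
  by move=> h1 h2; apply: (sobD_continuous sV); apply: EB; exact: Hd.
have dVx : {ae mu2, forall z : R * R, E z -> is_derive z.1 1 (fun x => V (x, z.2)) 0}.
  apply: filterS2 V0 (sobD_dx sV) => u h1 h2 Eu; have [e1 _] := h1 Eu; rewrite -e1; exact: h2 (EB _ Eu).
have dVy : {ae mu2, forall z : R * R, E z -> is_derive z.2 1 (fun y => V (z.1, y)) 0}.
  apply: filterS2 V0 (sobD_dy sV) => u h1 h2 Eu; have [_ e1] := h1 Eu; rewrite -e1; exact: h2 (EB _ Eu).
have H1 : {ae mu, forall y : R, `|y - z.2| < d -> forall a b : R, `|a - z.1| < d -> `|b - z.1| < d -> a <= b -> V (b, y) = V (a, y)}.
  apply: filterS2 (sobD_acx sV) (ae_ysection dVx) => y h1 h2 yz a b az bz ab.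
  apply: (@abs_cont_cst (fun x => V (x, y)) _ _ ab).
    by apply: h1 => // x xab; apply: EB; apply: Hd => //; exact: in1 az bz xab.
  by apply: filterS h2 => x Hx xab; apply: Hx; apply: Hd => //; exact: in1 az bz xab.
have H2 : {ae mu, forall x : R, `|x - z.1| < d -> forall a b : R, `|a - z.2| < d -> `|b - z.2| < d -> a <= b -> V (x, b) = V (x, a)}.
  apply: filterS2 (sobD_acy sV) (ae_xsection dVy) => x h1 h2 xz a b az bz ab.
  apply: (@abs_cont_cst (fun y => V (x, y)) _ _ ab).
    by apply: h1 => // y yab; apply: EB; apply: Hd => //; exact: in2 az bz yab.
  by apply: filterS h2 => y Hy yab; apply: Hy; apply: Hd => //; exact: in2 az bz yab.
have close (u v : R) : (forall e, 0 < e -> `|u - v| <= e) -> u = v.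
  move=> h; apply/eqP; rewrite -subr_eq0 -normr_le0; apply/ler_addgt0Pr => e0 e00; rewrite add0r; exact: h.
have G1 y a b : `|y - z.2| < d -> `|a - z.1| < d -> `|b - z.1| < d -> a <= b -> V (b, y) = V (a, y).
  move=> yz az bz ab; apply: close => e e0.
  have e20 : 0 < e / 2 by lra.
  have [da da0 Ha] := nbhs_box ((cvgrPdist_le _ _).1 (contV (a, y) az yz) _ e20).
  have [db db0 Hb] := nbhs_box ((cvgrPdist_le _ _).1 (contV (b, y) bz yz) _ e20).
  pose q := Num.min (d - `|y - z.2|) (Num.min da db).
  have q0 : 0 < q by rewrite !lt_min subr_gt0 yz da0.
  have [y' [yy' Qy']] := ae_near y H1 q0.
  move: yy'; rewrite !lt_min => /and3P[k1 k2 k3].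
  have yz' : `|y' - z.2| < d by move: k1 (ler_distD y y' z.2); lra_from.
  have := Ha (a, y'); have := Hb (b, y'); rewrite /= !subrr !normr0 => /(_ db0 k3) h3 /(_ da0 k2) h4.
  have E1 := Qy' yz' a b az bz ab; rewrite E1 in h3.
  by have := ler_distD (V (a, y')) (V (b, y)) (V (a, y)); rewrite [X in _ <= _ + X -> _]distrC; move: h3 h4; lra_from.
have G2 x a b : `|x - z.1| < d -> `|a - z.2| < d -> `|b - z.2| < d -> a <= b -> V (x, b) = V (x, a).
  move=> yz az bz ab; apply: close => e e0.
  have e20 : 0 < e / 2 by lra.
  have [da da0 Ha] := nbhs_box ((cvgrPdist_le _ _).1 (contV (x, a) yz az) _ e20).
  have [db db0 Hb] := nbhs_box ((cvgrPdist_le _ _).1 (contV (x, b) yz bz) _ e20).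
  pose q := Num.min (d - `|x - z.1|) (Num.min da db).
  have q0 : 0 < q by rewrite !lt_min subr_gt0 yz da0.
  have [y' [yy' Qy']] := ae_near x H2 q0.
  move: yy'; rewrite !lt_min => /and3P[k1 k2 k3].
  have yz' : `|y' - z.1| < d by move: k1 (ler_distD x y' z.1); lra_from.
  have := Ha (y', a); have := Hb (y', b); rewrite /= !subrr !normr0 => /(_ k3 db0) h3 /(_ k2 da0) h4.
  have E1 := Qy' yz' a b az bz ab; rewrite E1 in h3.
  by have := ler_distD (V (y', a)) (V (x, b)) (V (x, a)); rewrite [X in _ <= _ + X -> _]distrC; move: h3 h4; lra_from.
exists d => // w w1 w2; have z1 : `|z.1 - z.1| < d by rewrite subrr normr0.
have z2 : `|z.2 - z.2| < d by rewrite subrr normr0.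
have -> : V w = V (w.1, w.2) by rewrite -surjective_pairing.
have -> : V z = V (z.1, z.2) by rewrite -surjective_pairing.
transitivity (V (z.1, w.2)).
  by case: (leP z.1 w.1) => h; [rewrite (G1 w.2 z.1 w.1)|rewrite (G1 w.2 w.1 z.1)// ltW].
by case: (leP z.2 w.2) => h; [rewrite (G2 z.1 z.2 w.2)|rewrite (G2 z.1 w.2 z.2)// ltW].
Qed.

Lemma ae_zero_of_integral (D : set P) (F : P -> R) : measurable D -> mu2.-integrable D (EFin \o F) ->
  {ae mu2, forall z, D z -> 0 <= F z} -> \int[mu2]_(z in D) F z = 0 -> {ae mu2, forall z, D z -> F z = 0}.
Proof.
move=> mD IF F0 E0; have /integrableP[mF _] := IF.
have Ea : (\int[mu2]_(w in D) `|(F w)%:E| = 0)%E.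
  rewrite -[LHS]fineK; last by exact: (integrable_fin_num _ (integrable_abse IF)).
  rewrite -[RHS]/((0 : R)%:E) -E0 /Rintegral; congr EFin; congr fine; apply: ae_eq_integral => //.
    by apply: measurableT_comp => //.
  by apply: filterS F0 => z Hz Dz; rewrite /= ger0_norm//; exact: Hz.
apply: filterS ((ae_eq_integral_abs mu2 mD mF).1 Ea) => z Hz Dz.
by have := Hz Dz => -[].
Qed.

Lemma disc_positive_min (F : R * R -> R) r : r < 1 -> (forall z, B2 z -> {for z, continuous F}) ->
  (forall z, disc r z -> 0 < F z) -> exists2 m, 0 < m & forall z, disc r z -> m <= F z.
Proof.
move=> r1 cF F0; have : bounded_set ((fun z => (F z)^-1) @` disc r).
  apply: compact_bounded; apply: continuous_compact; last exact: compact_disc.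
  apply: continuous_in_subspaceT => z; rewrite inE => zr.
  by apply: cvgV; [rewrite gt_eqF// F0|exact: cF (discS r1 zr)].
move=> [M [_ HM]]; pose M1 := Num.max (M + 1) 1.
have M10 : 0 < M1 by rewrite lt_max ltr01 orbT.
exists M1^-1; first by rewrite invr_gt0.
move=> z zr; have := HM M1; rewrite lt_max ltrDl ltr01 => /(_ isT _ (ex_intro2 _ _ z zr erefl)).
rewrite /= gtr0_norm ?invr_gt0 ?F0// => h.
by rewrite -[leRHS]invrK lef_pV2 ?posrE ?invr_gt0 ?F0.
Qed.

End LocallyConstant.

(** * Every level curve meets the preimage of a ray *)

Section LevelMeetsRay.
Variable R : realType.
Local Notation mu := (@lebesgue_measure R).
Local Notation mu2 := (mu \x mu)%E.
Local Notation P := (measurableTypeR R * measurableTypeR R)%type.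
Local Notation B2 := (@B2 R).
Variables (tau tx ty n1 n2 px py : R * R -> R) (t r : R).
Hypothesis rc : ring_chart tau tx ty n1 n2 px py t r.
Variables (K : R) (f1 f2 ux uy vx vy : R * R -> R).
Hypothesis K0 : 0 < K.
Hypothesis s1 : sobD f1 ux uy.
Hypothesis s2 : sobD f2 vx vy.
Hypothesis fB : forall z, B2 z -> B2 (f1 z, f2 z).
Hypothesis qr : {ae mu2, forall z : R * R, B2 z ->
  opnorm (ux z) (uy z) (vx z) (vy z) ^+ 2 <= K * (ux z * vy z - uy z * vx z)}.
Variables (x1 x1x x1y x2 x2x x2y : R * R -> R) (S : R).
Hypothesis C1x : C1on B2 x1 x1x x1y.
Hypothesis C2x : C1on B2 x2 x2x x2y.
Hypothesis cross0 : forall z, B2 z -> 0 < x1x z * x2y z - x1y z * x2x z.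
Variables (c : R -> R * R) (c1 : R).
Hypothesis c_cont : forall s, 0 <= s <= c1 -> {for s, continuous c}.
Hypothesis c10 : 0 <= c1.
Hypothesis cB : forall s, 0 <= s <= c1 -> B2 (c s).
Hypothesis c_slit : forall s, 0 <= s <= c1 -> tau (c s) = 0.
Let f z := (f1 z, f2 z).
Hypothesis focus : x1 (f (c 0)) = S /\ x2 (f (c 0)) = 0.
Hypothesis distinct : f (c c1) <> f (c 0).

Let A1 z := x1 (f z).
Let A2 z := x2 (f z).
Let A1x z := x1x (f z) * ux z + x1y (f z) * vx z.
Let A1y z := x1x (f z) * uy z + x1y (f z) * vy z.
Let A2x z := x2x (f z) * ux z + x2y (f z) * vx z.
Let A2y z := x2x (f z) * uy z + x2y (f z) * vy z.

Let sA1 : sobD A1 A1x A1y.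
Proof. exact: sobD_comp s1 s2 fB C1x. Qed.

Let sA2 : sobD A2 A2x A2y.
Proof. exact: sobD_comp s1 s2 fB C2x. Qed.

Let J z := ux z * vy z - uy z * vx z.

Lemma jacobian_ge0 : {ae mu2, forall z, B2 z -> 0 <= J z}.
Proof.
apply: filterS qr => z Hz Bz; rewrite -(pmulr_rge0 _ K0).
by apply: le_trans (Hz Bz); exact: sqr_ge0.
Qed.

Lemma smoothstep_lo (a w x : R) : 0 < w -> x <= a -> smoothstep ((x - a) / w) = 0 /\ smoothstep' ((x - a) / w) / w = 0.
Proof.
move=> w0 xa; have h : (x - a) / w <= 0 by rewrite ler_pdivrMr// mul0r subr_le0.
by rewrite smoothstep0// smoothstep'0 ?mul0r//; left.
Qed.

Lemma smoothstep_hi (a w x : R) : 0 < w -> a + w <= x -> smoothstep ((x - a) / w) = 1 /\ smoothstep' ((x - a) / w) / w = 0.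
Proof.
move=> w0 xa; have h : 1 <= (x - a) / w by rewrite ler_pdivlMr// mul1r; lra.
by rewrite smoothstep1// smoothstep'0 ?mul0r//; right.
Qed.

Lemma smoothstep_mid (a w x : R) : 0 < w -> a < x -> x < a + w ->
  0 < smoothstep' ((x - a) / w) / w /\ smoothstep ((x - a) / w) < 1.
Proof.
move=> w0 h1 h2; pose y := (x - a) / w; rewrite -/y.
have y0 : 0 < y by apply: divr_gt0; rewrite ?subr_gt0.
have y1 : y < 1 by rewrite /y ltr_pdivrMr// mul1r; lra.
rewrite /smoothstep /smoothstep' clamp_id ?ltW//; split.
  by rewrite divr_gt0// mulr_gt0 ?subr_gt0// mulr_gt0.
rewrite -subr_gt0 (_ : _ - _ = (1 - y) ^+ 2 * (1 + 2 * y)); last by ring.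
by rewrite mulr_gt0 ?exprn_gt0 ?subr_gt0//; lra.
Qed.

(* If a level curve missed the ray, then the part of its inside mapped near the
   focus would carry no area, and [f] would be constant along the slit. *)
Lemma level_meets_ray s : 0 < s < t -> exists z, [/\ B2 z, tau z = s, x2 (f z) = 0 & S <= x1 (f z)].
Proof.
move=> /andP[s0 st]; apply: contrapT => none.
have r1 := rc_r rc; have mr := @measurable_disc R r.
(* This vanishes exactly where the level is [s] and the image lies on the ray: the last bracket is
   twice the positive part of [S - A1 z]. By assumption it has no zero, hence a positive minimum on
   the disc. *)
pose F z := `|tau z - s| + (`|A2 z| + (`|S - A1 z| + (S - A1 z))).
have cA1 := sobD_continuous sA1; have cA2 := sobD_continuous sA2.
have cF z : B2 z -> {for z, continuous F}.
  move=> Bz; have cS : {for z, continuous (fun z => S - A1 z)} by apply: cvgB; [exact: cvg_cst|exact: cA1].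
  apply: cvgD.
    by apply: cvg_norm; apply: cvgB; [exact: (rc_cont rc)|exact: cvg_cst].
  by apply: cvgD; [apply: cvg_norm; exact: cA2|apply: cvgD => //; exact: cvg_norm].
have pos2 (x : R) : 0 <= `|x| + x by have := ler_norm (- x); rewrite normrN; lra.
have F0 z : disc r z -> 0 < F z.
  move=> zr; have Bz := discS r1 zr.
  have [E|E] := eqVneq (tau z) s; last first.
    by apply: ltr_pwDl; [rewrite normr_gt0 subr_eq0|rewrite addr_ge0].
  apply: ltr_wpDl => //; have [E2|E2] := eqVneq (A2 z) 0; last first.
    by apply: ltr_pwDl; rewrite ?normr_gt0.
  apply: ltr_wpDl => //.
  have h : 0 < S - A1 z by rewrite subr_gt0 ltNge; apply/negP => h; apply: none; exists z.
  by rewrite gtr0_norm// addr_gt0.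
have [m m0 Hm] := disc_positive_min r1 cF F0.
pose e := Num.min (m / 6) (s / 2).
have e0 : 0 < e by rewrite lt_min; apply/andP; split; lra.
have em : e <= m / 6 by rewrite ge_min lexx.
have es : e <= s / 2 by rewrite ge_min lexx orbT.
have gap z : disc r z -> `|tau z - s| <= e -> `|A2 z| < e -> A1 z <= S - e.
  move=> zr h1 h2; have := Hm z zr; rewrite /F.
  by have [h|h] := leP 0 (S - A1 z); [rewrite (ger0_norm h)|rewrite (ltr0_norm h)]; lra.
(* The test function is [al (A1) ch (A2) ze (tau)]: [al] rises from 0 to 1 while [A1] crosses the
   focal value [S], [ch] confines [A2] to a strip around the ray and [ze] drops to 0 just before
   level [s]. *)
pose al x := smoothstep ((x - (S - e)) / (2 * e)); pose al' x := smoothstep' ((x - (S - e)) / (2 * e)) / (2 * e).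
pose ch x := 1 - smoothstep ((x ^+ 2 - 0) / e ^+ 2); pose ch' x := - (smoothstep' ((x ^+ 2 - 0) / e ^+ 2) / e ^+ 2 * (2 * x)).
pose ze x := 1 - smoothstep ((x - (s - e)) / e); pose ze' x := - (smoothstep' ((x - (s - e)) / e) / e).
have e20 : 0 < 2 * e by lra.
have ee0 : 0 < e ^+ 2 by rewrite exprn_gt0.
have Cal : C1 al al' := C1_affine_comp (S - e) (2 * e) (@C1_smoothstep R).
have Cze : C1 ze ze'.
  move=> x; have [h1 h2] := C1_affine_comp (s - e) e (@C1_smoothstep R) x; split; last exact: cvgN.
  have h3 : is_derive x 1 (fun=> 1 : R) 0 by exact: is_derive_cst.
  by rewrite /ze' -[X in is_derive _ _ _ X]add0r; exact: is_deriveB.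
have Cch : C1 ch ch'.
  move=> x; have [h1 h2] := C1_affine_comp 0 (e ^+ 2) (@C1_smoothstep R) (x ^+ 2).
  have dx : is_derive x 1 (fun y => y ^+ 2) (2 * x).
    by have dd := is_derive_id x (1 : R); have := is_deriveM dd dd; congr is_derive; rewrite /GRing.scale /=; ring.
  split.
    have h3 := @is_derive1_comp _ _ (fun y => y ^+ 2) x _ _ h1 dx.
    have h4 : is_derive x 1 (fun=> 1 : R) 0 by exact: is_derive_cst.
    by rewrite /ch' -[X in is_derive _ _ _ X]add0r; exact: is_deriveB.
  apply: cvgN; apply: cvgM; last by apply: cvgM; [exact: cvg_cst|exact: cvg_id].
  apply: (@continuous_comp _ _ _ (fun y : R => y ^+ 2) (fun y : R => smoothstep' ((y - 0) / e ^+ 2) / e ^+ 2)) => //.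
  by case: dx => /derivable1_diffP /differentiable_continuous.
have Wze : weight t (s - e) ze ze'.
  split => //; first lra.
    by move=> x hx; rewrite /ze'; have [_ ->] := smoothstep_lo e0 hx; rewrite oppr0.
  by move=> x hx; rewrite /ze'; have [_ ->] := @smoothstep_hi (s - e) e x e0 ltac:(lra); rewrite oppr0.
have Cg := C1onM (C1on_compC1 C1x Cal) (C1on_compC1 C2x Cch).
have sZ := sobDM (sobD_comp s1 s2 fB Cg) (sobD_C1 (C1on_weight rc Wze)).
have outside z : B2 z -> r < normsq z -> s <= tau z.
  move=> Bz rz; rewrite leNgt; apply/negP => h.
  have := rc_disc rc Bz (ltW (lt_trans h st)) => /(lt_trans rz); by rewrite ltxx.
have ze0 x : s <= x -> ze x = 0 by move=> hx; rewrite /ze; have [-> _] := @smoothstep_hi (s - e) e x e0 ltac:(lra); rewrite subrr.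
have ch0 x : e <= `|x| -> ch x = 0.
  move=> hx; have hx2 : 0 + e ^+ 2 <= x ^+ 2.
    by rewrite add0r -(real_normK (num_real x)) ler_pXn2r ?nnegrE ?normr_ge0// ltW.
  by rewrite /ch; have [-> _] := smoothstep_hi ee0 hx2; rewrite subrr.
have key z : disc r z -> al (A1 z) * ch (A2 z) * ze' (tau z) = 0.
  move=> zr; have [h1|h1] := leP e `|A2 z|; first by rewrite ch0// mulr0 mul0r.
  have [h2|h2] := leP `|tau z - s| e.
    rewrite /al; have [-> _] := smoothstep_lo e20 (gap z zr h2 h1); by rewrite !mul0r.
  have [h3|h3] := leP s (tau z).
    by rewrite /ze'; have [_ ->] := @smoothstep_hi (s - e) e (tau z) e0 ltac:(lra); rewrite oppr0 mulr0.
  have h4 : tau z <= s - e by move: h2; rewrite ltr0_norm ?subr_lt0//; lra.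
  by rewrite /ze'; have [_ ->] := smoothstep_lo e0 h4; rewrite oppr0 mulr0.
have St := disc_stokes r1 sZ sA2 (fun z Bz rz => etrans (congr1 _ (ze0 _ (outside z Bz rz))) (mulr0 _)).
(* In the product of the differential of the test function with [dA2] the derivative of [ch] drops
   out, and that of [ze] by [gap]; only [al'] times the Jacobian of [(A1, A2)] survives, which is
   nonnegative. *)
pose G z := ze (tau z) * ch (A2 z) * al' (A1 z) * ((x1x (f z) * x2y (f z) - x1y (f z) * x2x (f z)) * J z).
have EG z : disc r z -> (al (x1 (f1 z, f2 z)) * ch (x2 (f1 z, f2 z)) * (ze' (tau z) * tx z) +
    ze (tau z) * ((al (x1 (f1 z, f2 z)) * (ch' (x2 (f1 z, f2 z)) * x2x (f1 z, f2 z)) +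
        ch (x2 (f1 z, f2 z)) * (al' (x1 (f1 z, f2 z)) * x1x (f1 z, f2 z))) * ux z +
      (al (x1 (f1 z, f2 z)) * (ch' (x2 (f1 z, f2 z)) * x2y (f1 z, f2 z)) +
        ch (x2 (f1 z, f2 z)) * (al' (x1 (f1 z, f2 z)) * x1y (f1 z, f2 z))) * vx z)) * A2y z -
   (al (x1 (f1 z, f2 z)) * ch (x2 (f1 z, f2 z)) * (ze' (tau z) * ty z) +
    ze (tau z) * ((al (x1 (f1 z, f2 z)) * (ch' (x2 (f1 z, f2 z)) * x2x (f1 z, f2 z)) +
        ch (x2 (f1 z, f2 z)) * (al' (x1 (f1 z, f2 z)) * x1x (f1 z, f2 z))) * uy z +
      (al (x1 (f1 z, f2 z)) * (ch' (x2 (f1 z, f2 z)) * x2y (f1 z, f2 z)) +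
        ch (x2 (f1 z, f2 z)) * (al' (x1 (f1 z, f2 z)) * x1y (f1 z, f2 z))) * vy z)) * A2x z = G z.
  move=> /key; rewrite /A1 /A2 /f => K1.
  transitivity (al (x1 (f1 z, f2 z)) * ch (x2 (f1 z, f2 z)) * ze' (tau z) * (tx z * A2y z - ty z * A2x z) + G z).
    by rewrite /G /A2x /A2y /A1 /A2 /J /f; ring.
  by rewrite K1 mul0r add0r.
have J1 := disc_L2_trunc r1 (sobD_mx sZ) (sobD_L2x sZ r1) (sobD_my sA2) (sobD_L2y sA2 r1).
have J2 := disc_L2_trunc r1 (sobD_my sZ) (sobD_L2y sZ r1) (sobD_mx sA2) (sobD_L2x sA2 r1).
have JG : mu2.-integrable (disc r) (EFin \o G).
  apply: eq_integrable (integrableB mr J1 J2) => // z; rewrite inE => zr.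
  by rewrite /= -EFinB; congr EFin; exact: EG.
have IG : \int[mu2]_(z in disc r) G z = 0.
  by rewrite -[RHS]St; apply: eq_Rintegral => z; rewrite inE => /EG.
have ch_ge0 x : 0 <= ch x.
  by rewrite /ch subr_ge0; have /andP[] := @smoothstep_in R ((x ^+ 2 - 0) / e ^+ 2).
have ze_ge0 x : 0 <= ze x.
  by rewrite /ze subr_ge0; have /andP[] := @smoothstep_in R ((x - (s - e)) / e).
have al_ge0 x : 0 <= al' x by rewrite /al' divr_ge0 ?smoothstep'_ge0// ltW.
have G0 : {ae mu2, forall z, disc r z -> 0 <= G z}.
  apply: filterS jacobian_ge0 => z Hz zr; have Bz := discS r1 zr.
  rewrite /G; apply: mulr_ge0.
    by apply: mulr_ge0; [apply: mulr_ge0; [exact: ze_ge0|exact: ch_ge0]|exact: al_ge0].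
  by apply: mulr_ge0; [apply: ltW; apply: cross0; exact: fB|exact: Hz].
have Gz := ae_zero_of_integral mr JG G0 IG.
pose E := [set z | B2 z /\ [/\ tau z < s - e, `|A1 z - S| < e & `|A2 z| < e]].
have openE : open E.
  rewrite openE => z [Bz [h1 h2 h3]].
  have nB : nbhs z B2 by apply: open_nbhs_nbhs; split => //; exact: open_B2.
  have n1' : \forall w \near z, tau w < s - e by have /cvgr_lt := rc_cont rc Bz; apply.
  have n2' : \forall w \near z, `|A1 w - S| < e.
    have cc : {for z, continuous (fun w => `|A1 w - S|)} by apply: cvg_norm; apply: cvgB; [exact: cA1|exact: cvg_cst].
    by have /cvgr_lt := cc; apply.
  have n3' : \forall w \near z, `|A2 w| < e.
    have cc : {for z, continuous (fun w => `|A2 w|)} by apply: cvg_norm; exact: cA2.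
    by have /cvgr_lt := cc; apply.
  near=> w; split; [near: w; exact: nB|split; near: w; [exact: n1'|exact: n2'|exact: n3']].
have EB : E `<=` B2 by move=> z [].
have flat : {ae mu2, forall z, E z -> [/\ ux z = 0, uy z = 0, vx z = 0 & vy z = 0]}.
  apply: filterS2 Gz qr => z Hz Hq [Bz [h1 h2 h3]]; apply: opnorm0.
  have zr : disc r z by apply: ltW; apply: (rc_disc rc Bz); move: h1 e0 st; lra_from.
  suff J0 : J z = 0 by have := Hq Bz; rewrite -/(J z) J0 mulr0.
  apply/eqP; have := Hz zr; rewrite /G => /eqP; rewrite mulf_eq0 => /orP[|].
    rewrite mulf_eq0 => /orP[|/eqP E0]; last first.
      exfalso; move: h2; rewrite ltr_distl => /andP[q1 q2].
      have [+ _] := @smoothstep_mid (S - e) (2 * e) (A1 z) e20 q1 ltac:(move: q2; lra_from).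
      by rewrite -/(al' (A1 z)) E0 ltxx.
    rewrite mulf_eq0 => /orP[] /eqP E0; exfalso.
      by move: E0; rewrite /ze; have [-> _] := smoothstep_lo e0 (ltW h1); move=> /eqP; rewrite subr0 oner_eq0.
    have [e1|e1] := eqVneq (A2 z) 0.
      move: E0; rewrite /ch e1 expr0n /= subrr mul0r smoothstep0// => /eqP; by rewrite subr0 oner_eq0.
    have q1 : 0 < A2 z ^+ 2 by rewrite exprn_even_gt0.
    have q2 : A2 z ^+ 2 < 0 + e ^+ 2.
      by rewrite add0r -(real_normK (num_real (A2 z))) ltr_pXn2r ?nnegrE ?normr_ge0// ltW.
    by have [_] := smoothstep_mid ee0 q1 q2; move: E0; rewrite /ch => /eqP; rewrite subr_eq0 => /eqP <-; rewrite ltxx.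
  by rewrite mulf_eq0 gt_eqF//; apply: cross0; exact: fB.
have flat1 z : E z -> exists2 d, 0 < d & forall w, `|w.1 - z.1| < d -> `|w.2 - z.2| < d -> f1 w = f1 z.
  by apply: (sobD_locally_cst s1 openE EB); apply: filterS flat => w H /H[].
have flat2 z : E z -> exists2 d, 0 < d & forall w, `|w.1 - z.1| < d -> `|w.2 - z.2| < d -> f2 w = f2 z.
  by apply: (sobD_locally_cst s2 openE EB); apply: filterS flat => w H /H[].
apply: distinct.
(* The slit is connected: points mapped to the focus lie in [E], where [f] is locally constant, and
   the other points form an open set. So [f] would take the value of the focus along the whole slit,
   against [distinct]. *)
apply: (@interval_induction _ (fun x => f (c x) = f (c 0)) 0 c1 c10) => //.
move=> x xc; have cx := c_cont xc; have Bx := cB xc.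
have nearc (A : set (R * R)) : nbhs (c x) A -> exists2 d : R, 0 < d & forall y, `|y - x| < d -> A (c y).
  move=> /cx /nbhs_ballP[d /= d0 Hd]; exists d => // y yx; apply: (Hd y); by rewrite /ball /= distrC.
have [Ec|Ec] := pselect (f (c x) = f (c 0)).
  have Ex : E (c x).
    split => //; rewrite /A1 /A2 Ec; have [-> ->] := focus; rewrite subrr normr0 c_slit//; split => //; move: e0 es; lra_from.
  have [d1 d10 H1] := flat1 _ Ex; have [d2 d20 H2] := flat2 _ Ex.
  have : nbhs (c x) [set w | f w = f (c x)].
    apply/nbhs_ballP; exists (Num.min d1 d2); first by rewrite /= lt_min d10.
    move=> w [/= w1 w2]; rewrite /ball /= !lt_min in w1 w2.
    move: w1 w2 => /andP[a1 a2] /andP[b1 b2].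
    by rewrite /f (H1 w) 1?(H2 w)// distrC.
  move=> /nearc[d d0 Hd]; exists d => // u v _ xu xv _ du vd _.
  by rewrite -Ec; apply: Hd; rewrite ltr_distl; apply/andP; split => //; apply: lt_le_trans xv; rewrite gtrBl.
have : nbhs (c x) [set w | f w <> f (c 0)].
  have cf : {for c x, continuous f}.
    by apply: cvg_pair_at; [exact: (sobD_continuous s1)|exact: (sobD_continuous s2)].
  have : nbhs (f (c x)) [set p | p <> f (c 0)].
    apply: (@open_nbhs_nbhs _ (f (c x))); split => //.
    have : closed [set f (c 0)] by apply: accessible_closed_set1; apply: hausdorff_accessible; exact: norm_hausdorff.
    by rewrite -openC.
  by move=> /cf.
move=> /nearc[d d0 Hd]; exists d => // u v _ xu xv _ du vd Eu; exfalso.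
by apply: (Hd u) => //; rewrite ltr_distl; apply/andP; split => //; apply: (le_lt_trans xu); rewrite ltrDl.
Unshelve. all: by end_near.
Qed.

End LevelMeetsRay.

(** * Hyperboloid model and elliptic coordinates *)

Section Hyperboloid.
Variable R : realType.
Local Notation B2 := (@B2 R).
Implicit Types (z : R * R) (e f : R * R * R).

Definition lorentz e f : R := - (e.1.1 * f.1.1) + e.1.2 * f.1.2 + e.2 * f.2.

(** The vector product of the Lorentz form, orthogonal to both factors. Its sign is such that the
    Jacobian of two linear coordinates is a positive multiple of the coordinate along the product,
    see [gans_cross]. *)
Definition lcross e f : R * R * R :=
  (e.1.2 * f.2 - e.2 * f.1.2, e.1.1 * f.2 - e.2 * f.1.1, e.1.2 * f.1.1 - e.1.1 * f.1.2).

Definition hyperboloid z : R * R * R :=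
  ((1 + normsq z) / (1 - normsq z), 2 * z.1 / (1 - normsq z), 2 * z.2 / (1 - normsq z)).

(* The coordinate along [e] in the hyperboloid model; these are the Gans
   coordinates when [e] runs through a Lorentz-orthonormal frame. *)
Definition gans e z : R := - lorentz e (hyperboloid z).
Definition gansx e z : R := 2 * ((e.1.1 + gans e z) * z.1 - e.1.2) / (1 - normsq z).
Definition gansy e z : R := 2 * ((e.1.1 + gans e z) * z.2 - e.2) / (1 - normsq z).
Definition conformal z : R := 2 / (1 - normsq z).

Lemma denom_gt0 z : B2 z -> 0 < 1 - normsq z.
Proof. by move=> /B2E; rewrite subr_gt0. Qed.

Lemma ball_denom_neq0 z : B2 z -> 1 - normsq z != 0.
Proof. by move=> /denom_gt0/lt0r_neq0. Qed.

Lemma gansE e z : B2 z -> gans e z =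
  (e.1.1 * (1 + normsq z) - 2 * e.1.2 * z.1 - 2 * e.2 * z.2) / (1 - normsq z).
Proof. by move=> /ball_denom_neq0 n0; rewrite /gans /lorentz /hyperboloid /=; field. Qed.

Lemma C1on_eq (D : set (R * R)) (g gx gy gx' gy' : R * R -> R) : open D -> C1on D g gx gy ->
  (forall z, D z -> gx z = gx' z) -> (forall z, D z -> gy z = gy' z) -> C1on D g gx' gy'.
Proof.
move=> oD Cg ex ey z Dz; have [h1 h2 h3] := Cg z Dz; rewrite -(ex z Dz) -(ey z Dz); split => //.
  have E : {near z, gx =1 gx'} by apply: filterS (open_nbhs_nbhs (conj oD Dz)) => w /ex.
  by change (gx' w @[w --> z] --> gx' z); rewrite -ex//; apply: cvg_trans (near_eq_cvg E) h2.
have E : {near z, gy =1 gy'} by apply: filterS (open_nbhs_nbhs (conj oD Dz)) => w /ey.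
by change (gy' w @[w --> z] --> gy' z); rewrite -ey//; apply: cvg_trans (near_eq_cvg E) h3.
Qed.

Lemma C1on_fun_eq (D : set (R * R)) (g h gx gy : R * R -> R) : open D -> C1on D g gx gy ->
  (forall z, D z -> g z = h z) -> C1on D h gx gy.
Proof.
move=> oD Cg eg z Dz; have [h1 h2 h3] := Cg z Dz; split => //.
apply: (has_grad_near h1); have [d d0 H] := nbhs_box (open_nbhs_nbhs (conj oD Dz)).
by exists d => // w w1 w2; rewrite eg//; exact: H.
Qed.

Lemma C1onV (D : set (R * R)) (g gx gy : R * R -> R) : C1on D g gx gy -> (forall z, D z -> g z != 0) ->
  C1on D (fun z => (g z)^-1) (fun z => - (g z) ^- 2 * gx z) (fun z => - (g z) ^- 2 * gy z).
Proof.
move=> Cg g0; apply: (@C1on_comp _ D (fun x => x^-1) (fun x => - x ^- 2)) => // z Dz.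
have gz := g0 z Dz; split.
  have := @is_deriveV R id (g z) 1 (1 : R) gz (is_derive_id _ _).
  by congr is_derive; rewrite /GRing.scale /= mulr1.
by apply: cvgN; apply: cvgV; [rewrite expf_neq0|apply: cvgM; exact: cvg_id].
Qed.

Lemma C1on_sqrt (D : set (R * R)) (g gx gy : R * R -> R) : C1on D g gx gy -> (forall z, D z -> 0 < g z) ->
  C1on D (fun z => Num.sqrt (g z)) (fun z => (2 * Num.sqrt (g z))^-1 * gx z) (fun z => (2 * Num.sqrt (g z))^-1 * gy z).
Proof.
move=> Cg g0; apply: (@C1on_comp _ D Num.sqrt (fun x => (2 * Num.sqrt x)^-1)) => // z Dz.
have gz := g0 z Dz; split; first exact: is_derive1_sqrt.
apply: cvgV; first by rewrite mulf_neq0// lt0r_neq0// sqrtr_gt0.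
by apply: cvgM; [exact: cvg_cst|exact: sqrt_continuous].
Qed.

Lemma C1on_gans e : C1on B2 (gans e) (gansx e) (gansy e).
Proof.
have oB := @open_B2 R.
have Cn := @C1on_normsq R B2.
have Cd : C1on B2 (fun z => 1 + -1 * normsq z) _ _ := C1onD (@C1on_cst _ B2 1) (C1onM (@C1on_cst _ B2 (-1)) Cn).
have Ci := C1onV Cd (fun z Bz => ltac:(by rewrite /= mulN1r; exact: ball_denom_neq0)).
have Cu : C1on B2 (fun z => (e.1.1 * (1 + normsq z) + -2 * e.1.2 * z.1) + -2 * e.2 * z.2) _ _ :=
  C1onD (C1onD (C1onM (@C1on_cst _ B2 e.1.1) (C1onD (@C1on_cst _ B2 1) Cn))
    (C1onM (@C1on_cst _ B2 (-2 * e.1.2)) (@C1on_fst R B2))) (C1onM (@C1on_cst _ B2 (-2 * e.2)) (@C1on_snd R B2)).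
have C := C1onM Cu Ci.
have C' := @C1on_fun_eq _ _ (gans e) _ _ oB C (fun z Bz => ltac:(rewrite /= (gansE e Bz) mulN1r; congr (_ / _); ring)).
apply: (C1on_eq oB C') => z Bz; have n0 := ball_denom_neq0 Bz;
  rewrite /gansx /gansy (gansE e Bz) /= mulN1r; field.
all: by [].
Qed.

(** The hyperbolic gradient of a linear coordinate is the tangential projection of its vector, which
    adds the product of the two coordinates to the Lorentz product; the square of the conformal
    factor converts to Euclidean gradients. *)
Lemma gans_dot e f z : B2 z -> gansx e z * gansx f z + gansy e z * gansy f z =
  conformal z ^+ 2 * (gans e z * gans f z + lorentz e f).
Proof.
move=> Bz; have n0 := ball_denom_neq0 Bz.
by rewrite /gansx /gansy !(gansE _ Bz) /conformal /lorentz /normsq in n0 *; field.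
Qed.

Lemma gans_cross e f z : B2 z -> gansx e z * gansy f z - gansy e z * gansx f z =
  conformal z ^+ 2 * gans (lcross e f) z.
Proof.
move=> Bz; have n0 := ball_denom_neq0 Bz.
by rewrite /gansx /gansy !(gansE _ Bz) /conformal /lcross /normsq /= in n0 *; field.
Qed.

Section Frame.
Variables (e0 e1 : R * R * R).
Hypothesis e00 : lorentz e0 e0 = -1.
Hypothesis e11 : lorentz e1 e1 = 1.
Hypothesis e01 : lorentz e1 e0 = 0.
Hypothesis e0p : 0 < e0.1.1.
Let e2 := lcross e1 e0.

Lemma frame22 : lorentz e2 e2 = 1.
Proof.
transitivity (- (lorentz e1 e1 * lorentz e0 e0 - lorentz e1 e0 ^+ 2)).
  by rewrite /e2 /lcross /lorentz /=; ring.
by rewrite e00 e11 e01; ring.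
Qed.

Lemma frame12 : lorentz e1 e2 = 0.
Proof. by rewrite /e2 /lcross /lorentz /=; ring. Qed.

Lemma frame_cross : lcross e1 e2 = e0.
Proof.
have := e11; have := e01; rewrite /e2 /lcross /lorentz; case: (e0) (e1) => [[a b] c] [[a' b'] c'] /= h1 h2.
congr (_, _, _).
- transitivity ((- (a' * a') + b' * b' + c' * c') * a - (- (a' * a) + b' * b + c' * c) * a'); first by ring.
  by rewrite h1 h2; ring.
- transitivity ((- (a' * a') + b' * b' + c' * c') * b - (- (a' * a) + b' * b + c' * c) * b'); first by ring.
  by rewrite h1 h2; ring.
- transitivity ((- (a' * a') + b' * b' + c' * c') * c - (- (a' * a) + b' * b + c' * c) * c'); first by ring.
  by rewrite h1 h2; ring.
Qed.

Lemma frame_expand z : hyperboloid z =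
  (gans e0 z * e0.1.1 - gans e1 z * e1.1.1 - gans e2 z * e2.1.1,
   gans e0 z * e0.1.2 - gans e1 z * e1.1.2 - gans e2 z * e2.1.2,
   gans e0 z * e0.2 - gans e1 z * e1.2 - gans e2 z * e2.2).
Proof.
rewrite /gans; move: (hyperboloid z) e00 e11 e01; rewrite /e2 => p.
case: p (e0) (e1) => [[p q] s] [[a b] c] [[a' b'] c']; rewrite /lcross /lorentz /= => h0 h1 h2.
(* The Gram determinant of the two given vectors is -1; multiplying by its negative, which is 1,
   turns the expansion into a polynomial identity. *)
set D := (- (a' * a') + b' * b' + c' * c') * (- (a * a) + b * b + c * c) - (- (a' * a) + b' * b + c' * c) ^+ 2.
have DE : - D = 1 by rewrite /D h0 h1 h2; ring.
congr (_, _, _).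
- rewrite -[LHS]mul1r -DE /D; transitivity (
    - (a' * ((- (a * a) + b * b + c * c) * (- (a' * p) + b' * q + c' * s) - (- (a' * a) + b' * b + c' * c) * (- (a * p) + b * q + c * s))
     + a * ((- (a' * a') + b' * b' + c' * c') * (- (a * p) + b * q + c * s) - (- (a' * a) + b' * b + c' * c) * (- (a' * p) + b' * q + c' * s))
     - (- ((b' * c - c' * b) * p) + (a' * c - c' * a) * q + (b' * a - a' * b) * s) * (b' * c - c' * b))); first by ring.
  by rewrite h0 h1 h2; ring.
- rewrite -[LHS]mul1r -DE /D; transitivity (
    - (b' * ((- (a * a) + b * b + c * c) * (- (a' * p) + b' * q + c' * s) - (- (a' * a) + b' * b + c' * c) * (- (a * p) + b * q + c * s))
     + b * ((- (a' * a') + b' * b' + c' * c') * (- (a * p) + b * q + c * s) - (- (a' * a) + b' * b + c' * c) * (- (a' * p) + b' * q + c' * s))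
     - (- ((b' * c - c' * b) * p) + (a' * c - c' * a) * q + (b' * a - a' * b) * s) * (a' * c - c' * a))); first by ring.
  by rewrite h0 h1 h2; ring.
- rewrite -[LHS]mul1r -DE /D; transitivity (
    - (c' * ((- (a * a) + b * b + c * c) * (- (a' * p) + b' * q + c' * s) - (- (a' * a) + b' * b + c' * c) * (- (a * p) + b * q + c * s))
     + c * ((- (a' * a') + b' * b' + c' * c') * (- (a * p) + b * q + c * s) - (- (a' * a) + b' * b + c' * c) * (- (a' * p) + b' * q + c' * s))
     - (- ((b' * c - c' * b) * p) + (a' * c - c' * a) * q + (b' * a - a' * b) * s) * (b' * a - a' * b))); first by ring.
  by rewrite h0 h1 h2; ring.
Qed.

Lemma conformal_gt0 z : B2 z -> 0 < conformal z.
Proof. by move=> /denom_gt0 h; rewrite divr_gt0. Qed.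

(** The equation of the hyperboloid in the frame. It is read off from the gradients: by Lagrange's
    identity the squared Jacobian of the two spatial coordinates is their Gram determinant. *)
Lemma frame_gans0_sqr z : B2 z -> gans e0 z ^+ 2 = 1 + gans e1 z ^+ 2 + gans e2 z ^+ 2.
Proof.
move=> Bz; have l0 := lt0r_neq0 (conformal_gt0 Bz).
have h1 := gans_dot e1 e1 Bz; have h2 := gans_dot e2 e2 Bz; have h3 := gans_dot e1 e2 Bz.
have h4 := gans_cross e1 e2 Bz; rewrite frame_cross in h4; rewrite e11 in h1; rewrite frame22 in h2; rewrite frame12 addr0 in h3.
have E : conformal z ^+ 4 * gans e0 z ^+ 2 = conformal z ^+ 4 * (1 + gans e1 z ^+ 2 + gans e2 z ^+ 2).
  transitivity ((conformal z ^+ 2 * gans e0 z) ^+ 2); first by ring.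
  rewrite -h4.
  transitivity ((gansx e1 z * gansx e1 z + gansy e1 z * gansy e1 z) * (gansx e2 z * gansx e2 z + gansy e2 z * gansy e2 z)
     - (gansx e1 z * gansx e2 z + gansy e1 z * gansy e2 z) ^+ 2); first by ring.
  by rewrite h1 h2 h3; ring.
by apply: (mulfI (expf_neq0 4 l0)).
Qed.

(** Completing squares in [z]. The coordinate [gans e0] is the hyperbolic cosine of the distance
    from the point of [e0], so it tends to infinity at the circle; this makes its sublevel sets
    compact. *)
Lemma frame_gans0_lower z : B2 z -> 1 / e0.1.1 <= gans e0 z * (1 - normsq z).
Proof.
move=> Bz; have a0 := lt0r_neq0 e0p; rewrite (gansE _ Bz) divfK ?ball_denom_neq0//.
have -> : e0.1.1 * (1 + normsq z) - 2 * e0.1.2 * z.1 - 2 * e0.2 * z.2 =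
  e0.1.1 * ((z.1 - e0.1.2 / e0.1.1) ^+ 2 + (z.2 - e0.2 / e0.1.1) ^+ 2) + (e0.1.1 ^+ 2 - (e0.1.2 ^+ 2 + e0.2 ^+ 2)) / e0.1.1.
  by rewrite /normsq; field.
have -> : e0.1.1 ^+ 2 - (e0.1.2 ^+ 2 + e0.2 ^+ 2) = 1 by have := e00; rewrite /lorentz -!expr2; lra.
by rewrite lerDr mulr_ge0 ?addr_ge0 ?sqr_ge0// ltW.
Qed.

Lemma frame_gans0_gt0 z : B2 z -> 0 < gans e0 z.
Proof.
move=> Bz; have h := frame_gans0_lower Bz; rewrite -(pmulr_lgt0 _ (denom_gt0 Bz)).
by apply: lt_le_trans h; rewrite divr_gt0.
Qed.

Lemma frame_compact (M : R) : 0 < M -> exists2 r, r < 1 & forall z, B2 z -> gans e0 z <= M -> normsq z < r.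
Proof.
move=> M0; exists (1 - (2 * M * e0.1.1)^-1); first by rewrite ltrBlDr ltrDl invr_gt0 !mulr_gt0.
move=> z Bz zM; have h := frame_gans0_lower Bz; have d0 := denom_gt0 Bz.
have h2 : 1 / e0.1.1 <= M * (1 - normsq z) by apply: (le_trans h); apply: ler_wpM2r => //; exact: ltW.
have h3 : (2 * M * e0.1.1)^-1 < 1 - normsq z; last by lra.
rewrite invf_plt ?posrE ?mulr_gt0//.
rewrite -div1r ltr_pdivrMr//; move: h2; rewrite ler_pdivrMr// => h2.
have := mulr_gt0 (mulr_gt0 M0 d0) e0p; lra.
Qed.

End Frame.

End Hyperboloid.

(** * Algebra of elliptic coordinates *)

Section EllipticAlgebra.
Variable R : realType.
Variables (S C : R).
Hypothesis S0 : (0 : R) < S.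
Hypothesis C0 : (0 : R) < C.
Hypothesis CS : C ^+ 2 = 1 + S ^+ 2.
Implicit Types (u v : R).

(* Elliptic coordinates of the point [(u, C v)] with foci [(+-S, 0)]: the sum
   and difference of the focal distances are [2 S ecosh] and [2 S esin]. *)
Definition fdist u v := Num.sqrt (u ^+ 2 + C ^+ 2 * v ^+ 2).
Definition esin u v := (fdist (u + S) v - fdist (u - S) v) / (2 * S).
Definition ecosh u v := (fdist (u + S) v + fdist (u - S) v) / (2 * S).

Lemma fdist_ge0 u v : 0 <= fdist u v. Proof. exact: sqrtr_ge0. Qed.

Lemma fdist_sqr u v : fdist u v ^+ 2 = u ^+ 2 + C ^+ 2 * v ^+ 2.
Proof. by rewrite /fdist sqr_sqrtr// addr_ge0 ?sqr_ge0// mulr_ge0 ?sqr_ge0. Qed.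

Lemma fdistE u v : fdist (u + S) v = S * (ecosh u v + esin u v) /\
  fdist (u - S) v = S * (ecosh u v - esin u v).
Proof. by have s0 := lt0r_neq0 S0; rewrite /ecosh /esin; split; field. Qed.

Lemma elliptic_u u v : u = S * ecosh u v * esin u v.
Proof.
have [h1 h2] := fdistE u v; have := fdist_sqr (u + S) v; have := fdist_sqr (u - S) v.
rewrite h1 h2 => e1 e2; have s0 := lt0r_neq0 S0.
have : 4 * S * u = 4 * S * (S * ecosh u v * esin u v) by lra.
by apply: mulfI; rewrite mulf_neq0.
Qed.

(** Together with [elliptic_u] this says that [u = S cosh chi sin phi] and
    [C v = S sinh chi cos phi] up to sign, when [ecosh] and [esin] are written as [cosh chi] and
    [sin phi]. *)
Lemma elliptic_v u v : (C * v / S) ^+ 2 = (ecosh u v ^+ 2 - 1) * (1 - esin u v ^+ 2).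
Proof.
have [h1 h2] := fdistE u v; have := fdist_sqr (u + S) v; have := fdist_sqr (u - S) v.
rewrite h1 h2 => e1 e2; have s0 := lt0r_neq0 S0; have eu := elliptic_u u v.
apply: (mulfI (expf_neq0 2 s0)).
transitivity (C ^+ 2 * v ^+ 2); first by field.
have -> : C ^+ 2 * v ^+ 2 = S ^+ 2 * (ecosh u v ^+ 2 + esin u v ^+ 2) - u ^+ 2 - S ^+ 2 by lra.
by rewrite {3}eu; ring.
Qed.

(** Focal distances are nonnegative, so [|esin| <= ecosh]; as [(ecosh ^ 2 - 1) (1 - esin ^ 2)] is a
    square, 1 lies between the two squares. *)
Lemma elliptic_bounds u v : esin u v ^+ 2 <= 1 /\ 1 <= ecosh u v.
Proof.
have ev := elliptic_v u v; have := sqr_ge0 (C * v / S); rewrite ev => h.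
have [f1 f2] := fdistE u v.
have p1 : 0 <= ecosh u v + esin u v by rewrite -(pmulr_rge0 _ S0) -f1 fdist_ge0.
have p2 : 0 <= ecosh u v - esin u v by rewrite -(pmulr_rge0 _ S0) -f2 fdist_ge0.
have p3 : esin u v ^+ 2 <= ecosh u v ^+ 2 by rewrite -subr_ge0 subr_sqr mulr_ge0.
have p4 : 0 <= ecosh u v by lra.
have n1 : esin u v ^+ 2 <= 1.
  rewrite leNgt; apply/negP => n1; have : 0 < (ecosh u v ^+ 2 - 1) * (esin u v ^+ 2 - 1) by rewrite mulr_gt0//; lra.
  lra.
split => //; rewrite -(@ler_pXn2r _ 2%N) ?nnegrE// expr1n.
have [E|n1'] := eqVneq (esin u v ^+ 2) 1; first by rewrite -E.
have n2 : 0 < 1 - esin u v ^+ 2 by rewrite subr_gt0 lt_neqAle n1'.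
by move: h; rewrite pmulr_lge0// subr_ge0.
Qed.

Lemma ecosh_segment u : `|u| <= S -> ecosh u 0 = 1.
Proof.
rewrite ler_norml => /andP[h1 h2]; rewrite /ecosh /fdist expr0n /= mulr0 !addr0 !sqrtr_sqr.
by rewrite ger0_norm ?ler0_norm; [rewrite opprB; field; exact: lt0r_neq0|lra|lra].
Qed.

Lemma esin_ray u : S <= u -> esin u 0 = 1.
Proof.
move=> h; have s0 := S0; rewrite /esin /fdist expr0n /= mulr0 !addr0 !sqrtr_sqr.
have a1 : 0 <= u + S by lra.
have a2 : 0 <= u - S by lra.
by rewrite (ger0_norm a1) (ger0_norm a2); field; exact: lt0r_neq0.
Qed.

Lemma esin_rayN u : S <= - u -> esin u 0 = -1.
Proof.
move=> h; have s0 := S0; rewrite /esin /fdist expr0n /= mulr0 !addr0 !sqrtr_sqr.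
have a1 : u + S <= 0 by lra.
have a2 : u - S <= 0 by lra.
by rewrite (ler0_norm a1) (ler0_norm a2); field; exact: lt0r_neq0.
Qed.

Section Gram.
(* [l] is the conformal factor, [(g1, h1)] and [(g2, h2)] the gradients of the
   first two coordinates, [u0] the third. *)
Variables (l u v u0 g1 h1 g2 h2 N P m s : R).
Hypothesis d11 : g1 * g1 + h1 * h1 = l ^+ 2 * (u * u + 1).
Hypothesis d22 : g2 * g2 + h2 * h2 = l ^+ 2 * (v * v + 1).
Hypothesis d12 : g1 * g2 + h1 * h2 = l ^+ 2 * (u * v + 0).
Hypothesis cr : g1 * h2 - h1 * g2 = l ^+ 2 * u0.
Hypothesis m2 : m ^+ 2 = 1 - N ^+ 2.
Hypothesis s2 : s ^+ 2 = P ^+ 2 - 1.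
Hypothesis uE : u = S * P * N.
Hypothesis vE : C * v = S * (m * s).
Hypothesis D0 : 0 < P ^+ 2 - N ^+ 2.

(** With [N = sin phi], [m = cos phi], [P = cosh chi], [s = sinh chi], these are a component of the
    gradients of [phi] and [chi], found by differentiating [u = S P N] and [C v = S m s] and solving
    for the two differentials. *)
Definition ephi (g1 g2 : R) := (P * m * g1 - C * s * N * g2) / (S * (P ^+ 2 - N ^+ 2)).
Definition echi (g1 g2 : R) := (N * s * g1 + C * m * P * g2) / (S * (P ^+ 2 - N ^+ 2)).

(** Compared with [echi_norm], the two gradients differ in length only by a factor depending on [N]
    and one depending on [P]. Integrating each variable against its own factor therefore leads to
    conformal coordinates. *)
Lemma ephi_norm : ephi g1 g2 ^+ 2 + ephi h1 h2 ^+ 2 =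
  l ^+ 2 * (1 + S ^+ 2 * N ^+ 2) / (S ^+ 2 * (P ^+ 2 - N ^+ 2)).
Proof.
have s0 := lt0r_neq0 S0; have d0 := lt0r_neq0 D0.
have E : (P * m * g1 - C * s * N * g2) ^+ 2 + (P * m * h1 - C * s * N * h2) ^+ 2 =
   l ^+ 2 * (1 + S ^+ 2 * N ^+ 2) * (P ^+ 2 - N ^+ 2).
  transitivity (P ^+ 2 * m ^+ 2 * (g1 * g1 + h1 * h1) - 2 * P * m * C * s * N * (g1 * g2 + h1 * h2)
      + C ^+ 2 * s ^+ 2 * N ^+ 2 * (g2 * g2 + h2 * h2)); first by ring.
  rewrite d11 d22 d12.
  transitivity (l ^+ 2 * (P ^+ 2 * m ^+ 2 * (u ^+ 2 + 1) - 2 * P * m * s * N * u * (C * v)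
    + s ^+ 2 * N ^+ 2 * ((C * v) ^+ 2 + C ^+ 2))); first by ring.
  rewrite uE vE CS.
  transitivity (l ^+ 2 * (P ^+ 2 * m ^+ 2 * (S ^+ 2 * P ^+ 2 * N ^+ 2 + 1) - 2 * P ^+ 2 * N ^+ 2 * S ^+ 2 * m ^+ 2 * s ^+ 2
    + s ^+ 2 * N ^+ 2 * (S ^+ 2 * m ^+ 2 * s ^+ 2 + (1 + S ^+ 2)))); first by ring.
  by rewrite m2 s2; ring.
rewrite /ephi !expr_div_n -mulrDl E; field.
by rewrite ?d0 ?s0.
Qed.

Lemma echi_norm : echi g1 g2 ^+ 2 + echi h1 h2 ^+ 2 =
  l ^+ 2 * (1 + S ^+ 2 * P ^+ 2) / (S ^+ 2 * (P ^+ 2 - N ^+ 2)).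
Proof.
have s0 := lt0r_neq0 S0; have d0 := lt0r_neq0 D0.
have E : (N * s * g1 + C * m * P * g2) ^+ 2 + (N * s * h1 + C * m * P * h2) ^+ 2 =
   l ^+ 2 * (1 + S ^+ 2 * P ^+ 2) * (P ^+ 2 - N ^+ 2).
  transitivity (N ^+ 2 * s ^+ 2 * (g1 * g1 + h1 * h1) + 2 * P * m * C * s * N * (g1 * g2 + h1 * h2)
      + C ^+ 2 * m ^+ 2 * P ^+ 2 * (g2 * g2 + h2 * h2)); first by ring.
  rewrite d11 d22 d12.
  transitivity (l ^+ 2 * (N ^+ 2 * s ^+ 2 * (u ^+ 2 + 1) + 2 * P * m * s * N * u * (C * v)
    + m ^+ 2 * P ^+ 2 * ((C * v) ^+ 2 + C ^+ 2))); first by ring.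
  rewrite uE vE CS.
  transitivity (l ^+ 2 * (N ^+ 2 * s ^+ 2 * (S ^+ 2 * P ^+ 2 * N ^+ 2 + 1) + 2 * P ^+ 2 * N ^+ 2 * S ^+ 2 * m ^+ 2 * s ^+ 2
    + m ^+ 2 * P ^+ 2 * (S ^+ 2 * m ^+ 2 * s ^+ 2 + (1 + S ^+ 2)))); first by ring.
  by rewrite m2 s2; ring.
rewrite /echi !expr_div_n -mulrDl E; field.
by rewrite ?d0 ?s0.
Qed.

Lemma ephi_echi : ephi g1 g2 * echi h1 h2 - ephi h1 h2 * echi g1 g2 =
  l ^+ 2 * (C * u0) / (S ^+ 2 * (P ^+ 2 - N ^+ 2)).
Proof.
have s0 := lt0r_neq0 S0; have d0 := lt0r_neq0 D0.
have E : (P * m * g1 - C * s * N * g2) * (N * s * h1 + C * m * P * h2) -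
    (P * m * h1 - C * s * N * h2) * (N * s * g1 + C * m * P * g2) = l ^+ 2 * (C * u0) * (P ^+ 2 - N ^+ 2).
  transitivity ((P ^+ 2 * m ^+ 2 + s ^+ 2 * N ^+ 2) * C * (g1 * h2 - h1 * g2)); first by ring.
  by rewrite cr m2 s2; ring.
transitivity (((P * m * g1 - C * s * N * g2) * (N * s * h1 + C * m * P * h2) -
    (P * m * h1 - C * s * N * h2) * (N * s * g1 + C * m * P * g2)) / (S * (P ^+ 2 - N ^+ 2)) ^+ 2).
  by rewrite /ephi /echi; field; rewrite ?d0 ?s0.
by rewrite E; field; rewrite ?d0 ?s0.
Qed.

(** The remaining coordinate factors into the two rescalings, so the Jacobian of [phi] and [chi] is
    the product of the lengths of their gradients and the coordinates are orthogonal. *)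
Lemma elliptic_u0 : u0 ^+ 2 = 1 + u ^+ 2 + v ^+ 2 -> 0 < u0 ->
  C * u0 = Num.sqrt (1 + S ^+ 2 * P ^+ 2) * Num.sqrt (1 + S ^+ 2 * N ^+ 2).
Proof.
move=> E u00; have a0 x : 0 <= 1 + S ^+ 2 * x ^+ 2 by rewrite addr_ge0// mulr_ge0 ?sqr_ge0.
apply/eqP; rewrite -(@eqrXn2 _ 2%N)// ?mulr_ge0 ?sqrtr_ge0// ?ltW//; apply/eqP.
rewrite !exprMn !sqr_sqrtr// E.
transitivity (C ^+ 2 * (1 + u ^+ 2) + (C * v) ^+ 2); first by ring.
rewrite vE uE CS; transitivity ((1 + S ^+ 2) * (1 + S ^+ 2 * P ^+ 2 * N ^+ 2) + S ^+ 2 * (m ^+ 2 * s ^+ 2)); first by ring.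
by rewrite m2 s2; ring.
Qed.

End Gram.

End EllipticAlgebra.

(** * Gradients of the elliptic coordinates *)

Section EllipticGradients.
Variable R : realType.
Local Notation B2 := (@B2 R).
Variables (S C : R).
Hypothesis S0 : (0 : R) < S.
Hypothesis C0 : (0 : R) < C.
Hypothesis CS : C ^+ 2 = 1 + S ^+ 2.
Variables (x1 x1x x1y x2 x2x x2y : R * R -> R).
Hypothesis C1x : C1on B2 x1 x1x x1y.
Hypothesis C2x : C1on B2 x2 x2x x2y.
Let N z := esin S C (x1 z) (x2 z).
Let P z := ecosh S C (x1 z) (x2 z).

Lemma continuous_fdist a z : B2 z -> {for z, continuous (fun z => fdist C (x1 z + a) (x2 z))}.
Proof.
move=> Bz; have c1 := C1on_continuous C1x Bz; have c2 := C1on_continuous C2x Bz.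
apply: (@continuous_comp _ _ _ (fun z => (x1 z + a) ^+ 2 + C ^+ 2 * x2 z ^+ 2) Num.sqrt); last exact: sqrt_continuous.
have ca : {for z, continuous (fun z => x1 z + a)} by apply: cvgD => //; exact: cvg_cst.
by apply: cvgD; [apply: cvgM|apply: cvgM; [exact: cvg_cst|apply: cvgM]].
Qed.

Lemma continuous_esin z : B2 z -> {for z, continuous N}.
Proof.
move=> Bz; apply: cvgM; last exact: cvg_cst.
by apply: cvgB; exact: continuous_fdist.
Qed.

Lemma continuous_ecosh z : B2 z -> {for z, continuous P}.
Proof.
move=> Bz; apply: cvgM; last exact: cvg_cst.
by apply: cvgD; exact: continuous_fdist.
Qed.

Lemma C1on_fdist (D : set (R * R)) a : D `<=` B2 -> (forall z, D z -> 0 < fdist C (x1 z + a) (x2 z)) ->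
  C1on D (fun z => fdist C (x1 z + a) (x2 z))
    (fun z => (2 * fdist C (x1 z + a) (x2 z))^-1 * (2 * ((x1 z + a) * x1x z + C ^+ 2 * x2 z * x2x z)))
    (fun z => (2 * fdist C (x1 z + a) (x2 z))^-1 * (2 * ((x1 z + a) * x1y z + C ^+ 2 * x2 z * x2y z))).
Proof.
move=> DB f0; have c1 := C1onS DB C1x; have c2 := C1onS DB C2x.
have ca := C1onD c1 (@C1on_cst _ D a).
have Cq := C1onD (C1onM ca ca) (C1onM (@C1on_cst _ D (C ^+ 2)) (C1onM c2 c2)).
have E z : (x1 z + a) * (x1 z + a) + C ^+ 2 * (x2 z * x2 z) = (x1 z + a) ^+ 2 + C ^+ 2 * x2 z ^+ 2 by ring.
have Cs := C1on_sqrt Cq (fun z Dz => ltac:(rewrite /= E -sqrtr_gt0; exact: f0)).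
have -> : (fun z => fdist C (x1 z + a) (x2 z)) = (fun z => Num.sqrt ((x1 z + a) * (x1 z + a) + C ^+ 2 * (x2 z * x2 z))).
  by apply/funext => z; rewrite E.
move: Cs; congr C1on; apply/funext => z /=; rewrite /fdist -E; congr (_ * _); ring.
Qed.

Section OnOpen.
Variables (D : set (R * R)) (m s : R * R -> R).
Hypothesis oD : open D.
Hypothesis DB : D `<=` B2.
Hypothesis m2 : forall z, D z -> m z ^+ 2 = 1 - N z ^+ 2.
Hypothesis s2 : forall z, D z -> s z ^+ 2 = P z ^+ 2 - 1.
Hypothesis ms : forall z, D z -> C * x2 z = S * (m z * s z).
Hypothesis delta0 : forall z, D z -> 0 < P z ^+ 2 - N z ^+ 2.
Definition elphi (g1 g2 : R * R -> R) z := ephi S C (N z) (P z) (m z) (s z) (g1 z) (g2 z).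
Definition elchi (g1 g2 : R * R -> R) z := echi S C (N z) (P z) (m z) (s z) (g1 z) (g2 z).

Lemma fdist_pos z : D z -> 0 < fdist C (x1 z + S) (x2 z) /\ 0 < fdist C (x1 z + - S) (x2 z).
Proof.
move=> Dz; have [h1 h2] := fdistE C S0 (x1 z) (x2 z); have d0 := delta0 Dz.
have f1 := fdist_ge0 C (x1 z + S) (x2 z); have f2 := fdist_ge0 C (x1 z - S) (x2 z).
have d1 : P z ^+ 2 - N z ^+ 2 = (P z - N z) * (P z + N z) by rewrite subr_sqr.
rewrite !lt_def f1 f2 !andbT; split; apply/eqP => E; move: d0; rewrite d1.
  by move: h1; rewrite E => /esym/eqP; rewrite mulf_eq0 (gt_eqF S0)/= /P /N => /eqP ->; rewrite mulr0 ltxx.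
by move: h2; rewrite E => /esym/eqP; rewrite mulf_eq0 (gt_eqF S0)/= /P /N => /eqP ->; rewrite mul0r ltxx.
Qed.

Lemma esin_grad_algebra (u v n p mm ss g1 g2 : R) : u = S * p * n -> C * v = S * (mm * ss) ->
  mm ^+ 2 = 1 - n ^+ 2 -> 0 < p ^+ 2 - n ^+ 2 ->
  ((2 * (S * (p + n)))^-1 * (2 * ((u + S) * g1 + C ^+ 2 * v * g2)) -
   (2 * (S * (p - n)))^-1 * (2 * ((u + - S) * g1 + C ^+ 2 * v * g2))) / (2 * S) = mm * ephi S C n p mm ss g1 g2.
Proof.
move=> uE vE mE d0; have d1 := lt0r_neq0 d0; have s0 := lt0r_neq0 S0.
have : (p - n) * (p + n) != 0 by rewrite -subr_sqr.
rewrite mulf_eq0 negb_or => /andP[p1 p2].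
have -> : C ^+ 2 * v = C * (S * (mm * ss)) by rewrite -vE; ring.
rewrite uE /ephi.
transitivity ((p * (1 - n ^+ 2) * g1 - C * (mm * ss) * n * g2) / (S * (p ^+ 2 - n ^+ 2))).
  by field; rewrite ?d1 ?s0 ?p1 ?p2.
by rewrite -mE; field; rewrite ?d1 ?s0.
Qed.

Lemma ecosh_grad_algebra (u v n p mm ss g1 g2 : R) : u = S * p * n -> C * v = S * (mm * ss) ->
  ss ^+ 2 = p ^+ 2 - 1 -> 0 < p ^+ 2 - n ^+ 2 ->
  ((2 * (S * (p + n)))^-1 * (2 * ((u + S) * g1 + C ^+ 2 * v * g2)) +
   (2 * (S * (p - n)))^-1 * (2 * ((u + - S) * g1 + C ^+ 2 * v * g2))) / (2 * S) = ss * echi S C n p mm ss g1 g2.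
Proof.
move=> uE vE mE d0; have d1 := lt0r_neq0 d0; have s0 := lt0r_neq0 S0.
have : (p - n) * (p + n) != 0 by rewrite -subr_sqr.
rewrite mulf_eq0 negb_or => /andP[p1 p2].
have -> : C ^+ 2 * v = C * (S * (mm * ss)) by rewrite -vE; ring.
rewrite uE /echi.
transitivity ((n * (p ^+ 2 - 1) * g1 + C * (mm * ss) * p * g2) / (S * (p ^+ 2 - n ^+ 2))).
  by field; rewrite ?d1 ?s0 ?p1 ?p2.
by rewrite -mE; field; rewrite ?d1 ?s0.
Qed.

Lemma C1on_esin : C1on D N (fun z => m z * elphi x1x x2x z) (fun z => m z * elphi x1y x2y z).
Proof.
have h1 := C1on_fdist DB (fun z Dz => (fdist_pos Dz).1).
have h2 := C1on_fdist DB (fun z Dz => (fdist_pos Dz).2).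
have h := C1onM (C1onD h1 (C1onM (@C1on_cst _ D (-1)) h2)) (@C1on_cst _ D (2 * S)^-1).
have {}h := @C1on_fun_eq _ _ _ N _ _ oD h (fun z Dz => ltac:(rewrite /= mulN1r; reflexivity)).
apply: (C1on_eq oD h) => z Dz; have [f1 f2] := fdistE C S0 (x1 z) (x2 z);
  rewrite -(esin_grad_algebra _ _ (elliptic_u C S0 (x1 z) (x2 z)) (ms Dz) (m2 Dz) (delta0 Dz)) -[in RHS]f1 -[in RHS]f2; ring.
Qed.

Lemma C1on_ecosh : C1on D P (fun z => s z * elchi x1x x2x z) (fun z => s z * elchi x1y x2y z).
Proof.
have h1 := C1on_fdist DB (fun z Dz => (fdist_pos Dz).1).
have h2 := C1on_fdist DB (fun z Dz => (fdist_pos Dz).2).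
have h := C1onM (C1onD h1 h2) (@C1on_cst _ D (2 * S)^-1).
have {}h := @C1on_fun_eq _ _ _ P _ _ oD h (fun z Dz => erefl).
apply: (C1on_eq oD h) => z Dz; have [f1 f2] := fdistE C S0 (x1 z) (x2 z);
  rewrite -(ecosh_grad_algebra _ _ (elliptic_u C S0 (x1 z) (x2 z)) (ms Dz) (s2 Dz) (delta0 Dz)) -[in RHS]f1 -[in RHS]f2; ring.
Qed.

Lemma ms_div z : D z -> C / S * x2 z = m z * s z.
Proof. by move=> Dz; rewrite mulrAC (ms Dz) mulrC mulKf// lt0r_neq0. Qed.

(* [m] and [s] are determined by each other through [C x2 = S m s]; whichever of
   the two is nonzero gives the gradient of the other one. *)
Lemma C1on_es_of_em : C1on D m (fun z => - N z * elphi x1x x2x z) (fun z => - N z * elphi x1y x2y z) ->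
  (forall z, D z -> m z != 0) -> C1on D s (fun z => P z * elchi x1x x2x z) (fun z => P z * elchi x1y x2y z).
Proof.
move=> Cm m0; have s0 := lt0r_neq0 S0.
have h := C1onM (C1onM (@C1on_cst _ D (C / S)) (C1onS DB C2x)) (C1onV Cm m0).
have {}h := @C1on_fun_eq _ _ _ s _ _ oD h (fun z Dz => ltac:(by rewrite /= (ms_div Dz) mulrC mulKf ?m0)).
have alg z g2 g1 : D z -> C / S * x2 z * (- m z ^- 2 * (- N z * ephi S C (N z) (P z) (m z) (s z) g1 g2)) +
    (m z)^-1 * (C / S * g2 + x2 z * 0) = P z * echi S C (N z) (P z) (m z) (s z) g1 g2.
  move=> Dz; have mz := m0 z Dz; have d1 := lt0r_neq0 (delta0 Dz).
  rewrite (ms_div Dz).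
  apply: (mulfI mz); rewrite /ephi /echi.
  have E : m z ^+ 2 * P z ^+ 2 + s z ^+ 2 * N z ^+ 2 = P z ^+ 2 - N z ^+ 2 by rewrite m2// s2//; ring.
  transitivity ((s z * N z * P z * m z * g1 + C * ((P z ^+ 2 - N z ^+ 2) - s z ^+ 2 * N z ^+ 2) * g2) / (S * (P z ^+ 2 - N z ^+ 2))).
    by field; rewrite ?mz ?d1 ?s0.
  by rewrite -{1}E; field; rewrite ?mz ?d1 ?s0.
apply: (C1on_eq oD h) => z Dz; exact: alg.
Qed.

Lemma C1on_em_of_es : C1on D s (fun z => P z * elchi x1x x2x z) (fun z => P z * elchi x1y x2y z) ->
  (forall z, D z -> s z != 0) -> C1on D m (fun z => - N z * elphi x1x x2x z) (fun z => - N z * elphi x1y x2y z).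
Proof.
move=> Cm m0; have s0 := lt0r_neq0 S0.
have h := C1onM (C1onM (@C1on_cst _ D (C / S)) (C1onS DB C2x)) (C1onV Cm m0).
have {}h := @C1on_fun_eq _ _ _ m _ _ oD h (fun z Dz => ltac:(by rewrite /= (ms_div Dz) mulfK ?m0)).
have alg z g2 g1 : D z -> C / S * x2 z * (- s z ^- 2 * (P z * echi S C (N z) (P z) (m z) (s z) g1 g2)) +
    (s z)^-1 * (C / S * g2 + x2 z * 0) = - N z * ephi S C (N z) (P z) (m z) (s z) g1 g2.
  move=> Dz; have mz := m0 z Dz; have d1 := lt0r_neq0 (delta0 Dz).
  rewrite (ms_div Dz).
  apply: (mulfI mz); rewrite /ephi /echi.
  have E : m z ^+ 2 * P z ^+ 2 + s z ^+ 2 * N z ^+ 2 = P z ^+ 2 - N z ^+ 2 by rewrite m2// s2//; ring.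
  transitivity ((- (s z * N z * P z * m z * g1) + C * ((P z ^+ 2 - N z ^+ 2) - m z ^+ 2 * P z ^+ 2) * g2) / (S * (P z ^+ 2 - N z ^+ 2))).
    by field; rewrite ?mz ?d1 ?s0.
  by rewrite -{1}E; field; rewrite ?mz ?d1 ?s0.
apply: (C1on_eq oD h) => z Dz; exact: alg.
Qed.

End OnOpen.

End EllipticGradients.

(** * The point of the disc with given coordinates *)

Section GansInverse.
Variable R : realType.
Local Notation B2 := (@B2 R).
Variables (e0 e1 : R * R * R).
Hypothesis e00 : lorentz e0 e0 = -1.
Hypothesis e11 : lorentz e1 e1 = 1.
Hypothesis e01 : lorentz e1 e0 = 0.
Hypothesis e0p : (0 : R) < e0.1.1.
Let e2 := lcross e1 e0.
Implicit Types u v : R.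

Definition gh u v := Num.sqrt (1 + u ^+ 2 + v ^+ 2).
Definition gp (i : R * R * R -> R) u v := gh u v * i e0 - u * i e1 - v * i e2.
(** Stereographic projection of the point of the hyperboloid with coordinates [u] and [v]. The
    spatial vectors enter [gp] with a minus sign because [gans] is the negative of the Lorentz
    product. *)
Definition gpoint u v : R * R := (gp (fun e => e.1.2) u v / (1 + gp (fun e => e.1.1) u v),
  gp (fun e => e.2) u v / (1 + gp (fun e => e.1.1) u v)).

Lemma gh_gt0 u v : 0 < gh u v.
Proof. by rewrite sqrtr_gt0 -addrA ltr_pwDl// addr_ge0 ?sqr_ge0. Qed.

Lemma gh_sqr u v : gh u v ^+ 2 = 1 + u ^+ 2 + v ^+ 2.
Proof. by rewrite /gh sqr_sqrtr// -addrA addr_ge0 ?ler01// addr_ge0 ?sqr_ge0. Qed.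

Lemma gh_gans z : B2 z -> gh (gans e1 z) (gans e2 z) = gans e0 z.
Proof.
move=> Bz; rewrite /gh -(frame_gans0_sqr e00 e11 e01 Bz) sqrtr_sqr ger0_norm//.
by rewrite ltW// (frame_gans0_gt0 e00 e0p Bz).
Qed.

Lemma gpointK z : B2 z -> gpoint (gans e1 z) (gans e2 z) = z.
Proof.
move=> Bz; have := frame_expand e00 e11 e01 z; rewrite /gpoint /gp gh_gans// -/e2 => -[<- <- <-].
have n0 := ball_denom_neq0 Bz; case: z n0 {Bz} => x y /= n0.
have t0 : 1 + (1 + normsq (x, y)) / (1 - normsq (x, y)) != 0.
  have -> : 1 + (1 + normsq (x, y)) / (1 - normsq (x, y)) = 2 / (1 - normsq (x, y)) by field.
  by rewrite mulf_neq0 ?invr_neq0.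
by congr (_, _); field; rewrite n0 /= (_ : _ + _ = 2) ?pnatr_eq0//; ring.
Qed.

Lemma gp_norm u v : gp (fun e => e.1.1) u v ^+ 2 = 1 + gp (fun e => e.1.2) u v ^+ 2 + gp (fun e => e.2) u v ^+ 2.
Proof.
have h1 := frame22 e00 e11 e01; have h2 := frame12 e0 e1; rewrite -/e2 in h1 h2.
have h3 : lorentz e2 e0 = 0 by rewrite /e2 /lcross /lorentz /=; ring.
have : - gp (fun e => e.1.1) u v ^+ 2 + gp (fun e => e.1.2) u v ^+ 2 + gp (fun e => e.2) u v ^+ 2 = -1.
  rewrite /gp; transitivity (gh u v ^+ 2 * lorentz e0 e0 + u ^+ 2 * lorentz e1 e1 + v ^+ 2 * lorentz e2 e2
     - 2 * gh u v * u * lorentz e1 e0 - 2 * gh u v * v * lorentz e2 e0 + 2 * u * v * lorentz e1 e2).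
    by rewrite /lorentz; ring.
  by rewrite e00 e11 e01 h1 h2 h3 gh_sqr; ring.
by move=> h; lra.
Qed.

(** The point lies on the upper sheet: its Lorentz product with [e0] is negative, whereas by the
    Cauchy-Schwarz inequality for the spatial parts a point of the lower sheet would give a positive
    one. *)
Lemma gp0_gt0 u v : 0 < gp (fun e => e.1.1) u v.
Proof.
have h1 := frame12 e0 e1; rewrite -/e2 in h1.
have h3 : lorentz e2 e0 = 0 by rewrite /e2 /lcross /lorentz /=; ring.
set p0 := gp (fun e => e.1.1) u v; set p1 := gp (fun e => e.1.2) u v; set p2 := gp (fun e => e.2) u v.
have E : p0 * e0.1.1 - p1 * e0.1.2 - p2 * e0.2 = gh u v.
  rewrite /p0 /p1 /p2 /gp; transitivity (- (gh u v * lorentz e0 e0) + u * lorentz e1 e0 + v * lorentz e2 e0).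
    by rewrite /lorentz; ring.
  by rewrite e00 e01 h3; ring.
have n := gp_norm u v; rewrite -/p0 -/p1 -/p2 in n.
have g0 := gh_gt0 u v.
rewrite ltNge; apply/negP => p00.
have k1 : 0 < (p1 * e0.1.2 + p2 * e0.2) * -1 by have := mulr_le0_ge0 p00 (ltW e0p); lra.
have k2 : - (p0 * e0.1.1) < - (p1 * e0.1.2 + p2 * e0.2) by lra.
have k3 : 0 <= - (p0 * e0.1.1) by rewrite oppr_ge0 mulr_le0_ge0// ltW.
have k4 : (p0 * e0.1.1) ^+ 2 < (p1 * e0.1.2 + p2 * e0.2) ^+ 2.
  by rewrite -sqrrN -[ltRHS]sqrrN ltr_pXn2r ?nnegrE//; lra.
have k5 : (p1 * e0.1.2 + p2 * e0.2) ^+ 2 <= (p1 ^+ 2 + p2 ^+ 2) * (e0.1.2 ^+ 2 + e0.2 ^+ 2).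
  rewrite -subr_ge0 (_ : _ - _ = (p1 * e0.2 - p2 * e0.1.2) ^+ 2); last by ring.
  exact: sqr_ge0.
have E0 : e0.1.2 ^+ 2 + e0.2 ^+ 2 = e0.1.1 ^+ 2 - 1 by have := e00; rewrite /lorentz -!expr2; lra.
have E1 : p1 ^+ 2 + p2 ^+ 2 = p0 ^+ 2 - 1 by lra.
rewrite E0 E1 in k5.
have : (p0 ^+ 2 - 1) * (e0.1.1 ^+ 2 - 1) = (p0 * e0.1.1) ^+ 2 - (p1 ^+ 2 + p2 ^+ 2) - (e0.1.2 ^+ 2 + e0.2 ^+ 2) - 1.
  by rewrite E0 E1; ring.
have := sqr_ge0 p1; have := sqr_ge0 p2; have := sqr_ge0 e0.1.2; have := sqr_ge0 e0.2; lra.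
Qed.

Lemma hyperboloid_div (a b c : R) : a ^+ 2 = 1 + b ^+ 2 + c ^+ 2 -> 0 < a ->
  B2 (b / (1 + a), c / (1 + a)) /\ hyperboloid (b / (1 + a), c / (1 + a)) = (a, b, c).
Proof.
move=> n a0; have a1 : 1 + a != 0 by rewrite lt0r_neq0// addr_gt0.
have nE : normsq (b / (1 + a), c / (1 + a)) = (a - 1) / (1 + a).
  rewrite /normsq /= !expr_div_n -mulrDl (_ : b ^+ 2 + c ^+ 2 = (a - 1) * (1 + a)).
    by field.
  by transitivity (a ^+ 2 - 1); [rewrite n; ring|ring].
split; first by apply/B2E; rewrite nE ltr_pdivrMr ?addr_gt0// mul1r [ltRHS]addrC ltrD2l gtrN.
have a2 : 1 - (a - 1) / (1 + a) = 2 / (1 + a) by field.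
by rewrite /hyperboloid nE a2 /=; congr (_, _, _); field; rewrite a1.
Qed.

Lemma gpoint_hyperboloid u v : B2 (gpoint u v) /\ hyperboloid (gpoint u v) =
  (gp (fun e => e.1.1) u v, gp (fun e => e.1.2) u v, gp (fun e => e.2) u v).
Proof. exact: hyperboloid_div (gp_norm u v) (gp0_gt0 u v). Qed.

Lemma gpoint_in u v : B2 (gpoint u v). Proof. by have [] := gpoint_hyperboloid u v. Qed.

Lemma gans1_gpoint u v : gans e1 (gpoint u v) = u.
Proof.
have [_ E] := gpoint_hyperboloid u v; have h2 := frame12 e0 e1; rewrite -/e2 in h2.
rewrite /gans E /gp; transitivity (- (gh u v * lorentz e1 e0) + u * lorentz e1 e1 + v * lorentz e1 e2).
  by rewrite /lorentz /=; ring.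
by rewrite e01 e11 h2; ring.
Qed.

Lemma gans2_gpoint u v : gans e2 (gpoint u v) = v.
Proof.
have [_ E] := gpoint_hyperboloid u v; have h2 := frame12 e0 e1; have h1 := frame22 e00 e11 e01; rewrite -/e2 in h1 h2.
have h3 : lorentz e2 e0 = 0 by rewrite /e2 /lcross /lorentz /=; ring.
rewrite /gans E /gp; transitivity (- (gh u v * lorentz e2 e0) + u * lorentz e1 e2 + v * lorentz e2 e2).
  by rewrite /lorentz /=; ring.
by rewrite h3 h1 h2; ring.
Qed.

Lemma continuous_gpoint (T : topologicalType) (f g : T -> R) (x : T) :
  {for x, continuous f} -> {for x, continuous g} -> {for x, continuous (fun y => gpoint (f y) (g y))}.
Proof.
move=> cf cg.
have ch : {for x, continuous (fun y => gh (f y) (g y))}.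
  apply: (@continuous_comp _ _ _ (fun y => 1 + f y ^+ 2 + g y ^+ 2) Num.sqrt); last exact: sqrt_continuous.
  apply: cvgD; last by apply: cvgM.
  by apply: cvgD; [exact: cvg_cst|apply: cvgM].
have cp i : {for x, continuous (fun y => gp i (f y) (g y))}.
  by apply: cvgB; [apply: cvgB|]; apply: cvgM => //; exact: cvg_cst.
have ci : {for x, continuous (fun y => (1 + gp (fun e => e.1.1) (f y) (g y))^-1)}.
  apply: cvgV; first by rewrite lt0r_neq0// addr_gt0// gp0_gt0.
  by apply: cvgD; [exact: cvg_cst|exact: cp].
by apply: cvg_pair_at; apply: cvgM => //; exact: cp.
Qed.

End GansInverse.

Lemma C1_increasing (R : realType) (F f : R -> R) (x y : R) : C1 F f -> (forall t, 0 < f t) -> x < y -> F x < F y.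
Proof.
move=> CF f0 xy; have [|t| |c] := @MVT_segment R F f x y _ _.
- exact: ltW.
- by move=> _; have [] := CF t.
- by apply: derivable_within_continuous => t _; have [[]] := CF t.
- by rewrite -subr_gt0 => _ ->; rewrite mulr_gt0// subr_gt0.
Qed.

(** * The ring around the hyperbolic segment *)

Section DomainChart.
Variable R : realType.
Local Notation B2 := (@B2 R).
Variables (e0 e1 : R * R * R).
Hypothesis e00 : lorentz e0 e0 = -1.
Hypothesis e11 : lorentz e1 e1 = 1.
Hypothesis e01 : lorentz e1 e0 = 0.
Hypothesis e0p : (0 : R) < e0.1.1.
Let e2 := lcross e1 e0.
Variables (S C : R).
Hypothesis S0 : (0 : R) < S.
Hypothesis C0 : (0 : R) < C.
Hypothesis CS : C ^+ 2 = 1 + S ^+ 2.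
Variables (E E' : R -> R) (T : R).
Hypothesis CE : C1 E E'.
Hypothesis E0 : E 0 = 0.
Hypothesis E'E : forall x, E' x = (Num.sqrt (1 + x ^+ 2) * Num.sqrt (1 + S ^+ 2 * (1 + x ^+ 2)))^-1.
Hypothesis ET : forall t, t < T -> exists M, forall x, E x <= t -> x <= M.

Definition dN z := esin S C (gans e1 z) (gans e2 z).
Definition dP z := ecosh S C (gans e1 z) (gans e2 z).
Definition ds z := Num.sqrt (dP z ^+ 2 - 1).
(** The hyperbolic sine [ds] is taken nonnegative and this cosine carries the sign of the second
    coordinate. Going around the segment, [(dN, dm)] then runs through the whole circle. *)
Definition dm z := C / S * gans e2 z * (ds z)^-1.
(** The derivative of [E] absorbs the factor of [echi_norm] that depends on [dP]; [T] is the
    supremal value up to which sublevel sets of [E] are bounded. *)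
Definition dtau z := E (ds z).
Definition dphi (g1 g2 : R * R -> R) z := ephi S C (dN z) (dP z) (dm z) (ds z) (g1 z) (g2 z).
Definition dgrad (g1 g2 : R * R -> R) z :=
  (Num.sqrt (1 + S ^+ 2 * dP z ^+ 2))^-1 * echi S C (dN z) (dP z) (dm z) (ds z) (g1 z) (g2 z).
Local Notation px := (dphi (gansx e1) (gansx e2)).
Local Notation py := (dphi (gansy e1) (gansy e2)).
Local Notation tx := (dgrad (gansx e1) (gansx e2)).
Local Notation ty := (dgrad (gansy e1) (gansy e2)).

Lemma E'_gt0 x : 0 < E' x.
Proof.
by rewrite E'E invr_gt0 mulr_gt0// sqrtr_gt0 ltr_pwDl ?sqr_ge0// mulr_ge0 ?sqr_ge0// addr_ge0 ?sqr_ge0.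
Qed.

Lemma E_mono x y : x < y -> E x < E y.
Proof. exact: C1_increasing CE E'_gt0. Qed.

Lemma E_le x y : (E x <= E y) = (x <= y).
Proof.
apply/idP/idP => h; last by move: h; rewrite le_eqVlt => /orP[/eqP ->//|/E_mono/ltW].
by rewrite leNgt; apply/negP => /E_mono; rewrite ltNge h.
Qed.

Lemma ds_ge0 z : 0 <= ds z. Proof. exact: sqrtr_ge0. Qed.

Lemma dP_ge1 z : 1 <= dP z.
Proof. by have [] := elliptic_bounds C S0 (gans e1 z) (gans e2 z). Qed.

Lemma dN_le1 z : dN z ^+ 2 <= 1.
Proof. by have [] := elliptic_bounds C S0 (gans e1 z) (gans e2 z). Qed.

Lemma ds_sqr z : ds z ^+ 2 = dP z ^+ 2 - 1.
Proof. by rewrite sqr_sqrtr// subr_ge0 exprn_ege1// dP_ge1. Qed.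

Lemma dtau_gt0 z : (0 < dtau z) = (0 < ds z).
Proof. by rewrite !ltNge -{1}E0 /dtau E_le. Qed.

Local Notation Dp := [set z | B2 z /\ 0 < dtau z].

Lemma dm_ds z : Dp z -> C * gans e2 z = S * (dm z * ds z).
Proof.
move=> [_]; rewrite dtau_gt0 => /lt0r_neq0 s0; rewrite /dm.
by field; rewrite s0 lt0r_neq0.
Qed.

Lemma ddelta z : Dp z -> 0 < dP z ^+ 2 - dN z ^+ 2.
Proof.
move=> [_]; rewrite dtau_gt0 => s0; have := dN_le1 z; have := ds_sqr z; have := exprn_gt0 2 s0; lra.
Qed.

Lemma dm_sqr z : Dp z -> dm z ^+ 2 = 1 - dN z ^+ 2.
Proof.
move=> /[dup] Dz [_]; rewrite dtau_gt0 => s0; have s0' := lt0r_neq0 s0.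
have := elliptic_v C S0 (gans e1 z) (gans e2 z); rewrite -/(dP z) -/(dN z) -ds_sqr => E1.
apply: (mulfI (expf_neq0 2 s0')); rewrite -E1 /dm; field.
by rewrite s0' lt0r_neq0.
Qed.

Lemma continuous_dtau z : B2 z -> {for z, continuous dtau}.
Proof.
move=> Bz; apply: (@continuous_comp _ _ _ ds E); last exact: C1_continuous CE _.
apply: (@continuous_comp _ _ _ (fun z => dP z ^+ 2 - 1) Num.sqrt); last exact: sqrt_continuous.
have cP := @continuous_ecosh _ S C _ _ _ _ _ _ (C1on_gans e1) (C1on_gans e2) z Bz.
by apply: cvgB; [apply: cvgM|exact: cvg_cst].
Qed.

Lemma open_Dp : open Dp.
Proof.
rewrite openE => z [Bz tz]; apply: filterI; first by apply: open_nbhs_nbhs; split => //; exact: open_B2.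
by have := continuous_dtau Bz => /cvgr_gt; apply.
Qed.

Let DpB : Dp `<=` B2. Proof. by move=> z []. Qed.

Let C1N : C1on Dp dN (fun z => dm z * px z) (fun z => dm z * py z).
Proof. exact: (@C1on_esin _ S C S0 _ _ _ _ _ _ (C1on_gans e1) (C1on_gans e2) Dp dm ds open_Dp DpB dm_sqr dm_ds ddelta). Qed.

Let C1P : C1on Dp dP (fun z => ds z * elchi S C (gans e1) (gans e2) dm ds (gansx e1) (gansx e2) z)
   (fun z => ds z * elchi S C (gans e1) (gans e2) dm ds (gansy e1) (gansy e2) z).
Proof. exact: (@C1on_ecosh _ S C S0 _ _ _ _ _ _ (C1on_gans e1) (C1on_gans e2) Dp dm ds open_Dp DpB (fun z _ => ds_sqr z) dm_ds ddelta). Qed.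

Let C1s : C1on Dp ds (fun z => dP z * elchi S C (gans e1) (gans e2) dm ds (gansx e1) (gansx e2) z)
   (fun z => dP z * elchi S C (gans e1) (gans e2) dm ds (gansy e1) (gansy e2) z).
Proof.
have h := C1onD (C1onM C1P C1P) (@C1on_cst _ Dp (-1)).
have h0 z : Dp z -> 0 < dP z * dP z + -1.
  by move=> [_]; rewrite dtau_gt0 => s0; rewrite -expr2 -ds_sqr exprn_gt0.
have {}h := @C1on_fun_eq _ _ _ ds _ _ open_Dp (C1on_sqrt h h0) (fun z _ => erefl).
apply: (C1on_eq open_Dp h) => z [_]; rewrite dtau_gt0 => /lt0r_neq0 s0;
  rewrite -expr2 -/(ds z); field; exact: s0.
Qed.

Let C1m : C1on Dp dm (fun z => - dN z * px z) (fun z => - dN z * py z).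
Proof.
apply: (@C1on_em_of_es _ S C S0 _ _ _ _ _ _ (C1on_gans e2) Dp dm ds open_Dp DpB dm_sqr (fun z _ => ds_sqr z) dm_ds ddelta C1s).
by move=> z [_]; rewrite dtau_gt0 => /lt0r_neq0.
Qed.

Let C1t : C1on Dp dtau tx ty.
Proof.
have h := C1on_compC1 C1s CE.
have sP z : Num.sqrt (1 + ds z ^+ 2) = dP z.
  by rewrite ds_sqr addrC subrK sqrtr_sqr ger0_norm// (le_trans ler01)// dP_ge1.
have alg z x : E' (ds z) * (dP z * x) = (Num.sqrt (1 + S ^+ 2 * dP z ^+ 2))^-1 * x.
  rewrite E'E sP ds_sqr [1 + (_ - 1)]addrC subrK invfM.
  have p0 : dP z != 0 by rewrite lt0r_neq0// (lt_le_trans ltr01)// dP_ge1.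
  by rewrite mulrACA mulVf// mul1r.
by apply: (C1on_eq open_Dp h) => z Dz; exact: alg.
Qed.

Lemma frame_gram z : B2 z ->
  [/\ gansx e1 z * gansx e1 z + gansy e1 z * gansy e1 z = conformal z ^+ 2 * (gans e1 z * gans e1 z + 1),
   gansx e2 z * gansx e2 z + gansy e2 z * gansy e2 z = conformal z ^+ 2 * (gans e2 z * gans e2 z + 1),
   gansx e1 z * gansx e2 z + gansy e1 z * gansy e2 z = conformal z ^+ 2 * (gans e1 z * gans e2 z + 0) &
   gansx e1 z * gansy e2 z - gansy e1 z * gansx e2 z = conformal z ^+ 2 * gans e0 z].
Proof.
move=> Bz; have h1 := frame22 e00 e11 e01; have h2 := frame12 e0 e1; rewrite -/e2 in h1 h2.
by split; rewrite ?gans_cross ?gans_dot// ?e11 ?h1 ?h2// /e2 (frame_cross e11 e01).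
Qed.

Lemma domain_norm z : Dp z -> tx z ^+ 2 + ty z ^+ 2 = conformal z ^+ 2 / (S ^+ 2 * (dP z ^+ 2 - dN z ^+ 2)).
Proof.
move=> /[dup] Dz [Bz _]; have [g1 g2 g3 _] := frame_gram Bz.
have q0 : 0 < 1 + S ^+ 2 * dP z ^+ 2 by rewrite ltr_pwDl// mulr_ge0 ?sqr_ge0.
rewrite /dgrad [X in X + _]exprMn [X in _ + X]exprMn -mulrDr
  (echi_norm S0 CS g1 g2 g3 (dm_sqr Dz) (ds_sqr z) (elliptic_u C S0 _ _) (dm_ds Dz) (ddelta Dz)).
rewrite exprVn sqr_sqrtr ?ltW// mulrA mulrA [_^-1 * _ * _]mulrAC -/(dP z) -/(dN z).
by rewrite [_^-1 * (1 + _)]mulVf ?mul1r// lt0r_neq0.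
Qed.

Lemma domain_area z : Dp z -> area tx ty px py z =
  Num.sqrt (1 + S ^+ 2 * dN z ^+ 2) * (tx z ^+ 2 + ty z ^+ 2).
Proof.
move=> /[dup] Dz [Bz _]; have [g1 g2 g3 g4] := frame_gram Bz.
have q0 : 0 < 1 + S ^+ 2 * dP z ^+ 2 by rewrite ltr_pwDl// mulr_ge0 ?sqr_ge0.
have r0 : Num.sqrt (1 + S ^+ 2 * dP z ^+ 2) != 0 by rewrite lt0r_neq0// sqrtr_gt0.
rewrite domain_norm// /area /dphi /dgrad.
have A := ephi_echi C S0 g4 (dm_sqr Dz) (ds_sqr z) (ddelta Dz).
have U := elliptic_u0 C0 CS (dm_sqr Dz) (ds_sqr z) (elliptic_u C S0 _ _) (dm_ds Dz)
  (frame_gans0_sqr e00 e11 e01 Bz) (frame_gans0_gt0 e00 e0p Bz).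
rewrite -/(dP z) -/(dN z) in A U.
set rt := Num.sqrt (1 + S ^+ 2 * dP z ^+ 2) in U r0 *.
transitivity (rt^-1 * (ephi S C (dN z) (dP z) (dm z) (ds z) (gansx e1 z) (gansx e2 z) * echi S C (dN z) (dP z) (dm z) (ds z) (gansy e1 z) (gansy e2 z) -
  ephi S C (dN z) (dP z) (dm z) (ds z) (gansy e1 z) (gansy e2 z) * echi S C (dN z) (dP z) (dm z) (ds z) (gansx e1 z) (gansx e2 z))).
  by ring.
rewrite A U; have d0 := lt0r_neq0 (ddelta Dz); have s0 := lt0r_neq0 S0.
by field; rewrite ?r0 ?d0 ?s0.
Qed.

Lemma domain_chart t : 0 < t -> t < T -> exists r, ring_chart dtau tx ty dN dm px py t r.
Proof.
move=> t0 tT; have [M HM] := ET tT.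
(* By [elliptic_u0], [C] times [gans e0] is a product of two roots; they are bounded by [ds <= M]
   and [dN ^ 2 <= 1]. *)
pose B := Num.sqrt (1 + S ^+ 2 * (1 + M ^+ 2)) * Num.sqrt (1 + S ^+ 2) / C.
have B0 : 0 < B.
  have q1 : 0 < 1 + S ^+ 2 * (1 + M ^+ 2) by rewrite ltr_pwDl// mulr_ge0 ?sqr_ge0// addr_ge0 ?sqr_ge0.
  have q2 : 0 < 1 + S ^+ 2 by rewrite ltr_pwDl// sqr_ge0.
  by rewrite divr_gt0// mulr_gt0 ?sqrtr_gt0.
have [r r1 Hr] := frame_compact e00 e0p B0.
exists r; split => //; [exact: continuous_dtau|..|].
- by move=> z Dz; rewrite dm_sqr// addrC subrK.
- move=> z Dz; rewrite -/(area tx ty px py z) domain_area// mulr_gt0//.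
    by rewrite sqrtr_gt0 ltr_pwDl// mulr_ge0 ?sqr_ge0.
  rewrite domain_norm// divr_gt0//; first by rewrite exprn_gt0// conformal_gt0//; case: Dz.
  by rewrite mulr_gt0 ?exprn_gt0// ddelta.
move=> z Bz tz; apply: Hr => //; have sM := HM _ tz.
have E2 : gans e0 z ^+ 2 <= B ^+ 2.
  have h := frame_gans0_sqr e00 e11 e01 Bz; rewrite -/e2 in h.
  have h2 := elliptic_v C S0 (gans e1 z) (gans e2 z); rewrite -/(dP z) -/(dN z) in h2.
  have h1 := elliptic_u C S0 (gans e1 z) (gans e2 z); rewrite -/(dP z) -/(dN z) in h1.
  have CE2 : C ^+ 2 * gans e0 z ^+ 2 = (1 + S ^+ 2 * dP z ^+ 2) * (1 + S ^+ 2 * dN z ^+ 2).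
    rewrite h; have -> : C ^+ 2 * (1 + gans e1 z ^+ 2 + gans e2 z ^+ 2) = C ^+ 2 * (1 + gans e1 z ^+ 2) + S ^+ 2 * (C * gans e2 z / S) ^+ 2.
      by field; exact: lt0r_neq0.
    by rewrite h2 {1}h1 CS; ring.
  rewrite -(ler_pM2l (exprn_gt0 2 C0)) CE2.
  have -> : C ^+ 2 * B ^+ 2 = (1 + S ^+ 2 * (1 + M ^+ 2)) * (1 + S ^+ 2).
    rewrite /B !exprMn !sqr_sqrtr; [by field; exact: lt0r_neq0|..].
      by rewrite addr_ge0// sqr_ge0.
    by rewrite addr_ge0// mulr_ge0 ?sqr_ge0// addr_ge0 ?sqr_ge0.
  have P2 : dP z ^+ 2 <= 1 + M ^+ 2.
    have := ds_sqr z; have : ds z ^+ 2 <= M ^+ 2 by rewrite ler_pXn2r ?nnegrE ?ds_ge0// (le_trans (ds_ge0 z)).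
    lra.
  have pos x : 0 <= 1 + S ^+ 2 * x ^+ 2 by rewrite addr_ge0// mulr_ge0// sqr_ge0.
  apply: ler_pM => //; first by rewrite lerD2l ler_wpM2l ?sqr_ge0.
  by rewrite lerD2l -[leRHS]mulr1 ler_wpM2l ?sqr_ge0 ?dN_le1.
have g0 := frame_gans0_gt0 e00 e0p Bz.
by rewrite -(@ler_pXn2r _ 2%N) ?nnegrE ?(ltW g0) ?(ltW B0).
Qed.

Lemma E_inverse_continuous (s0 e : R) : 0 < e -> exists2 d : R, 0 < d & forall s : R, `|E s - E s0| < d -> `|s - s0| < e.
Proof.
move=> e0'; pose d := Num.min (E (s0 + e) - E s0) (E s0 - E (s0 - e)).
exists d.
  by rewrite lt_min !subr_gt0; apply/andP; split; apply: E_mono; rewrite ?ltrDl// gtrBl.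
move=> s; rewrite lt_min => /andP[h1 h2]; rewrite ltr_norml; apply/andP; split.
  rewrite ltrBrDl ltNge -E_le -ltNge; have := le_lt_trans (ler_norm _) (eq_ind _ (fun x => x < _) h2 _ (distrC _ _)).
  by rewrite ltrD2l ltrN2.
rewrite ltrBlDl ltNge -E_le -ltNge; have := le_lt_trans (ler_norm _) h1.
by rewrite ltrD2r.
Qed.

Lemma domain_inverse z0 : Dp z0 -> forall e : R, 0 < e -> exists2 d : R, 0 < d &
  forall z, Dp z -> `|dN z - dN z0| < d -> `|dm z - dm z0| < d -> `|dtau z - dtau z0| < d ->
    `|z.1 - z0.1| < e /\ `|z.2 - z0.2| < e.
Proof.
move=> Dz0 e e0'.
(* The explicit inverse, through [u = S cosh chi sin phi] and [C v = S sinh chi cos phi], as a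
   function of sine, cosine and hyperbolic sine. It is continuous everywhere. *)
pose G (q : R * R * R) : R * R :=
  gpoint e0 e1 (S * Num.sqrt (1 + q.2 ^+ 2) * q.1.1) (S * (q.1.2 * q.2) / C).
have GE z : Dp z -> G (dN z, dm z, ds z) = z.
  move=> Dz; have [Bz _] := Dz; rewrite /G /=.
  have -> : Num.sqrt (1 + ds z ^+ 2) = dP z.
    by rewrite ds_sqr addrC subrK sqrtr_sqr ger0_norm// (le_trans ler01)// dP_ge1.
  rewrite -(dm_ds Dz) -(elliptic_u C S0 (gans e1 z) (gans e2 z)) mulrAC divff ?mul1r ?lt0r_neq0//.
  exact: (gpointK e00 e11 e01 e0p Bz).
have Gc (q : R * R * R) : {for q, continuous G}.
  have c1 : {for q, continuous (fun q : R * R * R => q.1.1)}.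
    by apply: (@continuous_comp _ _ _ fst fst); exact: cvg_fst.
  have c2 : {for q, continuous (fun q : R * R * R => q.1.2)}.
    by apply: (@continuous_comp _ _ _ fst snd); [exact: cvg_fst|exact: cvg_snd].
  have c3 : {for q, continuous (fun q : R * R * R => q.2)} by exact: cvg_snd.
  apply: (continuous_gpoint e00 e11 e01 e0p).
    apply: cvgM => //; apply: cvgM; first exact: cvg_cst.
    apply: (@continuous_comp _ _ _ (fun q : R * R * R => 1 + q.2 ^+ 2) Num.sqrt); last exact: sqrt_continuous.
    by apply: cvgD; [exact: cvg_cst|apply: cvgM].
  by apply: cvgM; [apply: cvgM; [exact: cvg_cst|apply: cvgM]|exact: cvg_cst].
pose q0 := (dN z0, dm z0, ds z0).
have /nbhs_ballP[d1 d10 H] : \forall q \near q0, `|(G q).1 - (G q0).1| < e /\ `|(G q).2 - (G q0).2| < e.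
  have k1 : {for q0, continuous (fun q => (G q).1)} by apply: (@continuous_comp _ _ _ G fst); [exact: Gc|exact: cvg_fst].
  have k2 : {for q0, continuous (fun q => (G q).2)} by apply: (@continuous_comp _ _ _ G snd); [exact: Gc|exact: cvg_snd].
  move/cvgrPdist_lt : k1 => /(_ _ e0') k1; move/cvgrPdist_lt : k2 => /(_ _ e0') k2.
  by near=> q; split; rewrite distrC; near: q.
have [d2 d20 H2] := E_inverse_continuous (ds z0) d10.
exists (Num.min d1 d2); first by rewrite lt_min d10 d20.
move=> z Dz; rewrite !lt_min => /andP[hN _] /andP[hm _] /andP[_ ht].
have := H (dN z, dm z, ds z); rewrite /q0 !GE//; apply; split; first split; rewrite /= /ball /= distrC//.
exact: H2.
Unshelve. all: by end_near.
Qed.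

Lemma domain_grad_area z : Dp z ->
  tx z ^+ 2 + ty z ^+ 2 = (Num.sqrt (1 + S ^+ 2 * sin (angle (dN z) (dm z)) ^+ 2))^-1 * area tx ty px py z.
Proof.
move=> Dz; have nm : dN z ^+ 2 + dm z ^+ 2 = 1 by rewrite dm_sqr// addrC subrK.
have [-> _ _] := angleP nm; rewrite domain_area// mulKf// lt0r_neq0// sqrtr_gt0.
by rewrite ltr_pwDl// mulr_ge0 ?sqr_ge0.
Qed.

Lemma domain_slit u : `|u| <= S -> dtau (gpoint e0 e1 u 0) = 0.
Proof.
move=> uS; rewrite /dtau /ds /dP (gans1_gpoint e00 e11 e01 e0p) (gans2_gpoint e00 e11 e01 e0p).
by rewrite (ecosh_segment C S0 uS) expr1n subrr sqrtr0.
Qed.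

End DomainChart.

(** * The disc slit along the two outer rays *)

Section TargetChart.
Variable R : realType.
Local Notation B2 := (@B2 R).
Variables (e0 e1 : R * R * R).
Hypothesis e00 : lorentz e0 e0 = -1.
Hypothesis e11 : lorentz e1 e1 = 1.
Hypothesis e01 : lorentz e1 e0 = 0.
Hypothesis e0p : (0 : R) < e0.1.1.
Let e2 := lcross e1 e0.
Variables (S C : R).
Hypothesis S0 : (0 : R) < S.
Hypothesis C0 : (0 : R) < C.
Hypothesis CS : C ^+ 2 = 1 + S ^+ 2.
Variables (q d : R).
Hypothesis q0 : (0 : R) < q.
Hypothesis d0 : (0 : R) < d.
Hypothesis qd1 : q + 2 * d < 1.
Variables (k : R) (T T' H H' : R -> R).
Hypothesis k0 : 0 <= k.
Hypothesis CT : C1 T T'.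
Hypothesis T'E : forall x, T' x = k * (1 + T x ^+ 2) * (Num.sqrt (1 + x ^+ 2) * Num.sqrt (1 + S ^+ 2 * (1 + x ^+ 2)))^-1.
Let step (a x : R) := smoothstep ((x - a) / d).
Let step' (a x : R) := smoothstep' ((x - a) / d) / d.
Hypothesis CH : C1 H H'.
Hypothesis H'E : forall n, H' n = (1 - step q (n ^+ 2)) / (Num.sqrt (1 - n ^+ 2) * Num.sqrt (1 + S ^+ 2 * n ^+ 2)).

Local Notation N := (dN e0 e1 S C).
Local Notation P := (dP e0 e1 S C).
(** The signs are distributed the other way round than on the domain: here the cosine is nonnegative
    and the hyperbolic sine [s] takes both signs, because the slits are the rays where the cosine
    vanishes. *)
Let m z := Num.sqrt (1 - N z ^+ 2).
Let s z := C / S * gans e2 z * (m z)^-1.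
Let D := [set z | B2 z /\ N z ^+ 2 < 1].
Let phi (g1 g2 : R * R -> R) z := elphi S C (gans e1) (gans e2) m s g1 g2 z.
Let chi (g1 g2 : R * R -> R) z := elchi S C (gans e1) (gans e2) m s g1 g2 z.
Let phix := phi (gansx e1) (gansx e2).
Let phiy := phi (gansy e1) (gansy e2).
Let chix := chi (gansx e1) (gansx e2).
Let chiy := chi (gansy e1) (gansy e2).

Let qd_lt1 : q + d < 1. Proof. by have := d0; have := qd1; lra. Qed.

Let cN z : B2 z -> {for z, continuous N}.
Proof. exact: (@continuous_esin _ S C _ _ _ _ _ _ (C1on_gans e1) (C1on_gans e2)). Qed.

Let oNlt (c : R) : open [set z | B2 z /\ N z ^+ 2 < c].
Proof.
rewrite openE => z [Bz tz]; apply: filterI; first by apply: open_nbhs_nbhs; split => //; exact: open_B2.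
have c2 : {for z, continuous (fun z => N z ^+ 2)} by apply: cvgM; exact: cN.
by move/cvgr_lt : c2; apply.
Qed.

Let oNgt (e c : R) : open [set z | B2 z /\ c < N z ^+ 2 /\ 0 < e * N z].
Proof.
rewrite openE => z [Bz [tz pz]]; apply: filterI; first by apply: open_nbhs_nbhs; split => //; exact: open_B2.
have c2 : {for z, continuous (fun z => N z ^+ 2)} by apply: cvgM; exact: cN.
have c3 : {for z, continuous (fun z => e * N z)} by apply: cvgM; [exact: cvg_cst|exact: cN].
by apply: filterI; [move/cvgr_gt : c2; apply|move/cvgr_gt : c3; apply].
Qed.

Let DB : D `<=` B2. Proof. by move=> z []. Qed.

Let m_gt0 z : D z -> 0 < m z.
Proof. by move=> [_ h]; rewrite sqrtr_gt0 subr_gt0. Qed.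

Let m2 z : D z -> m z ^+ 2 = 1 - N z ^+ 2.
Proof. by move=> [_ h]; rewrite sqr_sqrtr// subr_ge0 ltW. Qed.

Let ms z : D z -> C * gans e2 z = S * (m z * s z).
Proof. by move=> /m_gt0 h; rewrite /s; field; rewrite !lt0r_neq0. Qed.

Let s2 z : D z -> s z ^+ 2 = P z ^+ 2 - 1.
Proof.
move=> Dz; have m0 := m_gt0 Dz.
have := elliptic_v C S0 (gans e1 z) (gans e2 z); rewrite -/(dP e0 e1 S C z) -/(dN e0 e1 S C z) -(m2 Dz) => E1.
apply: (mulIf (expf_neq0 2 (lt0r_neq0 m0))); rewrite -E1 /s; field.
by rewrite !lt0r_neq0.
Qed.

Let delta z : D z -> 0 < P z ^+ 2 - N z ^+ 2.
Proof.
move=> [_ h]; rewrite subr_gt0; apply: (lt_le_trans h).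
by rewrite exprn_ege1//; have [] := elliptic_bounds C S0 (gans e1 z) (gans e2 z).
Qed.

Let C1N : C1on D N (fun z => m z * phix z) (fun z => m z * phiy z).
Proof. exact: (@C1on_esin _ S C S0 _ _ _ _ _ _ (C1on_gans e1) (C1on_gans e2) D m s (@oNlt 1) DB m2 ms delta). Qed.

Let C1m : C1on D m (fun z => - N z * phix z) (fun z => - N z * phiy z).
Proof.
have h := C1onD (@C1on_cst _ D 1) (C1onM (@C1on_cst _ D (-1)) (C1onM C1N C1N)).
have h0 z : D z -> 0 < 1 + -1 * (N z * N z) by move=> [_]; rewrite mulN1r -expr2 subr_gt0.
have {}h := @C1on_fun_eq _ _ _ m _ _ (@oNlt 1) (C1on_sqrt h h0) _.
apply: (C1on_eq (@oNlt 1) (h _)) => z Dz; do ?[by rewrite mulN1r -expr2];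
  rewrite mulN1r -expr2 -/(m z); field; exact: lt0r_neq0 (m_gt0 Dz).
Qed.

Let C1s : C1on D s (fun z => P z * chix z) (fun z => P z * chiy z).
Proof.
apply: (@C1on_es_of_em _ S C S0 _ _ _ _ _ _ (C1on_gans e2) D m s (@oNlt 1) DB m2 s2 ms delta C1m).
by move=> z /m_gt0/lt0r_neq0.
Qed.

(* [(tg, tw)] is a cutoff of [(X, tan (k Y))], where [X + i Y] is the conformal
   elliptic coordinate of the plane slit along the two rays [dN = +-1]. *)
Definition tg z := H (N z).
Definition tgx z := H' (N z) * (m z * phix z).
Definition tgy z := H' (N z) * (m z * phiy z).
Definition tw z := (1 - step (q + d) (N z ^+ 2)) * T (s z).
Definition twD (a b : R) z := (1 - step (q + d) (N z ^+ 2)) * (T' (s z) * (P z * b))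
  - T (s z) * (step' (q + d) (N z ^+ 2) * (2 * N z * (m z * a))).
Definition twx z := twD (phix z) (chix z) z.
Definition twy z := twD (phiy z) (chiy z) z.

Let H'0 n : q + d <= n ^+ 2 -> H' n = 0.
Proof. by move=> h; rewrite H'E /step (smoothstep_hi d0 h).1 subrr mul0r. Qed.

Let H_end n1 n2 : n1 <= n2 -> (forall n, n1 <= n <= n2 -> q + d <= n ^+ 2) -> H n1 = H n2.
Proof.
move=> n12 h; apply/esym/eqP; rewrite -subr_eq0; apply/eqP.
have hc x : n1 <= x <= n2 -> is_derive x 1 (fun=> 0 : R) (H' x).
  by move=> hx; rewrite H'0 ?h//; exact: is_derive_cst.
by rewrite (increment_eq n12 (fun x _ => (CH x).1) hc) subrr.
Qed.

Let Ncase z : N z ^+ 2 <= 1.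
Proof. by have [] := elliptic_bounds C S0 (gans e1 z) (gans e2 z). Qed.

(** Beyond [q + d] the derivative of [H] is zero, so [tg] is constant near each ray, with the value
    of [H] at that end; [e] is the sign of [N]. *)
Lemma tg_ray e z : B2 z -> q + d < N z ^+ 2 -> 0 < e * N z -> e ^+ 2 = 1 -> tg z = H e.
Proof.
move=> Bz qN eN e2'; rewrite /tg.
have h1 := Ncase z; have qd0 := addr_gt0 q0 d0.
have [e1'|e1'] : e = 1 \/ e = -1.
- by move/eqP : e2'; rewrite sqrf_eq1 => /orP[]/eqP; [left|right].
- rewrite e1' mul1r in eN *; apply: H_end; first by rewrite -(@ler_pXn2r _ 2%N) ?nnegrE ?(ltW eN)// expr1n.
  move=> n /andP[a _]; apply: (le_trans (ltW qN)).
  by rewrite ler_pXn2r ?nnegrE ?(ltW eN) ?(le_trans (ltW eN) a).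
rewrite e1' mulN1r in eN *; apply/esym/H_end.
  by rewrite lerNl -(@ler_pXn2r _ 2%N) ?nnegrE ?(ltW eN)// expr1n sqrrN.
move=> n /andP[_ a]; apply: (le_trans (ltW qN)).
rewrite -(sqrrN (N z)) -(sqrrN n) ler_pXn2r ?nnegrE ?(ltW eN)// ?lerN2//.
by rewrite (le_trans (ltW eN))// lerN2.
Qed.

Lemma C1on_tg : C1on B2 tg tgx tgy.
Proof.
have h := C1on_compC1 C1N CH.
have hE e : e ^+ 2 = 1 -> forall z, [set z | B2 z /\ q + d < N z ^+ 2 /\ 0 < e * N z] z -> [/\ tg z = H e, tgx z = 0 & tgy z = 0].
  by move=> e2' z [Bz [qN eN]]; rewrite /tgx /tgy (H'0 (ltW qN)) !mul0r; split => //; exact: tg_ray eN e2'.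
have h1 := @C1on_glue _ _ _ _ _ _ _ _ (@oNgt 1 (q + d)) h (hE 1 (expr1n _ _)) (fun z => id).
apply: (C1on_glue (@oNgt (-1) (q + d)) h1 (hE (-1) _)); first by rewrite sqrrN expr1n.
move=> z Bz; have [N1|N1] := ltP (N z ^+ 2) 1; first by left; left.
have qN : q + d < N z ^+ 2 by exact: lt_le_trans N1.
have [np|nn|n0] := ltgtP (N z) 0.
- by right; split => //; split => //; rewrite mulN1r oppr_gt0.
- by left; right; split => //; split => //; rewrite mul1r.
- by move: N1; rewrite n0 expr0n /= ler10.
Qed.

Lemma C1on_tw : C1on B2 tw twx twy.
Proof.
have hT := C1on_compC1 C1s CT.
have hz := C1on_compC1 (C1onM C1N C1N) (C1_affine_comp (q + d) d (@C1_smoothstep R)).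
have h := C1onM (C1onD (@C1on_cst _ D 1) (C1onM (@C1on_cst _ D (-1)) hz)) hT.
have {}h : C1on D tw twx twy.
  apply: (@C1on_fun_eq _ D (fun z => (1 + -1 * smoothstep ((N z * N z - (q + d)) / d)) * T (s z)) tw twx twy (@oNlt 1)); last first.
    by move=> z _; rewrite /tw /step expr2 mulN1r.
  by apply: (C1on_eq (@oNlt 1) h) => z Dz; rewrite /twx /twy /twD /step /step' expr2; ring.
have oE : open [set z | B2 z /\ q + 2 * d < N z ^+ 2].
  rewrite openE => z [Bz tz]; apply: filterI; first by apply: open_nbhs_nbhs; split => //; exact: open_B2.
  have c2 : {for z, continuous (fun z => N z ^+ 2)} by apply: cvgM; exact: cN.
  by move/cvgr_gt : c2; apply.
apply: (@C1on_glue _ _ _ _ _ _ _ 0 oE h).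
  move=> z [Bz hq]; have hq' : q + d + d <= N z ^+ 2 by rewrite -addrA -mulr2n -mulr_natl ltW.
  have [a b] := smoothstep_hi d0 hq'.
  by rewrite /tw /twx /twy /twD /step /step' a b subrr !mul0r mulr0 subrr.
move=> z Bz; have [N1|N1] := ltP (N z ^+ 2) 1; first by left.
by right; split => //; exact: lt_le_trans N1.
Qed.

(** The two cutoffs are staggered: where [tw] is cut off, [tg] already has zero gradient. Elsewhere
    the equation for [T'] turns conformality of the coordinates into an equality with
    [k (1 + tw ^ 2)], and a cutoff [eta] in [H'] only improves it, as [eta ^ 2 <= eta]. *)
Lemma target_pointwise z : B2 z ->
  k * (1 + tw z ^+ 2) * (tgx z ^+ 2 + tgy z ^+ 2) <= tgx z * twy z - tgy z * twx z.
Proof.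
move=> Bz; have [qN|Nq] := leP (q + d) (N z ^+ 2).
  by rewrite /tgx /tgy (H'0 qN) !mul0r expr0n /= addr0 mulr0 subrr.
have Dz : D z by split => //; exact: lt_trans qd_lt1.
have [sl1 sl2] := smoothstep_lo d0 (ltW Nq).
have m0 := m_gt0 Dz; have mE : m z = Num.sqrt (1 - N z ^+ 2) by [].
have P1 : 1 <= P z by have [] := elliptic_bounds C S0 (gans e1 z) (gans e2 z).
have Pp : 0 < P z by exact: lt_le_trans P1.
have rP0 : 0 < Num.sqrt (1 + S ^+ 2 * P z ^+ 2) by rewrite sqrtr_gt0 ltr_pwDl// mulr_ge0 ?sqr_ge0.
have rN0' : 0 < 1 + S ^+ 2 * N z ^+ 2 by rewrite ltr_pwDl// mulr_ge0 ?sqr_ge0.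
have rN0 : 0 < Num.sqrt (1 + S ^+ 2 * N z ^+ 2) by rewrite sqrtr_gt0.
have rNE : Num.sqrt (1 + S ^+ 2 * N z ^+ 2) ^+ 2 = 1 + S ^+ 2 * N z ^+ 2 by rewrite sqr_sqrtr ?ltW.
have sP : Num.sqrt (1 + s z ^+ 2) = P z by rewrite s2// addrC subrK sqrtr_sqr gtr0_norm.
have twE : tw z = T (s z) by rewrite /tw /step sl1 subr0 mul1r.
have twDE a b : twD a b z = k * (1 + tw z ^+ 2) / Num.sqrt (1 + S ^+ 2 * P z ^+ 2) * b.
  rewrite /twD /step /step' sl1 sl2 twE T'E sP s2// [1 + (_ - 1)]addrC subrK mul0r mulr0 !subr0 mul1r.
  by field; rewrite !lt0r_neq0.
have H'zE : H' (N z) * m z = (1 - step q (N z ^+ 2)) / Num.sqrt (1 + S ^+ 2 * N z ^+ 2).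
  by rewrite H'E -mE; field; rewrite !lt0r_neq0.
have [g1 g2 g3 g4] := frame_gram e00 e11 e01 Bz.
have nphi := ephi_norm S0 CS g1 g2 g3 (m2 Dz) (s2 Dz) (elliptic_u C S0 _ _) (ms Dz) (delta Dz).
have A := ephi_echi C S0 g4 (m2 Dz) (s2 Dz) (delta Dz).
have U := elliptic_u0 C0 CS (m2 Dz) (s2 Dz) (elliptic_u C S0 _ _) (ms Dz)
  (frame_gans0_sqr e00 e11 e01 Bz) (frame_gans0_gt0 e00 e0p Bz).
rewrite /twx /twy !twDE /tgx /tgy [H' _ * (_ * phix _)]mulrA [H' _ * (_ * phiy _)]mulrA H'zE.
have eta01 : 0 <= 1 - step q (N z ^+ 2) <= 1.
  by have /andP[a b] := smoothstep_in ((N z ^+ 2 - q) / d); rewrite /step subr_ge0 b/= gerBl.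
move: eta01 nphi A U; rewrite -/(phix z) -/(phiy z) -/(chix z) -/(chiy z).
have -> : ephi S C (N z) (P z) (m z) (s z) (gansx e1 z) (gansx e2 z) = phix z by [].
have -> : ephi S C (N z) (P z) (m z) (s z) (gansy e1 z) (gansy e2 z) = phiy z by [].
have -> : echi S C (N z) (P z) (m z) (s z) (gansx e1 z) (gansx e2 z) = chix z by [].
have -> : echi S C (N z) (P z) (m z) (s z) (gansy e1 z) (gansy e2 z) = chiy z by [].
rewrite -/(dN e0 e1 S C z) -/(dP e0 e1 S C z).
move: (1 - step q (N z ^+ 2)) (phix z) (phiy z) (chix z) (chiy z) rN0 rP0 rNE (delta Dz).
set rN := Num.sqrt (1 + S ^+ 2 * N z ^+ 2); set rP := Num.sqrt (1 + S ^+ 2 * P z ^+ 2).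
set kw := k * (1 + tw z ^+ 2); have kw0 : 0 <= kw by rewrite mulr_ge0// addr_ge0 ?sqr_ge0.
set Q := P z ^+ 2 - N z ^+ 2; set l := conformal z; set u0 := gans e0 z.
move: rN rP kw kw0 Q l u0 => rN rP kw kw0 Q l u0 eta a1 a2 b1 b2 rN0'' rP0' rE Q0 /andP[eta0 eta1] nphi A U.
have -> : kw * ((eta / rN * a1) ^+ 2 + (eta / rN * a2) ^+ 2) = kw * eta ^+ 2 * l ^+ 2 / (S ^+ 2 * Q).
  transitivity (kw * eta ^+ 2 / rN ^+ 2 * (a1 ^+ 2 + a2 ^+ 2)); first by field; exact: lt0r_neq0.
  by rewrite nphi -rE; field; rewrite !lt0r_neq0.
have -> : eta / rN * a1 * (kw / rP * b2) - eta / rN * a2 * (kw / rP * b1) = kw * eta * l ^+ 2 / (S ^+ 2 * Q).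
  transitivity (kw * eta / (rN * rP) * (a1 * b2 - a2 * b1)); first by field; rewrite !lt0r_neq0.
  by rewrite A U; field; rewrite !lt0r_neq0.
have iQ : 0 <= (S ^+ 2 * Q)^-1 by rewrite invr_ge0; apply: mulr_ge0; [exact: sqr_ge0|exact: ltW].
apply: (ler_wpM2r iQ); apply: (ler_wpM2r (sqr_ge0 l)); apply: (ler_wpM2l kw0).
by rewrite expr2 -[leRHS]mulr1 ler_wpM2l.
Qed.

End TargetChart.

(** * Elliptic integrals *)

Section AgmIntegral.
Variable R : realType.

Definition agm_weight (a b x : R) := (Num.sqrt (a ^+ 2 * cos x ^+ 2 + b ^+ 2 * sin x ^+ 2))^-1.

(** The incomplete elliptic integral from 0, introduced as a primitive so that identities between
    such integrals follow by differentiation and [agmP_unique]. *)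
Definition agmP (a b : R) : R -> R := xget (fun=> 0) [set F | C1 F (agm_weight a b) /\ F 0 = 0].

Definition agmI a b := agmP a b (pi / 2).

Section Positive.
Variables a b : R.
Hypothesis a0 : 0 < a.
Hypothesis b0 : 0 < b.

Lemma agm_rad_gt0 x : 0 < a ^+ 2 * cos x ^+ 2 + b ^+ 2 * sin x ^+ 2.
Proof.
have a2 := exprn_gt0 2 a0; have b2 := exprn_gt0 2 b0; have cs := cos2Dsin2 x.
have [c0|c0] := eqVneq (cos x) 0.
  by rewrite c0 expr0n /= mulr0 add0r mulr_gt0//; move: cs; rewrite c0 expr0n /= add0r => ->.
apply: ltr_wpDr; first by apply: mulr_ge0; exact: sqr_ge0.
by apply: mulr_gt0 => //; rewrite exprn_even_gt0.
Qed.

Lemma agm_weight_gt0 x : 0 < agm_weight a b x.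
Proof. by rewrite invr_gt0 sqrtr_gt0 agm_rad_gt0. Qed.

Lemma continuous_agm_weight : continuous (agm_weight a b).
Proof.
move=> x; apply: cvgV; first by rewrite lt0r_neq0// sqrtr_gt0 agm_rad_gt0.
apply: (@continuous_comp _ _ _ (fun x => a ^+ 2 * cos x ^+ 2 + b ^+ 2 * sin x ^+ 2) Num.sqrt); last exact: sqrt_continuous.
by apply: cvgD; apply: cvgM; [exact: cvg_cst|apply: cvgM; exact: continuous_cos|exact: cvg_cst|apply: cvgM; exact: continuous_sin].
Qed.

Lemma agmP_spec : C1 (agmP a b) (agm_weight a b) /\ agmP a b 0 = 0.
Proof.
have [F CF F0] := primitive_ex continuous_agm_weight.
by rewrite /agmP; case: xgetP => [G _ []//|/(_ F)]; case.
Qed.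

Lemma C1_agmP : C1 (agmP a b) (agm_weight a b). Proof. by case: agmP_spec. Qed.
Lemma agmP0 : agmP a b 0 = 0. Proof. by case: agmP_spec. Qed.

Lemma agmP_lt x y : x < y -> agmP a b x < agmP a b y.
Proof. exact: C1_increasing C1_agmP agm_weight_gt0. Qed.

Lemma agmP_unique (F : R -> R) (x : R) : (forall y : R, is_derive y 1 F (agm_weight a b y)) -> F 0 = 0 -> agmP a b x = F x.
Proof.
move=> dF F0; have [x0|x0] := leP 0 x.
  have := increment_eq x0 (fun y _ => (C1_agmP y).1) (fun y _ => dF y).
  by rewrite agmP0 F0 !subr0.
have := increment_eq (ltW x0) (fun y _ => (C1_agmP y).1) (fun y _ => dF y).
by rewrite agmP0 F0 !sub0r => /oppr_inj.
Qed.

Lemma agmPN x : agmP a b (- x) = - agmP a b x.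
Proof.
suff -> : agmP a b x = - agmP a b (- x) by rewrite opprK.
apply: (@agmP_unique (fun y => - agmP a b (- y))); last by rewrite !oppr0 agmP0 oppr0.
move=> y; have h : is_derive (- y) 1 (agmP a b) (agm_weight a b y).
  by have := (C1_agmP (- y)).1; rewrite /agm_weight cosN sinN sqrrN.
have hn : is_derive y 1 (fun y : R => - y) (-1) by apply: is_deriveNid.
have := is_deriveN (@is_derive1_comp _ (agmP a b) (fun y => - y) y _ _ h hn).
by rewrite mulrN1 opprK.
Qed.

Lemma agmPDpi x : agmP a b (x + pi) = agmP a b x + agmP a b pi.
Proof.
apply/eqP; rewrite -subr_eq; apply/eqP; symmetry.
apply: (@agmP_unique (fun y => agmP a b (y + pi) - agmP a b pi)); last by rewrite add0r subrr.
move=> y; have h : is_derive (y + pi) 1 (agmP a b) (agm_weight a b y).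
  by have := (C1_agmP (y + pi)).1; rewrite /agm_weight cosDpi sinDpi !sqrrN.
have hn : is_derive y 1 (fun y : R => y + pi) 1 by apply: is_derive_eq; rewrite addr0.
have := is_deriveB (@is_derive1_comp _ (agmP a b) (fun y => y + pi) y _ _ h hn) (is_derive_cst (agmP a b pi) y 1).
by rewrite subr0 mulr1.
Qed.

Lemma agmP_pi : agmP a b pi = 2 * agmI a b.
Proof.
have := agmPDpi (- (pi / 2)); rewrite agmPN -/(agmI a b) (_ : - (pi / 2) + pi = pi / 2); last by field.
by rewrite -/(agmI a b); lra.
Qed.

Lemma agmP_2pi : agmP a b (2 * pi) = 4 * agmI a b.
Proof. by rewrite mulr_natl mulr2n agmPDpi agmP_pi; ring. Qed.

Lemma agmI_gt0 : 0 < agmI a b.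
Proof. by rewrite /agmI -agmP0 agmP_lt// divr_gt0 ?pi_gt0. Qed.

Lemma agmP_near e : 0 < e -> exists t, [/\ 0 < t, t < pi / 2 & agmI a b - e < agmP a b t].
Proof.
move=> e0; have p0 : 0 < (pi : R) / 2 by rewrite divr_gt0 ?pi_gt0.
have c : {for (pi / 2 : R), continuous (agmP a b)} by exact: (C1_continuous C1_agmP).
have /nbhs_ballP[d d0 hd] : \forall t \near (pi / 2 : R), agmI a b - e < agmP a b t.
  by move/cvgr_gt : c; apply; rewrite gtrBl.
have d0' : 0 < d := d0.
pose t := Num.max (pi / 4) (pi / 2 - d / 2).
have pp := pi_gt0 R.
have t1 : t < pi / 2 by rewrite gt_max; apply/andP; split; lra.
have t2 : pi / 2 - d / 2 <= t by rewrite le_max lexx orbT.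
have t3 : pi / 4 <= t by rewrite le_max lexx.
exists t; split => //; first by apply: lt_le_trans t3; rewrite divr_gt0.
by apply: hd; rewrite /ball /= ger0_norm; lra.
Qed.

End Positive.
End AgmIntegral.

(** * The coordinate across the strip *)

Section ArcCoordinate.
Variable R : realType.
Variables (S C : R).
Hypothesis S0 : (0 : R) < S.
Hypothesis C0 : (0 : R) < C.
Hypothesis CS : C ^+ 2 = 1 + S ^+ 2.

(** The substitution [x = tan y] turns [arcE' x dx] into [agm_weight C S y dy]. The values of [arcE]
    hence stay strictly between plus and minus the complete integral [agmI C S]. *)
Definition arcE x := agmP C S (atan x).
Definition arcE' x := (Num.sqrt (1 + x ^+ 2) * Num.sqrt (1 + S ^+ 2 * (1 + x ^+ 2)))^-1.
(** The factor stretches the range of [arcE] to the interval of length [pi] on which the tangent is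
    defined; [arcT] satisfies the differential equation required of [T] in the target chart. *)
Definition arcT x := tan (pi / (2 * agmI C S) * arcE x).
Definition arcT' x := pi / (2 * agmI C S) * (1 + arcT x ^+ 2) * arcE' x.

Lemma arc_weight x : agm_weight C S (atan x) * (1 + x ^+ 2)^-1 = arcE' x.
Proof.
have p : 0 < 1 + x ^+ 2 by rewrite ltr_pwDl ?sqr_ge0.
have p2 : 0 < 1 + S ^+ 2 * (1 + x ^+ 2) by rewrite ltr_pwDl// mulr_ge0 ?sqr_ge0 ?ltW.
have r0 : 0 < Num.sqrt (1 + x ^+ 2) by rewrite sqrtr_gt0.
have r2 : 0 < Num.sqrt (1 + S ^+ 2 * (1 + x ^+ 2)) by rewrite sqrtr_gt0.
have rE : Num.sqrt (1 + x ^+ 2) ^+ 2 = 1 + x ^+ 2 by rewrite sqr_sqrtr ?ltW.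
rewrite /agm_weight /arcE' sin2cos2 cos_atan exprVn rE.
have -> : C ^+ 2 / (1 + x ^+ 2) + S ^+ 2 * (1 - (1 + x ^+ 2)^-1) = (1 + S ^+ 2 * (1 + x ^+ 2)) / (1 + x ^+ 2).
  by rewrite CS; field; exact: lt0r_neq0.
rewrite sqrtrM ?ltW// sqrtrV ?ltW// -[X in _ / X = _]rE.
by field; rewrite !lt0r_neq0.
Qed.

Lemma C1_arcE : C1 arcE arcE'.
Proof.
move=> x; split.
  have := @is_derive1_comp _ (agmP C S) atan x _ _ (C1_agmP C0 S0 (atan x)).1 (is_derive1_atan x).
  by rewrite arc_weight.
have p t : 0 < 1 + (t : R) ^+ 2 by rewrite ltr_pwDl ?sqr_ge0.
have p2 t : 0 < 1 + S ^+ 2 * (1 + (t : R) ^+ 2) by rewrite ltr_pwDl// mulr_ge0 ?sqr_ge0 ?ltW.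
have c1 : {for x, continuous (fun x : R => 1 + x ^+ 2)}.
  by apply: cvgD; [exact: cvg_cst|apply: cvgM; exact: cvg_id].
have c2 : {for x, continuous (fun x : R => 1 + S ^+ 2 * (1 + x ^+ 2))}.
  by apply: cvgD; [exact: cvg_cst|apply: cvgM; [exact: cvg_cst|]].
have c3 : {for x, continuous (fun x : R => Num.sqrt (1 + x ^+ 2))}.
  by apply: (@continuous_comp _ _ _ (fun x : R => 1 + x ^+ 2) Num.sqrt); last exact: sqrt_continuous.
have c4 : {for x, continuous (fun x : R => Num.sqrt (1 + S ^+ 2 * (1 + x ^+ 2)))}.
  by apply: (@continuous_comp _ _ _ (fun x : R => 1 + S ^+ 2 * (1 + x ^+ 2)) Num.sqrt); last exact: sqrt_continuous.
by apply: cvgV; [rewrite mulf_neq0// lt0r_neq0// sqrtr_gt0|apply: cvgM].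
Qed.

Lemma arcE0 : arcE 0 = 0. Proof. by rewrite /arcE atan0 agmP0. Qed.

Lemma arcE_bound x : `|arcE x| < agmI C S.
Proof.
rewrite ltr_norml /arcE -(agmPN C0 S0); apply/andP; split; apply: (agmP_lt C0 S0);
  by rewrite ?atan_gtNpi2 ?atan_ltpi2.
Qed.

Lemma arcE_le t : t < agmI C S -> exists M, forall x, arcE x <= t -> x <= M.
Proof.
move=> tI; have [y [y0 y1 hy]] := agmP_near C0 S0 (ltac:(by rewrite subr_gt0) : 0 < agmI C S - t).
exists (tan y) => x xt; rewrite leNgt; apply/negP => yx.
have : y < atan x.
  rewrite -(@tanK _ y); first exact: lt_atan.
  by rewrite in_itv /= y1 andbT (lt_trans _ y0)// oppr_lt0 divr_gt0 ?pi_gt0.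
by move/(agmP_lt C0 S0); rewrite -/(arcE x) ltNge (le_trans xt)// ltW// (le_lt_trans _ hy)// opprB addrC subrK.
Qed.

Lemma C1_arcT : C1 arcT arcT'.
Proof.
have I0 := agmI_gt0 C0 S0; have pp := pi_gt0 R.
have cpos (x : R) : 0 < cos (pi / (2 * agmI C S) * arcE x).
  apply: cos_gt0_pihalf; have := arcE_bound x; rewrite ltr_norml => /andP[h1 h2].
  have E2 : (pi : R) / 2 = pi / (2 * agmI C S) * agmI C S by field; exact: lt0r_neq0.
  have k0 : 0 < pi / (2 * agmI C S) by rewrite divr_gt0// mulr_gt0.
  by rewrite E2 -mulrN !ltr_pM2l// h1.
have dT (x : R) : is_derive x 1 arcT (arcT' x).
  have d1 : is_derive x 1 (fun x : R => pi / (2 * agmI C S) * arcE x) (pi / (2 * agmI C S) * arcE' x).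
    have [dE _] := C1_arcE x; exact: is_deriveZ.
  have c0 := lt0r_neq0 (cpos x).
  have := @is_derive1_comp _ tan (fun x : R => pi / (2 * agmI C S) * arcE x) x _ _ (is_derive_tan c0) d1.
  rewrite mulrA [X in X * arcE' x]mulrC; congr is_derive.
  rewrite /arcT' /arcT /tan; congr (_ * _ * _); have := cos2Dsin2 (pi / (2 * agmI C S) * arcE x) => cs.
  by transitivity ((cos (pi / (2 * agmI C S) * arcE x) ^+ 2 + sin (pi / (2 * agmI C S) * arcE x) ^+ 2) / cos (pi / (2 * agmI C S) * arcE x) ^+ 2); [rewrite cs mul1r|field].
move=> x; split => //.
have cT : {for x, continuous arcT} by apply/differentiable_continuous/derivable1_diffP; case: (dT x).
apply: cvgM; last by have [] := C1_arcE x.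
apply: cvgM; first exact: cvg_cst.
by apply: cvgD; [exact: cvg_cst|apply: cvgM].
Qed.

End ArcCoordinate.

(** * The modulus inequality *)

Section RingModulus.
Variable R : realType.
Local Notation mu := (@lebesgue_measure R).
Local Notation mu2 := (mu \x mu)%E.
Local Notation B2 := (@B2 R).

(** The density of the other conformal coordinate in the variable [n = sin phi], cut off before
    [n ^ 2 = 1], where it is singular. *)
Definition end_weight (S q d n : R) : R := (1 - smoothstep ((n ^+ 2 - q) / d)) /
  (Num.sqrt (1 - n ^+ 2) * Num.sqrt (1 + S ^+ 2 * n ^+ 2)).

Lemma continuous_end_weight S q d : 0 < d -> q + d < 1 -> continuous (end_weight S q d).
Proof.
move=> d0 qd n.
have c2 : {for n, continuous (fun n : R => n ^+ 2)} by apply: cvgM; exact: cvg_id.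
have [n1|n1] := ltP (n ^+ 2) 1; last first.
  have h : \forall x \near n, end_weight S q d x = 0.
    have : \forall x \near n, q + d < x ^+ 2 by move/cvgr_gt : c2; apply; exact: lt_le_trans n1.
    apply: filterS => x hx; have [a _] := smoothstep_hi d0 (ltW hx).
    by rewrite /end_weight a subrr mul0r.
  have h0 := nbhs_singleton h.
  by apply/cvgrPdist_lt => e e0; apply: filterS h => x hx; rewrite hx h0 subrr normr0.
have q1 : 0 < 1 + S ^+ 2 * n ^+ 2 by rewrite ltr_pwDl// mulr_ge0 ?sqr_ge0.
apply: cvgM.
  apply: cvgB; first exact: cvg_cst.
  apply: (@continuous_comp _ _ _ (fun n : R => (n ^+ 2 - q) / d) (@smoothstep R)).
    by apply: cvgM; [apply: cvgB => //; exact: cvg_cst|exact: cvg_cst].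
  exact: (C1_continuous (@C1_smoothstep R)).
apply: cvgV; first by rewrite mulf_neq0// lt0r_neq0// sqrtr_gt0// subr_gt0.
apply: cvgM.
  apply: (@continuous_comp _ _ _ (fun n : R => 1 - n ^+ 2) Num.sqrt); last exact: sqrt_continuous.
  by apply: cvgB => //; exact: cvg_cst.
apply: (@continuous_comp _ _ _ (fun n : R => 1 + S ^+ 2 * n ^+ 2) Num.sqrt); last exact: sqrt_continuous.
by apply: cvgD; [exact: cvg_cst|apply: cvgM => //; exact: cvg_cst].
Qed.

Lemma end_weight_ge0 S q d n : 0 <= end_weight S q d n.
Proof.
have /andP[_ h] := smoothstep_in ((n ^+ 2 - q) / d).
by rewrite divr_ge0 ?subr_ge0// mulr_ge0 ?sqrtr_ge0.
Qed.

(** For [n = sin x] with [|x| <= t] the cutoff is 1 and the density becomes [agm_weight 1 C]; the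
    parts beyond [sin t] only add to the increment. *)
Lemma end_primitive (S C t d : R) (H : R -> R) : 0 < C -> C ^+ 2 = 1 + S ^+ 2 -> 0 < t -> t < pi / 2 -> 0 < d ->
  C1 H (end_weight S (sin t ^+ 2) d) -> 2 * agmP 1 C t <= H 1 - H (-1).
Proof.
move=> C0 CS t0 t2 d0 CH; have pp := pi_gt0 R.
have H_le x y : x <= y -> H x <= H y.
  move=> xy; have := @increment_le _ (fun=> 0 : R) H (fun=> 0) _ _ _ xy (fun x _ => is_derive_cst _ _ _)
    (fun x _ => (CH x).1) (fun x _ => end_weight_ge0 _ _ _ _).
  by rewrite subrr subr_ge0.
have tt : - t <= t by rewrite ge0_cp// ltW.
have sb x : - t <= x <= t -> [/\ 0 < cos x & sin x ^+ 2 <= sin t ^+ 2].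
  move=> /andP[x1 x2]; have xp : - (pi / 2) < x < pi / 2 by apply/andP; split; lra.
  split; first exact: cos_gt0_pihalf.
  have mono u v : - (pi / 2) <= u <= pi / 2 -> - (pi / 2) <= v <= pi / 2 -> u <= v -> sin u <= sin v.
    by move=> hu hv uv; rewrite leNgt ltr_sin ?in_itv// -leNgt.
  have s1 : sin x <= sin t by apply: mono => //; apply/andP; split; lra.
  have s2 : - sin t <= sin x by rewrite -sinN; apply: mono => //; apply/andP; split; lra.
  rewrite -[sin x ^+ 2]real_normK ?num_real// ler_pXn2r ?nnegrE ?normr_ge0//; first by rewrite ler_norml s2.
  by lra.
have dH (x : R) : - t <= x <= t -> is_derive x 1 (fun x => H (sin x)) (agm_weight 1 C x).
  move=> /sb[cx sx]; have := @is_derive1_comp _ H (@sin R) x _ _ (CH (sin x)).1 (is_derive_sin x).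
  congr is_derive; rewrite /end_weight (smoothstep_lo d0 sx).1 subr0 -cos2sin2 sqrtr_sqr gtr0_norm//.
  rewrite /agm_weight expr1n CS cos2sin2.
  have -> : 1 * (1 - sin x ^+ 2) + (1 + S ^+ 2) * sin x ^+ 2 = 1 + S ^+ 2 * sin x ^+ 2 by ring.
  have p : 0 < 1 + S ^+ 2 * sin x ^+ 2 by rewrite ltr_pwDl// mulr_ge0 ?sqr_ge0.
  by field; rewrite !lt0r_neq0 ?sqrtr_gt0.
have := increment_eq tt (fun x _ => (C1_agmP ltr01 C0 x).1) dH.
rewrite (agmPN ltr01 C0) opprK sinN => E.
have := H_le _ _ (sin_le1 t); have := H_le _ _ (sin_geN1 (- t)); rewrite sinN; move: E; lra.
Qed.

Variables (K : R) (f1 f2 ux uy vx vy : R * R -> R).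
Hypothesis K0 : 0 < K.
Hypothesis s1 : sobD f1 ux uy.
Hypothesis s2 : sobD f2 vx vy.
Let f z := (f1 z, f2 z).
Hypothesis fB : forall z, B2 z -> B2 (f1 z, f2 z).
Hypothesis qr : {ae mu2, forall z : R * R, B2 z ->
  opnorm (ux z) (uy z) (vx z) (vy z) ^+ 2 <= K * (ux z * vy z - uy z * vx z)}.

Variables (e0 e1 : R * R * R) (S C : R).
Hypothesis e00 : lorentz e0 e0 = -1.
Hypothesis e11 : lorentz e1 e1 = 1.
Hypothesis e01 : lorentz e1 e0 = 0.
Hypothesis e0p : (0 : R) < e0.1.1.
Hypothesis S0 : (0 : R) < S.
Hypothesis C0 : (0 : R) < C.
Hypothesis CS : C ^+ 2 = 1 + S ^+ 2.

Variables (g0 g1 : R * R * R) (S' C' : R).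
Hypothesis g00 : lorentz g0 g0 = -1.
Hypothesis g11 : lorentz g1 g1 = 1.
Hypothesis g01 : lorentz g1 g0 = 0.
Hypothesis g0p : (0 : R) < g0.1.1.
Let g2 := lcross g1 g0.
Hypothesis S0' : (0 : R) < S'.
Hypothesis C0' : (0 : R) < C'.
Hypothesis CS' : C' ^+ 2 = 1 + S' ^+ 2.

Hypothesis focus_p : gans g1 (f (gpoint e0 e1 S 0)) = S' /\ gans g2 (f (gpoint e0 e1 S 0)) = 0.
Hypothesis focus_m : gans g1 (f (gpoint e0 e1 (- S) 0)) = - S' /\ gans g2 (f (gpoint e0 e1 (- S) 0)) = 0.

Local Notation tau := (dtau e0 e1 S C (arcE S C)).

Let cross_pos z : B2 z -> 0 < gansx g1 z * gansy g2 z - gansy g1 z * gansx g2 z.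
Proof.
move=> Bz; have [_ _ _ ->] := frame_gram g00 g11 g01 Bz.
by rewrite mulr_gt0 ?exprn_gt0 ?conformal_gt0 ?(frame_gans0_gt0 g00 g0p Bz).
Qed.

Let foci_neq : f (gpoint e0 e1 (- S) 0) <> f (gpoint e0 e1 S 0).
Proof.
move=> h; have := focus_m.1; rewrite h focus_p.1 => /eqP; rewrite -addr_eq0 -mulr2n mulrn_eq0/=.
by rewrite (gt_eqF S0').
Qed.

(** The ray beyond the focus [S'] comes from [level_meets_ray] directly, with the segment traversed
    from [S] to [- S]. For the opposite ray both target coordinates are negated, which keeps the
    Jacobian, and the segment is traversed backwards. *)
Lemma level_rays t s : t < agmI C S -> 0 < s < t -> exists za zb, [/\ B2 za, B2 zb, tau za = s, tau zb = s &
  dN g0 g1 S' C' (f za) = -1 /\ dN g0 g1 S' C' (f zb) = 1].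
Proof.
move=> tI st; have t0 : 0 < t by case/andP : st => a b; exact: lt_trans b.
have [r rc] := domain_chart e00 e11 e01 e0p S0 C0 CS (C1_arcE S0 C0 CS) (arcE0 S0 C0) (fun=> erefl) (arcE_le S0 C0) t0 tI.
have SS : 0 <= 2 * S by rewrite mulr_ge0// ltW.
have cg (a b : R) x : {for x, continuous (fun x : R => gpoint e0 e1 (a + b * x) 0)}.
  apply: (continuous_gpoint e00 e11 e01 e0p); last exact: cvg_cst.
  by apply: cvgD; [exact: cvg_cst|apply: cvgM; [exact: cvg_cst|exact: cvg_id]].
have sl (e x : R) : `|e| = 1 -> 0 <= x <= 2 * S -> tau (gpoint e0 e1 (e * S + - e * x) 0) = 0.
  move=> e1' /andP[x0 x1]; apply: (domain_slit e00 e11 e01 e0p C S0 (arcE0 S0 C0)).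
  by rewrite mulNr -mulrBr normrM e1' mul1r ler_norml; apply/andP; split; lra.
have c0E : gpoint e0 e1 (1 * S + - 1 * 0) 0 = gpoint e0 e1 S 0 by rewrite mulr0 addr0 mul1r.
have c1E : gpoint e0 e1 (1 * S + - 1 * (2 * S)) 0 = gpoint e0 e1 (- S) 0 by congr (gpoint _ _ _ _); ring.
have d0E : gpoint e0 e1 (-1 * S + - (-1) * 0) 0 = gpoint e0 e1 (- S) 0 by rewrite mulr0 addr0 mulN1r.
have d1E : gpoint e0 e1 (-1 * S + - (-1) * (2 * S)) 0 = gpoint e0 e1 S 0 by congr (gpoint _ _ _ _); ring.
have fp := focus_p; have fm := focus_m; have fn := foci_neq.
have F1 : gans g1 (f ((fun x => gpoint e0 e1 (1 * S + - 1 * x) 0) 0)) = S' /\ gans g2 (f ((fun x => gpoint e0 e1 (1 * S + - 1 * x) 0) 0)) = 0.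
  by rewrite /= c0E.
have F2 : f (gpoint e0 e1 (1 * S + - 1 * (2 * S)) 0) <> f (gpoint e0 e1 (1 * S + - 1 * 0) 0) by rewrite c0E c1E.
have [zb] := @level_meets_ray _ _ _ _ _ _ _ _ _ _ rc _ _ _ _ _ _ _ K0 s1 s2 fB qr _ _ _ _ _ _ S'
  (C1on_gans g1) (C1on_gans g2) cross_pos (fun x => gpoint e0 e1 (1 * S + - 1 * x) 0) (2 * S)
  (fun x _ => cg _ _ x) SS (fun x _ => gpoint_in e00 e11 e01 e0p _ _) (fun x => sl 1 x (normr1 _))
  F1 F2 s st.
move=> [Bb tb xb Sb].
have N1 : `|-1 : R| = 1 by rewrite normrN normr1.
have C1n e := C1onM (@C1on_cst _ B2 (-1)) (C1on_gans e).
have crn z : B2 z -> 0 < (-1 * gansx g1 z + gans g1 z * 0) * (-1 * gansy g2 z + gans g2 z * 0) -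
    (-1 * gansy g1 z + gans g1 z * 0) * (-1 * gansx g2 z + gans g2 z * 0).
  by move=> /cross_pos; rewrite !mulr0 !addr0 !mulN1r !mulrNN.
have G1 : -1 * gans g1 (f (gpoint e0 e1 (-1 * S + - (-1) * 0) 0)) = S' /\ -1 * gans g2 (f (gpoint e0 e1 (-1 * S + - (-1) * 0) 0)) = 0.
  by rewrite d0E fm.1 fm.2 mulr0 mulrNN mul1r.
have G2 : f (gpoint e0 e1 (-1 * S + - (-1) * (2 * S)) 0) <> f (gpoint e0 e1 (-1 * S + - (-1) * 0) 0).
  by rewrite d0E d1E; exact: nesym.
have [za] := @level_meets_ray _ _ _ _ _ _ _ _ _ _ rc _ _ _ _ _ _ _ K0 s1 s2 fB qr _ _ _ _ _ _ S'
  (C1n g1) (C1n g2) crn (fun x => gpoint e0 e1 (-1 * S + - (-1) * x) 0) (2 * S)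
  (fun x _ => cg _ _ x) SS (fun x _ => gpoint_in e00 e11 e01 e0p _ _) (fun x => sl (-1) x N1)
  G1 G2 s st.
move=> [Ba ta xa Sa]; exists za, zb; split => //; rewrite /dN.
have xa0 : gans (lcross g1 g0) (f za) = 0 by move: xa; rewrite mulN1r => /eqP; rewrite oppr_eq0 => /eqP.
by rewrite xa0 xb (esin_ray C' S0' Sb) (esin_rayN C' S0')//; move: Sa; rewrite mulN1r.
Qed.

(** In the ring inequality the angular period is [4 agmI 1 C], the calibration constant is
    [pi / (2 K agmI C' S')], and the oscillation [H 1 - H (-1)] comes arbitrarily close to
    [2 agmI 1 C']; finally [t] tends to [agmI C S]. *)
Lemma ring_modulus : agmI 1 C' * agmI C S <= K * (agmI 1 C * agmI C' S').
Proof.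
have I1 := agmI_gt0 ltr01 C0'; have I2 := agmI_gt0 C0 S0; have I3 := agmI_gt0 ltr01 C0; have I4 := agmI_gt0 C0' S0'.
have pp := pi_gt0 R.
have key e t : 0 < e -> 0 < t -> t < agmI C S -> (agmI 1 C' - e) * t <= K * (agmI 1 C * agmI C' S').
  move=> ep t0 tI; have [u [u0 u2 hu]] := agmP_near ltr01 C0' ep.
  (* The cutoffs occupy two of the three equal parts between [q] and 1. *)
  pose q := sin u ^+ 2; pose d := (1 - q) / 3.
  have up : u < pi by move: u2 pp; lra_from.
  have q0 : 0 < q by rewrite exprn_gt0// sin_gt0_pi// u0 up.
  have q1 : q < 1.
    have : 0 < cos u by apply: cos_gt0_pihalf; rewrite u2 andbT; move: u0 pp; lra_from.
    by rewrite /q sin2cos2 => cu; rewrite gtrBl exprn_gt0.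
  have d0 : 0 < d by rewrite divr_gt0// subr_gt0.
  have qd2 : q + 2 * d < 1 by rewrite /d; move: q1; lra_from.
  have qd1 : q + d < 1 by move: qd2 d0; lra_from.
  have [H CH _] := primitive_ex (@continuous_end_weight S' q d d0 qd1).
  have HH := end_primitive C0' CS' u0 u2 d0 CH.
  have hx : 2 * (agmI 1 C' - e) <= H 1 - H (-1) by apply: le_trans HH; rewrite ler_pM2l// ltW.
  pose k := pi / (2 * agmI C' S').
  have k0 : 0 < k by apply: (divr_gt0 pp); apply: mulr_gt0 I4.
  have tp := @target_pointwise _ _ _ g00 g11 g01 g0p _ _ S0' C0' CS' q d d0 qd2 k (arcT S' C') (arcT' S' C') _ (ltW k0)
    (fun=> erefl) (fun=> erefl).
  have pb := quasiregular_pullback K0 fB qr (tg g0 g1 S' C' H) k0 tp.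
  have sU := sobD_comp s1 s2 fB (C1on_tg g0 g1 C' S0' q0 d0 qd2 CH (fun=> erefl)).
  have sW := sobD_comp s1 s2 fB (C1on_tw g0 g1 C' S0' d0 qd2 (C1_arcT S0' C0' CS')).
  have [r rc] := domain_chart e00 e11 e01 e0p S0 C0 CS (C1_arcE S0 C0 CS) (arcE0 S0 C0) (fun=> erefl) (arcE_le S0 C0) t0 tI.
  have ri := @domain_inverse _ _ _ e00 e11 e01 e0p _ _ S0 C0 _ _ (C1_arcE S0 C0 CS) (arcE0 S0 C0) (fun=> erefl).
  have ga z Dz := @domain_grad_area _ _ _ e00 e11 e01 e0p _ _ S0 C0 CS _ _ (C1_arcE S0 C0 CS) (arcE0 S0 C0) (fun=> erefl) z Dz.
  have wE x : agm_weight 1 C x = (Num.sqrt (1 + S ^+ 2 * sin x ^+ 2))^-1.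
    by rewrite /agm_weight CS cos2sin2; congr (Num.sqrt _)^-1; ring.
  have ph : periodic2pi (agm_weight 1 C).
    by move=> x; rewrite /agm_weight mulr_natl mulr2n addrA !cosDpi !sinDpi !opprK.
  have kK : 0 < k / K by rewrite divr_gt0.
  have main := @ring_inequality_limit _ _ _ _ _ _ _ _ _ _ rc ri _ _ (C1_agmP ltr01 C0) ph
    (fun x => ltW (agm_weight_gt0 ltr01 C0 x)) (fun z Dz => etrans (ga z Dz) (congr1 (fun x => x * _) (esym (wE _))))
    _ _ _ _ _ _ _ (H (-1)) (H 1) sU sW kK pb _.
  have lev (s : R) : 0 < s < t -> exists za zb : R * R, [/\ B2 za /\ 0 < tau za, B2 zb /\ 0 < tau zb, tau za = s, tau zb = s &
      tg g0 g1 S' C' H (f za) = H (-1) /\ tg g0 g1 S' C' H (f zb) = H 1].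
    move=> /[dup] st /andP[sp _]; have [za [zb [Ba Bb ta tb [Na Nb]]]] := level_rays tI st.
    by exists za, zb; rewrite /tg Na Nb ta tb.
  have {}main := main lev.
  move: main; rewrite (agmP_2pi ltr01 C0) (agmP0 ltr01 C0) subr0 => main.
  have h1 : 4 * (k / K) * (2 * (agmI 1 C' - e)) * t <= pi * (4 * agmI 1 C).
    apply: le_trans main; apply: (ler_wpM2r (ltW t0)).
    by apply: (ler_wpM2l _ hx); rewrite pmulr_rge0// ltW.
  have -> : (agmI 1 C' - e) * t = 4 * (k / K) * (2 * (agmI 1 C' - e)) * t * (K * agmI C' S' / (4 * pi)).
    have scal (p I x : R) : p != 0 -> I != 0 -> x * t = 4 * (p / (2 * I) / K) * (2 * x) * t * (K * I / (4 * p)).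
      by move=> p0 i0; field; rewrite p0 i0 lt0r_neq0.
    exact: (scal _ _ _ (lt0r_neq0 pp) (lt0r_neq0 I4)).
  have -> : K * (agmI 1 C * agmI C' S') = pi * (4 * agmI 1 C) * (K * agmI C' S' / (4 * pi)).
    have scal (p I x : R) : p != 0 -> K * (x * I) = p * (4 * x) * (K * I / (4 * p)).
      by move=> p0; field; rewrite p0.
    by apply: scal; exact: lt0r_neq0.
  apply: (ler_wpM2r _ h1); apply: divr_ge0; first exact: ltW (mulr_gt0 K0 I4).
  by rewrite mulr_ge0// ltW.
have key2 t : 0 < t -> t < agmI C S -> agmI 1 C' * t <= K * (agmI 1 C * agmI C' S').
  move=> t0 tI; apply/ler_addgt0Pr => e ep.
  have := key (e / t) t (divr_gt0 ep t0) t0 tI.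
  by rewrite mulrBl divfK ?lt0r_neq0// lerBlDr.
apply/ler_addgt0Pr => e ep.
pose t := Num.max (agmI C S / 2) (agmI C S - e / agmI 1 C').
have eI : 0 < e / agmI 1 C' := divr_gt0 ep I1.
have t0 : 0 < t by rewrite lt_max (divr_gt0 I2).
have tI : t < agmI C S by rewrite gt_max; apply/andP; split; [move: I2; lra_from|move: eI; lra_from].
have te : agmI C S - e / agmI 1 C' <= t by rewrite le_max lexx orbT.
rewrite -lerBlDr; apply: le_trans (key2 t t0 tI).
rewrite -[in leLHS](divfK (lt0r_neq0 I1) e) [_ * agmI 1 C']mulrC -mulrBr.
by rewrite (ler_pM2l I1).
Qed.

End RingModulus.

(** * The frame adapted to two points *)

Section TwoPointFrame.
Variable R : realType.
Local Notation B2 := (@B2 R).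

(** Taken at half the hyperbolic distance: this is the coordinate of either point relative to the
    midpoint, and so the focal parameter of the elliptic coordinates. *)
Definition hyp_sinh (a b : R * R) : R :=
  Num.sqrt (((a.1 - b.1) ^+ 2 + (a.2 - b.2) ^+ 2) / ((1 - normsq a) * (1 - normsq b))).
Definition hyp_cosh (a b : R * R) : R := Num.sqrt (1 + hyp_sinh a b ^+ 2).

Lemma pair_neq_dist (a b : R * R) : a <> b -> 0 < (a.1 - b.1) ^+ 2 + (a.2 - b.2) ^+ 2.
Proof.
move=> ab; rewrite lt0r addr_ge0 ?sqr_ge0// andbT; apply/negP.
rewrite paddr_eq0 ?sqr_ge0// !sqrf_eq0 !subr_eq0 => /andP[/eqP h1 /eqP h2].
by apply: ab; case: a b h1 h2 => [? ?] [? ?] /= -> ->.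
Qed.

Lemma hyp_sinh_gt0 a b : B2 a -> B2 b -> a <> b -> 0 < hyp_sinh a b.
Proof.
move=> Ba Bb ab; rewrite sqrtr_gt0 divr_gt0 ?pair_neq_dist//.
by rewrite mulr_gt0 ?denom_gt0.
Qed.

Lemma hyp_sinh_sqr a b : B2 a -> B2 b ->
  hyp_sinh a b ^+ 2 = ((a.1 - b.1) ^+ 2 + (a.2 - b.2) ^+ 2) / ((1 - normsq a) * (1 - normsq b)).
Proof.
move=> Ba Bb; rewrite sqr_sqrtr// divr_ge0// ?addr_ge0 ?sqr_ge0//.
by rewrite ltW// mulr_gt0 ?denom_gt0.
Qed.

Lemma hyp_cosh_gt0 a b : 0 < hyp_cosh a b.
Proof. by rewrite sqrtr_gt0 ltr_pwDl// sqr_ge0. Qed.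

Lemma hyp_cosh_sqr a b : hyp_cosh a b ^+ 2 = 1 + hyp_sinh a b ^+ 2.
Proof. by rewrite sqr_sqrtr// addr_ge0// sqr_ge0. Qed.

Lemma lorentz_hyperboloid a : B2 a -> lorentz (hyperboloid a) (hyperboloid a) = -1.
Proof.
move=> /ball_denom_neq0; rewrite /lorentz /hyperboloid /=; case: a => x y; rewrite /normsq /= => d0.
by field.
Qed.

Lemma lorentz_pair a b : B2 a -> B2 b -> lorentz (hyperboloid a) (hyperboloid b) = -1 - 2 * hyp_sinh a b ^+ 2.
Proof.
move=> Ba Bb; rewrite hyp_sinh_sqr//; move: (ball_denom_neq0 Ba) (ball_denom_neq0 Bb).
rewrite /lorentz /hyperboloid /=; case: a b {Ba Bb} => x y [u v]; rewrite /normsq /= => d0 d1.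
by field; rewrite ?d0 ?d1.
Qed.

Definition lin3 (s t : R) (u v : R * R * R) : R * R * R :=
  (s * u.1.1 + t * v.1.1, s * u.1.2 + t * v.1.2, s * u.2 + t * v.2).

(** For [u] and [v] on the hyperboloid over [a] and [b], the vectors [u + v] and [u - v] are
    orthogonal with Lorentz squares [-4 C ^ 2] and [4 S ^ 2]; normalised, they give the midpoint and
    the direction of the line. *)
Lemma two_point_frame a b : B2 a -> B2 b -> a <> b -> exists e0 e1 : R * R * R,
  [/\ lorentz e0 e0 = -1, lorentz e1 e1 = 1, lorentz e1 e0 = 0 & 0 < e0.1.1] /\
  [/\ gans e1 b = hyp_sinh a b, gans (lcross e1 e0) b = 0, gans e1 a = - hyp_sinh a b & gans (lcross e1 e0) a = 0].
Proof.
move=> Ba Bb ab; have S0 := hyp_sinh_gt0 Ba Bb ab; have C0 := hyp_cosh_gt0 a b; have CS := hyp_cosh_sqr a b.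
have LA := lorentz_hyperboloid Ba; have LB := lorentz_hyperboloid Bb; have LAB := lorentz_pair Ba Bb.
have A0 : 0 < (hyperboloid a).1.1 by rewrite /= divr_gt0 ?denom_gt0// ltr_pwDl// normsq_ge0.
have B0 : 0 < (hyperboloid b).1.1 by rewrite /= divr_gt0 ?denom_gt0// ltr_pwDl// normsq_ge0.
rewrite /gans; move: LA LB LAB A0 B0; set S := hyp_sinh a b in S0 CS *; set C := hyp_cosh a b in C0 CS.
set u := hyperboloid a; set v := hyperboloid b => LA LB LAB A0 B0.
have nS := lt0r_neq0 S0; have nC := lt0r_neq0 C0.
have bil s t s' t' : lorentz (lin3 s t u v) (lin3 s' t' u v) =
    s * s' * lorentz u u + (s * t' + t * s') * lorentz u v + t * t' * lorentz v v.
  by rewrite /lorentz /lin3 /=; ring.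
have bilv s t : lorentz (lin3 s t u v) v = s * lorentz u v + t * lorentz v v by rewrite /lorentz /lin3 /=; ring.
have bilu s t : lorentz (lin3 s t u v) u = s * lorentz u u + t * lorentz u v by rewrite /lorentz /lin3 /=; ring.
exists (lin3 (2 * C)^-1 (2 * C)^-1 u v), (lin3 (2 * S)^-1 (- (2 * S)^-1) u v).
split; split.
- rewrite bil LA LB LAB; transitivity (- ((1 + S ^+ 2) / C ^+ 2)); last by rewrite -CS divff ?expf_neq0.
  by field.
- by rewrite bil LA LB LAB; field.
- by rewrite bil LA LB LAB; field; rewrite nS nC.
- by rewrite /= addr_gt0// mulr_gt0// invr_gt0 mulr_gt0.
- by rewrite bilv LB LAB; field.
- by rewrite /lorentz /lcross /lin3 /=; ring.
- by rewrite bilu LA LAB; field.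
- by rewrite /lorentz /lcross /lin3 /=; ring.
Qed.

Lemma quasiregular_modulus (K : R) (f : R * R -> R * R) (a b : R * R) : 0 < K -> quasiregular K B2 f ->
  (forall z, B2 z -> B2 (f z)) -> B2 a -> B2 b -> a <> b -> f a <> f b ->
  agmI 1 (hyp_cosh (f a) (f b)) * agmI (hyp_cosh a b) (hyp_sinh a b) <=
  K * (agmI 1 (hyp_cosh a b) * agmI (hyp_cosh (f a) (f b)) (hyp_sinh (f a) (f b))).
Proof.
move=> K0 qf fB Ba Bb ab fab.
have [ux [uy [vx [vy [s1 s2 qr]]]]] := quasiregular_sobD qf.
have fE z : ((f z).1, (f z).2) = f z by case: (f z).
have fB' z : B2 z -> B2 ((f z).1, (f z).2) by rewrite fE; exact: fB.
have [e0 [e1 [[e00 e11 e01 e0p] [b1 b2 a1 a2]]]] := two_point_frame Ba Bb ab.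
have [g0 [g1 [[g00 g11 g01 g0p] [fb1 fb2 fa1 fa2]]]] := two_point_frame (fB _ Ba) (fB _ Bb) fab.
have gb : gpoint e0 e1 (hyp_sinh a b) 0 = b by rewrite -b1 -b2; exact: (gpointK e00 e11 e01 e0p Bb).
have ga : gpoint e0 e1 (- hyp_sinh a b) 0 = a by rewrite -a1 -a2; exact: (gpointK e00 e11 e01 e0p Ba).
apply: (ring_modulus K0 s1 s2 fB' qr e00 e11 e01 e0p (hyp_sinh_gt0 Ba Bb ab) (hyp_cosh_gt0 a b) (hyp_cosh_sqr a b)
  g00 g11 g01 g0p (hyp_sinh_gt0 (fB _ Ba) (fB _ Bb) fab) (hyp_cosh_gt0 _ _) (hyp_cosh_sqr _ _)).
  by rewrite gb fE fb1 fb2.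
by rewrite ga fE fa1 fa2.
Qed.

End TwoPointFrame.

(** * Gauss's transformation *)

Section AgmTransformations.
Variable R : realType.
Variables a b : R.
Hypothesis a0 : 0 < a.
Hypothesis b0 : 0 < b.

Lemma agmI_scale r : 0 < r -> agmI (r * a) (r * b) = r^-1 * agmI a b.
Proof.
move=> r0; have ra := mulr_gt0 r0 a0; have rb := mulr_gt0 r0 b0.
apply: (agmP_unique ra rb (F := fun y => r^-1 * agmP a b y)); last by rewrite agmP0// mulr0.
move=> y; have h : is_derive y 1 (fun y => r^-1 * agmP a b y) (r^-1 * agm_weight a b y).
  by have [d _] := C1_agmP a0 b0 y; exact: is_deriveZ.
have -> : agm_weight (r * a) (r * b) y = r^-1 * agm_weight a b y; last exact: h.
rewrite /agm_weight (_ : _ + _ = r ^+ 2 * (a ^+ 2 * cos y ^+ 2 + b ^+ 2 * sin y ^+ 2)); last by ring.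
by rewrite sqrtrM ?sqr_ge0// sqrtr_sqr gtr0_norm// invfM.
Qed.

Lemma agmI_sym : agmI a b = agmI b a.
Proof.
transitivity (agmI b a - agmP b a (pi / 2 - pi / 2)); last by rewrite subrr agmP0// subr0.
apply: (agmP_unique a0 b0 (F := fun y => agmI b a - agmP b a (pi / 2 - y))); last by rewrite subr0 subrr.
move=> y; have h : is_derive (pi / 2 - y) 1 (agmP b a) (agm_weight a b y).
  have := (C1_agmP b0 a0 (pi / 2 - y)).1; congr is_derive.
  by rewrite /agm_weight cosB sinB cos_pihalf sin_pihalf !mul0r !mul1r add0r subr0 addrC.
have hn : is_derive y 1 (fun y : R => pi / 2 - y) (-1).
  by apply: is_derive_eq (is_deriveB (is_derive_cst (pi / 2 : R) y 1) (is_derive_id y 1)) _; rewrite sub0r.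
have := is_deriveB (is_derive_cst (agmI b a) y 1) (@is_derive1_comp _ (agmP b a) (fun y => pi / 2 - y) y _ _ h hn).
by rewrite sub0r mulrN1 opprK.
Qed.

End AgmTransformations.

Section Gauss.
Variable R : realType.
Variables a b : R.
Hypothesis a0 : 0 < a.
Hypothesis b0 : 0 < b.
Let q (x : R) := a * cos x ^+ 2 + b * sin x ^+ 2.
Let X (x : R) := (a - b) * (sin x * cos x) / q x.
(** The tangent of [phi x - x] is [(b / a) tan x]. Expressing [x - (phi x - x)] as an arctangent
    avoids the pole of the tangent and makes [phi] smooth, with [phi (pi / 2) = pi]. *)
Let phi (x : R) := 2 * x - atan (X x).
Let D (x : R) := a ^+ 2 * cos x ^+ 2 + b ^+ 2 * sin x ^+ 2.

Let q_gt0 x : 0 < q x.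
Proof.
have cs := cos2Dsin2 x; have [c0|c0] := eqVneq (cos x) 0.
  by rewrite /q c0 expr0n /= mulr0 add0r mulr_gt0//; move: cs; rewrite c0 expr0n /= add0r => ->.
apply: ltr_wpDr; first by apply: mulr_ge0; [exact: ltW|exact: sqr_ge0].
by apply: mulr_gt0 => //; rewrite exprn_even_gt0.
Qed.

Let D_gt0 x : 0 < D x. Proof. exact: agm_rad_gt0. Qed.

Lemma sin_atan (x : R) : sin (atan x) = x / Num.sqrt (1 + x ^+ 2).
Proof.
have c0 : cos (atan x) != 0.
  by rewrite cos_atan invr_neq0// lt0r_neq0// sqrtr_gt0 ltr_pwDl// sqr_ge0.
by have := atanK x; rewrite /tan => h; rewrite -{2}h -cos_atan divfK.
Qed.

Let X2 x : 1 + X x ^+ 2 = D x / q x ^+ 2.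
Proof.
have nq := lt0r_neq0 (q_gt0 x); rewrite /X expr_div_n.
apply: (mulIf (expf_neq0 2 nq)); rewrite divfK ?expf_neq0// mulrDl mul1r divfK ?expf_neq0//.
rewrite /q /D -[in RHS](mulr1 (_ + _)) -(cos2Dsin2 x); ring.
Qed.

Let sX x : Num.sqrt (1 + X x ^+ 2) = Num.sqrt (D x) / q x.
Proof.
rewrite X2 sqrtrM ?ltW// sqrtrV ?sqr_ge0// sqrtr_sqr gtr0_norm//.
Qed.

Let cos_phi x : cos (phi x) = (a * cos x ^+ 2 - b * sin x ^+ 2) / Num.sqrt (D x).
Proof.
have nq := lt0r_neq0 (q_gt0 x); have nD : Num.sqrt (D x) != 0 by rewrite lt0r_neq0// sqrtr_gt0.
rewrite /phi cosB sin_atan cos_atan sX mulr_natl mulr2n cosD sinD /X; move: nD; set r := Num.sqrt _ => nD.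
transitivity (((cos x ^+ 2 - sin x ^+ 2) * q x + 2 * (a - b) * (sin x * cos x) ^+ 2) / r).
  by field; rewrite nq nD.
congr (_ / _); rewrite -[RHS]mulr1 -[X in _ = _ * X](cos2Dsin2 x) /q; ring.
Qed.

Let sin_phi x : sin (phi x) = (a + b) * (sin x * cos x) / Num.sqrt (D x).
Proof.
have nq := lt0r_neq0 (q_gt0 x); have nD : Num.sqrt (D x) != 0 by rewrite lt0r_neq0// sqrtr_gt0.
rewrite /phi sinB sin_atan cos_atan sX mulr_natl mulr2n cosD sinD /X; move: nD; set r := Num.sqrt _ => nD.
transitivity ((2 * (sin x * cos x) * q x - (cos x ^+ 2 - sin x ^+ 2) * (a - b) * (sin x * cos x)) / r).
  by field; rewrite nq nD.
congr (_ / _); rewrite -[RHS]mulr1 -[X in _ = _ * X](cos2Dsin2 x) /q; ring.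
Qed.

Let mean := (a + b) / 2.
Let geom := Num.sqrt (a * b).

Let weight_phi x : agm_weight mean geom (phi x) = Num.sqrt (D x) / (mean * q x).
Proof.
have r0 : 0 < Num.sqrt (D x) by rewrite sqrtr_gt0.
have rE : Num.sqrt (D x) ^+ 2 = D x by rewrite sqr_sqrtr ?ltW.
have m0 : 0 < mean by rewrite divr_gt0// addr_gt0.
rewrite /agm_weight cos_phi sin_phi.
rewrite (_ : _ + _ = (mean * q x / Num.sqrt (D x)) ^+ 2).
  by rewrite sqrtr_sqr gtr0_norm ?invf_div// divr_gt0// mulr_gt0.
rewrite !exprMn exprVn /geom sqr_sqrtr ?mulr_ge0 ?ltW// /q /mean.
by field; rewrite lt0r_neq0.
Qed.

Let is_derive_phi (x : R) : is_derive x 1 phi (2 * mean * q x / D x).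
Proof.
have nq := lt0r_neq0 (q_gt0 x); have nD := lt0r_neq0 (D_gt0 x).
have ds : is_derive x 1 (@sin R) (cos x) by exact: is_derive_sin.
have dc : is_derive x 1 (@cos R) (- sin x) by exact: is_derive_cos.
have dq : is_derive x 1 q (2 * (b - a) * (sin x * cos x)).
  apply: (is_derive_eq (is_deriveD (is_deriveZ a (is_deriveM dc dc)) (is_deriveZ b (is_deriveM ds ds)))).
  by rewrite /GRing.scale /=; ring.
have dn : is_derive x 1 (fun x => (a - b) * (sin x * cos x)) ((a - b) * (cos x ^+ 2 - sin x ^+ 2)).
  apply: (is_derive_eq (is_deriveZ (a - b) (is_deriveM ds dc))).
  by rewrite /GRing.scale /=; ring.
have dX : is_derive x 1 X (((a - b) * (cos x ^+ 2 - sin x ^+ 2) * q x - (a - b) * (sin x * cos x) * (2 * (b - a) * (sin x * cos x))) / q x ^+ 2).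
  apply: (is_derive_eq (is_deriveM dn (is_deriveV nq dq))).
  rewrite /GRing.scale /=; field; exact: nq.
have da := @is_derive1_comp _ (@atan R) X x _ _ (is_derive1_atan (X x)) dX.
have d2 : is_derive x 1 (fun x : R => 2 * x) 2.
  by apply: (is_derive_eq (is_deriveZ (2 : R) (is_derive_id x 1))); rewrite /GRing.scale /=; ring.
apply: (is_derive_eq (is_deriveB d2 da)).
rewrite X2; transitivity ((2 * D x - (a - b) * ((cos x ^+ 2 - sin x ^+ 2) * q x + 2 * (a - b) * (sin x * cos x) ^+ 2)) / D x).
  by field; rewrite nq nD.
congr (_ / _).
have -> : (cos x ^+ 2 - sin x ^+ 2) * q x + 2 * (a - b) * (sin x * cos x) ^+ 2 = a * cos x ^+ 2 - b * sin x ^+ 2.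
  rewrite -[RHS]mulr1 -[X in _ = _ * X](cos2Dsin2 x) /q; ring.
by rewrite /D /q /mean; field.
Qed.

(* The substitution [tan (phi1 - phi) = (b / a) tan phi] doubles the integrand. *)
Lemma agmI_gauss : agmI a b = agmI ((a + b) / 2) (Num.sqrt (a * b)).
Proof.
have m0 : 0 < mean by rewrite divr_gt0// addr_gt0.
have g0 : 0 < geom by rewrite sqrtr_gt0 mulr_gt0.
have pp : 0 <= (pi : R) / 2 by rewrite divr_ge0// pi_ge0.
have dF (x : R) : is_derive x 1 (fun x => agmP mean geom (phi x)) (2 * agm_weight a b x).
  have := @is_derive1_comp _ (agmP mean geom) phi x _ _ (C1_agmP m0 g0 (phi x)).1 (is_derive_phi x).
  congr is_derive; rewrite weight_phi /agm_weight -/(D x).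
  have r0 : 0 < Num.sqrt (D x) by rewrite sqrtr_gt0.
  have rE : Num.sqrt (D x) ^+ 2 = D x by rewrite sqr_sqrtr ?ltW.
  have nr := lt0r_neq0 r0; have nq := lt0r_neq0 (q_gt0 x); have nm := lt0r_neq0 m0.
  move: rE nr; set r := Num.sqrt _ => rE nr.
  by rewrite -rE; field; rewrite nr nq nm.
have dG (x : R) : is_derive x 1 (fun x => 2 * agmP a b x) (2 * agm_weight a b x).
  by have [d _] := C1_agmP a0 b0 x; exact: is_deriveZ.
have := increment_eq pp (fun x _ => dF x) (fun x _ => dG x).
rewrite /phi /X cos_pihalf sin0 !(mulr0, mul0r) atan0 !subr0 (agmP0 m0 g0) (agmP0 a0 b0) mulr0 !subr0.
have n2 : (2 : R) != 0 by rewrite pnatr_eq0.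
by rewrite mulrC (divfK n2) (agmP_pi m0 g0) => h; apply: (mulfI n2); exact: esym h.
Qed.

End Gauss.

(** * Landen's transformation *)

Section Landen.
Variable R : realType.
Implicit Types C : R.

Definition cosinh C := Num.sqrt (C ^+ 2 - 1).
(** The arithmetic mean of 1 and [C] divided by their geometric mean. *)
Definition landen C := (C + 1) / (2 * Num.sqrt C).

Lemma cosinh_gt0 C : 1 < C -> 0 < cosinh C.
Proof. by move=> c1; rewrite sqrtr_gt0 subr_gt0 exprn_egt1. Qed.

Lemma cosinh_sqr C : 1 < C -> cosinh C ^+ 2 = C ^+ 2 - 1.
Proof. by move=> c1; rewrite sqr_sqrtr// subr_ge0 exprn_ege1// ltW. Qed.

Lemma sqrt_gt1 C : 1 < C -> 1 < Num.sqrt C.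
Proof. by move=> c1; rewrite -[ltLHS]sqrtr1 ltr_sqrt// (lt_trans ltr01). Qed.

Lemma sqrt_sqr C : 1 < C -> Num.sqrt C ^+ 2 = C.
Proof. by move=> c1; rewrite sqr_sqrtr// (le_trans ler01)// ltW. Qed.

Lemma landen_gt1 C : 1 < C -> 1 < landen C.
Proof.
move=> c1; have r1 := sqrt_gt1 c1; have rE := sqrt_sqr c1; have r0 := lt_trans ltr01 r1.
rewrite /landen ltr_pdivlMr ?mulr_gt0// mul1r -subr_gt0 -{1}rE.
by rewrite (_ : _ - _ = (Num.sqrt C - 1) ^+ 2) ?exprn_gt0 ?subr_gt0//; ring.
Qed.

Lemma landen_le C : 1 < C -> landen C <= C.
Proof.
move=> c1; have r1 := sqrt_gt1 c1; have r0 := lt_trans ltr01 r1.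
rewrite /landen ler_pdivrMr ?mulr_gt0//; apply: (@le_trans _ _ (C * (2 * 1))); first by lra.
by apply: ler_wpM2l; [lra|rewrite ler_pM2l// ltW].
Qed.

Lemma landen_mono C C' : 1 < C -> C <= C' -> landen C <= landen C'.
Proof.
move=> c1 cc; have c1' := lt_le_trans c1 cc.
have := sqrt_sqr c1; have := sqrt_sqr c1'; have := sqrt_gt1 c1; have := sqrt_gt1 c1'.
have rr : Num.sqrt C <= Num.sqrt C' by rewrite ler_sqrt// (le_trans _ (ltW c1')).
rewrite /landen; move: rr; move: (Num.sqrt C) (Num.sqrt C') => r r' rr r1' r1 rE' rE.
have r0 := lt_trans ltr01 r1; have r0' := lt_trans ltr01 r1'.
rewrite ler_pdivrMr ?mulr_gt0// mulrAC ler_pdivlMr ?mulr_gt0// -rE -rE' -subr_ge0.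
rewrite (_ : _ - _ = 2 * (r' - r) * (r * r' - 1)); last by ring.
rewrite !mulr_ge0 ?subr_ge0//; apply: (le_trans (ltW r1)).
by rewrite -[leLHS]mulr1; apply: ler_wpM2l; exact: ltW.
Qed.

Lemma cosinh_landen C : 1 < C -> cosinh (landen C) = (C - 1) / (2 * Num.sqrt C).
Proof.
move=> c1; have r1 := sqrt_gt1 c1; have r0 := lt_trans ltr01 r1; have rE := sqrt_sqr c1.
rewrite /cosinh /landen (_ : _ - 1 = ((C - 1) / (2 * Num.sqrt C)) ^+ 2).
  by rewrite sqrtr_sqr ger0_norm// divr_ge0 ?mulr_ge0 ?ltW// subr_gt0.
move: rE r0; move: (Num.sqrt C) => r rE r0; rewrite -rE; field; exact: lt0r_neq0.
Qed.

Definition ringI1 C := agmI 1 C.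
Definition ringI2 C := agmI C (cosinh C).

Lemma ringI1_gt0 C : 1 < C -> 0 < ringI1 C.
Proof. by move=> c1; apply: agmI_gt0 => //; exact: lt_trans c1. Qed.

Lemma ringI2_gt0 C : 1 < C -> 0 < ringI2 C.
Proof. by move=> c1; apply: agmI_gt0; [exact: lt_trans c1|exact: cosinh_gt0]. Qed.

Lemma ringI1_landen C : 1 < C -> ringI1 (landen C) = Num.sqrt C * ringI1 C.
Proof.
move=> c1; have r1 := sqrt_gt1 c1; have r0 := lt_trans ltr01 r1; have c0 := lt_trans ltr01 c1.
have l0 := lt_trans ltr01 (landen_gt1 c1).
have := agmI_scale ltr01 l0 r0; rewrite mulr1.
have -> : Num.sqrt C * landen C = (1 + C) / 2 by rewrite /landen; field; exact: lt0r_neq0.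
have m0 : 0 < (1 + C) / 2 by rewrite divr_gt0// addr_gt0.
rewrite (agmI_sym r0 m0) -[X in agmI _ (Num.sqrt X)]mul1r -(agmI_gauss ltr01 c0).
by rewrite /ringI1 => ->; rewrite mulrA divff ?mul1r ?lt0r_neq0.
Qed.

(** Gauss's transformation read backwards: the arithmetic and geometric means of [C + 1] and [C - 1]
    are [C] and [cosinh C], and up to the factor [2 sqrt C] the former pair belongs to
    [landen C]. *)
Lemma ringI2_landen C : 1 < C -> ringI2 (landen C) = 2 * Num.sqrt C * ringI2 C.
Proof.
move=> c1; have r1 := sqrt_gt1 c1; have r0 := lt_trans ltr01 r1; have c0 := lt_trans ltr01 c1.
have l1 := landen_gt1 c1; have l0 := lt_trans ltr01 l1.
have r20 : 0 < 2 * Num.sqrt C by rewrite mulr_gt0.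
have := agmI_scale l0 (cosinh_gt0 l1) r20.
have -> : 2 * Num.sqrt C * landen C = C + 1 by rewrite /landen; field; exact: lt0r_neq0.
have -> : 2 * Num.sqrt C * cosinh (landen C) = C - 1 by rewrite cosinh_landen//; field; exact: lt0r_neq0.
have p0 : 0 < C + 1 by rewrite addr_gt0.
have m0 : 0 < C - 1 by rewrite subr_gt0.
rewrite (agmI_gauss p0 m0).
have -> : (C + 1 + (C - 1)) / 2 = C by field.
have -> : (C + 1) * (C - 1) = C ^+ 2 - 1 by ring.
by rewrite /ringI2 -/(cosinh C) => ->; rewrite mulrA divff ?mul1r ?lt0r_neq0.
Qed.

Definition logT C := ln (2 * (1 + C) / cosinh C).
Definition delta C := logT C - pi / 2 * ringI2 C / ringI1 C.

Lemma logT_arg_gt0 C : 1 < C -> 0 < 2 * (1 + C) / cosinh C.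
Proof. by move=> c1; rewrite divr_gt0 ?cosinh_gt0// mulr_gt0// addr_gt0// (lt_trans ltr01). Qed.

Definition logG C := ln (2 * (C + 1) / (1 + Num.sqrt C) ^+ 2).

(* Under Landen's transformation [pi / 2 * ringI2 / ringI1] doubles, so [delta]
   is the sum of the [logG] of the iterates, with weights [2^-(n+1)]. *)
Lemma delta_step C : 1 < C -> delta C = (logG C + delta (landen C)) / 2.
Proof.
move=> c1; have r1 := sqrt_gt1 c1; have r0 := lt_trans ltr01 r1; have c0 := lt_trans ltr01 c1.
have l1 := landen_gt1 c1; have h0 := cosinh_gt0 c1; have hE := cosinh_sqr c1.
have I0 := ringI1_gt0 c1.
have E : 2 * logT C = logG C + logT (landen C).
  rewrite /logT /logG mulr_natl mulr2n -!lnM ?posrE ?logT_arg_gt0//; last first.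
    by rewrite divr_gt0 ?exprn_gt0 ?mulr_gt0 ?addr_gt0.
  congr ln; rewrite cosinh_landen// /landen.
  transitivity (4 * (1 + C) ^+ 2 / cosinh C ^+ 2); first by field; exact: lt0r_neq0.
  have c10 : 0 < C - 1 by rewrite subr_gt0.
  rewrite hE; have rE := sqrt_sqr c1; move: rE r0; move: (Num.sqrt C) => r rE r0.
  have -> : C ^+ 2 - 1 = (C + 1) * (C - 1) by ring.
  have -> : 1 + (C + 1) / (2 * r) = (1 + r) ^+ 2 / (2 * r) by rewrite -rE; field; exact: lt0r_neq0.
  by field; rewrite !lt0r_neq0// addr_gt0.
rewrite /delta ringI1_landen// ringI2_landen//.
have -> : pi / 2 * (2 * Num.sqrt C * ringI2 C) / (Num.sqrt C * ringI1 C) = 2 * (pi / 2 * ringI2 C / ringI1 C).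
  by move: (pi / 2) => p; field; rewrite !lt0r_neq0.
by rewrite addrA -E; field; rewrite lt0r_neq0.
Qed.

End Landen.

(** * Sign and monotonicity of [delta] *)

Section RingBounds.
Variable R : realType.
Implicit Types C : R.

Lemma ringI1_le C : 1 < C -> ringI1 C <= pi / 2.
Proof.
move=> c1; have c0 := lt_trans ltr01 c1; have pp : 0 <= (pi : R) / 2 by rewrite divr_ge0// pi_ge0.
have dx (x : R) : 0 <= x <= pi / 2 -> is_derive x 1 (fun x : R => x) 1 by move=> _; exact: is_derive_id.
have := increment_le pp (fun x _ => (C1_agmP ltr01 c0 x).1) dx.
rewrite (agmP0 ltr01 c0) !subr0; apply => x _.
have rp := agm_rad_gt0 ltr01 c0 x.
rewrite invf_le1 ?sqrtr_gt0// -[leLHS]sqrtr1 ler_sqrt ?(ltW rp)//.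
rewrite expr1n mul1r cos2sin2 -subr_ge0 (_ : _ - _ = (C ^+ 2 - 1) * sin x ^+ 2); last by ring.
by rewrite mulr_ge0 ?sqr_ge0// subr_ge0 exprn_ege1// ltW.
Qed.

Lemma ringI1_ge C : 1 < C -> pi / 2 <= C * ringI1 C.
Proof.
move=> c1; have c0 := lt_trans ltr01 c1; have pp : 0 <= (pi : R) / 2 by rewrite divr_ge0// pi_ge0.
have dx (x : R) : 0 <= x <= pi / 2 -> is_derive x 1 (fun x : R => C^-1 * x) C^-1.
  by move=> _; apply: (is_derive_eq (is_deriveZ C^-1 (is_derive_id x 1))); rewrite /GRing.scale /= mulr1.
have := increment_le pp dx (fun x _ => (C1_agmP ltr01 c0 x).1).
rewrite (agmP0 ltr01 c0) mulr0 !subr0 [X in X <= _]mulrC ler_pdivrMr// [X in _ <= X]mulrC; apply => x _.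
have rp := agm_rad_gt0 ltr01 c0 x.
rewrite lef_pV2 ?posrE ?sqrtr_gt0// -[leRHS]gtr0_norm// -sqrtr_sqr ler_sqrt ?sqr_ge0//.
rewrite expr1n mul1r sin2cos2 -subr_ge0 (_ : _ - _ = (C ^+ 2 - 1) * cos x ^+ 2); last by ring.
by rewrite mulr_ge0 ?sqr_ge0// subr_ge0 exprn_ege1// ltW.
Qed.

Section Area.
Variable C : R.
Hypothesis c1 : 1 < C.
Let S := cosinh C.
Let r (x : R) := Num.sqrt (C ^+ 2 * cos x ^+ 2 + S ^+ 2 * sin x ^+ 2).

Let rad x : C ^+ 2 * cos x ^+ 2 + S ^+ 2 * sin x ^+ 2 = S ^+ 2 + cos x ^+ 2.
Proof. by rewrite /S cosinh_sqr// sin2cos2; ring. Qed.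

Let rad_gt0 x : 0 < S ^+ 2 + cos x ^+ 2.
Proof. by rewrite ltr_pwDl ?sqr_ge0// exprn_gt0// cosinh_gt0. Qed.

Let r_gt0 x : 0 < r x.
Proof. by rewrite /r rad sqrtr_gt0. Qed.

Let r_sqr x : r x ^+ 2 = S ^+ 2 + cos x ^+ 2.
Proof. by rewrite /r rad sqr_sqrtr// ltW. Qed.

Let r_gt_cos x : 0 < cos x + r x.
Proof.
rewrite -(opprK (cos x)) addrC subr_gt0; apply: (le_lt_trans (ler_norm _)).
rewrite normrN -(gtr0_norm (r_gt0 x)) -ltr_sqr ?nnegrE// real_normK ?num_real// real_normK ?num_real// r_sqr.
by rewrite ltrDr exprn_gt0// cosinh_gt0.
Qed.

Let is_derive_r (x : R) : is_derive x 1 r (- (sin x * cos x) / r x).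
Proof.
have ds : is_derive x 1 (@sin R) (cos x) by exact: is_derive_sin.
have dc : is_derive x 1 (@cos R) (- sin x) by exact: is_derive_cos.
have dq : is_derive x 1 (fun x : R => C ^+ 2 * cos x ^+ 2 + S ^+ 2 * sin x ^+ 2) (2 * (S ^+ 2 - C ^+ 2) * (sin x * cos x)).
  apply: (is_derive_eq (is_deriveD (is_deriveZ (C ^+ 2) (is_deriveM dc dc)) (is_deriveZ (S ^+ 2) (is_deriveM ds ds)))).
  by rewrite /GRing.scale /=; ring.
have p : 0 < C ^+ 2 * cos x ^+ 2 + S ^+ 2 * sin x ^+ 2 by rewrite rad.
have := @is_derive1_comp _ Num.sqrt (fun x : R => C ^+ 2 * cos x ^+ 2 + S ^+ 2 * sin x ^+ 2) x _ _ (is_derive1_sqrt p) dq.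
have SC : S ^+ 2 = C ^+ 2 - 1 by rewrite /S cosinh_sqr.
congr is_derive; rewrite -/(r x) {1}SC; have := lt0r_neq0 (r_gt0 x); move: (r x) => t t0.
by field.
Qed.

(** Up to a constant the negative inverse hyperbolic sine of [cos x / S]; an elementary primitive of
    [sin x / r x]. *)
Let asinh x := - ln (cos x + r x).

Let is_derive_asinh (x : R) : is_derive x 1 asinh (sin x / r x).
Proof.
have dc : is_derive x 1 (@cos R) (- sin x) by exact: is_derive_cos.
have := is_deriveN (@is_derive1_comp _ (@ln R) (fun x => cos x + r x) x _ _ (is_derive1_ln (r_gt_cos x)) (is_deriveD dc (is_derive_r x))).
congr is_derive; have := lt0r_neq0 (r_gt0 x); have := lt0r_neq0 (r_gt_cos x); move: (r x) => t t1 t0.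
by field; rewrite t0 t1.
Qed.

Let asinh_total : asinh (pi / 2) - asinh 0 = ln ((1 + C) / S).
Proof.
have S0 := cosinh_gt0 c1; have c0 := lt_trans ltr01 c1.
rewrite /asinh cos_pihalf cos0 /r sin0 sin_pihalf cos_pihalf cos0 !(expr0n, expr1n) /= !(mulr0, mulr1, addr0, add0r).
rewrite !sqrtr_sqr !gtr0_norm// opprK addrC -lnV ?posrE// -lnM ?posrE ?invr_gt0//.
by rewrite addr_gt0.
Qed.

(** The integrand [1 / r] is bounded below by [sin x / r], which has the primitive [asinh]. *)
Lemma ringI2_ge : ln ((1 + C) / S) <= ringI2 C.
Proof.
have pp : 0 <= (pi : R) / 2 by rewrite divr_ge0// pi_ge0.
have c0 := lt_trans ltr01 c1; have S0 := cosinh_gt0 c1.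
have := increment_le pp (fun x _ => is_derive_asinh x) (fun x _ => (C1_agmP c0 S0 x).1).
rewrite asinh_total (agmP0 c0 S0) subr0; apply => x _.
by rewrite -[leRHS]mul1r ler_pM2r ?sin_le1// invr_gt0.
Qed.

(** The integrand exceeds [sin x / r] by at most [cos x / (1 + sin x)], because [cos x <= r x]; the
    latter has the primitive [ln (1 + sin x)] and accounts for the factor 2 in [logT]. *)
Lemma ringI2_le : ringI2 C <= logT C.
Proof.
have pp : 0 <= (pi : R) / 2 by rewrite divr_ge0// pi_ge0.
have p0 := pi_gt0 R.
have c0 := lt_trans ltr01 c1; have S0 := cosinh_gt0 c1.
have s1 (x : R) : 0 <= x <= pi / 2 -> 0 < 1 + sin x.
  by move=> /andP[x0 x1]; rewrite ltr_pwDl// sin_ge0_pi// x0 /=; lra.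
have d (x : R) : 0 <= x <= pi / 2 -> is_derive x 1 (fun x => asinh x + ln (1 + sin x)) (sin x / r x + cos x / (1 + sin x)).
  move=> hx; have d1 : is_derive x 1 (fun x : R => 1 + sin x) (cos x).
    by apply: (is_derive_eq (is_deriveD (is_derive_cst (1 : R) x 1) (is_derive_sin x))); rewrite add0r.
  have := is_deriveD (is_derive_asinh x) (@is_derive1_comp _ (@ln R) (fun x => 1 + sin x) x _ _ (is_derive1_ln (s1 x hx)) d1).
  by congr is_derive; rewrite [_^-1 * _]mulrC.
have := increment_le pp (fun x _ => (C1_agmP c0 S0 x).1) d.
rewrite (agmP0 c0 S0) subr0 sin_pihalf sin0 addr0 ln1 addr0.
have -> : asinh (pi / 2) + ln (1 + 1) - asinh 0 = logT C.
  rewrite addrAC asinh_total /logT -lnM ?posrE ?divr_gt0 ?addr_gt0//.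
  by congr ln; rewrite mulrC mulrA.
apply => x hx; have sx := s1 x hx; have rx := r_gt0 x.
have cx : 0 <= cos x by apply: cos_ge0_pihalf; case/andP: hx => a ->; rewrite andbT; lra.
have cr : cos x <= r x.
  rewrite -(ler_pXn2r (_ : 0 < 2)%N) ?nnegrE ?(ltW rx)// r_sqr lerDr; exact: sqr_ge0.
rewrite -subr_ge0 /agm_weight -/(r x).
have -> : sin x / r x + cos x / (1 + sin x) - (r x)^-1 = cos x * (r x - cos x) / (r x * (1 + sin x)).
  transitivity ((cos x * r x - (1 - sin x ^+ 2)) / (r x * (1 + sin x))).
    by field; rewrite !lt0r_neq0.
  by congr (_ / _); rewrite -cos2sin2; ring.
by rewrite divr_ge0 ?mulr_ge0 ?subr_ge0 ?(ltW rx) ?(ltW sx).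
Qed.

End Area.

Lemma delta_le C : 1 < C -> delta C <= ln 2.
Proof.
move=> c1; have h := ringI2_ge c1; have I0 := ringI1_gt0 c1; have I1 := ringI1_le c1.
have c0 := lt_trans ltr01 c1; have S0 := cosinh_gt0 c1; have I2 := ringI2_gt0 c1.
have -> : delta C = ln 2 + (ln ((1 + C) / cosinh C) - pi / 2 * ringI2 C / ringI1 C).
  rewrite addrA -lnM ?posrE ?divr_gt0 ?addr_gt0//; congr (_ - _).
  by rewrite /logT mulrA.
rewrite gerDl subr_le0; apply: (le_trans h).
by rewrite (ler_pdivlMr _ _ I0) mulrC; exact: (ler_wpM2r (ltW I2) I1).
Qed.

(** A crude bound from [ringI1 >= pi / (2 C)], [ringI2 <= logT] and [ln x < x]. It is enough that it
    is bounded on []1, C]], because each use of [delta_step] halves the error. *)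
Lemma delta_ge C : 1 < C -> - (2 * cosinh C) <= delta C.
Proof.
move=> c1; have h := ringI2_le c1; have I0 := ringI1_gt0 c1; have I1 := ringI1_ge c1.
have c0 := lt_trans ltr01 c1; have S0 := cosinh_gt0 c1; have I2 := ringI2_gt0 c1; have SE := cosinh_sqr c1.
have h1 : pi / 2 * ringI2 C / ringI1 C <= C * logT C.
  have p0 : 0 <= (pi : R) / 2 by rewrite divr_ge0// pi_ge0.
  by rewrite (ler_pdivrMr _ _ I0) [C * _ * _]mulrAC; exact: (ler_pM p0 (ltW I2) I1 h).
have h2 : logT C <= 2 * (1 + C) / cosinh C by apply/ltW/ln_sublinear; exact: logT_arg_gt0.
have h3 : (C - 1) * logT C <= 2 * cosinh C.
  apply: (@le_trans _ _ ((C - 1) * (2 * (1 + C) / cosinh C))).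
    by apply: ler_wpM2l => //; rewrite subr_ge0 ltW.
  rewrite mulrA ler_pdivrMr// -mulrA -expr2 SE le_eqVlt; apply/orP; left; apply/eqP; ring.
by rewrite /delta; lra.
Qed.

Lemma le0_of_geometric (x B : R) : (forall n : nat, x * 2 ^+ n <= B) -> x <= 0.
Proof.
move=> h; rewrite leNgt; apply/negP => x0.
have B0 : 0 <= B by have := h 0%N; rewrite expr0 mulr1; apply: le_trans; exact: ltW.
have := archi_boundP (divr_ge0 B0 (ltW x0)); set n := Num.bound _ => hn.
have := h n; rewrite leNgt => /negP; apply; rewrite mulrC -ltr_pdivrMr//.
by apply: (lt_trans hn); rewrite -natrX ltr_nat ltn_expl.
Qed.

Lemma logG_ge0 C : 1 < C -> 0 <= logG C.
Proof.
move=> c1; have r1 := sqrt_gt1 c1; have r0 := lt_trans ltr01 r1; have rE := sqrt_sqr c1.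
apply: ln_ge0; rewrite ler_pdivlMr ?exprn_gt0 ?addr_gt0// mul1r -{2}rE -subr_ge0.
by rewrite (_ : _ - _ = (Num.sqrt C - 1) ^+ 2) ?sqr_ge0//; ring.
Qed.

Lemma logG_mono C C' : 1 < C -> C <= C' -> logG C <= logG C'.
Proof.
move=> c1 cc; have c1' := lt_le_trans c1 cc.
have rr : Num.sqrt C <= Num.sqrt C' by rewrite ler_sqrt// (le_trans _ (ltW c1')).
have r1 := sqrt_gt1 c1; have r1' := sqrt_gt1 c1'; have rE := sqrt_sqr c1; have rE' := sqrt_sqr c1'.
have r0 := lt_trans ltr01 r1; have r0' := lt_trans ltr01 r1'.
have c0 := lt_trans ltr01 c1; have c0' := lt_trans ltr01 c1'.
rewrite /logG ler_ln ?posrE ?divr_gt0 ?mulr_gt0 ?exprn_gt0 ?addr_gt0//.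
rewrite ler_pdivrMr ?exprn_gt0 ?addr_gt0// mulrAC ler_pdivlMr ?exprn_gt0 ?addr_gt0//.
move: rE rE' rr r1 r1'; move: (Num.sqrt C) (Num.sqrt C') => r r' <- <- rr r1 r1'.
rewrite -subr_ge0 (_ : _ - _ = 4 * (r' - r) * (r * r' - 1)); last by ring.
rewrite !mulr_ge0 ?subr_ge0//; apply: (le_trans (ltW r1)).
by rewrite -[leLHS]mulr1; apply: ler_wpM2l; apply: ltW => //; exact: lt_trans r1.
Qed.

Lemma cosinh_mono C C' : 1 < C -> C <= C' -> cosinh C <= cosinh C'.
Proof.
move=> c1 cc; have c1' := lt_le_trans c1 cc.
by rewrite ler_sqrt ?subr_ge0 ?exprn_ege1 ?(ltW c1')// lerD2r ler_pXn2r ?nnegrE// ltW// (lt_trans ltr01).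
Qed.

Lemma halving_step (x g x' p B : R) : 2 * x = g + x' -> g <= 0 -> 0 <= p -> x' * p <= B -> x * (2 * p) <= B.
Proof.
move=> E g0 p0; apply: le_trans; rewrite mulrCA mulrA E.
by apply: ler_wpM2r => //; rewrite gerDr.
Qed.

(** By [delta_step], the negative part at most halves when passing back from [landen D] to [D], as
    [logG] is nonnegative. The iterates stay in []1, C]], where [delta_ge] is uniform, so after [n]
    steps the bound carries the factor [2 ^ (- n)]. *)
Lemma delta_ge0 C : 1 < C -> 0 <= delta C.
Proof.
move=> c1; rewrite -oppr_le0; apply: (@le0_of_geometric _ (2 * cosinh C)) => n.
suff H D : 1 < D -> D <= C -> - delta D * 2 ^+ n <= 2 * cosinh C by exact: H.
elim: n D => [|n IH] D d1 DC.
  have := delta_ge d1; have := cosinh_mono d1 DC; rewrite expr0 mulr1.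
  by move: (delta D) (cosinh D) (cosinh C); lra_from.
have {}IH := IH _ (landen_gt1 d1) (le_trans (landen_le d1) DC).
have E : 2 * delta D = logG D + delta (landen D) by rewrite delta_step// mulrC divfK ?pnatr_eq0.
rewrite exprS; apply: halving_step IH; last by rewrite exprn_ge0.
  by rewrite mulrN E opprD.
by rewrite oppr_le0; exact: logG_ge0.
Qed.

(** The same halving for the difference at two points: [logG] is increasing and [landen] preserves
    the order, while [delta_le] and [delta_ge] bound all differences of iterates uniformly. *)
Lemma delta_mono C C' : 1 < C -> C <= C' -> delta C <= delta C'.
Proof.
move=> c1 cc; rewrite -subr_le0; apply: (@le0_of_geometric _ (ln 2 + 2 * cosinh C')) => n.
suff H D D' : 1 < D -> D <= D' -> D' <= C' -> (delta D - delta D') * 2 ^+ n <= ln 2 + 2 * cosinh C' by exact: H.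
elim: n D D' => [|n IH] D D' d1 dd DC; have d1' := lt_le_trans d1 dd.
  have := delta_le d1; have := delta_ge d1'; have := cosinh_mono d1' DC; rewrite expr0 mulr1.
  by move: (delta D) (delta D') (cosinh D') (cosinh C') (ln 2); lra_from.
have {}IH := IH _ _ (landen_gt1 d1) (landen_mono d1 dd) (le_trans (landen_le d1') DC).
have E (x : R) : 1 < x -> 2 * delta x = logG x + delta (landen x) by move=> x1; rewrite delta_step// mulrC divfK ?pnatr_eq0.
rewrite exprS; apply: (halving_step (g := logG D - logG D')) IH; last by rewrite exprn_ge0.
  by rewrite mulrBr (E _ d1) (E _ d1') opprD addrACA.
by rewrite subr_le0; exact: logG_mono.
Qed.

Lemma logT_anti C C' : 1 < C -> C <= C' -> logT C' <= logT C.
Proof.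
move=> c1 cc; have c1' := lt_le_trans c1 cc; have s0 := cosinh_gt0 c1; have s0' := cosinh_gt0 c1'.
have c0 := lt_trans ltr01 c1; have c0' := lt_trans ltr01 c1'.
rewrite /logT ler_ln ?posrE ?logT_arg_gt0// ler_pdivrMr// mulrAC ler_pdivlMr// -!mulrA ler_pM2l//.
have k C1 C2 : 0 < C1 -> 0 < cosinh C2 -> 0 <= (1 + C1) * cosinh C2.
  by move=> a b; apply: mulr_ge0; [rewrite addr_ge0// ltW|exact: ltW].
rewrite -(ler_pXn2r (_ : 0 < 2)%N) ?nnegrE ?k// !exprMn !cosinh_sqr// -subr_ge0.
rewrite (_ : _ - _ = 2 * (1 + C) * (1 + C') * (C' - C)); last by ring.
have h1 : 0 <= 1 + C by rewrite addr_ge0// ltW.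
have h2 : 0 <= 1 + C' by rewrite addr_ge0// ltW.
by rewrite !mulr_ge0 ?subr_ge0.
Qed.

Lemma logT_ge0 C : 1 < C -> 0 <= logT C.
Proof.
move=> c1; have s0 := cosinh_gt0 c1; have c0 := lt_trans ltr01 c1.
apply: ln_ge0; rewrite ler_pdivlMr// mul1r -(ler_pXn2r (_ : 0 < 2)%N) ?nnegrE ?mulr_ge0 ?addr_ge0 ?ltW//.
by rewrite cosinh_sqr//; nra.
Qed.

(** If [C' <= C], [logT] decreases and [K >= 1] suffices. Otherwise [logT] is split into [delta] and
    the quotient of integrals: [delta] increases and is nonnegative, so it only grows under [K], and
    the quotient is controlled by the hypothesis. *)
Lemma logT_distortion (K : R) C C' : 1 <= K -> 1 < C -> 1 < C' ->
  ringI1 C' * ringI2 C <= K * (ringI1 C * ringI2 C') -> logT C <= K * logT C'.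
Proof.
move=> K1 c1 c1' H; have [cc|/ltW cc] := leP C' C.
  apply: (le_trans (logT_anti c1' cc)); rewrite -[leLHS]mul1r.
  by apply: ler_wpM2r => //; exact: logT_ge0.
have h1 := delta_mono c1 cc; have h2 := delta_ge0 c1'.
have I0 := ringI1_gt0 c1; have I0' := ringI1_gt0 c1'.
have M : pi / 2 * ringI2 C / ringI1 C <= K * (pi / 2 * ringI2 C' / ringI1 C').
  rewrite (ler_pdivrMr _ _ I0) [K * _]mulrA [K * _ / _ * _]mulrAC (ler_pdivlMr _ _ I0').
  have p0 : 0 <= (pi : R) / 2 by rewrite divr_ge0// pi_ge0.
  have := ler_wpM2l p0 H; congr (_ <= _); ring.
have h3 : delta C' <= K * delta C' by rewrite -[leLHS]mul1r; apply: ler_wpM2r.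
have -> : logT C = delta C + pi / 2 * ringI2 C / ringI1 C by rewrite /delta subrK.
have -> : logT C' = delta C' + pi / 2 * ringI2 C' / ringI1 C' by rewrite /delta subrK.
by rewrite mulrDr; exact: (lerD (le_trans h1 h3) M).
Qed.

End RingBounds.

(** * The Hilbert metric of the disc *)

Section HilbertDisk.
Variable R : realType.
Local Notation B2 := (@B2 R).

(** The hyperbolic tangent of half the number whose hyperbolic sine is [x]. *)
Definition half_th (x : R) := x / (1 + Num.sqrt (1 + x ^+ 2)).

Section Chord.
Variables a b : R * R.
Hypothesis Ba : B2 a.
Hypothesis Bb : B2 b.
Hypothesis ab : a <> b.
Let d1 := b.1 - a.1.
Let d2 := b.2 - a.2.
Let l2 := d1 ^+ 2 + d2 ^+ 2.
Let l := Num.sqrt l2.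
Let ad := a.1 * d1 + a.2 * d2.
Let cr := a.1 * d2 - a.2 * d1.
Let Dl := ad ^+ 2 + l2 * (1 - normsq a).
(** The parameters at which the line through [a] and [b] meets the unit circle, one before [a] and
    one after [b]; [Dl] is a quarter of the discriminant. *)
Let tm := (- ad - Num.sqrt Dl) / l2.
Let tp := (- ad + Num.sqrt Dl) / l2.
Let lp (t : R) : R * R := (a.1 + t * (b.1 - a.1), a.2 + t * (b.2 - a.2)).

Let l20 : 0 < l2.
Proof. by have := pair_neq_dist (nesym ab). Qed.

Let l0 : 0 < l. Proof. by rewrite sqrtr_gt0. Qed.

Let l_sqr : l ^+ 2 = l2. Proof. by rewrite sqr_sqrtr// ltW. Qed.

Let Dl_gt : ad ^+ 2 < Dl.
Proof. by rewrite ltrDl mulr_gt0// denom_gt0. Qed.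

Let Dl0 : 0 < Dl. Proof. exact: le_lt_trans (sqr_ge0 _) Dl_gt. Qed.

Let Dl_sqr : Num.sqrt Dl ^+ 2 = Dl. Proof. by rewrite sqr_sqrtr// ltW. Qed.

Let Dl_gt2 : (l2 + ad) ^+ 2 < Dl.
Proof.
rewrite -subr_gt0 (_ : _ - _ = l2 * (1 - normsq b)) ?mulr_gt0 ?denom_gt0//.
by rewrite /Dl /l2 /ad /d1 /d2 /normsq; ring.
Qed.

Let abs_lt_root x : x ^+ 2 < Dl -> `|x| < Num.sqrt Dl.
Proof. by move=> h; rewrite -sqrtr_sqr ltr_sqrt. Qed.

Let tm_lt0 : tm < 0.
Proof.
have := abs_lt_root Dl_gt; rewrite ltr_norml => /andP[h1 h2].
by rewrite ltr_pdivrMr// mul0r subr_lt0 ltrNl.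
Qed.

Let tp_gt1 : 1 < tp.
Proof.
have := abs_lt_root Dl_gt2; rewrite ltr_norml => /andP[h1 h2].
by rewrite ltr_pdivlMr// mul1r addrC ltrBrDr.
Qed.

Let tm_tp : tm * tp = - (1 - normsq a) / l2.
Proof.
rewrite /tm /tp; have n := lt0r_neq0 l20.
transitivity ((ad ^+ 2 - Num.sqrt Dl ^+ 2) / l2 ^+ 2); first by field.
by rewrite Dl_sqr /Dl; field.
Qed.

Let tm_tp1 : (1 - tm) * (tp - 1) = (1 - normsq b) / l2.
Proof.
have n := lt0r_neq0 l20.
have -> : (1 - tm) * (tp - 1) = (tm + tp) - tm * tp - 1 by ring.
rewrite tm_tp (_ : tm + tp = - (2 * ad) / l2); last by rewrite /tm /tp; field.
have -> : normsq b = normsq a + 2 * ad + l2 by rewrite /normsq /ad /l2 /d1 /d2; ring.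
by field.
Qed.

Let lp_line t : line a b (lp t). Proof. by exists t. Qed.

Let S1E (p : R * R) : S1 p <-> normsq p = 1.
Proof.
rewrite /S1 /eucl /normsq /=; split => [h|->]; last exact: sqrtr1.
by rewrite -(@sqr_sqrtr _ (_ + _)) ?h ?expr1n// addr_ge0 ?sqr_ge0.
Qed.

Let lp_norm t : normsq (lp t) - 1 = l2 * ((t - tm) * (t - tp)).
Proof.
have n := lt0r_neq0 l20.
have -> : (t - tm) * (t - tp) = t ^+ 2 - (tm + tp) * t + tm * tp by ring.
rewrite tm_tp (_ : tm + tp = - (2 * ad) / l2); last by rewrite /tm /tp; field.
transitivity (l2 * t ^+ 2 + 2 * ad * t + normsq a - 1); last by field.
by rewrite /normsq /lp /l2 /ad /d1 /d2 /=; ring.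
Qed.

Let lp_S1 t : S1 (lp t) <-> t = tm \/ t = tp.
Proof.
rewrite S1E; split => [h|[]->]; last 2 first.
- by apply/eqP; rewrite -subr_eq0 lp_norm subrr mul0r mulr0.
- by apply/eqP; rewrite -subr_eq0 lp_norm subrr mulr0 mulr0.
have : l2 * ((t - tm) * (t - tp)) == 0 by rewrite -lp_norm h subrr.
by rewrite mulf_eq0 (gt_eqF l20) /= mulf_eq0 !subr_eq0 => /orP[]/eqP; [left|right].
Qed.

Let eucl_scale t : Num.sqrt ((t * d1) ^+ 2 + (t * d2) ^+ 2) = `|t| * l.
Proof. by rewrite !exprMn -mulrDr sqrtrM ?sqr_ge0// sqrtr_sqr. Qed.

Let dist_a t : eucl (psub (lp t) a) = `|t| * l.
Proof. by rewrite /eucl /psub /lp /= -eucl_scale; congr Num.sqrt; rewrite /d1 /d2; ring. Qed.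

Let dist_b t : eucl (psub (lp t) b) = `|t - 1| * l.
Proof. by rewrite /eucl /psub /lp /= -eucl_scale; congr Num.sqrt; rewrite /d1 /d2; ring. Qed.

Let psubC (p r : R * R) : eucl (psub p r) = eucl (psub r p).
Proof. by rewrite /eucl /psub /=; congr Num.sqrt; ring. Qed.

Let hil_uE : hil_u a b = lp tm.
Proof.
rewrite /hil_u; case: xgetP => [p -> [[t pE] [Sp lt]]|/(_ (lp tm))[]]; last first.
  split; first exact: lp_line.
  split; first by apply/lp_S1; left.
  rewrite dist_a dist_b ltr_pM2r// ltr0_norm// ltr0_norm; last by rewrite subr_lt0 (lt_trans tm_lt0).
  by rewrite opprB ltrDr.
move: Sp lt; rewrite pE -/(lp t) => /lp_S1[->//|->]; rewrite dist_a dist_b ltr_pM2r//.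
rewrite gtr0_norm ?(lt_trans ltr01 tp_gt1)// gtr0_norm ?subr_gt0//.
by rewrite ltNge gerBl ler01.
Qed.

Let hil_vE : hil_v a b = lp tp.
Proof.
have ne : lp tp <> lp tm.
  move=> h; have := dist_a tp; rewrite h dist_a => /(mulIf (lt0r_neq0 l0)).
  have := dist_b tp; rewrite h dist_b => /(mulIf (lt0r_neq0 l0)).
  rewrite ltr0_norm; last by rewrite subr_lt0 (lt_trans tm_lt0).
  rewrite gtr0_norm ?subr_gt0// ltr0_norm// gtr0_norm ?(lt_trans ltr01 tp_gt1)// => h1 h2.
  by move: h1; rewrite -h2; lra.
rewrite /hil_v hil_uE; case: xgetP => [p -> [[t pE] [Sp np]]|/(_ (lp tp))[]]; last first.
  by split; [exact: lp_line|split => //; apply/lp_S1; right].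
by move: Sp np; rewrite pE -/(lp t) => /lp_S1[->|->].
Qed.

Let X := ((1 - tm) * tp) / (- tm * (tp - 1)).

Let hilbertE : hilbert a b = ln X.
Proof.
rewrite /hilbert; case: eqP => // _; rewrite hil_uE hil_vE dist_b dist_a.
rewrite (psubC a) (psubC b) dist_a dist_b; congr ln.
have tp0 := lt_trans ltr01 tp_gt1; have tm1 := lt_trans tm_lt0 ltr01.
rewrite (ltr0_norm tm_lt0) (gtr0_norm tp0) [`|tp - 1|]gtr0_norm ?subr_gt0// [`|tm - 1|]ltr0_norm ?subr_lt0// opprB.
have n0 := lt0r_neq0 l0; have n1 : tp - 1 != 0 by rewrite lt0r_neq0// subr_gt0.
have n2 : tm != 0 by rewrite ltr0_neq0.
by rewrite /X; field; rewrite n0 n1 n2.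
Qed.

Let X_gt1 : 1 < X.
Proof.
have tp0 := lt_trans ltr01 tp_gt1.
rewrite /X ltr_pdivlMr ?mulr_gt0 ?oppr_gt0 ?subr_gt0// mul1r -subr_gt0.
rewrite (_ : _ - _ = tp - tm); last by ring.
by rewrite subr_gt0 (lt_trans tm_lt0).
Qed.

(** The left side is the squared hyperbolic sine of half of [ln X]. By [DlE] and [dist0E] the right
    side is [1 - m ^ 2] times the square of [hyp_sinh a b]. *)
Let X_sinh : (X - 1) ^+ 2 / (4 * X) = Dl / ((1 - normsq a) * (1 - normsq b)).
Proof.
have na := ball_denom_neq0 Ba; have nb := ball_denom_neq0 Bb; have nl := lt0r_neq0 l20.
have n1 : tp - 1 != 0 by rewrite lt0r_neq0// subr_gt0.
have n2 : tm != 0 by rewrite ltr0_neq0.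
have n3 : tp != 0 by rewrite lt0r_neq0// (lt_trans ltr01).
have n4 : 1 - tm != 0 by rewrite lt0r_neq0// subr_gt0 (lt_trans tm_lt0).
transitivity ((tp - tm) ^+ 2 / (4 * (- (tm * tp)) * ((1 - tm) * (tp - 1)))).
  by rewrite /X; field; rewrite n1 n2 n3 n4.
rewrite tm_tp tm_tp1 (_ : tp - tm = 2 * Num.sqrt Dl / l2); last by rewrite /tm /tp; field.
by rewrite !expr_div_n exprMn Dl_sqr; field; rewrite na nb nl.
Qed.

Let DlE : Dl = l2 - cr ^+ 2.
Proof. by rewrite /Dl /l2 /ad /cr /normsq; ring. Qed.

Let dist0E : dist0 (line a b) = `|cr| / l.
Proof.
have n0 := lt0r_neq0 l0; have nl := lt0r_neq0 l20.
have lb p : line a b p -> `|cr| / l <= eucl p.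
  move=> [t ->]; rewrite -[leLHS]ger0_norm ?divr_ge0 ?(ltW l0)// -sqrtr_sqr /eucl.
  rewrite ler_sqrt ?addr_ge0 ?sqr_ge0// expr_div_n l_sqr real_normK ?num_real// ler_pdivrMr//=.
  rewrite -subr_ge0 (_ : _ - _ = (ad + t * l2) ^+ 2) ?sqr_ge0//.
  by rewrite /cr /ad /l2 /d1 /d2; ring.
have att : eucl (lp (- ad / l2)) = `|cr| / l.
  rewrite /eucl (_ : _ + _ = (cr / l) ^+ 2); first by rewrite sqrtr_sqr normf_div (gtr0_norm l0).
  rewrite expr_div_n l_sqr /lp /=; move: nl; rewrite /cr /ad /l2 -/d1 -/d2; move: d1 d2 => x y nl.
  by field.
apply/eqP; rewrite eq_le; apply/andP; split.
  rewrite -att; apply: ge_inf; last by exists (lp (- ad / l2)) => //; exact: lp_line.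
  by exists (`|cr| / l) => _ [p pl <-]; exact: lb.
apply: lb_le_inf; first by exists (eucl (lp 0)), (lp 0) => //; exact: lp_line.
by move=> _ [p pl <-]; exact: lb.
Qed.

Lemma dist0_line : 0 < 1 - dist0 (line a b) ^+ 2 <= 1.
Proof.
rewrite dist0E expr_div_n l_sqr real_normK ?num_real// gerBl divr_ge0 ?sqr_ge0 ?(ltW l20)// andbT.
by rewrite subr_gt0 ltr_pdivrMr// mul1r -subr_gt0 -DlE.
Qed.

(** In terms of [y], the exponential of [ln x / 4], both sides are [(y ^ 2 - 1) / (y ^ 2 + 1)]. *)
Lemma th_half_th (x s : R) : 1 < x -> 0 <= s -> (x - 1) ^+ 2 / (4 * x) = s ^+ 2 -> th (ln x / 4) = half_th s.
Proof.
move=> x1 s0 sE; have x0 := lt_trans ltr01 x1.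
pose y := expR (ln x / 4); have y0 : 0 < y by exact: expR_gt0.
have y4 : y ^+ 4 = x by rewrite -expRM_natl mulrC divfK ?pnatr_eq0// lnK.
have y1 : 1 <= y by rewrite -expR0 ler_expR divr_ge0// ln_ge0// ltW.
have ny := lt0r_neq0 y0.
have p2 : 0 < y ^+ 2 + 1 by rewrite addr_gt0// exprn_gt0.
have y21 : 0 <= y ^+ 2 - 1 by rewrite subr_ge0 exprn_ege1.
have sY : s = (y ^+ 2 - 1) * (y ^+ 2 + 1) / (2 * y ^+ 2).
  apply/eqP; rewrite -(eqrXn2 (_ : 0 < 2)%N)//; last by rewrite divr_ge0 ?mulr_ge0 ?sqr_ge0// ltW.
  by apply/eqP; rewrite -sE -y4; field.
have cY : Num.sqrt (1 + s ^+ 2) = (y ^+ 4 + 1) / (2 * y ^+ 2).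
  rewrite (_ : 1 + s ^+ 2 = ((y ^+ 4 + 1) / (2 * y ^+ 2)) ^+ 2).
    by rewrite sqrtr_sqr ger0_norm// divr_ge0 ?addr_ge0 ?mulr_ge0 ?exprn_ge0 ?ltW.
  by rewrite sY; field.
have np2 := lt0r_neq0 p2.
rewrite /half_th cY sY /th -/y expRN -/y.
transitivity ((y ^+ 2 - 1) / (y ^+ 2 + 1)); first by field; rewrite ny np2.
have E : 1 + (y ^+ 4 + 1) / (2 * y ^+ 2) = (y ^+ 2 + 1) ^+ 2 / (2 * y ^+ 2) by field.
by rewrite E; field; rewrite ny np2.
Qed.

Lemma hilbert_th : th (hilbert a b / 4) = half_th (Num.sqrt (1 - dist0 (line a b) ^+ 2) * hyp_sinh a b).
Proof.
have /andP[m0 _] := dist0_line; have nl := lt0r_neq0 l20.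
have na := ball_denom_neq0 Ba; have nb := ball_denom_neq0 Bb.
rewrite hilbertE; apply: th_half_th => //; first by rewrite mulr_ge0 ?sqrtr_ge0.
rewrite X_sinh exprMn sqr_sqrtr ?ltW// hyp_sinh_sqr// dist0E expr_div_n l_sqr real_normK ?num_real//.
have -> : (a.1 - b.1) ^+ 2 + (a.2 - b.2) ^+ 2 = l2 by rewrite /l2 /d1 /d2; ring.
by rewrite DlE; field; rewrite na nb nl.
Qed.

End Chord.

Lemma half_th_den_gt0 (x : R) : 0 < 1 + Num.sqrt (1 + x ^+ 2).
Proof. by rewrite ltr_pwDl// sqrtr_ge0. Qed.

Lemma half_th_mono (x y : R) : 0 <= x -> x <= y -> half_th x <= half_th y.
Proof.
move=> x0 xy; have y0 := le_trans x0 xy.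
rewrite /half_th ler_pdivrMr ?half_th_den_gt0// mulrAC ler_pdivlMr ?half_th_den_gt0// !mulrDr !mulr1.
apply: lerD => //; rewrite -(ler_pXn2r (_ : 0 < 2)%N) ?nnegrE ?mulr_ge0 ?sqrtr_ge0//.
rewrite !exprMn !sqr_sqrtr ?addr_ge0 ?sqr_ge0// !mulrDr !mulr1 [y ^+ 2 * _]mulrC lerD2r.
by rewrite ler_pXn2r.
Qed.

(** Shrinking the argument lowers the denominator of [half_th]. With [w = sqrt (1 - m ^ 2)] this is
    the origin of the factor [1 / sqrt (1 - m ^ 2)] in [D]. *)
Lemma half_th_shrink (w x : R) : 0 <= w -> w <= 1 -> 0 <= x -> w * half_th x <= half_th (w * x).
Proof.
move=> w0 w1 x0; rewrite /half_th mulrA; apply: ler_wpM2l; first exact: mulr_ge0.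
rewrite lef_pV2 ?posrE ?half_th_den_gt0// lerD2l ler_sqrt ?addr_ge0 ?sqr_ge0// lerD2l exprMn.
by rewrite -[leRHS]mul1r ler_wpM2r ?sqr_ge0// exprn_ile1.
Qed.

Lemma half_th_gt0 (x : R) : 0 < x -> 0 < half_th x.
Proof. by move=> x0; rewrite divr_gt0// half_th_den_gt0. Qed.

Lemma logT_hyp_cosh a b : B2 a -> B2 b -> a <> b ->
  [/\ 1 < hyp_cosh a b, cosinh (hyp_cosh a b) = hyp_sinh a b & logT (hyp_cosh a b) = ln (2 / half_th (hyp_sinh a b))].
Proof.
move=> Ba Bb ab; have S0 := hyp_sinh_gt0 Ba Bb ab; have CS := hyp_cosh_sqr a b.
have E : cosinh (hyp_cosh a b) = hyp_sinh a b by rewrite /cosinh CS addrC addKr sqrtr_sqr gtr0_norm.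
split => //; first by rewrite -sqrtr1 ltr_sqrt ?ltrDl ?exprn_gt0// ltr_pwDl// sqr_ge0.
by rewrite /logT E /half_th invf_div mulrA.
Qed.

Lemma hilbert_ref (a : R * R) : hilbert a a = 0.
Proof. by rewrite /hilbert eqxx. Qed.

End HilbertDisk.

Lemma distortion_of_log (R : realType) (K s t : R) : 1 <= K -> 0 < s -> 0 < t -> ln (2 / t) <= K * ln (2 / s) ->
  s <= 2 `^ (1 - K^-1) * t `^ K^-1.
Proof.
move=> K1 s0 t0; have K0 : 0 < K := lt_le_trans ltr01 K1.
rewrite !ln_div ?posrE// => h.
rewrite -ler_ln ?posrE ?mulr_gt0 ?powR_gt0// lnM ?posrE ?powR_gt0// !ln_powR.
have : K^-1 * (ln 2 - ln t) <= ln 2 - ln s by rewrite mulrC ler_pdivrMr// [leRHS]mulrC.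
by lra.
Qed.

Theorem theorem1p2 (R : realType) (a b : R * R) (K : R)
    (f : R * R -> R * R) :
  @B2 R a -> @B2 R b -> a <> b -> 1 <= K ->
  quasiregular K (@B2 R) f -> f @` (@B2 R) = @B2 R ->
  let m := dist0 (line a b) in
  let D := 2 `^ (1 - K^-1) * (1 / Num.sqrt (1 - m ^+ 2)) `^ K^-1 in
  th (hilbert (f a) (f b) / 4) <= D * (th (hilbert a b / 4)) `^ K^-1.
Proof.
move=> Ba Bb ab K1 qf fB; cbv zeta; set m := dist0 _; have K0 : 0 < K := lt_le_trans ltr01 K1.
have fB' z : B2 z -> B2 (f z) by move=> Bz; rewrite -fB; exists z.
have [fab|/eqP fab] := eqVneq (f a) (f b).
  rewrite fab hilbert_ref mul0r /th oppr0 subrr mul0r.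
  by rewrite mulr_ge0 ?mulr_ge0 ?powR_ge0.
have Ba' := fB' _ Ba; have Bb' := fB' _ Bb.
have [c1 cS lT] := logT_hyp_cosh Ba Bb ab; have [c1' cS' lT'] := logT_hyp_cosh Ba' Bb' fab.
have := quasiregular_modulus K0 qf fB' Ba Bb ab fab.
rewrite -{1}cS -{1}cS' => /(logT_distortion K1 c1 c1'); rewrite lT lT'.
have S0 := hyp_sinh_gt0 Ba Bb ab; have S0' := hyp_sinh_gt0 Ba' Bb' fab.
move=> /(distortion_of_log K1 (half_th_gt0 S0') (half_th_gt0 S0)) main.
have /andP[m0 m1] := dist0_line Ba ab; have /andP[m0' m1'] := dist0_line Ba' fab.
have w0 : 0 < Num.sqrt (1 - m ^+ 2) by rewrite sqrtr_gt0.
have w1 : Num.sqrt (1 - m ^+ 2) <= 1 by rewrite -[leRHS]sqrtr1 ler_sqrt.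
(* On the image side the distance of the line from the origin is unknown, so its factor, at most 1,
   is dropped by monotonicity; on the domain side the factor is kept and moved out by
   [half_th_shrink]. *)
apply: (@le_trans _ _ (half_th (hyp_sinh (f a) (f b)))).
  rewrite hilbert_th//; apply: half_th_mono; first by rewrite mulr_ge0 ?sqrtr_ge0 ?ltW.
  by rewrite -[leRHS]mul1r; apply: ler_wpM2r; [exact: ltW|rewrite -[leRHS]sqrtr1 ler_sqrt].
apply: (le_trans main); rewrite -mulrA; apply: ler_wpM2l; first exact: powR_ge0.
have h := half_th_shrink (ltW w0) w1 (ltW S0); rewrite -hilbert_th// in h.
have t0 := half_th_gt0 S0; have i0 : 0 <= 1 / Num.sqrt (1 - m ^+ 2) by rewrite divr_ge0// ltW.
have h0 : 0 <= th (hilbert a b / 4) by apply: le_trans h; rewrite mulr_ge0 ?ltW.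
have p0 := mulr_ge0 i0 h0.
rewrite -powRM//; apply: ge0_ler_powR; rewrite ?invr_ge0 ?(ltW K0) ?nnegrE ?(ltW t0) ?p0//.
by rewrite mul1r mulrC ler_pdivlMr// mulrC.
Qed.
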